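(* Let $\ell\in\mathbb N$, $\ell\ge1$, be a fixed moment-matching order and let $s\in(0,\tfrac12)$. Suppose that the coefficient assumption, the initial-condition assumption, the mRPC stability assumption and the positivity assumption (all stated in the context) hold. Then there is a constant $\delta>0$, depending only on $K,T,\delta_0$, such that if $R=\delta^{-1/2}(-2\log h)^{1/2}$, $L=\lfloor\lambda_1R^\eta\rfloor$, $S=\lfloor\lambda_2R^\eta\rfloor$, then there exist constants $C>0$ and $h_\ell>0$, depending on $d,K,T,\lambda_1,\lambda_2,\delta,\eta,s,r$ (and $h_\ell$ also on $\ell$), such that for all $h\in(0,h_\ell)$ and all $0\le k\le n$, $$W_1\big(\mu_k,\mu^{\mathrm{RPC}}_{k,\ell}\big)\le C\ell^{-s}+C(-\log h)^{-\frac{r(\eta-1)}2},$$ where $\mu_k$ is the distribution of the Euler-type solution $v_k$, and $\mu^{\mathrm{RPC}}_{k,\ell}$ is the probability measure supported on $I_R$ that matches the mRPC moments up to order $\ell$, i.e. $\int_{I_R}x^\gamma\,d\mu^{\mathrm{RPC}}_{k,\ell}=m^{\mathrm{RPC}}_{k,\gamma}$ for all $|\gamma|\le\ell$ (such a measure exists for all sufficiently small $h$).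
   Context: Notation. $\mathbb N=\{0,1,2,\dots\}$; for a multi-index $\gamma\in\mathbb N^d$, $|\gamma|=\sum_i\gamma_i$ and $x^\gamma=\prod_i x_i^{\gamma_i}$; $e_i$ is the $i$-th unit multi-index; $|\cdot|$ is the Euclidean norm on vectors and $|A|=\sqrt{\mathrm{tr}(AA^T)}$ for matrices; $I_R=[-R,R]^d$. The $1$-Wasserstein distance is $W_1(\mu,\nu)=\inf_\pi\int|x-y|\,\pi(dx,dy)$, the infimum over all couplings $\pi$ of $\mu$ and $\nu$. Euler-type scheme. Fix $T>0$ and $d,m\ge1$. A step size is $h=T/n$ with $n\in\mathbb N$, $n\ge 1$, $t_k=kh$. For each $h$ let $b_h:\mathbb R^d\to\mathbb R^d$ and $\sigma_h:\mathbb R^d\to\mathbb R^{d\times m}$ be given (numerical drift and diffusion for an SDE $du=b(u)dt+\sigma(u)dW$, $u(0)=u_0$). Let $z_0,z_1,\dots$ be i.i.d. standard Gaussian vectors in $\mathbb R^m$, independent of $u_0$. The Euler-type scheme is $v_{k+1}=v_k+b_h(v_k)h+\sigma_h(v_k)z_k\sqrt h$, $v_0=u_0$, $0\le k\le n-1$. Coefficient assumption. (i) There is $K>0$ (independent of $h$) such that for all $x,y\in\mathbb R^d$: $|b_h(x)|\le K(|x|+1)$, $\sup_x|\sigma_h(x)|<K$, $|b_h(x)-b_h(y)|\le K|x-y|$, $|\sigma_h(x)-\sigma_h(y)|\le K|x-y|$. (ii) There are $r>0$ and $C>0$ such that for every $R>0$ and every integer $S\ge0$ there are polynomial maps $p_b^{R,S}$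 ($\mathbb R^d$-valued) and $p_\sigma^{R,S}$ ($\mathbb R^{d\times m}$-valued) with $\max\{\deg p_b^{R,S},2\deg p_\sigma^{R,S}\}\le S$ and $\max\{\sup_{x\in I_R}|b_h(x)-p_b^{R,S}(x)|,\ \sup_{x\in I_R}|\sigma_h(x)-p_\sigma^{R,S}(x)|\}\le CR^rS^{-r}$ (with $S^{-r}=+\infty$ for $S=0$). Write $p_b^{R,S}(x)=\sum_{|\alpha|\le S}b_\alpha x^\alpha$ and $p_\sigma^{R,S}(x)p_\sigma^{R,S}(x)^T=\sum_{|\alpha|\le S}\sigma_\alpha x^\alpha$. (iii) There are constants $R^*>0$, $\lambda_1\ge\lambda_2>0$, $\eta\in(1,2)$ and $C_{b,\sigma}>0$, independent of $R$, such that for each $R>R^*$, with $L=\lfloor\lambda_1R^\eta\rfloor$, $S=\lfloor\lambda_2R^\eta\rfloor$, $M_{R,b}=\sum_{|\alpha|\le S}|b_\alpha|(2L+2S)^{|\alpha|}$, $M_{R,\sigma}=\sum_{|\alpha|\le S}|\sigma_\alpha|(2L+2S)^{|\alpha|}$, one has $M_{R,b,\sigma}:=M_{R,b}+\tfrac12M_{R,\sigma}\le C_{b,\sigma}R^\eta$. Initial-condition assumption. There is $\delta_0>0$ with $\mathbb E[\exp(\delta_0|u_0|^2)]<\infty$. mRPC algorithm (with $J=2L+S$, $S\le L$). Let $\mathcal J_{L,S}=\{(\alpha,\beta,\gamma):|\alpha|,|\beta|,|\gamma|\le L,\ |\alpha|+|\beta|+|\gamma|\le J\}$. Given a sequence $m=(m_\gamma)_{|\gamma|\le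 J}$ whose Hankel matrix $(m_{\alpha+\beta})_{|\alpha|,|\beta|\le L}$ is positive definite, let $\Lambda_m$ be the linear functional on polynomials of degree $\le J$ with $\Lambda_m(x^\gamma)=m_\gamma$; let $\{T_\alpha\}_{|\alpha|\le L}$ be obtained by Gram–Schmidt from the monomials $\{x^\alpha\}_{|\alpha|\le L}$ (in a fixed degree-graded order) for $\langle p,q\rangle=\Lambda_m(pq)$, and let $\Gamma_{\alpha\beta\gamma}=\Lambda_m(T_\alpha T_\beta T_\gamma)$ for $(\alpha,\beta,\gamma)\in\mathcal J_{L,S}$. For $|\mu|\le L$ write $x^\mu=\sum_{|\alpha|\le|\mu|}p_{\mu\alpha}T_\alpha$. The approximate expectation $\mathcal E_m$ is the linear functional on polynomials of degree $\le2L+2S$ given on monomials as follows. If $|\gamma|\le J$, write $\gamma=\gamma_1+\gamma_2+\gamma_3$ with $|\gamma_1|,|\gamma_2|\le L$, $|\gamma_3|\le S$ and put $\mathcal E_m[x^\gamma]=\sum_{\alpha,\beta,\nu}p_{\gamma_1\alpha}p_{\gamma_2\beta}p_{\gamma_3\nu}\Gamma_{\alpha\beta\nu}$ (this equals $m_\gamma$). If $J<|\gamma|\le2L+2S$, fix a decomposition $\gamma=\gamma_1+\gamma_2+\gamma_3+\gamma_4$ with $|\gamma_1|,|\gamma_2|\le L$, $|\gamma_3|,|\gamma_4|\le S$ and put $\mathcal E_m[x^\gamma]=\sum_{|\nu|\le L}q^{(1)}_\nu q^{(2)}_\nu$, with $q^{(1)}_\nu=\sum_{\alpha,\beta}p_{\gamma_1\alpha}p_{\gamma_3\beta}\Gamma_{\alpha\beta\nu}$,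 $q^{(2)}_\nu=\sum_{\alpha,\beta}p_{\gamma_2\alpha}p_{\gamma_4\beta}\Gamma_{\alpha\beta\nu}$. One mRPC step maps $m$ to $m'=(m'_\gamma)_{|\gamma|\le J}$, where, with $p_b=p_b^{R,S}$, $p_\sigma=p_\sigma^{R,S}$, $$m'_\gamma=m_\gamma+h\sum_{i:\gamma_i\ge1}\gamma_i\,\mathcal E_m\big[x^{\gamma-e_i}p_b^{(i)}\big]+\frac h2\sum_{j=1}^m\sum_{i,l=1}^d\gamma_i(\gamma_l-\delta_{il})\,\mathcal E_m\big[x^{\gamma-e_i-e_l}p_\sigma^{(i,j)}p_\sigma^{(l,j)}\big]$$ (terms with zero coefficient are omitted; $\delta_{il}$ is the Kronecker delta). The mRPC moments are $m^{\mathrm{RPC}}_{0,\gamma}=\mathbb E[u_0^\gamma]$ and $\{m^{\mathrm{RPC}}_{k+1,\gamma}\}_{|\gamma|\le J}$ is the result of one mRPC step from $\{m^{\mathrm{RPC}}_{k,\gamma}\}_{|\gamma|\le J}$. For $J<|\gamma|\le2L+2S$, $m^{\mathrm{RPC}}_{k,\gamma}$ denotes $\mathcal E[x^\gamma]$ computed from $\{m^{\mathrm{RPC}}_{k,\gamma}\}_{|\gamma|\le J}$. mRPC stability assumption. (i) For every $0\le k\le n$ the Hankel matrix $(m^{\mathrm{RPC}}_{k,\alpha+\beta})_{|\alpha|,|\beta|\le L}$ is positive definite. (ii) There is a constant $C_\delta$, depending only on $K$ and $T$, with $\sup_{0\le k\le n}|m^{\mathrm{RPC}}_{k,\gamma}|\le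 C_\delta\sqrt{|\gamma|!}$ for all $|\gamma|\le2L+2S$. Positivity assumption. There is $h_0>0$ such that for all $h\in(0,h_0)$ and each $k$ the distribution $\mu_k$ of $v_k$ is continuous and: there is $R^*>0$ such that for every degree $q$ there is $\lambda(q)>0$ such that for all $R>R^*$ and every real vector $\{c_\alpha\}_{|\alpha|\le q}$ with $\sum_{|\alpha|\le q}c_\alpha^2=1$ and $\sum_{|\alpha|\le q}c_\alpha x^\alpha\ge0$ on $I_R$, one has $\int_{I_R}\sum_{|\alpha|\le q}c_\alpha x^\alpha\,\mu_k(dx)\ge\lambda(q)$ for all $0\le k\le n$ (the bound $\lambda(q)$ being uniform in $k$ and in such $c$).
   Formalization: h_ℓ may also depend on the assumption constants (approximation C, C_{b,σ}, R*, h_0, λ(q), a bound on E exp(δ_0|u_0|²)), as existence of the measure requires; the matching measure is not unique, so the bound is shown for all such measures if ℓ≥2 and for some such measure if ℓ=1. *)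

(* Defs.v *)
Set Warnings "-notation-overridden,-notation-incompatible-prefix,-ambiguous-paths".
From HB Require Import structures.
From mathcomp Require Export all_boot all_order all_algebra.
From mathcomp Require Export all_classical all_reals all_analysis.
(* The notations of mpoly clash with those of mathcomp-analysis. *)
From mathcomp Require Export -(notations) mpoly.

Set Implicit Arguments.
Unset Strict Implicit.
Unset Printing Implicit Defensive.

Import Order.TTheory GRing.Theory Num.Theory.

Local Open Scope classical_set_scope.
Local Open Scope ring_scope.

(* Points of R^d are [d.-tuple R], whose measurable sets are generated by the
   coordinate projections, i.e. the Borel sets of R^d. *)
Section euclidean.
Variable R : realType.

Definition enorm d (x : d.-tuple R) : R :=
  Num.sqrt (\sum_(i < d) tnth x i ^+ 2).

Definition edist d (x y : d.-tuple R) : R :=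
  enorm [tuple tnth x i - tnth y i | i < d].

Definition fnorm d m (A : 'M[R]_(d, m)) : R := Num.sqrt (\tr (A *m A^T)).

Definition cube d (r : R) : set (d.-tuple R) :=
  [set x | forall i, `|tnth x i| <= r].

Definition mono d (g : multinom d) (x : d.-tuple R) : R :=
  \prod_(i < d) tnth x i ^+ g i.

Definition coupling d (mu nu : set (d.-tuple R) -> \bar R)
    (pi : probability (d.-tuple R * d.-tuple R)%type R) : Prop :=
  forall A, measurable A ->
    pi (fst @^-1` A) = mu A /\ pi (snd @^-1` A) = nu A.

Definition W1 d (mu nu : set (d.-tuple R) -> \bar R) : \bar R :=
  ereal_inf [set (\int[pi]_z (edist z.1 z.2)%:E)%E
            | pi in [set pi | coupling mu nu pi]].

(* Total degree; the zero polynomial gets degree 0. *)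
Definition deg d (p : mpoly d R) : nat := (mmeasure (@mdeg d) p).-1.

Definition vpoly_eval d (p : d.-tuple (mpoly d R)) (x : d.-tuple R) :
    d.-tuple R :=
  [tuple meval (tnth x) (tnth p i) | i < d].

Definition mxpoly_eval d m (p : 'M[mpoly d R]_(d, m)) (x : d.-tuple R) :
    'M[R]_(d, m) :=
  map_mx (meval (tnth x)) p.

End euclidean.

Section euler.
Variable R : realType.
Variables (dO : measure_display) (Omega : measurableType dO).
Variables (P : probability Omega R) (d m : nat).
Variables (u0 : {RV P >-> d.-tuple R}) (z : nat -> {RV P >-> m.-tuple R}).

Definition standard_gaussian (Z : {RV P >-> m.-tuple R}) : Prop :=
  forall A : 'I_m -> set R, (forall i, measurable (A i)) ->
    P [set w | forall i, A i (tnth (Z w) i)] =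
    (\prod_(i < m) normal_prob 0 1 (A i))%E.

(* Mutual independence of u0, z_0, z_1, ...; a subfamily is obtained by taking
   full sets for the other members. *)
Definition independent_noise : Prop :=
  forall (N : nat) (A : set (d.-tuple R)) (B : nat -> set (m.-tuple R)),
    measurable A -> (forall k, measurable (B k)) ->
    P [set w | A (u0 w) /\ forall k, (k < N)%N -> B k (z k w)] =
    (P (u0 @^-1` A) * \prod_(k < N) P (z k @^-1` B k))%E.

Definition noise_assumption : Prop :=
  (forall k, standard_gaussian (z k)) /\ independent_noise.

(* [b] and [sigma] are the coefficients for the step size [h]. *)
Fixpoint euler (h : R) (b : d.-tuple R -> d.-tuple R)
    (sigma : d.-tuple R -> 'M[R]_(d, m)) (k : nat) (w : Omega) : d.-tuple R :=
  if k is k'.+1 then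
    let v := euler h b sigma k' w in
    [tuple tnth v i + tnth (b v) i * h
           + (\sum_(j < m) sigma v i j * tnth (z k' w) j) * Num.sqrt h | i < d]
  else u0 w.

Definition euler_law h b sigma k : set (d.-tuple R) -> \bar R :=
  pushforward P (euler h b sigma k).

Definition initial_assumption (delta0 M0 : R) : Prop :=
  (\int[P]_w (expR (delta0 * enorm (u0 w) ^+ 2))%:E <= M0%:E)%E.

End euler.

(* The free choices in the mRPC algorithm: the degree-graded order of the
   monomials and, for each (L, S), the decompositions of the exponents. *)
Record mrpc_choices (d : nat) := MrpcChoices {
  mord : rel (multinom d);
  mord_total : total mord;
  mord_trans : transitive mord;
  mord_anti : antisymmetric mord;
  mord_graded : forall a b, (mdeg a < mdeg b)%N -> mord a b;
  dec3 : nat -> nat -> multinom d -> multinom d * multinom d * multinom d;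
  dec3P : forall L S g, (mdeg g <= 2 * L + S)%N ->
    let: (g1, g2, g3) := dec3 L S g in
    g = mnm_add (mnm_add g1 g2) g3 /\
    [/\ (mdeg g1 <= L)%N, (mdeg g2 <= L)%N & (mdeg g3 <= S)%N];
  dec4 : nat -> nat -> multinom d ->
    multinom d * multinom d * multinom d * multinom d;
  dec4P : forall L S g, (2 * L + S < mdeg g <= 2 * L + 2 * S)%N ->
    let: (g1, g2, g3, g4) := dec4 L S g in
    g = mnm_add (mnm_add (mnm_add g1 g2) g3) g4 /\
    [/\ (mdeg g1 <= L)%N, (mdeg g2 <= L)%N, (mdeg g3 <= S)%N
      & (mdeg g4 <= S)%N] }.

(* A family [mu] indexed by all multi-indices represents the finite sequence of
   its values at |gamma| <= 2L+S; the moments of a step depend only on them. *)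
Section mrpc.
Variables (R : realType) (d : nat) (ch : mrpc_choices d) (L S : nat).
Implicit Types (mu : multinom d -> R) (p : mpoly d R) (g : multinom d).

Definition moment_functional mu p : R :=
  \sum_(g <- msupp p) mcoeff g p * mu g.

Definition hankel_posdef mu : Prop :=
  forall c : bmultinom d L.+1 -> R, (exists a, c a != 0) ->
    0 < \sum_(a : bmultinom d L.+1) \sum_(b : bmultinom d L.+1)
          c a * mu (mnm_add a b) * c b.

Definition ordered_monomials : seq (multinom d) :=
  sort (mord ch) [seq bmnm a | a <- enum {: bmultinom d L.+1}].

Fixpoint gram_schmidt mu (acc : seq (mpoly d R)) (s : seq (multinom d)) :=
  if s is a :: s' then
    let U := mpolyX R a
      - \sum_(q <- acc) moment_functional mu (mpolyX R a * q) *: q in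
    gram_schmidt mu
      (rcons acc ((Num.sqrt (moment_functional mu (U * U)))^-1 *: U)) s'
  else acc.

Definition orthobasis mu (a : multinom d) : mpoly d R :=
  nth 0 (gram_schmidt mu [::] ordered_monomials) (index a ordered_monomials).

Definition triple_product mu (a b c : multinom d) : R :=
  moment_functional mu (orthobasis mu a * orthobasis mu b * orthobasis mu c).

(* The coefficients p_{a b} with x^a = \sum_(|b| <= |a|) p_{a b} T_b; they are
   unique for |a| <= L when the Hankel matrix is positive definite. *)
Definition basis_coef mu : multinom d -> multinom d -> R :=
  xget (fun _ _ => 0) [set c : multinom d -> multinom d -> R |
    forall a, (mdeg a <= L)%N ->
    mpolyX R a =
      \sum_(b : bmultinom d (mdeg a).+1) c a b *: orthobasis mu b].

Definition half_product mu g g' (nu : multinom d) : R :=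
  \sum_(a : bmultinom d (mdeg g).+1) \sum_(b : bmultinom d (mdeg g').+1)
    basis_coef mu g a * basis_coef mu g' b * triple_product mu a b nu.

Definition approx_monomial mu g : R :=
  if (mdeg g <= 2 * L + S)%N then
    let: (g1, g2, g3) := dec3 ch L S g in
    \sum_(a : bmultinom d (mdeg g1).+1) \sum_(b : bmultinom d (mdeg g2).+1)
      \sum_(c : bmultinom d (mdeg g3).+1)
        basis_coef mu g1 a * basis_coef mu g2 b * basis_coef mu g3 c
        * triple_product mu a b c
  else
    let: (g1, g2, g3, g4) := dec4 ch L S g in
    \sum_(nu : bmultinom d L.+1)
      half_product mu g1 g3 nu * half_product mu g2 g4 nu.

Definition approx_expectation mu p : R :=
  \sum_(g <- msupp p) mcoeff g p * approx_monomial mu g.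

Section step.
Variables (m : nat) (h : R).
Variables (pb : d.-tuple (mpoly d R)) (ps : 'M[mpoly d R]_(d, m)).

(* [mnm_sub] is truncated, but only in terms whose coefficient vanishes. *)
Definition mrpc_step mu g : R :=
  mu g
  + h * (\sum_(i < d) (g i)%:R *
      approx_expectation mu (mpolyX R (mnm_sub g (mnm1 i)) * tnth pb i))
  + h / 2 * (\sum_(j < m) \sum_(i < d) \sum_(l < d)
      (g i)%:R * ((g l)%:R - (i == l)%:R) *
      approx_expectation mu
        (mpolyX R (mnm_sub (mnm_sub g (mnm1 i)) (mnm1 l))
         * ps i j * ps l j)).

Fixpoint mrpc_iter (mu0 : multinom d -> R) (k : nat) : multinom d -> R :=
  if k is k'.+1 then mrpc_step (mrpc_iter mu0 k') else mu0.

Definition mrpc_moment mu0 k g : R :=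
  if (mdeg g <= 2 * L + S)%N then mrpc_iter mu0 k g
  else approx_monomial (mrpc_iter mu0 k) g.

End step.
End mrpc.

Section assumptions.
Variables (R : realType) (d m : nat) (T : R).

Definition level (lambda eta r : R) : nat := Num.truncn (lambda * r `^ eta).

Definition step_size (n : nat) : R := T / n%:R.

Definition radius (delta h : R) : R :=
  (Num.sqrt delta)^-1 * Num.sqrt (- 2 * ln h).

(* b_h, sigma_h *)
Variables (b : R -> d.-tuple R -> d.-tuple R).
Variables (sigma : R -> d.-tuple R -> 'M[R]_(d, m)).
(* p_b^{R,S}, p_sigma^{R,S} for the step size h, applied as [pb h R S] *)
Variables (pb : R -> R -> nat -> d.-tuple (mpoly d R)).
Variables (ps : R -> R -> nat -> 'M[mpoly d R]_(d, m)).

Definition lipschitz_growth (K : R) : Prop :=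
  forall n, (0 < n)%N -> let h := step_size n in
  [/\ forall x, enorm (b h x) <= K * (enorm x + 1),
      (ereal_sup (range (fun x => (fnorm (sigma h x))%:E)) < K%:E)%E,
      forall x y, edist (b h x) (b h y) <= K * edist x y
    & forall x y, fnorm (sigma h x - sigma h y) <= K * edist x y].

(* For S = 0 the error bound reads +oo, i.e. there is no bound. *)
Definition poly_approximation (r C : R) : Prop :=
  forall n, (0 < n)%N -> let h := step_size n in
  forall (rad : R) (S : nat), 0 < rad ->
  [/\ forall i, (deg (tnth (pb h rad S) i) <= S)%N,
      forall i j, (2 * deg (ps h rad S i j) <= S)%N
    & (0 < S)%N -> forall x, cube rad x ->
      edist (b h x) (vpoly_eval (pb h rad S) x)
        <= C * rad `^ r * S%:R `^ (- r) /\
      fnorm (sigma h x - mxpoly_eval (ps h rad S) x)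
        <= C * rad `^ r * S%:R `^ (- r)].

Definition drift_mass (h rad : R) (L S : nat) : R :=
  \sum_(a : bmultinom d S.+1)
    enorm [tuple mcoeff a (tnth (pb h rad S) i) | i < d]
    * (2 * L + 2 * S)%:R ^+ mdeg a.

Definition diffusion_mass (h rad : R) (L S : nat) : R :=
  \sum_(a : bmultinom d S.+1)
    fnorm (map_mx (mcoeff a) (ps h rad S *m (ps h rad S)^T))
    * (2 * L + 2 * S)%:R ^+ mdeg a.

Definition mass_growth (lambda1 lambda2 eta Cbs Rstar : R) : Prop :=
  forall n, (0 < n)%N -> let h := step_size n in
  forall rad : R, Rstar < rad ->
  let L := level lambda1 eta rad in let S := level lambda2 eta rad in
  drift_mass h rad L S + 2^-1 * diffusion_mass h rad L S <= Cbs * rad `^ eta.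

Definition coefficient_assumption
    (K r C lambda1 lambda2 eta Cbs Rstar : R) : Prop :=
  [/\ lipschitz_growth K, poly_approximation r C
    & mass_growth lambda1 lambda2 eta Cbs Rstar].

Variables (dO : measure_display) (Omega : measurableType dO).
Variables (P : probability Omega R).
Variables (u0 : {RV P >-> d.-tuple R}) (z : nat -> {RV P >-> m.-tuple R}).

Definition initial_moment (g : multinom d) : R := (\int[P]_w mono g (u0 w))%R.

Variables (ch : mrpc_choices d) (lambda1 lambda2 eta delta : R).

(* m^RPC_{k,gamma} for the algorithm run with h, R = radius delta h,
   L = |_lambda1 R^eta_| and S = |_lambda2 R^eta_| *)
Definition rpc_moment (h : R) (k : nat) (g : multinom d) : R :=
  let rad := radius delta h in
  let L := level lambda1 eta rad in let S := level lambda2 eta rad in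
  mrpc_moment ch L S h (pb h rad S) (ps h rad S) initial_moment k g.

Definition stability_assumption (Rstar Cdelta : R) : Prop :=
  forall n, (0 < n)%N -> let h := step_size n in
  let rad := radius delta h in Rstar < rad ->
  let L := level lambda1 eta rad in let S := level lambda2 eta rad in
  (forall k, (k <= n)%N -> hankel_posdef L (rpc_moment h k)) /\
  (forall k g, (k <= n)%N -> (mdeg g <= 2 * L + 2 * S)%N ->
     `|rpc_moment h k g| <= Cdelta * Num.sqrt ((mdeg g)`!)%:R).

(* A vector (c_a)_{|a| <= q} is given as the polynomial \sum_a c_a x^a. *)
Definition positivity_assumption (h0 Rpos : R) (lambda : nat -> R) : Prop :=
  forall n, (0 < n)%N -> let h := step_size n in h < h0 ->
  forall k, (k <= n)%N -> let muk := euler_law u0 z h (b h) (sigma h) k in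
  (forall x, muk [set x] = 0%E) /\
  forall (q : nat) (rad : R) (p : mpoly d R), Rpos < rad -> (deg p <= q)%N ->
    \sum_(a : bmultinom d q.+1) mcoeff a p ^+ 2 = 1 ->
    (forall x : d.-tuple R, cube rad x -> 0 <= meval (tnth x) p) ->
    ((lambda q)%:E <= \int[muk]_(x in cube rad) (meval (tnth x) p)%:E)%E.

Definition matches_rpc (ell : nat) (h : R) (k : nat)
    (nu : probability (d.-tuple R) R) : Prop :=
  let I := @cube R d (radius delta h) in
  nu I = 1%E /\
  forall g, (mdeg g <= ell)%N ->
    (\int[nu]_(x in I) mono g x)%R = rpc_moment h k g.

End assumptions.

(* Main.v *)
From HB Require Import structures.
Require Import Defs.
From mathcomp Require Import measurable_realfun.
From mathcomp Require Import ring lra zify.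

(* Let mu and nu have sub-Gaussian moments of order l and nearly the same moments up to
   order l. On a cube of size of order sqrt l, tensor products of Jackson kernels form a
   polynomial partition of unity of degree at most l, concentrated at scale l^(-1/2) around
   its nodes, whose weights under mu and nu nearly agree; routing the mass through the
   nodes, and controlling the rest by the moments of order l, yields W1 = O(l^(-1/2)).

   It remains to see that, for fixed l, the mRPC moments of order at most l converge to
   those of the Euler law as h -> 0, uniformly in k. Replacing the coefficients by their
   polynomial approximations inside the cube changes the scheme little in mean square. For
   the new scheme the moments satisfy the mRPC recursion up to a consistency error of order
   h^(3/2), Gaussian tails and a closure error for |gamma| > J. In the norm
   max |e_gamma| / W^|gamma|, W = 2L + 2S, the generator is bounded by
   M = M_(R,b,sigma) <= C R^eta, so that errors grow at most by exp (T M). This is beaten by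
   sqrt h = exp (- R^2 / 4) and by the tails since eta < 2, and by the closure error, which
   is of order q^-J for any q, since J is of order R^eta.

   Hence any matching measure obeys the bound, even without the logarithmic term and with
   delta = 1. Its existence follows from Farkas' lemma on a fine grid of the cube and the
   positivity assumption. For ell = 1 the measure is chosen to match up to order 2. *)

Set Implicit Arguments.
Unset Strict Implicit.
Unset Printing Implicit Defensive.

Import Order.TTheory GRing.Theory Num.Theory.
Import numFieldNormedType.Exports.

Local Open Scope classical_set_scope.
Local Open Scope ring_scope.

(** * Integrable functions, expectations and independence *)

(** The weight W^|gamma| suits the generator: differentiating x^gamma lowers the degree by one and
    produces the factors gamma_i, whose sum |gamma| is at most W, while multiplication by p_b costs
    at most M_(R,b). As n! <= W^n for n <= W, the moments themselves are bounded in this norm.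
    Returning to a fixed order l costs only the factor W^l.

    The polynomials are used inside the cube only: outside they may grow too fast for the scheme to
    have exponential moments. The tails of the schemes are paid by the bounds E exp (t |v_k|) <= A
    exp (B t^2), with A and B independent of h and k.

    The Jackson kernel is the normalised square of the Fejer kernel. Squaring makes the mean
    distance to the node O(1/n), where the Fejer kernel itself loses a logarithm, and keeps it
    nonnegative, as transport weights must be.

    A polynomial that is nonnegative on a grid may be slightly negative between the grid points. The
    uniform lower bound lambda(q) in the positivity assumption absorbs both this defect and the
    error of the mRPC moments. *)

Notation intg P f := (P.-integrable setT (EFin \o f)).

Section expectation.
Context {d} {T : measurableType d} {R : realType}.
Variable P : probability T R.
Implicit Types f g : T -> R.

Lemma intg_measurable f : intg P f -> measurable_fun setT f.
Proof. by move=> /(measurable_int P) /measurable_EFinP. Qed.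

Lemma intg_le f g : measurable_fun setT f -> (forall x, `|f x| <= g x) ->
  intg P g -> intg P f.
Proof.
move=> mf fg; apply: le_integrable => //; first exact/measurable_EFinP.
by move=> x _ /=; rewrite lee_fin (le_trans (fg x)) ?ler_norm.
Qed.

Lemma intg_cst c : intg P (fun=> c).
Proof. exact: finite_measure_integrable_cst. Qed.

Lemma intgD f g : intg P f -> intg P g -> intg P (fun x => f x + g x).
Proof. by move=> hf hg; apply: eq_integrable (integrableD _ hf hg). Qed.

Lemma intgZ c f : intg P f -> intg P (fun x => c * f x).
Proof. by move=> hf; apply: eq_integrable (integrableZl _ c hf). Qed.

Lemma intgN f : intg P f -> intg P (fun x => - f x).
Proof. by move=> /(intgZ (-1)); apply: eq_integrable => // x _ /=; rewrite mulN1r. Qed.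

Lemma intgB f g : intg P f -> intg P g -> intg P (fun x => f x - g x).
Proof. by move=> hf /intgN hg; exact: intgD. Qed.

Lemma intg_abs f : intg P f -> intg P (fun x => `|f x|).
Proof. by move=> hf; apply: integrable_norm. Qed.

Lemma intg_sum (I : Type) (s : seq I) (Q : pred I) (f : I -> T -> R) :
  (forall i, Q i -> intg P (f i)) -> intg P (fun x => \sum_(i <- s | Q i) f i x).
Proof.
move=> hf; apply: (@eq_integrable _ _ _ _ _ _
  (fun x => (\sum_(i <- s | Q i) (f i x)%:E)%E)) => //.
  by move=> x _; rewrite /= sumEFin.
exact: integrable_sum.
Qed.

Lemma Rexp_cst c : \int[P]_x (fun=> c) x = c.
Proof. by rewrite Rintegral_cst//= -[in fine _]/(P setT) probability_setT mulr1. Qed.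

Lemma Rexp_sum (I : Type) (s : seq I) (Q : pred I) (f : I -> T -> R) :
  (forall i, Q i -> intg P (f i)) ->
  \int[P]_x (\sum_(i <- s | Q i) f i x) = \sum_(i <- s | Q i) \int[P]_x f i x.
Proof.
move=> hf; elim: s => [|i s IH].
  by rewrite big_nil; under eq_Rintegral do rewrite big_nil; rewrite Rexp_cst.
rewrite big_cons; under eq_Rintegral do rewrite big_cons.
case: ifP => Qi; last by rewrite -IH.
rewrite RintegralD ?IH//; [exact: hf|exact: intg_sum].
Qed.

Lemma Rexp_le f g : intg P f -> intg P g -> (forall x, f x <= g x) ->
  \int[P]_x f x <= \int[P]_x g x.
Proof. by move=> *; apply: le_Rintegral. Qed.

Lemma Rexp_abs_le f g : intg P f -> intg P g -> (forall x, `|f x| <= g x) ->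
  `|\int[P]_x f x| <= \int[P]_x g x.
Proof.
move=> hf hg fg; apply: (le_trans (le_normr_Rintegral _ hf)) => //.
by apply: Rexp_le => //; exact: intg_abs.
Qed.

Lemma intg_EFin f : intg P f ->
  (\int[P]_x (f x)%:E)%E = (\int[P]_x f x)%:E.
Proof. by move=> hf; rewrite fineK//; exact: integrable_fin_num. Qed.

Lemma ge0_intg f M : measurable_fun setT f -> (forall x, 0 <= f x) ->
  (\int[P]_x (f x)%:E <= M%:E)%E -> intg P f /\ \int[P]_x f x <= M.
Proof.
move=> mf f0 fM; have hf : intg P f.
  apply/integrableP; split; first exact/measurable_EFinP.
  rewrite (eq_integral (fun x => (f x)%:E)); last first.
    by move=> x _ /=; rewrite ger0_norm.
  by rewrite (le_lt_trans fM)// ltry.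
by split => //; rewrite -lee_fin -intg_EFin.
Qed.

End expectation.

(** * Independence of two variables and the product law *)

Section independence.
Context {d d1 d2} {T : measurableType d} {T1 : measurableType d1}
  {T2 : measurableType d2} {R : realType}.
Variable P : probability T R.

Definition indep_rv (X : T -> T1) (Y : T -> T2) : Prop :=
  forall A B, measurable A -> measurable B ->
    P [set w | A (X w) /\ B (Y w)] = (P (X @^-1` A) * P (Y @^-1` B))%E.

Variables (X : {mfun T >-> T1}) (Y : {mfun T >-> T2}).
Hypothesis XY : indep_rv X Y.

Let XYf (w : T) : T1 * T2 := (X w, Y w).

Let mXY : measurable_fun setT XYf.
Proof. exact: measurable_fun_pair. Qed.

HB.instance Definition _ := isMeasurableFun.Build _ _ _ _ XYf mXY.

(** Rectangles generate the product sigma-algebra, so independence identifies the joint law with the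
    product of the laws. *)
Lemma indep_joint (A : set (T1 * T2)) : measurable A ->
  (distribution P X \x distribution P Y)%E A = P [set w | A (X w, Y w)].
Proof.
move=> mA; rewrite (@product_measure_unique _ _ _ _ _ _ _ (distribution P XYf))//.
Qed.

Lemma indep_integral (f : T1 * T2 -> \bar R) :
  measurable_fun setT f -> (forall z, 0 <= f z)%E ->
  (\int[P]_w f (X w, Y w) = \int[P]_w \int[P]_w' f (X w, Y w'))%E.
Proof.
move=> mf f0.
have -> : (\int[P]_w f (X w, Y w) = \int[distribution P XYf]_z f z)%E.
  by rewrite ge0_integral_distribution.
rewrite (eq_measure_integral (distribution P X \x distribution P Y)%E); last first.
  by move=> A mA _; rewrite -[LHS]/(P _) -indep_joint.
rewrite fubini_tonelli1// ge0_integral_distribution//; last 2 first.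
- exact: measurable_fun_fubini_tonelli_F.
- by move=> x; apply: integral_ge0.
apply: eq_integral => w _ /=; rewrite /fubini_F ge0_integral_distribution//.
exact: measurableT_comp.
Qed.

(** Replaces conditioning on [X]: a bound for the expectation over [Y] at each frozen value [x] is
    integrated against the law of [X] by Fubini. Used with the current state as [X] and the next
    noise as [Y]. *)
Lemma indep_expectation_close (f : T1 * T2 -> R) (F r : T1 -> R) :
  measurable_fun setT f -> measurable_fun setT F ->
  intg P (fun w => f (X w, Y w)) -> intg P (F \o X) -> intg P (r \o X) ->
  (forall x, intg P (fun w => f (x, Y w))) ->
  (forall x, `|\int[P]_w f (x, Y w) - F x| <= r x) ->
  `|\int[P]_w f (X w, Y w) - \int[P]_w F (X w)| <= \int[P]_w r (X w).
Proof.
move=> mf mF hf hF hr hx hxr.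
have mf' : measurable_fun setT (EFin \o f) by exact/measurable_EFinP.
pose G x := \int[P]_w f (x, Y w).
have E1 : (EFin \o G) = fubini_F (distribution P Y) (EFin \o f).
  apply/funext => x; rewrite /fubini_F integral_distribution//.
  - by rewrite -[LHS]intg_EFin.
  - exact: measurableT_comp.
  - exact: hx.
have int2 : (distribution P X \x distribution P Y)%E.-integrable setT (EFin \o f).
  apply/integrableP; split => //.
  rewrite (eq_measure_integral (distribution P XYf)); last first.
    by move=> A mA _; rewrite -[RHS]/(P _) -indep_joint.
  rewrite ge0_integral_distribution//; last exact: measurableT_comp.
  by have /integrableP[_] := hf.
have E2 : \int[P]_w f (X w, Y w) = \int[P]_w G (X w).
  rewrite /Rintegral; congr fine.
  have -> : (\int[P]_w (f (X w, Y w))%:E = \int[distribution P XYf]_z (EFin \o f) z)%E.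
    by rewrite integral_distribution.
  rewrite (eq_measure_integral (distribution P X \x distribution P Y)%E); last first.
    by move=> A mA _; rewrite -[LHS]/(P _) -indep_joint.
  rewrite -integral12_prod_meas1// -E1 integral_distribution//.
  - by rewrite E1; apply: measurable_fubini_F int2.
  - have := integrable_fubini_F int2; rewrite -E1 => /integrableP[mG iG].
    apply/integrableP; split; first exact: measurableT_comp.
    rewrite -(@ge0_integral_distribution _ _ _ _ _ P X (abse \o (EFin \o G)))//.
      exact: measurableT_comp.
    by move=> y; exact: abse_ge0.
have mG : measurable_fun setT G.
  by apply/measurable_EFinP; rewrite E1; apply: measurable_fubini_F int2.
have hG : intg P (fun w => G (X w)).
  apply: (@intg_le _ _ _ _ _ (fun w => `|F (X w)| + r (X w))).
  - exact: measurableT_comp.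
  - move=> w; have := hxr (X w); rewrite -/(G _) => h.
    by rewrite -[G _](subrK (F (X w))) (le_trans (ler_normD _ _))// addrC lerD2l.
  - by apply: intgD => //; exact: intg_abs.
rewrite E2 -RintegralB//; apply: Rexp_abs_le => //; first exact: intgB.
by move=> w; exact: hxr.
Qed.

End independence.

(** * Propagation of independence along a recursion *)

Section chain.
Context {d d1 d2 d3} {T : measurableType d} {T1 : measurableType d1}
  {T2 : measurableType d2} {T3 : measurableType d3} {R : realType}.
Variable P : probability T R.

(** Both sides are finite measures in [C] and agree on the pi-system of rectangles. The event [E],
    which will concern the later noise, is carried along as a restriction of [P]. *)
Lemma indep_joint_event (X : {mfun T >-> T1}) (Y : {mfun T >-> T2})
    (E : set T) (c : {nonneg R}) : measurable E ->
  (forall A B, measurable A -> measurable B ->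
    P [set w | [/\ A (X w), B (Y w) & E w]] =
    (P (X @^-1` A) * P (Y @^-1` B) * c%:num%:E)%E) ->
  forall C : set (T1 * T2), measurable C ->
    P [set w | C (X w, Y w) /\ E w] =
    ((distribution P X \x distribution P Y) C * c%:num%:E)%E.
Proof.
move=> mE h C mC.
pose XYf (w : T) : T1 * T2 := (X w, Y w).
have mXY : measurable_fun setT XYf by exact: measurable_fun_pair.
pose m0 : {measure set (T1 * T2) -> \bar R} := pushforward (mrestr P mE) XYf.
pose m1 := m0 mXY.
pose m2 : {measure set (T1 * T2) -> \bar R} :=
  mscale c (distribution P X \x distribution P Y)%E.
rewrite -[LHS]/(m1 C) muleC -[RHS]/(m2 C).
pose G : set (set (T1 * T2)) :=
  [set A `*` B | A in measurable & B in measurable].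
apply: (measure_unique G (fun=> setT)) => //.
- exact: measurable_prod_measurableType.
- move=> _ _ [X1 mX1 [X2 mX2 <-]] [Y1 mY1 [Y2 mY2 <-]].
  rewrite -setXI; exists (X1 `&` Y1); first exact: measurableI.
  by exists (X2 `&` Y2) => //; exact: measurableI.
- by move=> _; exists setT => //; exists setT => //; rewrite setXTT.
- by rewrite bigcup_const.
- move=> _ [A mA [B mB <-]].
  transitivity (P [set w | [/\ A (X w), B (Y w) & E w]]).
    by congr (P _); apply/seteqP; split => w /= [] // [].
  rewrite h// -[m2 _]/(_ * _)%E muleC; congr (_ * _)%E.
  by rewrite -[RHS]/((_ \x _)%E _) product_measure1E.
- move=> _; rewrite -[m1 _]/(P (XYf @^-1` setT `&` E)) preimage_setT setTI.
  by apply: le_lt_trans (probability_le1 P mE) _; rewrite ltry.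
Qed.

Definition indep_seq M (X : T -> T1) (Y : nat -> T -> T2) : Prop :=
  forall (A : set T1) (B : nat -> set T2),
    measurable A -> (forall k, measurable (B k)) ->
    P [set w | A (X w) /\ forall k, (k < M)%N -> B k (Y k w)] =
    (P (X @^-1` A) * \prod_(k < M) P (Y k @^-1` B k))%E.

Variables (X : {mfun T >-> T1}) (Y : nat -> {mfun T >-> T2}) (M : nat).
Hypothesis XY : indep_seq M.+1 X Y.

Let indep3 A B0 (B : nat -> set T2) :
  measurable A -> measurable B0 -> (forall k, measurable (B k)) ->
  P [set w | [/\ A (X w), B0 (Y 0%N w) &
                 forall k, (k < M)%N -> B k (Y k.+1 w)]] =
  (P (X @^-1` A) * P (Y 0%N @^-1` B0) *
    \prod_(k < M) P (Y k.+1 @^-1` B k))%E.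
Proof.
move=> mA mB0 mB; have := XY (B := fun k => if k is k'.+1 then B k' else B0) mA.
rewrite big_ord_recl/= muleA => <-; last by case.
congr (P _); apply/seteqP; split => w /=.
  by case=> hA hB0 hB; split=> // -[|k] // /hB.
by case=> hA h; split => //; [exact: (h 0%N)|move=> k kM; exact: (h k.+1)].
Qed.

Lemma indep_seq_head : indep_rv P X (Y 0%N).
Proof.
move=> A B mA mB; have := indep3 (B := fun=> setT) mA mB.
rewrite big1 ?mule1; last by move=> i _; rewrite preimage_setT probability_setT.
move=> <- //.
by congr (P _); apply/seteqP; split => w /= [].
Qed.

(** One step of a recursion driven by independent noise: the new state [Psi (X, Y 0)] is independent
    of the shifted sequence. The event on the later noise is taken as [E] in [indep_joint_event],
    with the constant [P E]. *)
Lemma indep_seq_next (Psi : T1 * T2 -> T3) : measurable_fun setT Psi ->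
  forall (A : set T3) (B : nat -> set T2),
    measurable A -> (forall k, measurable (B k)) ->
    P [set w | A (Psi (X w, Y 0%N w)) /\ forall k, (k < M)%N -> B k (Y k.+1 w)] =
    (P [set w | A (Psi (X w, Y 0%N w))] * \prod_(k < M) P (Y k.+1 @^-1` B k))%E.
Proof.
move=> mPsi A B mA mB.
set E := [set w | forall k, (k < M)%N -> B k (Y k.+1 w)].
have mE : measurable E.
  have -> : E = \bigcap_(k in `I_M) (Y k.+1 @^-1` B k) by [].
  apply: fin_bigcap_measurable => // k _.
  by rewrite -[X in measurable X]setTI; exact: measurable_funP.
have PE : P E = (\prod_(k < M) P (Y k.+1 @^-1` B k))%E.
  have := indep3 (A := setT) (B0 := setT) measurableT measurableT mB.
  rewrite !preimage_setT !probability_setT !mul1e => <-.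
  by congr (P _); apply/seteqP; split => w /= // [].
have c0 : 0 <= fine (P E) by rewrite fine_ge0.
have cE : (NngNum c0)%:num%:E = P E by rewrite /= fineK// fin_num_measure.
have h := @indep_joint_event X (Y 0%N) E (NngNum c0) mE.
have mC : measurable (Psi @^-1` A) by rewrite -[X in measurable X]setTI; exact: mPsi.
have {}h := h _ _ mC.
rewrite -[X in P X]/[set w | (Psi @^-1` A) (X w, Y 0%N w) /\ E w] h; last first.
  by move=> A' B' mA' mB'; rewrite indep3// cE PE.
by rewrite cE PE indep_joint//; exact: indep_seq_head.
Qed.

End chain.

(** * Gaussian moments *)

Section density.
Context d (T : measurableType d) (R : realType).
Variables (mu nu : {measure set T -> \bar R}) (g : T -> R).
Hypotheses (g0 : forall x, 0 <= g x) (mg : measurable_fun setT g).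
Hypothesis nuE : forall A, measurable A ->
  nu A = (\int[mu]_(x in A) (g x)%:E)%E.

Import HBNNSimple.

(** Monotone limits of simple functions reduce the identity to indicators, where it is [nuE].
    Applied to the normal law and to couplings given by a density. *)
Lemma ge0_integral_density (f : T -> \bar R) :
  measurable_fun setT f -> (forall x, 0 <= f x)%E ->
  (\int[nu]_x f x = \int[mu]_x (f x * (g x)%:E))%E.
Proof.
move=> mf f0; pose h := nnsfun_approx measurableT mf.
have mgE : measurable_fun setT (EFin \o g) by exact/measurable_EFinP.
have -> : (\int[nu]_x f x = limn (fun n => \int[nu]_x (EFin \o h n) x))%E.
  have fE x : f x = limn (fun n => (EFin \o h n) x).
    by apply/esym/cvg_lim => //; exact: cvg_nnsfun_approx.
  under eq_integral => x _ do rewrite fE.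
  apply: monotone_convergence => //.
  - by move=> n; exact/measurable_EFinP.
  - by move=> n x _ //=; rewrite lee_fin.
  - by move=> x _ a b ab; rewrite lee_fin; exact/lefP/nd_nnsfun_approx.
have -> : (\int[mu]_x (f x * (g x)%:E) =
    limn (fun n => \int[mu]_x ((EFin \o h n) x * (g x)%:E)))%E.
  have fg x : (f x * (g x)%:E = limn (fun n => (EFin \o h n) x * (g x)%:E))%E.
    by apply/esym/cvg_lim => //; apply: cvgeZr => //; exact: cvg_nnsfun_approx.
  under eq_integral => x _ do rewrite fg.
  apply: monotone_convergence => [//| | |].
  - by move=> n; apply/emeasurable_funM => //; exact/measurable_EFinP.
  - by move=> n x _ /=; rewrite mule_ge0 ?lee_fin.
  - move=> x _ a b ab/=; rewrite lee_wpmul2r ?lee_fin//.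
    exact/lefP/nd_nnsfun_approx.
suff suf n : (\int[nu]_x (EFin \o h n) x =
    \int[mu]_x ((EFin \o h n) x * (g x)%:E))%E.
  by congr (limn _); apply/funext.
transitivity (\int[nu]_x
   (\sum_(y \in range (h n)) (y * \1_(h n @^-1` [set y]) x)%:E))%E.
  by apply: eq_integral => t tE; rewrite /= fimfunE -fsumEFin.
have indich m r : measurable_fun setT (fun x => (r * \1_(h m @^-1` [set r]) x)%:E).
  by apply: (measurable_comp measurableT) => //; exact: measurable_funM.
rewrite ge0_integral_fsum//; last by move=> m y Ey; exact: nnfun_muleindic_ge0.
transitivity (\int[mu]_x (\sum_(y \in range (h n))
    (y * \1_(h n @^-1` [set y]) x)%:E * (g x)%:E))%E; last first.
  under eq_integral => x xE.
    rewrite -ge0_mule_fsuml => [|y]; last exact: nnfun_muleindic_ge0.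
    rewrite fsumEFin // -(fimfunE _ x); over.
  by [].
rewrite ge0_integral_fsum//; last 2 first.
  - by move=> y; apply: emeasurable_funM.
  - by move=> y x _; apply: mule_ge0; [exact: nnfun_muleindic_ge0|rewrite lee_fin].
apply: eq_fsbigr => r rhn.
under eq_integral do rewrite EFinM.
rewrite integralZl_indic_nnsfun => //.
under [RHS]eq_integral do rewrite EFinM -muleA.
rewrite ge0_integralZl//.
- under [in RHS]eq_integral do rewrite muleC.
  rewrite [in RHS](eq_integral ((EFin \o g) \_ (h n @^-1` [set r]))); last first.
    by move=> x xE; rewrite epatch_indic.
  by rewrite -integral_mkcondr setTI -nuE// integral_indic// setIT.
- by apply: emeasurable_funM => //; exact/measurable_EFinP.
- by move=> t Et; rewrite mule_ge0 ?lee_fin.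
- by move: rhn; rewrite inE => -[t _ <-]; rewrite lee_fin.
Qed.

End density.

(** Completing the square: exp (c x) times the standard normal density is exp (c^2 / 2) times the
    density of N(c, 1), whose integral is 1. *)
Lemma normal_mgf (R : realType) (c : R) :
  (\int[normal_prob 0 1]_x (expR (c * x))%:E = (expR (c ^+ 2 / 2))%:E)%E.
Proof.
rewrite (@ge0_integral_density _ _ _ lebesgue_measure _ (normal_pdf 0 1))//.
- transitivity (\int[lebesgue_measure]_x
      ((expR (c ^+ 2 / 2))%:E * (normal_pdf c 1 x)%:E))%E.
    apply: eq_integral => x _; rewrite !normal_pdfE ?oner_eq0// -!EFinM.
    congr (_%:E); rewrite /normal_fun mulrCA [RHS]mulrCA -!expRD; congr (_ * expR _).
    by field.
  rewrite ge0_integralZl//= ?integral_normal_pdf ?mule1 ?lee_fin ?expR_ge0//.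
    by apply/measurable_EFinP; exact: measurable_normal_pdf.
  by move=> x _; rewrite lee_fin normal_pdf_ge0.
- by move=> x; exact: normal_pdf_ge0.
- exact: measurable_normal_pdf.
- by apply/measurable_EFinP; apply: measurableT_comp => //; exact: measurable_funM.
Qed.

Lemma normal_transfer (R : realType) d (T : measurableType d)
    (P : probability T R) (X : {mfun T >-> R}) (f : R -> \bar R) :
  (forall A, measurable A -> P (X @^-1` A) = normal_prob 0 1 A) ->
  measurable_fun setT f -> (forall x, 0 <= f x)%E ->
  (\int[P]_w (f (X w)) = \int[normal_prob 0 1]_y f y)%E.
Proof.
move=> h mf f0.
have mX : measurable_fun setT (X : T -> measurableTypeR R).
  by move=> _ Y mY; exact: (@measurable_funPT _ _ _ _ X measurableT Y mY).
pose X' : {mfun T >-> measurableTypeR R} :=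
  HB.pack (X : T -> measurableTypeR R)
    (isMeasurableFun.Build _ _ _ _ (X : T -> measurableTypeR R) mX).
have <- := @ge0_integral_distribution _ _ _ _ _ P X' f mf f0.
by apply: eq_measure_integral => A mA _; exact: h.
Qed.

(** Induction on [M]: the factor [f 0 (Y 0)] is absorbed into [X], and by [indep_seq_next] the new
    first variable is independent of the shifted sequence. *)
Lemma indep_seq_prod d d2 (T : measurableType d) (T2 : measurableType d2)
    (R : realType) (P : probability T R) M (X : {mfun T >-> R})
    (Y : nat -> {mfun T >-> T2}) (f : nat -> T2 -> R) :
  (forall w, 0 <= X w) -> (forall k, measurable_fun setT (f k)) ->
  (forall k y, 0 <= f k y) -> indep_seq P M X Y ->
  (\int[P]_w (X w * \prod_(k < M) f k (Y k w))%:E =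
   (\int[P]_w (X w)%:E) * \prod_(k < M) \int[P]_w (f k (Y k w))%:E)%E.
Proof.
move=> X0 mf f0; elim: M X Y f X0 mf f0 => [|M IH] X Y f X0 mf f0 XY.
  by rewrite big_ord0 mule1; apply: eq_integral => w _; rewrite big_ord0 mulr1.
pose Psi (z : R * T2) := z.1 * f 0%N z.2.
have mPsi : measurable_fun setT Psi.
  by apply: measurable_funM => //; exact: measurableT_comp.
pose X' w := Psi (X w, Y 0%N w).
have mX' : measurable_fun setT X'.
  by apply: measurableT_comp => //; exact: measurable_fun_pair.
pose X'' : {mfun T >-> R} := HB.pack X' (isMeasurableFun.Build _ _ _ _ X' mX').
have XY' : indep_seq P M X'' (fun k => Y k.+1).
  by move=> A B mA mB; exact: (indep_seq_next XY mPsi).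
rewrite big_ord_recl muleA.
transitivity (\int[P]_w (X'' w * \prod_(k < M) f k.+1 (Y k.+1 w))%:E)%E.
  by apply: eq_integral => w _; rewrite big_ord_recl mulrA.
apply: etrans (IH X'' (fun k => Y k.+1) (fun k => f k.+1) _ _ _ XY') _ => //.
  by move=> w; exact: (mulr_ge0 (X0 w) (f0 _ _)).
congr (_ * _)%E.
have PsiE : measurable_fun setT (EFin \o Psi) by exact/measurable_EFinP.
(* The absolute value makes [g] nonnegative on the whole product, as [indep_integral] requires; it
   changes nothing at the values of [X]. *)
pose g (z : R * T2) := (`|z.1| * f 0%N z.2)%:E.
have mg : measurable_fun setT g.
  apply/measurable_EFinP; apply: measurable_funM.
    by apply: measurableT_comp => //; exact: measurableT_comp.
  exact: measurableT_comp.
transitivity (\int[P]_w g (X w, Y 0%N w))%E.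
  by apply: eq_integral => w _; rewrite /g/= ger0_norm.
rewrite (indep_integral (indep_seq_head XY))//; last first.
  by move=> z; rewrite lee_fin mulr_ge0.
transitivity (\int[P]_w ((X w)%:E * \int[P]_w' (f 0%N (Y 0%N w'))%:E))%E.
  apply: eq_integral => w _; rewrite /g/= ger0_norm//.
  under eq_integral do rewrite EFinM.
  rewrite ge0_integralZl//; last by rewrite lee_fin.
    by apply/measurable_EFinP; exact: measurableT_comp.
  by move=> x _; rewrite lee_fin.
rewrite ge0_integralZr//.
- exact/measurable_EFinP.
- by move=> x _; rewrite lee_fin.
- by apply: integral_ge0 => x _; rewrite lee_fin.
Qed.

Section gauss.
Context {R : realType} {dO} {Omega : measurableType dO} {m : nat}.
Variables (P : probability Omega R) (Z : {RV P >-> m.-tuple R}).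
Hypothesis gZ : standard_gaussian Z.

Definition lin (c : 'I_m -> R) (z : m.-tuple R) : R := \sum_(j < m) c j * tnth z j.

Lemma measurable_lin c : measurable_fun setT (lin c).
Proof.
apply: measurable_sum => j; apply: measurable_funM => //; exact: measurable_tnth.
Qed.

Lemma gauss_mgf c : (\int[P]_w (expR (lin c (Z w)))%:E =
  (expR ((\sum_(j < m) c j ^+ 2) / 2))%:E)%E.
Proof.
(* The [m] coordinates are extended by 0 to a sequence, and the constant 1 serves as the first
   variable, so that the probabilities of boxes take the form of [indep_seq]. *)
pose Yf k w := if insub k is Some i then tnth (Z w) (i : 'I_m) else 0.
have mY k : measurable_fun setT (Yf k).
  rewrite /Yf; case: insub => [i|]; last exact: measurable_cst.
  by apply: (measurableT_comp (measurable_tnth i)).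
pose Y k : {mfun Omega >-> R} := HB.pack (Yf k) (isMeasurableFun.Build _ _ _ _ (Yf k) (mY k)).
have YE (i : 'I_m) w : Yf i w = tnth (Z w) i by rewrite /Yf valK.
have norm1 (A : set R) (i : 'I_m) : measurable A -> P ((Y (nat_of_ord i)) @^-1` A) = normal_prob 0 1 A.
  move=> mA; have := gZ (A := fun j => if j == i then A else setT).
  rewrite (bigD1 i)//= eqxx big1 ?mule1; last first.
    by move=> j /negPf ->; rewrite probability_setT.
  move=> <-; last by move=> j; case: ifP.
  congr (P _); apply/seteqP; split => w /=.
    by rewrite YE => h j; case: eqP => // ->.
  by move=> /(_ i); rewrite eqxx YE.
pose X1 : {mfun Omega >-> R} := cst 1.
have XY : indep_seq P m X1 Y.
  move=> A B mA mB.
  have [A1|A1] := pselect (A 1).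
    have -> : X1 @^-1` A = setT by apply/seteqP; split.
    rewrite probability_setT mul1e.
    rewrite [RHS](eq_bigr (fun i : 'I_m => normal_prob 0 1 (B i))); last first.
      by move=> i _; exact: norm1.
    have <- := gZ (A := fun j => B j) (fun i => mB i).
    congr (P _); apply/seteqP; split => w /=.
      by move=> [_ h] i; rewrite -YE; apply: h.
    by move=> h; split => // k km; have := h (Ordinal km); rewrite -YE.
  have -> : X1 @^-1` A = set0 by apply/seteqP; split.
  rewrite measure0 mul0e.
  have -> : [set w | A (X1 w) /\ (forall k : nat, (k < m)%N -> B k (Y k w))] = set0.
    by apply/seteqP; split => // w [].
  by rewrite measure0.
pose f k (y : R) := expR ((if insub k is Some i then c (i : 'I_m) else 0) * y).
have mf k : measurable_fun setT (f k).
  by apply: measurableT_comp => //; exact: measurable_funM.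
have := indep_seq_prod (X := X1) (Y := Y) (f := f) (fun=> ler01) mf _ XY.
have -> : (\int[P]_w (X1 w)%:E = 1)%E.
  rewrite (integral_cst P measurableT 1%E).
  exact: (etrans (mul1e _) (probability_setT P)).
rewrite mul1e => H.
transitivity (\int[P]_w (X1 w * \prod_(k < m) f k (Y k w))%:E)%E.
  apply: eq_integral => w _; rewrite mul1r /lin expR_sum.
  by congr (_%:E); apply: eq_bigr => i _; rewrite -YE /f valK.
rewrite H; last by move=> k y; rewrite expR_ge0.
rewrite mulr_suml expR_sum -prodEFin; apply: eq_bigr => i _.
transitivity (\int[normal_prob 0 1]_y (f i y)%:E)%E.
  apply: (normal_transfer (X := Y i) (f := fun y => (f i y)%:E)).
  - by move=> A mA; exact: norm1.
  - exact/measurable_EFinP.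
  - by move=> x; rewrite lee_fin expR_ge0.
by rewrite /f valK normal_mgf.
Qed.

End gauss.

(** * Elementary inequalities for the exponential *)

Section exp_ineq.
Context {R : realType}.
Implicit Types x u a : R.

Lemma exprn_fact_expR x n : 0 <= x -> x ^+ n <= n`!%:R * expR x.
Proof.
move=> x0; case: n => [|n].
  by rewrite expr0 fact0 mul1r -expR0 ler_expR.
have h := expR_ge1Dxn n x0.
rewrite mulrC -ler_pdivrMr ?ltr0n ?fact_gt0//.
by apply: le_trans h; rewrite lerDr.
Qed.

Lemma expR_abs_le x : expR `|x| <= expR x + expR (- x).
Proof.
have h1 := expR_ge0 x; have h2 := expR_ge0 (- x).
by case: (ger0P x) => _; [rewrite lerDl|rewrite lerDr].
Qed.

Lemma expR_le1D2 a : 0 <= a <= 2^-1 -> expR a <= 1 + a + 2 * a ^+ 2.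
Proof.
move=> /andP[a0 a1]; have h : 1 - a <= expR (- a) by exact: expR_ge1Dx.
have e0 := expR_gt0 a; have : expR a * (1 - a) <= 1.
  by apply: le_trans (ler_wpM2l (ltW e0) h) _; rewrite expRxMexpNx_1.
have : (1 - a) * (1 + a + 2 * a ^+ 2) >= 1.
  have -> : (1 - a) * (1 + a + 2 * a ^+ 2) = 1 + a ^+ 2 * (1 - 2 * a) by ring.
  by rewrite lerDl mulr_ge0 ?sqr_ge0//; lra.
by move=> h1 h2; rewrite -(@ler_pM2r _ (1 - a)); [rewrite [leRHS]mulrC; lra|lra].
Qed.

(** With E = exp u and F = exp (-u), the relation E F = 1 gives E + F - 2 = E (1 - F)^2 = F (E -
    1)^2. The linear bounds 1 - u <= F and 1 + u <= E turn these two forms into an upper and a lower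
    estimate. *)
Lemma cosh_taylor2 u :
  `|expR u + expR (- u) - 2 - u ^+ 2| <= `|u| ^+ 3 * expR `|u|.
Proof.
wlog u0 : u / 0 <= u.
  move=> H; case: (lerP 0 u) => [/H//|/ltW u0].
  by have := H (- u); rewrite oppr_ge0 opprK sqrrN normrN addrC => /(_ u0); rewrite [expR u + _]addrC addrC.
rewrite (ger0_norm u0); set E := expR u; set F := expR (- u).
have EF : E * F = 1 by exact: expRxMexpNx_1.
have E0 : 0 < E by exact: expR_gt0.
have F0 : 0 < F by exact: expR_gt0.
have F1 : F <= 1 by rewrite expR_le1 oppr_le0.
have hF : 1 - u <= F by exact: expR_ge1Dx.
have hE : 1 + u <= E by exact: expR_ge1Dx.
have id : E + F - 2 = E * (1 - F) ^+ 2.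
  have -> : E * (1 - F) ^+ 2 = E - 2 * (E * F) + E * F * F by ring.
  by rewrite EF; ring.
have id2 : E + F - 2 = F * (E - 1) ^+ 2.
  have -> : F * (E - 1) ^+ 2 = E * F * E - 2 * (E * F) + F by ring.
  by rewrite EF; ring.
rewrite ler_norml; apply/andP; split.
  have h1 : F * u ^+ 2 <= E + F - 2.
    by rewrite id2 ler_wpM2l ?(ltW E0) ?(ltW F0)// lerXn2r ?nnegrE//; lra.
  have h2 : (1 - u) * u ^+ 2 <= F * u ^+ 2 by rewrite ler_wpM2r ?sqr_ge0.
  have h3 : u ^+ 3 <= u ^+ 3 * E by rewrite ler_peMr ?exprn_ge0//; lra.
  have : (1 - u) * u ^+ 2 = u ^+ 2 - u ^+ 3 by ring.
  lra.
have h1 : E + F - 2 <= E * u ^+ 2.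
  by rewrite id ler_wpM2l ?(ltW E0) ?(ltW F0)// lerXn2r ?nnegrE//; lra.
have h2 : E <= 1 + u * E.
  have : E * (1 - u) <= 1 by apply: le_trans (ler_wpM2l (ltW E0) hF) _; rewrite EF.
  by rewrite mulrBr mulr1 [E * u]mulrC; lra.
have h3 : E * u ^+ 2 <= u ^+ 2 + u ^+ 3 * E.
  have -> : u ^+ 2 + u ^+ 3 * E = (1 + u * E) * u ^+ 2 by ring.
  by rewrite ler_wpM2r ?sqr_ge0.
lra.
Qed.

Lemma small_eq0 (x C t0 : R) : 0 < t0 -> 0 <= C ->
  (forall t : R, 0 < t <= t0 -> `|x| <= t * C) -> x = 0.
Proof.
move=> t00 C0 h; apply/eqP; rewrite -normr_le0; apply/ler_addgt0Pl => e e0.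
rewrite addr0; pose t := Num.min t0 (e / (C + 1)).
have C1 : 0 < C + 1 by lra.
have t1 : t <= e / (C + 1) by rewrite ge_min lexx orbT.
have tp : 0 < t by rewrite lt_min t00 divr_gt0.
have := h t; rewrite tp ge_min lexx => /(_ isT) /le_trans; apply.
apply: (@le_trans _ _ (e / (C + 1) * C)); first by rewrite ler_wpM2r.
by rewrite mulrAC ler_pdivrMr// ler_wpM2l ?ltW//; lra.
Qed.

End exp_ineq.

(** * Mean and variance from the moment generating function *)

Section mgf.
Context {d} {T : measurableType d} {R : realType}.
Variables (P : probability T R) (X : T -> R) (s : R).
Hypotheses (mX : measurable_fun setT X) (s0 : 0 <= s).
Hypothesis mgf : forall t, (\int[P]_w (expR (t * X w))%:E = (expR (t ^+ 2 * s / 2))%:E)%E.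

Let mexp t : measurable_fun setT (fun w => expR (t * X w)).
Proof. by apply: measurableT_comp => //; exact: measurable_funM. Qed.

Lemma mgf_intg t : intg P (fun w => expR (t * X w)).
Proof.
have := @ge0_intg _ _ _ P (fun w => expR (t * X w)) (expR (t ^+ 2 * s / 2)) (mexp t).
by case=> [w||//]; rewrite ?expR_ge0// mgf.
Qed.

Lemma mgf_exp t : \int[P]_w (expR (t * X w)) = expR (t ^+ 2 * s / 2).
Proof. by rewrite /Rintegral mgf. Qed.

Lemma mgf_intg_abs t : 0 <= t -> intg P (fun w => expR (t * `|X w|)).
Proof.
move=> t0; apply: (intg_le _ _ (intgD (mgf_intg t) (mgf_intg (- t)))).
  by apply: measurableT_comp => //; apply: measurable_funM => //; exact: measurableT_comp.
move=> w; rewrite ger0_norm ?expR_ge0// mulNr -{1}(ger0_norm t0) -normrM.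
exact: expR_abs_le.
Qed.

Lemma mgf_abs_le t : 0 <= t ->
  \int[P]_w (expR (t * `|X w|)) <= 2 * expR (t ^+ 2 * s / 2).
Proof.
move=> t0; rewrite mulr2n mulrDl !mul1r -{1}mgf_exp -(sqrrN t) -mgf_exp.
rewrite -RintegralD//; try exact: mgf_intg.
apply: Rexp_le; [exact: mgf_intg_abs|apply: intgD; exact: mgf_intg|].
by move=> w; rewrite mulNr -{1}(ger0_norm t0) -normrM; exact: expR_abs_le.
Qed.

Lemma mgf_intg_pow n : intg P (fun w => X w ^+ n).
Proof.
apply: (intg_le _ _ (intgZ n`!%:R (mgf_intg_abs ler01))).
  exact: measurable_funX.
by move=> w; rewrite mul1r normrX exprn_fact_expR.
Qed.

Lemma mgf_intg1 : intg P X.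
Proof. by have := mgf_intg_pow 1; apply: eq_integrable => // w _; rewrite /= expr1. Qed.

(** Integrating 1 + tX <= exp (tX) gives t E[X] <= exp (t^2 s / 2) - 1 = O(t^2). Both signs of t,
    divided by |t| -> 0, force E[X] = 0. *)
Lemma mgf_mean0 : \int[P]_w X w = 0.
Proof.
have key t : t * \int[P]_w X w <= expR (t ^+ 2 * s / 2) - 1.
  rewrite -mgf_exp -RintegralZl//; last exact: mgf_intg1.
  rewrite lerBrDl -[X in X + _](Rexp_cst P 1) -RintegralD//; last 2 first.
  - exact: intg_cst.
  - by apply: intgZ; exact: mgf_intg1.
  apply: Rexp_le; first by apply: intgD; [exact: intg_cst|apply: intgZ; exact: mgf_intg1].
    exact: mgf_intg.
  by move=> w; exact: expR_ge1Dx.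
(* For t <= 1 / (1 + s) the exponent t^2 s / 2 is at most 1/2, the range of [expR_le1D2]. *)
apply: (@small_eq0 _ _ (s + s ^+ 2) (1 / (1 + s))); first by rewrite divr_gt0// ltr_wpDr.
  by rewrite addr_ge0 ?sqr_ge0.
move=> t /andP[t0 t1].
have s1 : 0 < 1 + s by rewrite ltr_wpDr.
have ts : t * (1 + s) <= 1 by move: t1; rewrite ler_pdivlMr.
have tps := mulr_ge0 (ltW t0) s0.
have t1' : t <= 1 by clear t1; lra.
have as1 : 0 <= t ^+ 2 * s / 2 <= 2^-1.
  by apply/andP; split; [rewrite divr_ge0// mulr_ge0// sqr_ge0|clear t1; nra].
have h := expR_le1D2 as1.
have h2 : expR (t ^+ 2 * s / 2) - 1 <= t * (t * (s + s ^+ 2)).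
  have tt1 : t ^+ 2 <= 1 by rewrite expr_le1// ltW.
  have := mulr_ge0 (sqr_ge0 (t * s)) (_ : 0 <= 1 - t ^+ 2).
  have := mulr_ge0 (sqr_ge0 t) s0; have := sqr_ge0 (t * s); clear t1.
  have -> : (t * s) ^+ 2 * (1 - t ^+ 2) = (t * s) ^+ 2 - 4 * (t ^+ 2 * s / 2) ^+ 2 by field.
  have -> : t * (t * (s + s ^+ 2)) = t ^+ 2 * s + (t * s) ^+ 2 by ring.
  move=> H1 H2 /(_ _) H3; have {H3} : 0 <= (t * s) ^+ 2 - 4 * (t ^+ 2 * s / 2) ^+ 2 by apply: H3; lra.
  lra.
have k1 := key t; have k2 := key (- t); rewrite sqrrN in k2.
rewrite -(@ler_pM2l _ t)// -{1}(gtr0_norm t0) -normrM ler_norml.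
by apply/andP; split; lra.
Qed.

(** The second-order expansion of exp (tX) + exp (-tX) has an error of order t^3 by [cosh_taylor2],
    while its expectation is 2 exp (t^2 s / 2) = 2 + t^2 s + O(t^4). Dividing by t^2 and letting t
    tend to 0 identifies the variance. *)
Lemma mgf_var : \int[P]_w (X w ^+ 2) = s.
Proof.
apply/eqP; rewrite -subr_eq0; apply/eqP.
set V := \int[P]_w (X w ^+ 2).
pose C := \int[P]_w (6 * expR (2 * `|X w|)).
have iC : intg P (fun w => 6 * expR (2 * `|X w|)) by apply: intgZ; exact: mgf_intg_abs.
have C0 : 0 <= C by apply: Rintegral_ge0 => w _; rewrite mulr_ge0 ?expR_ge0.
have key (t : R) : 0 < t <= 1 -> `|2 * (expR (t ^+ 2 * s / 2) - 1) - t ^+ 2 * V| <= t ^+ 3 * C.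
  move=> /andP[t0 t1].
  have i1 := mgf_intg t; have i2 := mgf_intg (- t).
  have i3 : intg P (fun w => expR (t * X w) + expR (- t * X w)) by exact: intgD.
  have i4 : intg P (fun w => expR (t * X w) + expR (- t * X w) - 2).
    by apply: intgB => //; exact: intg_cst.
  have i5 : intg P (fun w => t ^+ 2 * X w ^+ 2) by apply: intgZ; exact: mgf_intg_pow.
  have -> : 2 * (expR (t ^+ 2 * s / 2) - 1) - t ^+ 2 * V =
      \int[P]_w (expR (t * X w) + expR (- t * X w) - 2 - t ^+ 2 * X w ^+ 2).
    rewrite RintegralB// RintegralB//; last exact: intg_cst.
    rewrite RintegralD// RintegralZl//; last exact: mgf_intg_pow.
    by rewrite !mgf_exp sqrrN Rexp_cst -/V; ring.
  rewrite /C -RintegralZl//; apply: Rexp_abs_le.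
  - exact: intgB.
  - exact: intgZ.
  move=> w; rewrite -exprMn mulNr; apply: le_trans (cosh_taylor2 _) _.
  rewrite normrM exprMn (gtr0_norm t0) -mulrA ler_wpM2l ?exprn_ge0 ?(ltW t0)//.
  have h := @exprn_fact_expR _ `|X w| 3 (normr_ge0 _).
  have -> : 2 * `|X w| = `|X w| + `|X w| by ring.
  rewrite expRD mulrA; apply: ler_pM; rewrite ?exprn_ge0 ?expR_ge0//.
  by rewrite ler_expR ler_piMl// ltW.
apply: (@small_eq0 _ _ (C + s ^+ 2) (1 / (1 + s))); first by rewrite divr_gt0// ltr_wpDr.
  by rewrite addr_ge0 ?sqr_ge0.
move=> t /andP[t0 t1].
have s1 : 0 < 1 + s by rewrite ltr_wpDr.
have ts : t * (1 + s) <= 1 by move: t1; rewrite ler_pdivlMr.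
have tps := mulr_ge0 (ltW t0) s0.
have t1' : t <= 1 by clear t1; lra.
have as1 : 0 <= t ^+ 2 * s / 2 <= 2^-1.
  by apply/andP; split; [rewrite divr_ge0// mulr_ge0// sqr_ge0|clear t1; nra].
have h := expR_le1D2 as1; have h' := expR_ge1Dx (t ^+ 2 * s / 2).
have tt : 0 < t <= 1 by rewrite t0.
have := key t tt; rewrite ler_norml => /andP[k1 k2].
rewrite -(@ler_pM2l _ (t ^+ 2)) ?exprn_gt0// -{1}(ger0_norm (sqr_ge0 t)) -normrM ler_norml.
have : 0 <= t ^+ 3 * s ^+ 2 * (1 - t) by rewrite !mulr_ge0 ?sqr_ge0 ?exprn_ge0//; lra.
have -> : t ^+ 2 * (t * (C + s ^+ 2)) = t ^+ 3 * C + t ^+ 3 * s ^+ 2 by ring.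
have -> : t ^+ 3 * s ^+ 2 * (1 - t) = t ^+ 3 * s ^+ 2 - 4 * (t ^+ 2 * s / 2) ^+ 2 by field.
have -> : t ^+ 2 * (V - s) = t ^+ 2 * V - 2 * (t ^+ 2 * s / 2) by field.
have : 0 <= t ^+ 3 * s ^+ 2 by rewrite mulr_ge0 ?sqr_ge0 ?exprn_ge0 ?ltW.
by move=> *; apply/andP; split; lra.
Qed.

End mgf.

(** * The Jackson kernel *)

Section jackson.
Context {R : realType}.
Implicit Types (t : R) (n k : nat).

Let csum n t : R := \sum_(a < n) cos (a%:R * t).
Let ssum n t : R := \sum_(a < n) sin (a%:R * t).

Lemma csum_closed n t :
  2 * sin (t / 2) * csum n t = sin (n%:R * t - t / 2) + sin (t / 2).
Proof.
elim: n => [|n IH].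
  by rewrite /csum big_ord0 mulr0 mul0r sub0r sinN addNr.
rewrite /csum big_ord_recr/= mulrDr -/(csum n t) IH.
have -> : n.+1%:R * t - t / 2 = n%:R * t + t / 2.
  by rewrite -[n.+1]addn1 natrD; field.
by rewrite sinB sinD; ring.
Qed.

Lemma ssum_closed n t :
  2 * sin (t / 2) * ssum n t = cos (t / 2) - cos (n%:R * t - t / 2).
Proof.
elim: n => [|n IH].
  by rewrite /ssum big_ord0 mulr0 mul0r sub0r cosN subrr.
rewrite /ssum big_ord_recr/= mulrDr -/(ssum n t) IH.
have -> : n.+1%:R * t - t / 2 = n%:R * t + t / 2.
  by rewrite -[n.+1]addn1 natrD; field.
by rewrite cosB cosD; ring.
Qed.

(* |sum_(a < n) e^(iat)|^2, i.e. n times the Fejer kernel *)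
Definition fejer n t : R := csum n t ^+ 2 + ssum n t ^+ 2.

Lemma fejer_ge0 n t : 0 <= fejer n t.
Proof. by rewrite addr_ge0 ?sqr_ge0. Qed.

(** The geometric sum satisfies |sum_(a < n) e^(iat)| <= 2 / |1 - e^(it)| = 1 / |sin (t/2)|, here in
    real form. *)
Lemma fejer_sin n t : fejer n t * sin (t / 2) ^+ 2 <= 1.
Proof.
have hA := csum_closed n t; have hB := ssum_closed n t.
have h1 := cos2Dsin2 (t / 2); have h2 := cos2Dsin2 (n%:R * t - t / 2).
have : 4 * (fejer n t * sin (t / 2) ^+ 2) =
    (2 * sin (t / 2) * csum n t) ^+ 2 + (2 * sin (t / 2) * ssum n t) ^+ 2.
  by rewrite /fejer; ring.
rewrite hA hB.
have := sqr_ge0 (sin (n%:R * t - t / 2) - sin (t / 2)).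
have := sqr_ge0 (cos (t / 2) + cos (n%:R * t - t / 2)).
nra.
Qed.

Definition gap (a b : nat) : nat := (a - b) + (b - a).

Lemma cos_gap a b t : cos (a%:R * t - b%:R * t) = cos ((gap a b)%:R * t).
Proof.
rewrite -mulrBl /gap; case: (leqP a b) => ab.
  rewrite (eqP ab) add0n natrB// -cosN; congr cos; ring.
by rewrite (eqP (ltnW ab)) addn0 natrB// ltnW.
Qed.

Lemma fejerE n t :
  fejer n t = \sum_(p : 'I_n * 'I_n) cos ((gap p.1 p.2)%:R * t).
Proof.
rewrite -(pair_bigA _ (fun a b : 'I_n => cos ((gap a b)%:R * t)))/=.
rewrite /fejer !expr2 /csum /ssum !mulr_suml -big_split/=.
apply: eq_bigr => a _; rewrite !mulr_sumr -big_split/=.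
by apply: eq_bigr => b _; rewrite -cos_gap cosB.
Qed.

Definition gap4 n (p : ('I_n * 'I_n) * ('I_n * 'I_n)) : nat :=
  gap (p.1.1 + p.2.1) (p.1.2 + p.2.2).

(** A product cos u cos v is the mean of cos (u + v) and cos (u - v). Exchanging the two indices of
    the second pair swaps these terms, so after summation one of them may be kept alone. *)
Lemma fejer2E n t : fejer n t ^+ 2 =
  \sum_(p : ('I_n * 'I_n) * ('I_n * 'I_n)) cos ((gap4 p)%:R * t).
Proof.
pose F (p q : 'I_n * 'I_n) : R := cos ((gap4 (p, q))%:R * t).
pose G (p q : 'I_n * 'I_n) : R := F p (q.2, q.1).
have FG : \sum_p \sum_q F p q = \sum_p \sum_q G p q.
  apply: eq_bigr => p _; rewrite (reindex_inj (h := fun q => (q.2, q.1))).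
    by apply: eq_bigr => -[].
  by move=> [a b] [c e] [-> ->].
rewrite -(pair_bigA _ F) /=.
have -> : fejer n t ^+ 2 = \sum_p \sum_q (F p q + G p q) / 2.
  rewrite expr2 {1}fejerE mulr_suml; apply: eq_bigr => p _.
  rewrite fejerE mulr_sumr; apply: eq_bigr => q _.
  rewrite /G /F /gap4/= -!cos_gap !natrD !mulrDl.
  set a := p.1%:R * t; set b := p.2%:R * t; set c := q.1%:R * t; set e := q.2%:R * t.
  have -> : a + c - (b + e) = (a - b) + (c - e) by ring.
  have -> : a + e - (b + c) = (a - b) - (c - e) by ring.
  by move: (a - b) (c - e) => u v; rewrite cosB cosD; field.
transitivity ((\sum_p \sum_q F p q + \sum_p \sum_q G p q) / 2).
  rewrite -big_split/= mulr_suml; apply: eq_bigr => p _.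
  by rewrite -big_split/= mulr_suml.
by rewrite -FG; field.
Qed.

Lemma gap4_bound n (p : ('I_n * 'I_n) * ('I_n * 'I_n)) : (gap4 p <= 2 * n.-1)%N.
Proof.
case: p => -[a b] [c e]; rewrite /gap4 /gap/=.
have := ltn_ord a; have := ltn_ord b; have := ltn_ord c; have := ltn_ord e.
move: (a : nat) (b : nat) (c : nat) (e : nat) => {}a {}b {}c {}e; lia.
Qed.

Section nodes.
Variable N : nat.
Definition node (j : 'I_N) : R := 2 * pi * j%:R / N%:R.

(** At t = 2 pi k / N the angle N t - t/2 equals - t/2 modulo 2 pi, so the right-hand sides of the
    closed forms vanish; sin (t/2) is nonzero because 0 < t/2 < pi. *)
Lemma node_sum k : (0 < k < N)%N ->
  \sum_(j < N) cos (k%:R * node j) = 0 /\ \sum_(j < N) sin (k%:R * node j) = 0.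
Proof.
move=> /andP[k0 kN]; have N0 : N%:R != 0 :> R by rewrite pnatr_eq0; lia.
pose t : R := 2 * pi * k%:R / N%:R.
have tE (j : 'I_N) : k%:R * node j = j%:R * t by rewrite /t /node; field.
under eq_bigr do rewrite tE; under [X in _ /\ X = _]eq_bigr do rewrite tE.
have Nt : N%:R * t - t / 2 = - (t / 2) + (pi *+ 2) *+ k.
  by rewrite /t -[_ *+ k]mulr_natr -[pi *+ 2]mulr_natr; move: (pi : R) => p; field.
have S0 : 2 * sin (t / 2) != 0.
  rewrite mulf_neq0// gt_eqF// sin_gt0_pi//.
  have -> : t / 2 = pi * (k%:R / N%:R) by rewrite /t; field.
  rewrite mulr_gt0 ?pi_gt0 ?divr_gt0 ?ltr0n//; last lia.
  rewrite gtr_pMr ?pi_gt0// ltr_pdivrMr ?mul1r ?ltr_nat// ltr0n; lia.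
split; apply: (mulfI S0); rewrite mulr0.
  rewrite [LHS](csum_closed N t) Nt (periodicn (@sinD2pi R)) sinN; ring.
rewrite [LHS](ssum_closed N t) Nt (periodicn (@cosD2pi R)) cosN; ring.
Qed.

Lemma node_sum0 k : (k < N)%N ->
  \sum_(j < N) cos (k%:R * node j) = (if k == 0%N then N%:R else 0).
Proof.
case: k => [|k] kN.
  rewrite (eq_bigr (fun=> 1)) ?sumr_const ?card_ord// => j _.
  by rewrite mul0r cos0.
by have [] := @node_sum k.+1 kN.
Qed.

Lemma node_shift k t : (k < N)%N ->
  (\sum_(j < N) cos (k%:R * (t - node j)) = (if k == 0%N then N%:R else 0)) /\
  (\sum_(j < N) cos (k%:R * (t + node j)) = (if k == 0%N then N%:R else 0)).
Proof.
case: k => [|k] kN.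
  by split; rewrite (eq_bigr (fun=> 1)) ?sumr_const ?card_ord// => j _;
    rewrite mul0r cos0.
have [h1 h2] := @node_sum k.+1 kN; split.
- under eq_bigr do rewrite mulrBr cosB.
  by rewrite big_split/= -!mulr_sumr h1 h2 !mulr0 addr0.
- under eq_bigr do rewrite mulrDr cosD.
  by rewrite sumrB/= -!mulr_sumr h1 h2 !mulr0 subr0.
Qed.

End nodes.

Fixpoint chebyshev k : {poly R} :=
  match k with
  | 0 => 1
  | 1 => 'X
  | (k'.+1 as k1).+1 => 2 *: ('X * chebyshev k1) - chebyshev k'
  end.

Lemma chebyshevSS k : chebyshev k.+2 = 2 *: ('X * chebyshev k.+1) - chebyshev k.
Proof. by []. Qed.

Lemma chebyshev_ind (Q : nat -> Prop) : Q 0%N -> Q 1%N ->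
  (forall k, Q k -> Q k.+1 -> Q k.+2) -> forall k, Q k.
Proof. by move=> h0 h1 h k; have [] : Q k /\ Q k.+1 by elim: k => [|k [? ?]]; split=> //; exact: h. Qed.

Lemma size_chebyshev k : (size (chebyshev k) <= k.+1)%N.
Proof.
elim/chebyshev_ind: k => [||k h1 h2]; rewrite ?size_poly1 ?size_polyX//.
rewrite chebyshevSS (leq_trans (size_polyD _ _))// geq_max size_polyN.
apply/andP; split; last by rewrite (leq_trans h1)// leqW.
rewrite (leq_trans (size_scale_leq _ _))// (leq_trans (size_polyMleq _ _))//.
by rewrite size_polyX.
Qed.

Lemma chebyshev_cos k t : (chebyshev k).[cos t] = cos (k%:R * t).
Proof.
elim/chebyshev_ind: k => [||k h1 h2].
- by rewrite hornerC mul0r cos0.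
- by rewrite hornerX mul1r.
rewrite chebyshevSS hornerD hornerN hornerZ hornerM hornerX h1 h2.
have -> : k.+2%:R * t = k.+1%:R * t + t by rewrite -[k.+2]addn1 natrD mulrDl mul1r.
have -> : k%:R * t = k.+1%:R * t - t by rewrite -[k.+1]addn1 natrD mulrDl mul1r addrK.
by rewrite cosB cosD; ring.
Qed.

(** The crude base 3M, M = max(1, |x|), passes through the recursion because 2 M (3M)^(k+1) + (3M)^k
    <= (3M)^(k+2). It serves outside [-1, 1], where Chebyshev polynomials are no longer bounded by
    1. *)
Lemma chebyshev_bound k (x : R) : `|(chebyshev k).[x]| <= (3 * Num.max 1 `|x|) ^+ k.
Proof.
set M := Num.max _ _; have M1 : 1 <= M by rewrite le_max lexx.
have Mx : `|x| <= M by rewrite le_max lexx orbT.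
elim/chebyshev_ind: k => [||k h1 h2].
- by rewrite hornerC normr1 expr0.
- by rewrite hornerX expr1; lra.
rewrite chebyshevSS !hornerE (le_trans (ler_normB _ _))//.
have P0 : 0 <= (3 * M) ^+ k by rewrite exprn_ge0//; lra.
have P1 : 0 <= (3 * M) ^+ k.+1 by rewrite exprn_ge0//; lra.
rewrite !normrM normr_nat.
have : `|x| * `|(chebyshev k.+1).[x]| <= M * (3 * M) ^+ k.+1 by exact: ler_pM.
have : (3 * M) ^+ k <= M * (3 * M) ^+ k.+1.
  rewrite exprS mulrA ler_peMl//; nra.
rewrite (exprS _ k.+1); move: h1 h2 P0 P1.
set Q := _ ^+ k.+1; set Q' := _ ^+ k => h1 h2 P0 P1 h3 h4; lra.
Qed.

(** * Normalisation and concentration of the Jackson kernel *)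

Section kernel.
Variable n : nat.
Hypothesis n0 : (0 < n)%N.
Let N := (2 * n)%N.
Let I4 : finType := (('I_n * 'I_n) * ('I_n * 'I_n))%type.
(** The number of index quadruples of frequency 0, that is, the mean of the squared [fejer n] over a
    period. *)
Let c : R := \sum_(p : I4 | gap4 p == 0%N) 1.

Let gap4N (p : I4) : (gap4 p < N)%N.
Proof. by have := gap4_bound p; rewrite /N; lia. Qed.

(** All frequencies of the squared [fejer n] are at most 2 (n - 1) < N, so only the constant term
    survives summation over [N] equispaced nodes. *)
Let fejer2_sum t :
  (\sum_(j < N) fejer n (t - node j) ^+ 2 = N%:R * c) /\
  (\sum_(j < N) fejer n (t + node j) ^+ 2 = N%:R * c).
Proof.
have E (s : R) : \sum_(p : I4) (if gap4 p == 0%N then s else 0) = s * c.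
  by rewrite -big_mkcond/= mulr_sumr; apply: eq_bigr => p _; rewrite mulr1.
split.
  under eq_bigr do rewrite fejer2E; rewrite exchange_big/= -E; apply: eq_bigr => p _.
  by have [] := node_shift t (gap4N p).
under eq_bigr do rewrite fejer2E; rewrite exchange_big/= -E; apply: eq_bigr => p _.
by have [] := node_shift t (gap4N p).
Qed.

Let fejer_sum t :
  (\sum_(j < N) fejer n (t - node j) = N%:R * n%:R) /\
  (\sum_(j < N) fejer n (t + node j) = N%:R * n%:R).
Proof.
have gN (p : 'I_n * 'I_n) : (gap p.1 p.2 < N)%N.
  by case: p => -[a ha] [b hb]; rewrite /gap/= /N; lia.
have E (s : R) : \sum_(p : 'I_n * 'I_n) (if gap p.1 p.2 == 0%N then s else 0) = s * n%:R.
  rewrite -(pair_bigA _ (fun a b : 'I_n => if gap a b == 0%N then s else 0))/=.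
  rewrite (eq_bigr (fun=> s)) ?sumr_const ?card_ord ?mulr_natr// => a _.
  rewrite (bigD1 a)//= {1}/gap subnn eqxx big1 ?addr0// => b ba.
  case: ifP => //; rewrite /gap => /eqP h; move: ba; rewrite -val_eqE /=; lia.
split.
  under eq_bigr do rewrite fejerE; rewrite exchange_big/= -E; apply: eq_bigr => p _.
  by have [] := node_shift t (gN p).
under eq_bigr do rewrite fejerE; rewrite exchange_big/= -E; apply: eq_bigr => p _.
by have [] := node_shift t (gN p).
Qed.

(** The node at angle 0 alone contributes the square of [fejer n 0], which is n^4. This lower bound
    for the normalising constant yields the rate of concentration. *)
Let n4 : n%:R ^+ 4 <= N%:R * c.
Proof.
have [_ <-] := fejer2_sum 0.
have N0 : (0 < N)%N by rewrite /N; lia.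
rewrite (bigD1 (Ordinal N0))//= /node mulr0 mul0r addr0.
rewrite -[leLHS]addr0 lerD//; last by apply: sumr_ge0 => j _; rewrite sqr_ge0.
rewrite fejer2E (eq_bigr (fun=> 1)); last by move=> p _; rewrite mulr0 cos0.
rewrite sumr_const !card_prod !card_ord -natrX ler_nat.
by rewrite !expnS expn0 muln1 !mulnA.
Qed.

Let Nc0 : 0 < N%:R * c.
Proof. by apply: lt_le_trans n4; rewrite exprn_gt0// ltr0n. Qed.

(** At x = cos t this is the normalised squared Fejer kernel centred at [node j], averaged with its
    reflection under t -> -t (see [jackson_cos]). Being even in t, it is a polynomial in x. *)
Definition jackson_poly (j : 'I_N) : {poly R} :=
  (N%:R * c)^-1 *: \sum_(p : I4) cos ((gap4 p)%:R * node j) *: chebyshev (gap4 p).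

Definition jackson_node (j : 'I_N) : R := cos (node j).

Lemma size_jackson j : (size (jackson_poly j) <= (2 * n.-1).+1)%N.
Proof.
rewrite (leq_trans (size_scale_leq _ _))// (leq_trans (size_sum _ _ _))//.
apply/bigmax_leqP => p _; rewrite (leq_trans (size_scale_leq _ _))//.
by rewrite (leq_trans (size_chebyshev _))// ltnS gap4_bound.
Qed.

Lemma jackson_sum (x : R) : \sum_j (jackson_poly j).[x] = 1.
Proof.
under eq_bigr => j _.
  rewrite hornerZ horner_sum; under eq_bigr do rewrite hornerZ; over.
rewrite -mulr_sumr exchange_big/=.
under eq_bigr => p _ do rewrite -mulr_suml (node_sum0 (gap4N p)).
rewrite (bigID (fun p : I4 => gap4 p == 0%N))/= [X in _ + X]big1 ?addr0; last first.
  by move=> p /negPf ->; rewrite mul0r.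
rewrite (eq_bigr (fun=> N%:R * 1)) -?mulr_sumr ?mulVf ?gt_eqF//.
by move=> p /eqP ->; rewrite eqxx hornerC.
Qed.

Let jackson_cos j t : (jackson_poly j).[cos t] =
  (2 * (N%:R * c))^-1 * (fejer n (t - node j) ^+ 2 + fejer n (t + node j) ^+ 2).
Proof.
have -> : (2 * (N%:R * c))^-1 = (N%:R * c)^-1 * 2^-1 by rewrite invfM mulrC.
rewrite hornerZ horner_sum !fejer2E -big_split/= -mulrA.
congr (_ * _); rewrite mulr_sumr; apply: eq_bigr => p _.
by rewrite hornerZ chebyshev_cos [_ * (t - _)]mulrBr [_ * (t + _)]mulrDr cosB cosD; field.
Qed.

Lemma jackson_ge0 j (x : R) : `|x| <= 1 -> 0 <= (jackson_poly j).[x].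
Proof.
move=> x1; rewrite -(@acosK _ x); last by rewrite in_itv/= -ler_norml.
by rewrite jackson_cos mulr_ge0 ?addr_ge0 ?sqr_ge0// invr_ge0 mulr_ge0// ltW.
Qed.

Let fejer_le t : fejer n t <= n%:R ^+ 2.
Proof.
rewrite fejerE (le_trans (ler_norm _))// (le_trans (ler_norm_sum _ _ _))//.
rewrite (le_trans (ler_sum _ (fun p _ => cos_max _)))//.
by rewrite sumr_const card_prod card_ord -natrX ler_nat; lia.
Qed.

(** F = [fejer n t] satisfies F <= n^2 and F sin^2 (t/2) <= 1, whence (F |sin (t/2)|)^2 = F (F sin^2
    (t/2)) <= n^2. *)
Let fejer2_sin t : fejer n t ^+ 2 * `|sin (t / 2)| <= n%:R * fejer n t.
Proof.
rewrite expr2 mulrAC ler_wpM2r ?fejer_ge0//.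
rewrite -(@ler_pXn2r _ 2)// ?nnegrE ?mulr_ge0 ?fejer_ge0//.
rewrite exprMn -[`|_| ^+ 2]normrX (ger0_norm (sqr_ge0 _)) expr2 -mulrA.
apply: (le_trans (ler_wpM2l (fejer_ge0 _ _) (fejer_sin n t))).
by rewrite mulr1 fejer_le.
Qed.

Let cos_dist (s t : R) : `|cos s - cos t| <= 2 * `|sin ((s - t) / 2)| /\
  `|cos s - cos t| <= 2 * `|sin ((s + t) / 2)|.
Proof.
have -> : cos s - cos t = - 2 * sin ((s - t) / 2) * sin ((s + t) / 2).
  have -> : cos s = cos ((s + t) / 2 + (s - t) / 2) by congr cos; field.
  have -> : cos t = cos ((s + t) / 2 - (s - t) / 2) by congr cos; field.
  by rewrite cosB cosD; ring.
rewrite !normrM normrN normr_nat; have h1 := sin_max ((s - t) / 2).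
have h2 := sin_max ((s + t) / 2).
by split; [rewrite ler_piMr// mulr_ge0|rewrite mulrAC ler_piMr// mulr_ge0].
Qed.

(** As |cos s - cos t| is at most 2 |sin ((s - t) / 2)| and at most 2 |sin ((s + t) / 2)|,
    [fejer2_sin] exchanges the distance and one factor [fejer] for 2n. The remaining sums over the
    nodes are N n, against the normalisation N c with c >= n^3 / 2. *)
Lemma jackson_dist (x : R) : `|x| <= 1 ->
  \sum_j (jackson_poly j).[x] * `|x - jackson_node j| <= 4 / n%:R.
Proof.
move=> x1; rewrite -(@acosK _ x); last by rewrite in_itv/= -ler_norml.
set t := acos x; have [E1 E2] := fejer_sum t.
apply: (@le_trans _ _ (\sum_(j < N) (2 * (N%:R * c))^-1 *
    (2 * n%:R * (fejer n (t - node j) + fejer n (t + node j))))).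
  apply: ler_sum => j _; rewrite jackson_cos -[leLHS]mulrA ler_wpM2l//.
    by rewrite invr_ge0 mulr_ge0// ltW.
  rewrite mulrDl mulrDr.
  have [h1 h2] := cos_dist t (node j).
  have k1 := fejer2_sin (t - node j); have k2 := fejer2_sin (t + node j).
  apply: lerD.
    apply: (le_trans (ler_wpM2l (sqr_ge0 _) h1)); rewrite mulrCA -mulrA.
    by rewrite ler_wpM2l.
  apply: (le_trans (ler_wpM2l (sqr_ge0 _) h2)); rewrite mulrCA -mulrA.
  by rewrite ler_wpM2l.
rewrite -!mulr_sumr big_split/= E1 E2 invfM.
have nn : 0 < n%:R :> R by rewrite ltr0n.
have c0 : 0 < c.
  by move: Nc0; rewrite pmulr_rgt0// ltr0n /N; lia.
have N0 : 0 < N%:R :> R by rewrite ltr0n /N; lia.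
have cn : n%:R ^+ 3 / 2 <= c.
  have : n%:R * n%:R ^+ 3 <= n%:R * (2 * c).
    by move: n4; rewrite /N natrM exprS [2 * n%:R]mulrC -mulrA.
  rewrite ler_pM2l// => h; lra.
have -> : 2^-1 * (N%:R * c)^-1 * (2 * n%:R * (N%:R * n%:R + N%:R * n%:R)) = 2 * n%:R ^+ 2 / c.
  by field; rewrite !gt_eqF.
rewrite ler_pdivrMr// mulrAC ler_pdivlMr//.
have -> : 2 * n%:R ^+ 2 * n%:R = 4 * (n%:R ^+ 3 / 2) :> R by field.
by rewrite ler_wpM2l.
Qed.

(** For use outside [-1, 1], where the kernel may be negative and large: the n^4 terms, each of
    degree at most 2 (n - 1), are compensated by [n4]. *)
Lemma jackson_bound j (x : R) :
  `|(jackson_poly j).[x]| <= (3 * Num.max 1 `|x|) ^+ (2 * n.-1).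
Proof.
rewrite hornerZ normrM ger0_norm ?invr_ge0 ?(ltW Nc0)// [leLHS]mulrC ler_pdivrMr//.
rewrite horner_sum (le_trans (ler_norm_sum _ _ _))//.
set M := 3 * _; have M1 : 1 <= M.
  rewrite /M; have : 1 <= Num.max 1 `|x| by rewrite le_max lexx.
  lra.
apply: (@le_trans _ _ (\sum_(p : I4) M ^+ (2 * n.-1))).
  apply: ler_sum => p _; rewrite hornerZ normrM -[leRHS]mul1r.
  apply: ler_pM => //; first exact: cos_max.
  by rewrite (le_trans (chebyshev_bound _ _))// ler_weXn2l// gap4_bound.
rewrite sumr_const !card_prod !card_ord -[leLHS]mulr_natr ler_wpM2l ?exprn_ge0//; first by rewrite (le_trans ler01).
rewrite (le_trans _ n4)// -natrX ler_nat.
by rewrite !expnS expn0 muln1 !mulnA.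
Qed.

End kernel.
End jackson.

(** * Norms and transport plans on partitions of unity *)

Section norms.
Context {R : realType}.

Lemma measurable_sqrt : measurable_fun setT (@Num.sqrt R).
Proof. by apply: continuous_measurable_fun; exact: sqrt_continuous. Qed.

Definition norm1 d (x : d.-tuple R) : R := \sum_(i < d) `|tnth x i|.

Lemma norm1_ge0 d (x : d.-tuple R) : 0 <= norm1 x.
Proof. exact: sumr_ge0. Qed.

Lemma enorm_ge0 d (x : d.-tuple R) : 0 <= enorm x.
Proof. exact: sqrtr_ge0. Qed.

Lemma enorm_sqr d (x : d.-tuple R) : enorm x ^+ 2 = \sum_(i < d) tnth x i ^+ 2.
Proof. by rewrite sqr_sqrtr//; apply: sumr_ge0 => i _; exact: sqr_ge0. Qed.

Lemma enorm_le_norm1 d (x : d.-tuple R) : enorm x <= norm1 x.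
Proof.
rewrite -(@ler_pXn2r _ 2)// ?nnegrE ?enorm_ge0 ?norm1_ge0// enorm_sqr.
rewrite expr2 {1}/norm1 mulr_suml; apply: ler_sum => i _.
rewrite -real_normK ?num_real// expr2 ler_wpM2l//.
by rewrite /norm1 (bigD1 i)//= lerDl sumr_ge0.
Qed.

Lemma coord_le_enorm d (x : d.-tuple R) i : `|tnth x i| <= enorm x.
Proof.
rewrite -(@ler_pXn2r _ 2)// ?nnegrE ?enorm_ge0// enorm_sqr.
rewrite real_normK ?num_real// (bigD1 i)//= lerDl.
by apply: sumr_ge0 => j _; exact: sqr_ge0.
Qed.

Lemma edist_le_norm1 d (x y : d.-tuple R) :
  edist x y <= \sum_(i < d) `|tnth x i - tnth y i|.
Proof.
rewrite (le_trans (enorm_le_norm1 _))// /norm1 ler_sum// => i _.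
by rewrite tnth_mktuple.
Qed.

Lemma edist_ge0 d (x y : d.-tuple R) : 0 <= edist x y.
Proof. exact: enorm_ge0. Qed.

Lemma measurable_coord d i : measurable_fun setT (fun x : d.-tuple R => tnth x i).
Proof. exact: measurable_tnth. Qed.

Lemma measurable_enorm d : measurable_fun setT (@enorm R d).
Proof.
apply: measurableT_comp; first exact: measurable_sqrt.
by apply: measurable_sum => i; apply: measurable_funX; exact: measurable_coord.
Qed.

Lemma measurable_coord_dist d : measurable_fun setT
  (fun z : d.-tuple R * d.-tuple R => [tuple tnth z.1 i - tnth z.2 i | i < d]).
Proof.
apply/measurable_fun_tnthP => i.
have -> : (@tnth d R ^~ i \o
    (fun z : d.-tuple R * d.-tuple R => [tuple tnth z.1 i - tnth z.2 i | i < d])) =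
    (fun z => tnth z.1 i - tnth z.2 i).
  by apply/funext => z /=; rewrite tnth_mktuple.
apply: measurable_funB.
  by apply: (measurableT_comp (measurable_coord i)).
by apply: (measurableT_comp (measurable_coord i)).
Qed.

Lemma measurable_edist d :
  measurable_fun setT (fun z : d.-tuple R * d.-tuple R => edist z.1 z.2).
Proof.
by apply: (measurableT_comp (@measurable_enorm d)); exact: measurable_coord_dist.
Qed.

Definition dist1 d (y x : d.-tuple R) : R := \sum_(i < d) `|tnth x i - tnth y i|.

Lemma dist1_ge0 d (x y : d.-tuple R) : 0 <= dist1 x y.
Proof. exact: sumr_ge0. Qed.

Lemma measurable_dist1 d (y : d.-tuple R) : measurable_fun setT (dist1 y).
Proof.
apply: measurable_sum => i; apply: measurableT_comp => //.
by apply: measurable_funB => //; exact: measurable_coord.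
Qed.

Lemma edist_dist1 d (x y z : d.-tuple R) : edist x y <= dist1 z x + dist1 z y.
Proof.
rewrite (le_trans (edist_le_norm1 _ _))// -big_split/= ler_sum// => i _.
by rewrite -[tnth x i - _](subrKA (tnth z i)) (le_trans (ler_normD _ _))// lerD2l distrC.
Qed.

End norms.

(** * Couplings given by a density *)

Section density_probability.
Context d (T : measurableType d) (R : realType).
Variables (mu : {measure set T -> \bar R}) (F : T -> R).
Hypotheses (F0 : forall x, 0 <= F x) (mF : measurable_fun setT F).
Hypothesis F1 : (\int[mu]_x (F x)%:E = 1)%E.

Let dens (A : set T) : \bar R := (\int[mu]_(x in A) (F x)%:E)%E.

Let dens0 : dens set0 = 0%E. Proof. exact: integral_set0. Qed.

Let dens_ge0 A : (0 <= dens A)%E.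
Proof. by apply: integral_ge0 => x _; rewrite lee_fin. Qed.

Let dens_sigma_additive : semi_sigma_additive dens.
Proof.
move=> A mA tA mUA; rewrite /dens ge0_integral_bigcup//; last 2 first.
- by apply/measurable_EFinP; exact: measurable_funTS.
- by move=> x _; rewrite lee_fin.
apply: is_cvg_ereal_nneg_natsum_cond => n _ _; exact: dens_ge0.
Qed.

HB.instance Definition _ :=
  measure_function.isMeasure.Build _ _ _ dens dens0 dens_ge0 dens_sigma_additive.

HB.instance Definition _ := Measure_isProbability.Build _ _ _ dens F1.

Lemma density_probability : exists pi : probability T R,
  forall A, measurable A -> pi A = (\int[mu]_(x in A) (F x)%:E)%E.
Proof. by exists dens. Qed.

End density_probability.

Lemma integral_prod_sep d1 d2 (T1 : measurableType d1) (T2 : measurableType d2)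
    (R : realType) (mu : probability T1 R) (nu : probability T2 R)
    (f : T1 -> R) (g : T2 -> R) :
  measurable_fun setT f -> measurable_fun setT g ->
  (forall x, 0 <= f x) -> (forall x, 0 <= g x) ->
  (\int[mu \x nu]_z (f z.1 * g z.2)%:E =
   (\int[mu]_x (f x)%:E) * (\int[nu]_x (g x)%:E))%E.
Proof.
move=> mf mg f0 g0; rewrite fubini_tonelli1//; last 2 first.
- apply/measurable_EFinP; apply: measurable_funM.
    exact: (measurableT_comp mf).
  exact: (measurableT_comp mg).
- by move=> z; rewrite lee_fin mulr_ge0.
transitivity (\int[mu]_x ((f x)%:E * (\int[nu]_y (g y)%:E)))%E.
  apply: eq_integral => x _; rewrite /fubini_F/=.
  under eq_integral do rewrite EFinM.
  rewrite ge0_integralZl//; last by rewrite lee_fin.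
    exact/measurable_EFinP.
  by move=> y _; rewrite lee_fin.
rewrite ge0_integralZr//.
- exact/measurable_EFinP.
- by move=> x _; rewrite lee_fin.
- by apply: integral_ge0 => x _; rewrite lee_fin.
Qed.

Section coupling.
Context {R : realType} (d : nat) (I : finType).
Variables (mu nu : probability (d.-tuple R) R).
Variables (phi psi : I -> d.-tuple R -> R) (x : I -> d.-tuple R) (w : I -> R).
Hypotheses (mphi : forall i, measurable_fun setT (phi i))
  (mpsi : forall i, measurable_fun setT (psi i)).
Hypotheses (phi0 : forall i y, 0 <= phi i y) (psi0 : forall i y, 0 <= psi i y).
Hypotheses (phi1 : forall y, \sum_i phi i y = 1) (psi1 : forall y, \sum_i psi i y = 1).
Hypotheses (phiw : forall i, (\int[mu]_y (phi i y)%:E = (w i)%:E)%E)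
  (psiw : forall i, (\int[nu]_y (psi i y)%:E = (w i)%:E)%E).

(** Density, with respect to the product of [mu] and [nu], of the coupling that draws [i] with
    probability [w i] and then two independent points from the laws proportional to [phi i] and
    [psi i]. The inverse of 0 being 0, indices of weight 0 drop out. *)
Let F (z : d.-tuple R * d.-tuple R) : R :=
  \sum_i (w i)^-1 * (phi i z.1 * psi i z.2).

Let w0 i : 0 <= w i.
Proof. by rewrite -lee_fin -phiw; apply: integral_ge0 => y _; rewrite lee_fin. Qed.

Let mterm (f g : d.-tuple R -> R) : measurable_fun setT f -> measurable_fun setT g ->
  measurable_fun setT (fun z : d.-tuple R * d.-tuple R => f z.1 * g z.2).
Proof.
move=> mf mg; apply: measurable_funM.
  exact: (measurableT_comp mf).
exact: (measurableT_comp mg).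
Qed.

Let mF : measurable_fun setT F.
Proof. by apply: measurable_sum => i; apply: measurable_funM => //; exact: mterm. Qed.

Let F0 z : 0 <= F z.
Proof. by apply: sumr_ge0 => i _; rewrite !mulr_ge0// invr_ge0. Qed.

Let intF (f g : d.-tuple R -> R) : measurable_fun setT f -> measurable_fun setT g ->
  (forall y, 0 <= f y) -> (forall y, 0 <= g y) ->
  (\int[mu \x nu]_z (f z.1 * g z.2 * F z)%:E =
   \sum_i (w i)^-1%:E * ((\int[mu]_y (f y * phi i y)%:E) *
                         (\int[nu]_y (g y * psi i y)%:E)))%E.
Proof.
move=> mf mg f0 g0.
transitivity (\int[mu \x nu]_z \sum_i ((w i)^-1%:E *
    ((f z.1 * phi i z.1) * (g z.2 * psi i z.2))%:E))%E.
  apply: eq_integral => z _; rewrite /F mulr_sumr -sumEFin; apply: eq_bigr => i _.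
  by rewrite -EFinM; congr (_%:E); ring.
have mfg i : measurable_fun setT (fun z : d.-tuple R * d.-tuple R =>
    ((f z.1 * phi i z.1) * (g z.2 * psi i z.2))%:E).
  apply/measurable_EFinP; apply: (mterm (f := fun y => f y * phi i y) (g := fun y => g y * psi i y));
    exact: measurable_funM.
have fg0 i (z : d.-tuple R * d.-tuple R) :
    (0 <= ((f z.1 * phi i z.1) * (g z.2 * psi i z.2))%:E)%E.
  by rewrite lee_fin !mulr_ge0.
rewrite ge0_integral_sum//; last 2 first.
- by move=> i; apply: emeasurable_funM.
- by move=> i z _; apply: mule_ge0 => //; rewrite lee_fin invr_ge0.
apply: eq_bigr => i _; rewrite ge0_integralZl//; last first.
  by rewrite lee_fin invr_ge0.
congr (_ * _)%E.
rewrite (integral_prod_sep mu nu (f := fun y => f y * phi i y) (g := fun y => g y * psi i y))//.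
- exact: measurable_funM.
- exact: measurable_funM.
- by move=> y; rewrite mulr_ge0.
- by move=> y; rewrite mulr_ge0.
Qed.

Let wVw i (a : \bar R) : w i != 0 -> ((w i)^-1%:E * (a * (w i)%:E) = a)%E.
Proof. by move=> wi; rewrite muleCA -EFinM mulVf// mule1. Qed.

(** Shows that dropping the indices with [w i = 0] leaves the marginals of [F] correct. *)
Let w_eq0 i (f : d.-tuple R -> R) : w i = 0 -> measurable_fun setT f ->
  (forall y, 0 <= f y <= 1) -> (\int[mu]_y (f y * phi i y)%:E = 0)%E /\
  (\int[nu]_y (f y * psi i y)%:E = 0)%E.
Proof.
move=> wi mf f01; split; apply/eqP; rewrite eq_le; apply/andP; split;
  try by apply: integral_ge0 => y _; rewrite lee_fin mulr_ge0//; case/andP: (f01 y).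
- have <- : (\int[mu]_y (phi i y)%:E = 0)%E by rewrite phiw wi.
  apply: ge0_le_integral => //.
  + by move=> y _; rewrite lee_fin mulr_ge0//; case/andP: (f01 y).
  + by apply/measurable_EFinP; exact: measurable_funM.
  + exact/measurable_EFinP.
  + by move=> y _; rewrite lee_fin ler_piMl//; case/andP: (f01 y).
- have <- : (\int[nu]_y (psi i y)%:E = 0)%E by rewrite psiw wi.
  apply: ge0_le_integral => //.
  + by move=> y _; rewrite lee_fin mulr_ge0//; case/andP: (f01 y).
  + by apply/measurable_EFinP; exact: measurable_funM.
  + exact/measurable_EFinP.
  + by move=> y _; rewrite lee_fin ler_piMl//; case/andP: (f01 y).
Qed.

Let indic_int (m : probability (d.-tuple R) R) (p : I -> d.-tuple R -> R) A :
  measurable A -> (forall i, measurable_fun setT (p i)) ->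
  (forall i y, 0 <= p i y) -> (forall y, \sum_i p i y = 1) ->
  (\sum_i \int[m]_y (\1_A y * p i y)%:E = m A)%E.
Proof.
move=> mA mp p0 p1; rewrite -ge0_integral_sum//; last 2 first.
- by move=> i; apply/measurable_EFinP; exact: measurable_funM.
- by move=> i y _; rewrite lee_fin mulr_ge0.
rewrite -(setIT A) -(integral_indic m measurableT mA) setIT; apply: eq_integral => y _.
by rewrite sumEFin -mulr_sumr p1 mulr1.
Qed.

(** In the coupling [F] both points are attached to the same index [i], and their distance is split
    at [x i] by the triangle inequality; each part is then integrated against one marginal. *)
Lemma W1_partition :
  (W1 mu nu <= \sum_i (\int[mu]_y (dist1 (x i) y * phi i y)%:E +
                       \int[nu]_y (dist1 (x i) y * psi i y)%:E))%E.
Proof.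
have indic01 A (y : d.-tuple R) : 0 <= (\1_A y : R) <= 1.
  by rewrite indicE; case: (_ \in _); rewrite ?lexx ler01.
have one0 (y : d.-tuple R) : 0 <= (1 : R) by [].
have m1 : measurable_fun setT (fun y : d.-tuple R => 1 : R) by exact: measurable_cst.
have marg1 A : measurable A -> (\int[mu \x nu]_(z in fst @^-1` A) (F z)%:E = mu A)%E.
  move=> mA; rewrite integral_mkcond/=.
  transitivity (\int[mu \x nu]_z (\1_A z.1 * 1 * F z)%:E)%E.
    apply: eq_integral => z _; rewrite /patch mulr1 indicE.
    by rewrite (_ : (z \in fst @^-1` A) = (z.1 \in A)) ?inE//; case: ifP => _;
      rewrite ?mul1r ?mul0r.
  rewrite (intF (f := \1_A) (g := fun=> 1))//.
  rewrite -(indic_int mu mA mphi phi0 phi1); apply: eq_bigr => i _.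
  under [X in (_ * (_ * X))%E]eq_integral do rewrite mul1r.
  rewrite psiw; have [wi|wi] := eqVneq (w i) 0; last exact: wVw.
  by have [-> _] := w_eq0 wi (f := \1_A) (measurable_indic mA) (fun y => indic01 A y);
    rewrite wi mule0 mule0.
have marg2 A : measurable A -> (\int[mu \x nu]_(z in snd @^-1` A) (F z)%:E = nu A)%E.
  move=> mA; rewrite integral_mkcond/=.
  transitivity (\int[mu \x nu]_z (1 * \1_A z.2 * F z)%:E)%E.
    apply: eq_integral => z _; rewrite /patch mul1r indicE.
    by rewrite (_ : (z \in snd @^-1` A) = (z.2 \in A)) ?inE//; case: ifP => _;
      rewrite ?mul1r ?mul0r.
  rewrite (intF (f := fun=> 1) (g := \1_A))//.
  rewrite -(indic_int nu mA mpsi psi0 psi1); apply: eq_bigr => i _.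
  under [X in (_ * (X * _))%E]eq_integral do rewrite mul1r.
  rewrite phiw; have [wi|wi] := eqVneq (w i) 0; last by rewrite [((w i)%:E * _)%E]muleC wVw.
  by have [_ ->] := w_eq0 wi (f := \1_A) (measurable_indic mA) (fun y => indic01 A y);
    rewrite wi mule0 mule0.
have F1 : (\int[mu \x nu]_z (F z)%:E = 1)%E.
  by rewrite -(probability_setT mu) -marg1// preimage_setT.
have [pi piE] := density_probability F0 mF F1.
apply: (@le_trans _ _ (\int[pi]_z (edist z.1 z.2)%:E)%E).
  apply: ereal_inf_lbound; exists pi => // A mA.
  split; rewrite piE ?marg1 ?marg2//; rewrite -[X in measurable X]setTI.
    exact: measurable_fst.
  exact: measurable_snd.
rewrite (ge0_integral_density F0 mF piE); last 2 first.
- by apply/measurable_EFinP; exact: measurable_edist.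
- by move=> z; rewrite lee_fin edist_ge0.
pose c (z : d.-tuple R * d.-tuple R) : R := \sum_i (w i)^-1 *
  ((dist1 (x i) z.1 * phi i z.1) * psi i z.2 + phi i z.1 * (dist1 (x i) z.2 * psi i z.2)).
have md i := measurable_dist1 (x i).
have d0 i y : 0 <= dist1 (x i) y * phi i y by rewrite mulr_ge0// dist1_ge0.
have d0' i y : 0 <= dist1 (x i) y * psi i y by rewrite mulr_ge0// dist1_ge0.
have mdp i : measurable_fun setT (fun y => dist1 (x i) y * phi i y) by exact: measurable_funM.
have mdq i : measurable_fun setT (fun y => dist1 (x i) y * psi i y) by exact: measurable_funM.
have mc1 i := mterm (mdp i) (mpsi i).
have mc2 i := mterm (mphi i) (mdq i).
apply: (@le_trans _ _ (\int[mu \x nu]_z (c z)%:E)%E).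
  apply: ge0_le_integral => //.
  - by move=> z _; rewrite mule_ge0 ?lee_fin ?edist_ge0.
  - by apply: emeasurable_funM; apply/measurable_EFinP => //; exact: measurable_edist.
  - apply/measurable_EFinP; apply: measurable_sum => i; apply: measurable_funM => //.
    by apply: measurable_funD.
  - move=> z _; rewrite -EFinM lee_fin /F mulr_sumr ler_sum// => i _.
    rewrite mulrCA ler_wpM2l ?invr_ge0//.
    rewrite [leRHS](_ : _ = (dist1 (x i) z.1 + dist1 (x i) z.2) * (phi i z.1 * psi i z.2)); last by ring.
    by rewrite ler_wpM2r ?mulr_ge0// edist_dist1.
rewrite (_ : (\int[mu \x nu]_z (c z)%:E)%E = (\sum_i (w i)^-1%:E *
    ((\int[mu]_y (dist1 (x i) y * phi i y)%:E) * (w i)%:E +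
     (w i)%:E * (\int[nu]_y (dist1 (x i) y * psi i y)%:E)))%E); last first.
  transitivity (\int[mu \x nu]_z \sum_i ((w i)^-1%:E *
      (((dist1 (x i) z.1 * phi i z.1) * psi i z.2)%:E +
       (phi i z.1 * (dist1 (x i) z.2 * psi i z.2))%:E)))%E.
    by apply: eq_integral => z _; rewrite /c -sumEFin; apply: eq_bigr => i _; rewrite -EFinD -EFinM.
  rewrite ge0_integral_sum//; last 2 first.
  - by move=> i; apply: emeasurable_funM => //; apply: emeasurable_funD; exact/measurable_EFinP.
  - by move=> i z _; apply: mule_ge0; rewrite lee_fin ?invr_ge0//;
      rewrite addr_ge0// !mulr_ge0 ?dist1_ge0.
  apply: eq_bigr => i _; rewrite ge0_integralZl//; last 3 first.
  - by apply: emeasurable_funD; exact/measurable_EFinP.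
  - by move=> z _; apply: adde_ge0; rewrite lee_fin !mulr_ge0 ?dist1_ge0.
  - by rewrite lee_fin invr_ge0.
  congr (_ * _)%E; rewrite ge0_integralD//; last 4 first.
  - by move=> z _; rewrite lee_fin !mulr_ge0 ?dist1_ge0.
  - exact/measurable_EFinP.
  - by move=> z _; rewrite lee_fin !mulr_ge0 ?dist1_ge0.
  - exact/measurable_EFinP.
  rewrite (integral_prod_sep mu nu (f := fun y => dist1 (x i) y * phi i y) (g := psi i))//.
  rewrite (integral_prod_sep mu nu (f := phi i) (g := fun y => dist1 (x i) y * psi i y))//.
  by rewrite psiw phiw.
apply: lee_sum => i _.
have i0 : (0 <= \int[mu]_y (dist1 (x i) y * phi i y)%:E)%E.
  by apply: integral_ge0 => y _; rewrite lee_fin.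
have j0 : (0 <= \int[nu]_y (dist1 (x i) y * psi i y)%:E)%E.
  by apply: integral_ge0 => y _; rewrite lee_fin.
have [->|wi] := eqVneq (w i) 0; first by rewrite invr0 mul0e adde_ge0.
rewrite ge0_muleDr ?mule_ge0 ?lee_fin// wVw//.
by rewrite [((w i)%:E * _)%E]muleC wVw.
Qed.

End coupling.

(** * Transport through the nodes of a kernel that is nonnegative on [Q] only *)

Section kernel_coupling.
Context {R : realType} (d : nat) (J : finType).
Variables (Phi : J -> d.-tuple R -> R) (node : J -> d.-tuple R)
  (Q : set (d.-tuple R)) (t : d.-tuple R -> R) (a b e1 e2 : R).
Hypotheses (mPhi : forall j, measurable_fun setT (Phi j)) (mQ : measurable Q)
  (mt : measurable_fun setT t).
Hypotheses (Phi_ge0 : forall j y, Q y -> 0 <= Phi j y)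
  (Phi_sum : forall y, \sum_j Phi j y = 1)
  (Phi_dist : forall y, Q y -> \sum_j Phi j y * dist1 (node j) y <= a)
  (Phi_out : forall j y, ~ Q y -> `|Phi j y| <= t y).
Hypotheses (normQ : forall y : d.-tuple R, Q y -> norm1 y <= b)
  (norm_out : forall y : d.-tuple R, ~ Q y -> norm1 y <= b * t y)
  (t_ge0 : forall y, 0 <= t y) (b0 : 0 <= b) (a0 : 0 <= a).

Let PhiQ j y : R := Phi j y * \1_Q y.

Let mPhiQ j : measurable_fun setT (PhiQ j).
Proof. by apply: measurable_funM => //; exact: measurable_indic. Qed.

Let PhiQ_ge0 j y : 0 <= PhiQ j y.
Proof.
rewrite /PhiQ indicE; have [/set_mem/Phi_ge0 h|] := boolP (y \in Q); first by rewrite mulr1.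
by rewrite mulr0.
Qed.

Let PhiQ_sum y : \sum_j PhiQ j y = \1_Q y.
Proof. by rewrite -mulr_suml Phi_sum mul1r. Qed.

Let PhiQ_le1 j y : PhiQ j y <= 1.
Proof.
have : \sum_j PhiQ j y <= 1 by rewrite PhiQ_sum indicE; case: (_ \in _).
by apply: le_trans; rewrite (bigD1 j)//= lerDl sumr_ge0.
Qed.

Let zero : d.-tuple R := [tuple 0 | _ < d].

Let dist1_zero y : dist1 zero y = norm1 y.
Proof. by apply: eq_bigr => i _; rewrite tnth_mktuple subr0. Qed.

(** The two measures give slightly different masses to [PhiQ j]. The factor [c j] lowers each of
    them to a common value, and the extra index [inr] collects the remaining mass, which [nd] routes
    through the origin. *)
Let phi (c : J -> R) (o : J + 'I_1) (y : d.-tuple R) : R :=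
  match o with inl j => c j * PhiQ j y | inr _ => 1 - \sum_j c j * PhiQ j y end.

Let nd (o : J + 'I_1) : d.-tuple R :=
  match o with inl j => node j | inr _ => zero end.

Let mphi c o : measurable_fun setT (phi c o).
Proof.
case: o => [j|i] /=; first by apply: measurable_funM.
apply: measurable_funB => //; apply: measurable_sum => j; exact: measurable_funM.
Qed.

Let phi_sum c y : \sum_o phi c o y = 1.
Proof. by rewrite big_sumType/= big_ord1 addrC subrK. Qed.

Let phi_ge0 c o y : (forall j, 0 <= c j <= 1) -> 0 <= phi c o y.
Proof.
move=> c01; case: o => [j|i] /=; first by rewrite mulr_ge0//; case/andP: (c01 j).
rewrite subr_ge0 (@le_trans _ _ (\sum_j PhiQ j y))//.
  by apply: ler_sum => j _; rewrite ler_piMl//; case/andP: (c01 j).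
by rewrite PhiQ_sum indicE; case: (_ \in _).
Qed.

Section one_measure.
Variable m : probability (d.-tuple R) R.
Hypotheses (it : intg m t) (t_le : \int[m]_y t y <= e2).

Let mass j : R := \int[m]_y PhiQ j y.

Let iPhiQ j : intg m (PhiQ j).
Proof.
apply: (intg_le _ _ (intg_cst m 1)) => // y.
by rewrite ger0_norm.
Qed.

Lemma phi_mass c j : (\int[m]_y (phi c (inl j) y)%:E = (c j * mass j)%:E)%E.
Proof.
rewrite intg_EFin; last exact: intgZ.
by rewrite RintegralZl.
Qed.

Lemma phi_rest c i : (\int[m]_y (phi c (inr i) y)%:E = (1 - \sum_j c j * mass j)%:E)%E.
Proof.
have i1 : intg m (fun y => \sum_j c j * PhiQ j y) by apply: intg_sum => j _; exact: intgZ.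
rewrite intg_EFin; last by apply: intgB => //; exact: intg_cst.
rewrite RintegralB//; last exact: intg_cst.
rewrite (Rexp_cst m 1) Rexp_sum; last by move=> j _; exact: intgZ.
by congr (1 - _)%:E; apply: eq_bigr => j _; rewrite RintegralZl.
Qed.

(** On [Q], the mass kept at the nodes travels at most [a] on average, and the mass cut off is
    within [b] of the origin. Off [Q], everything is sent to the origin, at a cost of at most
    [b * t]. *)
Lemma kernel_cost c : (forall j, 0 <= c j <= 1) ->
  (\sum_o \int[m]_y (dist1 (nd o) y * phi c o y)%:E <=
   (a + b * e2 + b * \sum_j (1 - c j) * mass j)%:E)%E.
Proof.
move=> c01.
have mdp o : measurable_fun setT (fun y => dist1 (nd o) y * phi c o y).
  by apply: measurable_funM => //; exact: measurable_dist1.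
rewrite -ge0_integral_sum//; last 2 first.
- by move=> o; exact/measurable_EFinP.
- by move=> o y _; rewrite lee_fin mulr_ge0 ?dist1_ge0// phi_ge0.
pose G y := a + b * t y + b * \sum_j (1 - c j) * PhiQ j y.
have i1 : intg m (fun y => \sum_j (1 - c j) * PhiQ j y).
  by apply: intg_sum => j _; exact: intgZ.
have i2 : intg m (fun y => a + b * t y).
  by apply: intgD; [exact: intg_cst|exact: intgZ].
have iG : intg m G by apply: intgD => //; exact: intgZ.
apply: (@le_trans _ _ (\int[m]_y (G y)%:E)%E).
  apply: ge0_le_integral => //.
  - by move=> y _; apply: sume_ge0 => o _; rewrite lee_fin mulr_ge0 ?dist1_ge0// phi_ge0.
  - by apply: emeasurable_sum => o; exact/measurable_EFinP.
  - by have /intg_measurable/measurable_EFinP := iG.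
  move=> y _; rewrite sumEFin lee_fin big_sumType/= big_ord1 dist1_zero.
  have n0 := norm1_ge0 y; rewrite /G.
  have [Qy|nQy] := pselect (Q y).
    have q1 j : PhiQ j y = Phi j y by rewrite /PhiQ indicE mem_set// mulr1.
    rewrite -addrA lerD//.
      apply: le_trans (Phi_dist Qy); apply: ler_sum => j _; rewrite q1 mulrC ler_wpM2r ?dist1_ge0//.
      by rewrite ler_piMl ?Phi_ge0//; case/andP: (c01 j).
    have -> : 1 - \sum_j c j * PhiQ j y = \sum_j (1 - c j) * PhiQ j y.
      rewrite -[in LHS](Phi_sum y) -sumrB; apply: eq_bigr => j _.
      by rewrite mulrBl mul1r q1.
    rewrite -[leLHS]add0r lerD ?mulr_ge0// ler_wpM2r ?normQ//.
    by apply: sumr_ge0 => j _; rewrite mulr_ge0// subr_ge0; case/andP: (c01 j).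
  have q0 j : PhiQ j y = 0 by rewrite /PhiQ indicE memNset// mulr0.
  rewrite [X in X + _]big1 ?add0r; last by move=> j _; rewrite q0 !mulr0.
  rewrite big1 ?subr0 ?mulr1; last by move=> j _; rewrite q0 mulr0.
  rewrite big1 ?mulr0 ?addr0; last by move=> j _; rewrite q0 mulr0.
  by rewrite (le_trans (norm_out nQy))// lerDr.
rewrite intg_EFin// lee_fin /G RintegralD//; last exact: intgZ.
rewrite RintegralD//; [|exact: intg_cst|exact: intgZ].
rewrite (Rexp_cst m a) !RintegralZl// Rexp_sum; last by move=> j _; exact: intgZ.
rewrite lerD ?lerD2l// ?ler_wpM2l//.
by apply: ler_sum => j _; rewrite RintegralZl.
Qed.

Lemma mass_approx j : intg m (Phi j) -> `|mass j - \int[m]_y Phi j y| <= e2.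
Proof.
move=> iPhi; rewrite /mass -RintegralB//.
apply: le_trans t_le; apply: Rexp_abs_le => //; first exact: intgB.
move=> y; rewrite /PhiQ indicE; have [_|nQ] := boolP (y \in Q).
  by rewrite mulr1 subrr normr0.
by rewrite mulr0 sub0r normrN Phi_out// => /mem_set; apply/negP.
Qed.

End one_measure.

Lemma W1_kernel (mu nu : probability (d.-tuple R) R) :
  intg mu t -> intg nu t -> \int[mu]_y t y <= e2 -> \int[nu]_y t y <= e2 ->
  (forall j, intg mu (Phi j)) -> (forall j, intg nu (Phi j)) ->
  (forall j, `|\int[mu]_y Phi j y - \int[nu]_y Phi j y| <= e1) ->
  (W1 mu nu <= (2 * (a + b * e2 + b * (#|J|%:R * (e1 + 2 * e2))))%:E)%E.
Proof.
move=> tmu tnu lmu lnu imu inu close.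
pose u j := \int[mu]_y PhiQ j y; pose v j := \int[nu]_y PhiQ j y.
(* The mass that both measures have at node [j]; what is cut off is at most |u j - v j|. *)
pose w j := Num.min (u j) (v j).
have u0 j : 0 <= u j by apply: Rintegral_ge0 => y _; exact: PhiQ_ge0.
have v0 j : 0 <= v j by apply: Rintegral_ge0 => y _; exact: PhiQ_ge0.
have w0 j : 0 <= w j by rewrite le_min u0 v0.
(* This includes x = 0, where the quotient is 0 by convention and y = 0 as well. *)
have frac (x y : R) : 0 <= y <= x -> 0 <= y / x <= 1 /\ y / x * x = y.
  move=> /andP[y0 yx]; have [x0|x0] := eqVneq x 0.
    by rewrite x0 invr0 !mulr0 lexx ler01; split=> //; apply/eqP; rewrite eq_le y0 -x0 yx.
  have x1 : 0 < x by rewrite lt_neqAle eq_sym x0 (le_trans y0).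
  by rewrite divfK// divr_ge0 ?(le_trans y0)// ler_pdivrMr// mul1r.
have cu j : 0 <= w j / u j <= 1 /\ w j / u j * u j = w j.
  by apply: frac; rewrite w0 ge_min lexx.
have cv j : 0 <= w j / v j <= 1 /\ w j / v j * v j = w j.
  by apply: frac; rewrite w0 ge_min lexx orbT.
have uv j : `|u j - v j| <= e1 + 2 * e2.
  have h1 := mass_approx tmu lmu (imu j); have h2 := mass_approx tnu lnu (inu j).
  move: h1 h2 (close j); rewrite -/(u j) -/(v j) !ler_norml.
  by move=> /andP[? ?] /andP[? ?] /andP[? ?]; apply/andP; split; lra.
have e12 : #|J|%:R * (e1 + 2 * e2) = \sum_(j : J) (e1 + 2 * e2).
  by rewrite sumr_const mulr_natl.
pose W (o : J + 'I_1) := match o with inl j => w j | inr _ => 1 - \sum_j w j end.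
have := @W1_partition R d _ mu nu (phi (fun j => w j / u j)) (phi (fun j => w j / v j))
  nd W.
move=> /(_ _ _ _ _ _ _ _ _) h; apply: (le_trans (h _ _ _ _ _ _ _ _)) => {h}.
- by move=> o; exact: mphi.
- by move=> o; exact: mphi.
- by move=> o y; apply: phi_ge0 => j; case: (cu j).
- by move=> o y; apply: phi_ge0 => j; case: (cv j).
- by move=> y; exact: phi_sum.
- by move=> y; exact: phi_sum.
- case=> [j|i]; first by rewrite phi_mass; case: (cu j) => _ ->.
  by rewrite phi_rest; congr (1 - _)%:E; apply: eq_bigr => j _; case: (cu j).
- case=> [j|i]; first by rewrite phi_mass; case: (cv j) => _ ->.
  by rewrite phi_rest; congr (1 - _)%:E; apply: eq_bigr => j _; case: (cv j).
rewrite big_split/=.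
have k1 := kernel_cost tmu lmu (fun j => (cu j).1).
have k2 := kernel_cost tnu lnu (fun j => (cv j).1).
apply: (le_trans (leeD k1 k2)); rewrite -EFinD lee_fin.
have s1 : \sum_j (1 - w j / u j) * u j <= \sum_(j : J) (e1 + 2 * e2).
  apply: ler_sum => j _; rewrite mulrBl mul1r (cu j).2.
  have := uv j; rewrite ler_norml /w => /andP[? ?].
  by rewrite lerBlDr -lerBlDl le_min; apply/andP; split; lra.
have s2 : \sum_j (1 - w j / v j) * v j <= \sum_(j : J) (e1 + 2 * e2).
  apply: ler_sum => j _; rewrite mulrBl mul1r (cv j).2.
  have := uv j; rewrite ler_norml /w => /andP[? ?].
  by rewrite lerBlDr -lerBlDl le_min; apply/andP; split; lra.
rewrite e12 mulr2n mulrDl !mul1r.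
by rewrite lerD// lerD2l ler_wpM2l.
Qed.

End kernel_coupling.

(** * Wasserstein distance and moments *)

Lemma scaled_le1 (R : realType) (x rho : R) : 0 < rho -> `|x| <= rho -> `|x / rho| <= 1.
Proof. by move=> r0 xr; rewrite normrM normfV (gtr0_norm r0) ler_pdivrMr// mul1r. Qed.

(** * Tensor products of Jackson kernels *)

Section tensor.
Context {R : realType} (d n : nat) (rho : R).
Hypotheses (n0 : (0 < n)%N) (rho0 : 0 < rho).
Let N := (2 * n)%N.
Let D := (2 * n.-1)%N.
Let J : finType := {ffun 'I_d -> 'I_N}.

Definition tensor_kernel (j : J) (x : d.-tuple R) : R :=
  \prod_(i < d) (@jackson_poly R n (j i)).[tnth x i / rho].

Definition tensor_node (j : J) : d.-tuple R :=
  [tuple rho * @jackson_node R n (j i) | i < d].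

Lemma tensor_ge0 j x : cube rho x -> 0 <= tensor_kernel j x.
Proof.
move=> Qx; apply: prodr_ge0 => i _; apply: jackson_ge0 => //.
exact: scaled_le1.
Qed.

Lemma tensor_sum x : \sum_j tensor_kernel j x = 1.
Proof.
rewrite -(bigA_distr_bigA (fun i a => (@jackson_poly R n a).[tnth x i / rho])).
by rewrite big1// => i _; exact: jackson_sum.
Qed.

Lemma tensor_dist x : cube rho x ->
  \sum_j tensor_kernel j x * dist1 (tensor_node j) x <= d%:R * rho * (4 / n%:R).
Proof.
move=> Qx.
under eq_bigr do rewrite /dist1 mulr_sumr.
rewrite exchange_big/= -mulrA mulr_natl -[X in _ *+ X]card_ord -sumr_const.
apply: ler_sum => i _.
(* The distance in direction [i] is inserted as a factor of the product, equal to 1 in the other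
   directions. The sum over [j] then factorises into one-dimensional sums, all of which but the i-th
   are 1. *)
rewrite (eq_bigr (fun j : J => \prod_(i' < d) ((@jackson_poly R n (j i')).[tnth x i' / rho] *
  (if i' == i then rho * `|tnth x i / rho - @jackson_node R n (j i')| else 1)))); last first.
  move=> j _; rewrite big_split/=; congr (_ * _).
  rewrite (bigD1 i)//= eqxx [X in _ * X]big1 ?mulr1; last by move=> k /negPf ->.
  rewrite tnth_mktuple -[X in _ = X * _](gtr0_norm rho0) -normrM mulrBr.
  by rewrite [rho * (_ / _)]mulrC divfK// gt_eqF.
rewrite -(bigA_distr_bigA (fun i' a => (@jackson_poly R n a).[tnth x i' / rho] *
  (if i' == i then rho * `|tnth x i / rho - @jackson_node R n a| else 1))).
rewrite (bigD1 i)//= eqxx [X in _ * X]big1 ?mulr1; last first.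
  move=> k /negPf ->; under eq_bigr do rewrite mulr1; exact: jackson_sum.
under eq_bigr do rewrite mulrCA.
rewrite -mulr_sumr ler_wpM2l ?(ltW rho0)//; apply: jackson_dist => //.
exact: scaled_le1.
Qed.

(** With Y >= 1 the largest |x_i| / rho, each factor is at most (3Y)^(2 (n - 1)), so the product is
    at most (3Y)^(2p) = 9^p Y^(2p). Summing over the coordinates replaces Y^(2p) by a polynomial
    that involves only moments of order 2p and dominates the norm as well. *)
Lemma tensor_out p j x : (0 < d)%N -> (0 < p)%N -> (n.-1 * d <= p)%N -> ~ cube rho x ->
  `|tensor_kernel j x| <= 9 ^+ p * \sum_(i < d) (tnth x i / rho) ^+ (2 * p) /\
  norm1 x <= d%:R * rho * (9 ^+ p * \sum_(i < d) (tnth x i / rho) ^+ (2 * p)).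
Proof.
move=> d0 p0 np nQ; pose i0 := Ordinal d0.
have [i _ imax] := @Order.TotalTheory.arg_maxP _ _ _ i0 predT (fun i => `|tnth x i|) isT.
pose Y := `|tnth x i| / rho.
have Yi k : `|tnth x k| / rho <= Y.
  by rewrite ler_pM2r ?invr_gt0//; apply: imax.
have Y1 : 1 <= Y.
  rewrite leNgt; apply/negP => Ylt; apply: nQ => k.
  have := le_lt_trans (Yi k) Ylt; rewrite ltr_pdivrMr// mul1r; exact: ltW.
have Y0 : 0 <= Y by rewrite (le_trans ler01).
have Yp : Y ^+ (2 * p) <= \sum_(k < d) (tnth x k / rho) ^+ (2 * p).
  rewrite (bigD1 i)//= -[leLHS]addr0 lerD//; last first.
    by apply: sumr_ge0 => k _; rewrite exprM exprn_ge0// sqr_ge0.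
  by rewrite /Y !exprM -{1}(gtr0_norm rho0) -normfV -normrM real_normK ?num_real.
have p9 : 1 <= 9 ^+ p :> R by rewrite exprn_ege1// ler1n.
have S0 : 0 <= \sum_(k < d) (tnth x k / rho) ^+ (2 * p).
  by apply: le_trans Yp; rewrite exprn_ge0.
split.
  apply: (@le_trans _ _ ((3 * Y) ^+ (2 * p))); last first.
    rewrite exprMn ler_pM ?exprn_ge0//.
    by rewrite exprM; have -> : 3 ^+ 2 = 9 :> R by ring.
  rewrite normr_prod.
  apply: (@le_trans _ _ (\prod_(k < d) (3 * Y) ^+ D)).
    apply: ler_prod => k _; rewrite normr_ge0/=.
    apply: le_trans (jackson_bound n0 _ _) _; rewrite lerXn2r ?nnegrE ?mulr_ge0 ?le_max ?ler01 ?invr_ge0 ?(ltW rho0)//.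
    rewrite ler_wpM2l// ge_max Y1/= normrM normfV (gtr0_norm rho0).
    exact: Yi.
  rewrite prodr_const card_ord -exprM ler_weXn2l//; first by lra.
  by rewrite /D -mulnA leq_mul2l.
rewrite -mulrA mulr_natl -[X in _ *+ X]card_ord -sumr_const.
apply: ler_sum => k _; rewrite -ler_pdivrMl// mulrC (le_trans (Yi k))//.
apply: (@le_trans _ _ (Y ^+ (2 * p))).
  by rewrite -{1}(expr1 Y) ler_weXn2l//; lia.
by rewrite (le_trans Yp)// ler_peMl.
Qed.

Let expo (f : {ffun 'I_d -> 'I_D.+1}) : multinom d := Multinom [tuple (f i : nat) | i < d].

Let coef (j : J) (f : {ffun 'I_d -> 'I_D.+1}) : R :=
  \prod_(i < d) ((@jackson_poly R n (j i))`_(f i) / rho ^+ f i).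

Lemma tensor_mono j x : tensor_kernel j x = \sum_f coef j f * mono (expo f) x.
Proof.
rewrite /tensor_kernel.
under eq_bigr => i _ do rewrite (horner_coef_wide _ (size_jackson (j i))).
rewrite (bigA_distr_bigA (fun i (a : 'I_D.+1) => (@jackson_poly R n (j i))`_a * (tnth x i / rho) ^+ a)).
apply: eq_bigr => f _; rewrite /coef /mono -big_split/=; apply: eq_bigr => i _.
by rewrite multinomE tnth_mktuple exprMn exprVn; ring.
Qed.

Lemma mdeg_expo f : (mdeg (expo f) <= D * d)%N.
Proof.
rewrite mdegE; apply: (@leq_trans (\sum_(i < d) D)).
  by apply: leq_sum => i _; rewrite multinomE tnth_mktuple -ltnS.
by rewrite sum_nat_const card_ord mulnC.
Qed.

Lemma measurable_mono g : measurable_fun setT (@mono R d g).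
Proof.
apply: measurable_prod => i _; apply: measurable_funX; exact: measurable_coord.
Qed.

Lemma measurable_tensor j : measurable_fun setT (tensor_kernel j).
Proof.
rewrite (_ : tensor_kernel j = fun x => \sum_f coef j f * mono (expo f) x).
  by apply: measurable_sum => f; apply: measurable_funM => //; exact: measurable_mono.
by apply/funext => x; exact: tensor_mono.
Qed.

Lemma tensor_integral (m : probability (d.-tuple R) R) j :
  (forall g, (mdeg g <= D * d)%N -> intg m (mono g)) ->
  intg m (tensor_kernel j) /\
  \int[m]_x tensor_kernel j x = \sum_f coef j f * \int[m]_x mono (expo f) x.
Proof.
move=> im.
have E : tensor_kernel j = fun x => \sum_f coef j f * mono (expo f) x.
  by apply/funext => x; exact: tensor_mono.
have i1 f : intg m (fun x => coef j f * mono (expo f) x).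
  by apply: intgZ; apply: im; exact: mdeg_expo.
split; first by rewrite E; apply: intg_sum => f _.
rewrite E Rexp_sum//; apply: eq_bigr => f _; rewrite RintegralZl//.
by apply: im; exact: mdeg_expo.
Qed.

(** [B] comes from the absolute values of the coefficients of the kernels. It depends on [d], [n]
    and [rho] only, so the admissible discrepancy of the moments can be chosen after it. *)
Lemma tensor_close : exists2 B : R, 0 < B &
  forall (e : R) (mu nu : probability (d.-tuple R) R) j, 0 <= e ->
  (forall g, (mdeg g <= D * d)%N -> intg mu (mono g)) ->
  (forall g, (mdeg g <= D * d)%N -> intg nu (mono g)) ->
  (forall g, (mdeg g <= D * d)%N ->
    `|\int[mu]_x mono g x - \int[nu]_x mono g x| <= e) ->
  `|\int[mu]_x tensor_kernel j x - \int[nu]_x tensor_kernel j x| <= B * e.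
Proof.
exists (1 + \sum_j \sum_f `|coef j f|).
  by rewrite ltr_wpDr// sumr_ge0// => j _; rewrite sumr_ge0.
move=> e mu nu j e0 imu inu close.
have [_ ->] := tensor_integral j imu; have [_ ->] := tensor_integral j inu.
rewrite -sumrB (le_trans (ler_norm_sum _ _ _))//.
apply: (@le_trans _ _ ((\sum_f `|coef j f|) * e)).
  rewrite mulr_suml; apply: ler_sum => f _; rewrite -mulrBr normrM ler_wpM2l//.
  by apply: close; exact: mdeg_expo.
rewrite ler_wpM2r// (bigD1 j)//= ler_wpDl// lerDl sumr_ge0// => k _.
exact: sumr_ge0.
Qed.

End tensor.

Lemma measurable_cube (R : realType) d (r : R) : measurable (@cube R d r).
Proof.
have -> : @cube R d r = \bigcap_(i in [set: 'I_d]) ((fun x => `|tnth x i|) @^-1` `]-oo, r]).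
  apply/seteqP; split => x /= h i; first by move=> _ /=; rewrite in_itv/=.
  by have := h i Logic.I; rewrite /= in_itv.
apply: fin_bigcap_measurable => // i _.
rewrite -[X in measurable X]setTI.
have : measurable_fun setT (fun x : d.-tuple R => `|tnth x i|).
  by apply: measurableT_comp => //; exact: measurable_coord.
by apply => //; exact: measurable_itv.
Qed.

Lemma succ_le_exp2 k : (k.+1 <= 2 ^ k)%N.
Proof. by rewrite ltn_expl. Qed.

Section W1_moments.
Context {R : realType} (d : nat).
Hypothesis d0 : (0 < d)%N.

Lemma W1_moments (M : R) : 0 <= M -> exists2 C : R, 0 < C &
  forall ell : nat, (1 < ell)%N -> exists2 eps : R, 0 < eps &
  forall mu nu : probability (d.-tuple R) R,
  (forall g, (mdeg g <= ell)%N -> intg mu (mono g)) ->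
  (forall g, (mdeg g <= ell)%N -> intg nu (mono g)) ->
  (forall g, (mdeg g <= ell)%N ->
    `|\int[mu]_x mono g x - \int[nu]_x mono g x| <= eps) ->
  (forall i, \int[mu]_x (tnth x i ^+ (2 * ell./2)) <= M * (2 * ell./2)%:R ^+ ell./2) ->
  (forall i, \int[nu]_x (tnth x i ^+ (2 * ell./2)) <= M * (2 * ell./2)%:R ^+ ell./2) ->
  (W1 mu nu <= (C / Num.sqrt ell%:R)%:E)%E.
Proof.
move=> M0; have dR : 1 <= d%:R :> R by rewrite ler1n.
pose K : R := 4 * d%:R + 2 * d%:R * M + 1 + 2 ^+ d * (1 + 2 * d%:R * M).
have K0 : 0 < K.
  have dM : 0 <= d%:R * M by rewrite mulr_ge0.
  have : 0 <= 2 ^+ d * (1 + 2 * d%:R * M) by rewrite mulr_ge0 ?exprn_ge0//; lra.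
  by rewrite /K; lra.
(* For rho^2 = A p this gives 9^p (2p)^p / rho^(2p) = 64^(-p): the contribution from outside the
   cube has to beat the number of nodes, which is at most of order 2^p. *)
pose A : R := 2 * 9 * 64.
have A0 : 0 < A by rewrite /A !mulr_gt0.
have AE : 64^-1 = 9 * (A^-1 * 2) :> R by rewrite /A; field.
clearbody A.
exists (2 * d%:R * Num.sqrt A * K * Num.sqrt 3).
  by rewrite !mulr_gt0 ?sqrtr_gt0 ?(lt_le_trans ltr01 dR).
(* The degree 2 (n - 1) d of the tensor kernel is then at most 2p <= ell, and 1 / n is at most d /
   p. *)
move=> ell ell1; pose p := ell./2; pose n := (p %/ d).+1.
have p0 : (0 < p)%N by rewrite /p; lia.
have p3 : (ell <= 3 * p)%N by rewrite /p; lia.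
have pR : 0 < p%:R :> R by rewrite ltr0n.
have n0 : (0 < n)%N by [].
have npd : (n.-1 * d <= p)%N by rewrite /n/= leq_trunc_div.
pose rho : R := Num.sqrt (A * p%:R).
have rho0 : 0 < rho by rewrite sqrtr_gt0 mulr_gt0.
have Dell : (2 * n.-1 * d <= ell)%N.
  by rewrite -mulnA (@leq_trans (2 * p))// ?leq_mul2l//; rewrite /p; lia.
have [B B0 hB] := @tensor_close R d n rho.
pose J : finType := {ffun 'I_d -> 'I_(2 * n)}.
have J0 : 0 < #|J|%:R :> R by rewrite ltr0n card_ffun !card_ord expn_gt0.
(* Makes the total discrepancy over all nodes, #|J| B eps, equal to 32^(-p). *)
pose eps := (32%:R ^- p / (#|J|%:R * B) : R).
have eps0 : 0 < eps by rewrite divr_gt0 ?invr_gt0 ?exprn_gt0// mulr_gt0.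
exists eps => // mu nu imu inu close mmu mnu.
pose t (x : d.-tuple R) : R := 9 ^+ p * \sum_(i < d) (tnth x i / rho) ^+ (2 * p).
have mt : measurable_fun setT t.
  apply: measurable_funM => //; apply: measurable_sum => i; apply: measurable_funX.
  by apply: measurable_funM => //; exact: measurable_coord.
have t0 x : 0 <= t x.
  rewrite mulr_ge0 ?exprn_ge0//; apply: sumr_ge0 => i _.
  by rewrite exprM exprn_ge0// sqr_ge0.
pose e2 : R := d%:R * M * 64 ^- p.
have tint (m : probability (d.-tuple R) R) :
    (forall g, (mdeg g <= ell)%N -> intg m (mono g)) ->
    (forall i, \int[m]_x (tnth x i ^+ (2 * p)) <= M * (2 * p)%:R ^+ p) ->
    intg m t /\ \int[m]_x t x <= e2.
  move=> im mm.
  have ip i : intg m (fun x => tnth x i ^+ (2 * p)).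
    have -> : (fun x : d.-tuple R => tnth x i ^+ (2 * p)) = mono (mnm_muln (mnm1 i) (2 * p)).
      apply/funext => x; rewrite /mono (bigD1 i)//= big1 ?mulr1; last first.
        by move=> k ki; rewrite mulmnE mnm1E eq_sym (negPf ki) mul0n expr0.
      by rewrite mulmnE mnm1E eqxx mul1n.
    by apply: im; rewrite mdegMn mdeg1 mul1n /p; lia.
  have ip' i : intg m (fun x => (tnth x i / rho) ^+ (2 * p)).
    have -> : (fun x : d.-tuple R => (tnth x i / rho) ^+ (2 * p)) =
              (fun x => rho ^- (2 * p) * tnth x i ^+ (2 * p)).
      by apply/funext => x; rewrite exprMn exprVn mulrC.
    exact: intgZ.
  split; first by apply: intgZ; apply: intg_sum.
  rewrite RintegralZl//; last exact: intg_sum.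
  rewrite Rexp_sum//.
  apply: (@le_trans _ _ (9 ^+ p * \sum_(i < d) (rho ^- (2 * p) * (M * (2 * p)%:R ^+ p)))).
    rewrite ler_wpM2l ?exprn_ge0//; apply: ler_sum => i _.
    rewrite (_ : \int[m]_x (tnth x i / rho) ^+ (2 * p) =
                 \int[m]_x (rho ^- (2 * p) * tnth x i ^+ (2 * p))); last first.
      by apply: eq_Rintegral => x _; rewrite exprMn exprVn mulrC.
    by rewrite RintegralZl// ler_wpM2l// invr_ge0 exprn_ge0// ltW.
  rewrite sumr_const card_ord /e2 exprM /rho sqr_sqrtr; last by rewrite mulr_ge0// ltW.
  rewrite -[_ *+ d]mulr_natl exprMn natrM exprMn.
  have -> : 64 ^- p = 9 ^+ p * (A ^- p * 2 ^+ p) :> R.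
    by rewrite -!exprVn -!exprMn AE.
  rewrite le_eqVlt; apply/orP; left; apply/eqP.
  have : p%:R ^+ p != 0 :> R by rewrite expf_neq0// gt_eqF.
  have : A ^+ p != 0 :> R by rewrite expf_neq0// gt_eqF.
  move: (p%:R ^+ p) (A ^+ p) (9 ^+ p) (2 ^+ p) => a b c e b0 a0; field.
  by rewrite b0 a0.
have [tmu lmu] := tint mu imu mmu; have [tnu lnu] := tint nu inu mnu.
have cmu g : (mdeg g <= 2 * n.-1 * d)%N -> intg mu (mono g).
  by move=> h; apply: imu; apply: leq_trans Dell.
have cnu g : (mdeg g <= 2 * n.-1 * d)%N -> intg nu (mono g).
  by move=> h; apply: inu; apply: leq_trans Dell.
have ccl g : (mdeg g <= 2 * n.-1 * d)%N -> `|\int[mu]_x mono g x - \int[nu]_x mono g x| <= eps.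
  by move=> h; apply: close; apply: leq_trans Dell.
have h := @W1_kernel R d J (@tensor_kernel R d n rho) (@tensor_node R d n rho) (cube rho) t
  (d%:R * rho * (4 / n%:R)) (d%:R * rho) (B * eps) e2
  (@measurable_tensor R d n rho) (@measurable_cube R d rho).
apply: (@le_trans _ _ (2 * (d%:R * rho * (4 / n%:R) + d%:R * rho * e2 +
    d%:R * rho * (#|J|%:R * (B * eps + 2 * e2))))%:E).
  refine (h _ _ _ _ _ _ _ _ _ mu nu tmu tnu lmu lnu _ _ _).
  - by move=> j y; exact: tensor_ge0.
  - exact: tensor_sum.
  - by move=> y; exact: tensor_dist.
  - by move=> j y nQ; have [] := tensor_out n0 rho0 j d0 p0 npd nQ.
  - move=> y Qy; rewrite /norm1 mulr_natl -[X in _ *+ X]card_ord -sumr_const.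
    by apply: ler_sum => i _; exact: Qy.
  - have j0 : J by exact: [ffun=> Ordinal (isT : (0 < 2 * n)%N)].
    by move=> y nQ; have [] := tensor_out n0 rho0 j0 d0 p0 npd nQ.
  - exact: t0.
  - by rewrite mulr_ge0// ltW.
  - by rewrite !mulr_ge0// ltW.
  - by move=> j; have [] := @tensor_integral R d n rho mu j cmu.
  - by move=> j; have [] := @tensor_integral R d n rho nu j cnu.
  - by move=> j; apply: hB => //; exact: ltW.
rewrite lee_fin.
have p32 : p%:R * 32 ^- p <= 1 :> R.
  rewrite ler_pdivrMr ?exprn_gt0// mul1r -natrX ler_nat.
  by rewrite (leq_trans (ltnW (ltn_expl p (isT : (1 < 32)%N)))).
have e0 : 0 <= e2 by rewrite /e2 !mulr_ge0// invr_ge0 exprn_ge0.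
have E1 : #|J|%:R * (B * eps) = 32 ^- p.
  rewrite /eps mulrA mulrC divfK// gt_eqF// mulr_gt0//.
have E2 : #|J|%:R * e2 <= 2 ^+ d * (d%:R * M) * 32 ^- p.
  (* There are (2n)^d nodes, and n = p %/ d + 1 is at most 2 to the power p %/ d. *)
  have cJ : #|J|%:R <= 2 ^+ d * 2 ^+ p :> R.
    rewrite card_ffun !card_ord -!natrX -natrM ler_nat expnMn leq_mul2l.
    apply/orP; right; apply: (@leq_trans ((2 ^ (p %/ d)) ^ d)).
      by rewrite leq_exp2r// succ_le_exp2.
    by rewrite -expnM leq_exp2l// leq_trunc_div.
  apply: (le_trans (ler_wpM2r e0 cJ)); rewrite /e2.
  have -> : 64 ^- p = 2 ^- p * 32 ^- p :> R.
    by rewrite -!exprVn -exprMn; congr (_ ^+ _); field.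
  rewrite le_eqVlt; apply/orP; left; apply/eqP.
  have : 2 ^+ p != 0 :> R by rewrite expf_neq0.
  have : 32 ^+ p != 0 :> R by rewrite expf_neq0.
  move: (2 ^+ d) (32 ^+ p) (2 ^+ p) => a b c b0 c0; field.
  by rewrite b0 c0.
have E3 : e2 <= d%:R * M * 32 ^- p.
  rewrite /e2 ler_wpM2l ?mulr_ge0// lef_pV2 ?posrE ?exprn_gt0//.
  by rewrite lerXn2r// ?nnegrE//; lra.
have nR : 0 < n%:R :> R by rewrite ltr0n.
have n1 : n%:R^-1 <= d%:R / p%:R :> R.
  rewrite ler_pdivlMr// -ler_pdivlMl ?invr_gt0// invrK -natrM ler_nat.
  by rewrite /n ltnW// ltn_ceil.
have q32 : 32 ^- p <= p%:R^-1 :> R by rewrite -[leRHS]mul1r ler_pdivlMr// mulrC.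
have r1 : rho / p%:R = Num.sqrt A / Num.sqrt p%:R.
  rewrite /rho sqrtrM; last exact: ltW.
  rewrite -{2}(sqr_sqrtr (ltW pR)) expr2 invfM mulrA mulfK//.
  by rewrite gt_eqF// sqrtr_gt0.
have r2 : (Num.sqrt p%:R)^-1 <= Num.sqrt 3 / Num.sqrt ell%:R :> R.
  have l0 : 0 < ell%:R :> R by rewrite ltr0n (leq_trans _ ell1).
  rewrite ler_pdivlMr ?sqrtr_gt0// mulrC ler_pdivrMr ?sqrtr_gt0//.
  rewrite -sqrtrM//; by apply: ler_wsqrtr; rewrite -natrM ler_nat.
have dM : 0 <= d%:R * M by rewrite mulr_ge0.
have hbr : 4 / n%:R + e2 + (32 ^- p + 2 * (#|J|%:R * e2)) <= K / p%:R.
  have dq : 0 <= 2 ^+ d * (d%:R * M) by rewrite mulr_ge0 ?exprn_ge0.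
  have h1 : d%:R * M * 32 ^- p <= d%:R * M * p%:R^-1 by rewrite ler_wpM2l.
  have h2 : 2 ^+ d * (d%:R * M) * 32 ^- p <= 2 ^+ d * (d%:R * M) * p%:R^-1 by rewrite ler_wpM2l.
  have pV : 0 <= p%:R^-1 :> R by rewrite invr_ge0.
  have h3 : 0 <= d%:R * M * p%:R^-1 by rewrite mulr_ge0.
  have h4 : 0 <= 2 ^+ d * p%:R^-1 :> R by rewrite mulr_ge0 ?exprn_ge0.
  have -> : K / p%:R = 4 * (d%:R / p%:R) + 2 * (d%:R * M * p%:R^-1) + p%:R^-1 +
     2 ^+ d * p%:R^-1 + 2 * (2 ^+ d * (d%:R * M) * p%:R^-1) by rewrite /K; ring.
  lra.
apply: (@le_trans _ _ (2 * d%:R * rho * (K / p%:R))).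
  have -> : 2 * (d%:R * rho * (4 / n%:R) + d%:R * rho * e2 +
      d%:R * rho * (#|J|%:R * (B * eps + 2 * e2))) =
      2 * d%:R * rho * (4 / n%:R + e2 + (32 ^- p + 2 * (#|J|%:R * e2))).
    by rewrite -E1; ring.
  by rewrite ler_wpM2l// !mulr_ge0// ltW.
have -> : 2 * d%:R * rho * (K / p%:R) = 2 * d%:R * K * Num.sqrt A * (Num.sqrt p%:R)^-1.
  rewrite mulrACA -!mulrA; congr (_ * (_ * _)).
  by rewrite r1.
apply: (le_trans (ler_wpM2l _ r2)); first by rewrite !mulr_ge0 ?sqrtr_ge0// ltW.
by rewrite le_eqVlt; apply/orP; left; apply/eqP; ring.
Qed.

End W1_moments.

(** * Measures on a cube with prescribed moments *)

Lemma nth_In (T : Type) (x : T) s i : (i < size s)%N -> List.In (nth x s i) s.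
Proof.
by elim: s i => // v s IH [|i] /= h; [left|right; exact: IH].
Qed.

(* Bartl's induction on the number of generators. *)
Lemma farkas (R : realFieldType) (I : finType) (a : seq (I -> R)) (t : I -> R) :
  (forall c : I -> R, (forall v, List.In v a -> 0 <= \sum_i c i * v i) ->
    0 <= \sum_i c i * t i) ->
  exists2 y : seq R, size y = size a & (forall i, 0 <= nth 0 y i) /\
    forall i, t i = \sum_(j < size a) nth 0 y j * nth (fun=> 0) a j i.
Proof.
have [n sa] : exists n, size a = n by exists (size a).
elim: n a sa t => [|n IH] [|v a]//= sa t h.
  exists [::] => //; split=> [i|i]; first by rewrite nth_nil.
  rewrite big_ord0; have := h (fun j => - (i == j)%:R) (fun v => False_ind _).
  rewrite (bigD1 i)//= eqxx big1 ?addr0 ?mulN1r; last first.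
    by move=> j /negbTE; rewrite eq_sym => ->; rewrite oppr0 mul0r.
  have := h (fun j => (i == j)%:R) (fun v => False_ind _).
  rewrite (bigD1 i)//= eqxx big1 ?addr0 ?mul1r; last first.
    by move=> j /negbTE; rewrite eq_sym => ->; rewrite mul0r.
  by move=> h1 h2; apply/eqP; rewrite eq_le h1 -oppr_ge0 h2.
case: sa => sa.
pose hyp := forall c : I -> R, (forall u, List.In u a -> 0 <= \sum_i c i * u i) ->
    0 <= \sum_i c i * t i.
have [/(IH _ sa)[y sy [y0 ty]]|/existsNP[c /not_implyP[ca /negP]]] := pselect hyp.
  exists (0 :: y); first by rewrite /= sy.
  split=> [[|i]//|i]; first exact: y0.
  by rewrite /= big_ord_recl/= mul0r add0r ty.
rewrite -ltNge => ct.
(* [c] is nonnegative on the generators in [a] and negative on [t], so by [h] it must be negative on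
   [v]. *)
have cv : \sum_i c i * v i < 0.
  rewrite ltNge; apply/negP => cv.
  have := h c; rewrite leNgt ct => H; have : false by apply: H => u /= [<-//|]; exact: ca.
  by [].
set cv0 := \sum_i c i * v i in cv.
(* Projection along [v] onto the hyperplane where [c] vanishes. By [prE], testing a projected vector
   with [e] amounts to testing the original one with a functional that vanishes on [v], so the
   induction hypothesis applies to the projected system. The coefficient [y1] of [v] is recovered
   afterwards; its sign comes from that of [c]. *)
pose pr (u : I -> R) i := u i - (\sum_j c j * u j) / cv0 * v i.
have prE (e u : I -> R) : \sum_i e i * pr u i =
    \sum_i (e i - (\sum_j e j * v j) / cv0 * c i) * u i.
  rewrite (eq_bigr (fun i => e i * u i - (\sum_j c j * u j) / cv0 * (e i * v i))); last first.
    by move=> i _; rewrite /pr; ring.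
  rewrite sumrB -mulr_sumr [RHS](eq_bigr (fun i => e i * u i -
    (\sum_j e j * v j) / cv0 * (c i * u i))); last by move=> i _; ring.
  by rewrite sumrB -mulr_sumr; congr (_ - _); ring.
have sa' : size (map pr a) = n by rewrite size_map.
have [|y sy [y0 ty]] := IH _ sa' (pr t).
  move=> e ea; rewrite prE; apply: h => u /= [<-|ua].
    rewrite (eq_bigr (fun i => e i * v i - (\sum_j e j * v j) / cv0 * (c i * v i))); last first.
      by move=> i _; ring.
    by rewrite sumrB -mulr_sumr -/cv0 mulfVK ?subrr// lt_eqF.
  by rewrite -prE; apply: ea; apply/List.in_map_iff; exists u.
rewrite size_map in sy ty.
pose y1 := (\sum_i c i * t i) / cv0 -
  \sum_(j < size a) nth 0 y j * ((\sum_i c i * nth (fun=> 0) a j i) / cv0).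
exists (y1 :: y); first by rewrite /= sy.
split=> [[|i]|i]; rewrite /=; last 1 first.
- rewrite big_ord_recl/=.
  have := ty i; rewrite {1}/pr => /eqP; rewrite subr_eq => /eqP ->.
  rewrite (eq_bigr (fun j : 'I_(size a) => nth 0 y j * nth (fun=> 0) a j i -
     nth 0 y j * ((\sum_l c l * nth (fun=> 0) a j l) / cv0) * v i)); last first.
    move=> j _; rewrite (nth_map (fun=> 0))// /pr; ring.
  rewrite sumrB -mulr_suml /y1 mulrBl; ring.
- rewrite subr_ge0 (@le_trans _ _ 0)//.
    rewrite sumr_le0// => j _; rewrite mulr_ge0_le0//.
    rewrite mulr_ge0_le0 ?invr_le0 ?(ltW cv)//; apply: ca.
    by apply: nth_In; rewrite ltn_ord.
  by rewrite mulr_le0 ?invr_le0 ?(ltW cv)// ltW.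
- exact: y0.
Qed.

Lemma mem_In (T : eqType) (x : T) s : x \in s -> List.In x s.
Proof. by elim: s => // v s IH; rewrite inE => /orP[/eqP ->|/IH]; [left|right]. Qed.

(** * Monomials and moment functionals *)

Section mono.
Context {R : realType} {d : nat}.
Implicit Types (g : multinom d) (x y : d.-tuple R).

Lemma mnm_induction (Q : multinom d -> Prop) : Q mnm0 ->
  (forall i g, Q g -> Q (mnm_add (mnm1 i) g)) -> forall g, Q g.
Proof.
move=> Q0 QS g; have [n] := ubnP (mdeg g); elim: n g => // n IH g gn.
have [g0|] := eqVneq (mdeg g) 0%N.
  by move/eqP: g0; rewrite mdeg_eq0 => /eqP ->.
rewrite mdegE sum_nat_eq0 => /forallPn[i]; rewrite /= => gi.
have E : g = mnm_add (mnm1 i) (mnm_sub g (mnm1 i)).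
  by rewrite addmC submK// lep1mP.
rewrite E; apply: QS; apply: IH; move: gn; rewrite {1}E mdegD mdeg1.
by rewrite add1n ltnS.
Qed.

Lemma mono0 x : mono mnm0 x = 1.
Proof. by rewrite /mono big1// => i _; rewrite mnm0E expr0. Qed.

Lemma monoD g1 g2 x : mono (mnm_add g1 g2) x = mono g1 x * mono g2 x.
Proof. by rewrite /mono -big_split; apply: eq_bigr => i _; rewrite mnmDE exprD. Qed.

Lemma mono1 i x : mono (mnm1 i) x = tnth x i.
Proof.
rewrite /mono (bigD1 i)//= mnm1E eqxx expr1 big1 ?mulr1// => j /negbTE ji.
by rewrite mnm1E eq_sym ji expr0.
Qed.

Lemma mono_bound g x A : (forall i, `|tnth x i| <= A) -> `|mono g x| <= A ^+ mdeg g.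
Proof.
move=> xA; rewrite /mono normr_prod mdegE -prodrXr; apply: ler_prod => i _.
by rewrite normr_ge0 normrX lerXn2r ?nnegrE// (le_trans _ (xA i)).
Qed.

Lemma mono_lipschitz g x y A : 1 <= A ->
  (forall i, `|tnth x i| <= A) -> (forall i, `|tnth y i| <= A) ->
  `|mono g x - mono g y| <= (mdeg g)%:R * A ^+ mdeg g * dist1 y x.
Proof.
move=> A1 xA yA; have A0 : 0 <= A by lra.
elim/mnm_induction: g => [|i g IH].
  by rewrite !mono0 subrr normr0 mdeg0 !mul0r.
rewrite !monoD !mono1 mdegD mdeg1 add1n.
have -> : tnth x i * mono g x - tnth y i * mono g y =
  tnth x i * (mono g x - mono g y) + (tnth x i - tnth y i) * mono g y by ring.
apply: (le_trans (ler_normD _ _)); rewrite !normrM.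
have h1 : `|tnth x i| * `|mono g x - mono g y| <=
    A * ((mdeg g)%:R * A ^+ mdeg g * dist1 y x) by apply: ler_pM.
have h2 : `|tnth x i - tnth y i| * `|mono g y| <= dist1 y x * (A * A ^+ mdeg g).
  apply: ler_pM => //; first by rewrite /dist1 (bigD1 i)//= lerDl sumr_ge0.
  by apply: (le_trans (mono_bound g yA)); rewrite ler_peMl ?exprn_ge0.
rewrite (le_trans (lerD h1 h2))// exprS -natr1 le_eqVlt; apply/orP; left; apply/eqP.
ring.
Qed.

(** Trades the sum over the support, which varies with [p], for a sum over a fixed finite type,
    where linearity is termwise. *)
Lemma moment_functionalE mu (p : mpoly d R) k : (msize p <= k)%N ->
  moment_functional mu p = \sum_(a : bmultinom d k) mcoeff a p * mu a.
Proof.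
move=> pk; rewrite /moment_functional (ssrcomplements.big_mksub (bmultinom d k : subFinType _))/=.
- by rewrite big_rmcond//= => i; move/memN_msupp_eq0 => ->; rewrite mul0r.
- by rewrite msupp_uniq.
- by move=> i /msize_mdeg_lt /leq_trans; apply.
Qed.

Lemma moment_functionalX mu g : moment_functional mu (mpolyX R g) = mu g.
Proof. by rewrite /moment_functional msuppX big_seq1 mcoeffX eqxx mul1r. Qed.

Lemma moment_functionalD mu (p q : mpoly d R) :
  moment_functional mu (p + q) = moment_functional mu p + moment_functional mu q.
Proof.
pose k := maxn (msize (p + q)) (maxn (msize p) (msize q)).
rewrite (@moment_functionalE _ _ k) ?leq_maxl// (@moment_functionalE _ p k); last first.
  by rewrite leq_max leq_maxl orbT.
rewrite (@moment_functionalE _ q k); last by rewrite leq_max leq_maxr orbT.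
by rewrite -big_split; apply: eq_bigr => a _; rewrite mcoeffD mulrDl.
Qed.

Lemma moment_functionalZ mu c (p : mpoly d R) :
  moment_functional mu (c *: p) = c * moment_functional mu p.
Proof.
pose k := maxn (msize (c *: p)) (msize p).
rewrite (@moment_functionalE _ _ k) ?leq_maxl// (@moment_functionalE _ p k) ?leq_maxr//.
by rewrite mulr_sumr; apply: eq_bigr => a _; rewrite mcoeffZ mulrA.
Qed.

Lemma moment_functional0 mu : moment_functional mu (0 : mpoly d R) = 0.
Proof. by rewrite -(scale0r (0 : mpoly d R)) moment_functionalZ mul0r. Qed.

Lemma moment_functional_sum mu (J : Type) (s : seq J) (Q : pred J) (F : J -> mpoly d R) :
  moment_functional mu (\sum_(j <- s | Q j) F j) =
  \sum_(j <- s | Q j) moment_functional mu (F j).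
Proof.
by apply: (big_morph _ (moment_functionalD mu) (moment_functional0 mu)).
Qed.

Lemma meval_moment (x : d.-tuple R) (p : mpoly d R) :
  meval (tnth x) p = moment_functional (fun g => mono g x) p.
Proof. by rewrite mevalE. Qed.

End mono.

Section discrete.
Context {R : realType} {d : measure_display} {T : measurableType d}.

Section msum_dirac.
Variables (n : nat) (y : nat -> {nonneg R}) (x : nat -> T) (D : set T).
Hypotheses (mD : measurable D) (xD : forall k, (k < n)%N -> D (x k)).
Hypothesis y1 : \sum_(k < n) (y k)%:num = 1.

Let mu := msum (fun k => mscale (y k) (dirac (x k))) n.

HB.instance Definition _ := measure_function.Measure.on mu.

Let mu_set A : measurable A -> (forall k, (k < n)%N -> A (x k)) -> mu A = 1%E.
Proof.
move=> mA xA; rewrite /mu /msum -y1 -sumEFin; apply: eq_bigr => k _.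
by rewrite -[LHS]/((y k)%:num%:E * \d_(x k) A)%E diracE mem_set ?mule1//; exact: xA.
Qed.

Let mu_probability : mu setT = 1%E.
Proof. exact: mu_set. Qed.

HB.instance Definition _ := Measure_isProbability.Build _ _ _ mu mu_probability.

Let ge0_mu_integral (f : T -> R) : measurable_fun setT f -> (forall u, 0 <= f u) ->
  (\int[mu]_(u in D) (f u)%:E)%E = (\sum_(k < n) (y k)%:num * f (x k))%:E.
Proof.
move=> mf f0; have mE : measurable_fun D (EFin \o f).
  by apply/measurable_EFinP; exact: measurable_funS mf.
rewrite ge0_integral_measure_sum//; last by move=> u _; rewrite lee_fin.
rewrite -sumEFin; apply: eq_bigr => k _.
rewrite ge0_integral_mscale//; last by move=> u _; rewrite lee_fin.
by rewrite integral_dirac// diracE mem_set ?mul1e//; exact: xD.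
Qed.

Lemma msum_dirac_probability : exists nu : probability T R, nu D = 1%E /\
    forall f : T -> R, measurable_fun setT f ->
      (\int[nu]_(u in D) f u)%R = \sum_(k < n) (y k)%:num * f (x k).
Proof.
exists mu; split; first exact: mu_set.
move=> f mf; rewrite /Rintegral integralE.
rewrite (_ : (fun u => (f u)%:E)^\+%E = fun u => (Num.max (f u) 0)%:E); last first.
  by apply/funext => u; rewrite funeposE EFin_max.
rewrite (_ : (fun u => (f u)%:E)^\-%E = fun u => (Num.max (- f u) 0)%:E); last first.
  by apply/funext => u; rewrite funenegE EFin_max.
rewrite !ge0_mu_integral/=; last 4 first.
- by apply: measurable_maxr => //; exact: measurableT_comp.
- by move=> u; rewrite le_max lexx orbT.
- by apply: measurable_maxr => //; exact: measurableT_comp.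
- by move=> u; rewrite le_max lexx orbT.
rewrite -sumrB; apply: eq_bigr => k _; rewrite -mulrBr; congr (_ * _).
by case: (leP (f (x k)) 0) => h; case: (leP (- f (x k)) 0); lra.
Qed.

End msum_dirac.
End discrete.

Section cube_moments.
Context {R : realType} (d : nat).

Implicit Types (rad eps : R).

Definition grid rad N (j : {ffun 'I_d -> 'I_N.+1}) : d.-tuple R :=
  [tuple - rad + 2 * rad * (j i)%:R / N%:R | i < d].

Lemma grid_cube rad N j : 0 < rad -> (0 < N)%N -> cube rad (grid rad (N := N) j).
Proof.
move=> r0 N0 i; rewrite tnth_mktuple.
have N0' : 0 < N%:R :> R by rewrite ltr0n.
have h : 0 <= ((j i)%:R / N%:R : R) <= 1.
  by rewrite divr_ge0//= ler_pdivrMr// mul1r ler_nat -ltnS.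
rewrite ler_norml -mulrA; set t := _ / _ in h *; nra.
Qed.

Lemma grid_close rad N x : 0 < rad -> (0 < N)%N -> cube rad x ->
  exists j, dist1 (grid rad (N := N) j) x <= d%:R * (2 * rad / N%:R).
Proof.
move=> r0 N0 xc; have N0' : 0 < N%:R :> R by rewrite ltr0n.
have r20 : 0 < 2 * rad by lra.
pose a i := (tnth x i + rad) / (2 * rad) * N%:R.
have a0 i : 0 <= a i <= N%:R.
  have := xc i; rewrite ler_norml => /andP[h1 h2].
  have h3 : 0 <= (tnth x i + rad) / (2 * rad) <= 1.
    by rewrite divr_ge0//= ?ler_pdivrMr//; lra.
  case/andP: h3 => h3 h4; rewrite /a mulr_ge0 ?(ltW N0')//=.
  by rewrite ler_piMl ?(ltW N0').
exists [ffun i => inord (Num.truncn (a i))].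
rewrite /dist1 mulr_natl -[d in _ *+ d]card_ord -sumr_const; apply: ler_sum => i _; rewrite tnth_mktuple ffunE.
have /andP[ai0 aiN] := a0 i; have /andP[t1 t2] := truncn_itv ai0.
rewrite inordK; last first.
  by rewrite ltnS -(ler_nat R) (le_trans t1).
have -> : tnth x i - (- rad + 2 * rad * (Num.truncn (a i))%:R / N%:R) =
   (a i - (Num.truncn (a i))%:R) * (2 * rad / N%:R).
  rewrite /a; field; by rewrite (gt_eqF N0') (gt_eqF r0).
have c0 : 0 <= 2 * rad / N%:R by rewrite divr_ge0 ?ltW.
rewrite normrM (ger0_norm c0) ler_piMl// ger0_norm; last by lra.
by move: t2; rewrite -natr1; lra.
Qed.

(* The measure is carried by a fine grid; separation (Farkas) yields its weights. *)
Lemma cube_moment_measure q rad (mm : multinom d -> R) eps :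
  0 < rad -> 0 < eps -> mm mnm0 = 1 ->
  (forall p : mpoly d R, (msize p <= q.+1)%N ->
    \sum_(a : bmultinom d q.+1) mcoeff a p ^+ 2 = 1 ->
    (forall x, cube rad x -> - eps <= meval (tnth x) p) ->
    0 <= moment_functional mm p) ->
  exists nu : probability (d.-tuple R) R, nu (cube rad) = 1%E /\
    forall g, (mdeg g <= q)%N -> (\int[nu]_(x in cube rad) mono g x)%R = mm g.
Proof.
move=> r0 e0 mm0 H.
pose A := 1 + rad; pose I : finType := bmultinom d q.+1.
(* B / N bounds the difference between the values at a point of the cube and at a nearby grid point,
   for polynomials of degree at most [q] with coefficients bounded by 1. *)
pose B := #|I|%:R * (q%:R * A ^+ q * (d%:R * (2 * rad))).
have A1 : 1 <= A by rewrite /A; lra.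
have B0 : 0 <= B by rewrite !mulr_ge0 ?exprn_ge0//; lra.
pose N := (Num.truncn (B / eps)).+1.
have N0 : 0 < N%:R :> R by rewrite ltr0n.
have BN : B / N%:R <= eps.
  rewrite ler_pdivrMr// mulrC -ler_pdivrMr// ltW//.
  by have /andP[] := truncn_itv (divr_ge0 B0 (ltW e0)).
pose V (j : {ffun 'I_d -> 'I_N.+1}) (a : I) := mono a (grid rad j).
pose gens := [seq V j | j <- enum {ffun 'I_d -> 'I_N.+1}].
have key (c : I -> R) : (forall v, List.In v gens -> 0 <= \sum_i c i * v i) ->
    0 <= \sum_i c i * mm i.
  move=> hc; have hV j : 0 <= \sum_i c i * V j i.
    by apply: hc; apply/List.in_map_iff; exists j; split=> //; apply: mem_In; rewrite mem_enum.
  pose s2 := \sum_i c i ^+ 2; have s20 : 0 <= s2 by rewrite sumr_ge0// => i _; rewrite sqr_ge0.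
  have [s2z|s2n] := eqVneq s2 0.
    rewrite big1// => i _; have : c i ^+ 2 = 0.
      by apply: (psumr_eq0P _ s2z) => // j _; rewrite sqr_ge0.
    by move=> /eqP; rewrite sqrf_eq0 => /eqP ->; rewrite mul0r.
  have s2p : 0 < s2 by rewrite lt_def s2n.
  pose s := Num.sqrt s2; have s0 : 0 < s by rewrite sqrtr_gt0.
  pose p : mpoly d R := \sum_i (c i / s) *: mpolyX R (i : multinom d).
  have pc (a : I) : mcoeff a p = c a / s.
    rewrite /p raddf_sum/= (bigD1 a)//= mcoeffZ mcoeffX eqxx mulr1 big1 ?addr0// => i ia.
    by rewrite mcoeffZ mcoeffX -bmeqP (negbTE ia) mulr0.
  have pm (mu : multinom d -> R) : moment_functional mu p = (\sum_i c i * mu i) / s.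
    rewrite /p moment_functional_sum mulr_suml; apply: eq_bigr => i _.
    by rewrite moment_functionalZ moment_functionalX mulrAC.
  suff : 0 <= moment_functional mm p by rewrite pm pmulr_lge0 ?invr_gt0.
  apply: H.
  - apply: (leq_trans (mmeasure_sum _ _ _ _)); apply/bigmax_leqP => i _.
    by apply: (leq_trans (mmeasureZ_le _ _ _)); rewrite mmeasureX bmdeg.
  - rewrite (eq_bigr (fun a => c a ^+ 2 / s2)); last first.
      by move=> a _; rewrite pc expr_div_n sqr_sqrtr.
    by rewrite -mulr_suml mulfV.
  (* Nonnegativity on the grid gives only the lower bound [- eps] on the cube, which is why [H]
     admits such polynomials. *)
  - move=> x xc; have [j hj] := grid_close r0 (ltn0Sn _ : (0 < N)%N) xc.
    have pj : 0 <= meval (tnth (grid rad j)) p.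
      by rewrite meval_moment pm; apply: divr_ge0; [exact: hV|exact: ltW].
    suff : `|meval (tnth x) p - meval (tnth (grid rad j)) p| <= eps.
      by rewrite ler_norml => /andP[]; lra.
    rewrite !meval_moment !pm -mulrBl -sumrB mulr_suml.
    apply: (le_trans (ler_norm_sum _ _ _)); apply: (le_trans _ BN).
    have -> : B / N%:R = \sum_(i : I) (q%:R * A ^+ q * (d%:R * (2 * rad / N%:R))).
      rewrite sumr_const -mulr_natl /B; ring.
    apply: ler_sum => i _; rewrite -mulrBr mulrAC normrM.
    have ci : `|c i / s| <= 1.
      rewrite normrM normfV (gtr0_norm s0) ler_pdivrMr// mul1r.
      rewrite -(@ler_pXn2r _ 2)// ?nnegrE ?(ltW s0)// sqr_sqrtr// real_normK ?num_real//.
      by rewrite /s2 (bigD1 i)//= lerDl sumr_ge0// => j' _; rewrite sqr_ge0.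
    rewrite -[leRHS]mul1r ler_pM//.
    have xA k : `|tnth x k| <= A by rewrite (le_trans (xc k))// /A; lra.
    have yA k : `|tnth (grid rad j) k| <= A.
      by rewrite (le_trans (grid_cube _ r0 _ k))// /A; lra.
    apply: (le_trans (mono_lipschitz _ A1 xA yA)).
    have iq : (mdeg i <= q)%N by rewrite -ltnS bmdeg.
    apply: ler_pM; rewrite ?dist1_ge0 ?mulr_ge0 ?exprn_ge0//; try lra.
    by apply: ler_pM; rewrite ?exprn_ge0 ?ler_nat ?ler_weXn2l//; lra.
have [y _ [y0 ym]] := farkas key.
pose ny k := NngNum (y0 k).
pose j0 : {ffun 'I_d -> 'I_N.+1} := [ffun=> ord0].
pose x k := nth (grid rad j0) [seq grid rad j | j <- enum {ffun 'I_d -> 'I_N.+1}] k.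
have xE k a : (k < size gens)%N -> nth (fun=> 0) gens k a = mono (a : I) (x k).
  rewrite size_map => kn; rewrite /x /gens (nth_map j0 _ V kn).
  by rewrite (nth_map j0 _ (grid rad (N := N)) kn).
have xc k : (k < size gens)%N -> cube rad (x k).
  by rewrite size_map => kn; rewrite /x (nth_map j0)//; exact: grid_cube.
(* The constant monomial is among the matched ones, so [mm0] makes the weights sum to 1. *)
have y1 : \sum_(k < size gens) (ny k)%:num = 1.
  have /= := ym (bm0 : bmultinom d q.+1); rewrite mm0 => ->; apply: eq_bigr => k _.
  by rewrite xE ?ltn_ord//= mono0 mulr1.
have [nu [nu1 nuf]] := msum_dirac_probability (@measurable_cube R d rad) xc y1.
exists nu; split=> // g gq; rewrite nuf; last exact: measurable_mono.
have gq' : (mdeg g < q.+1)%N by [].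
have /= := ym (BMultinom gq'); move=> ->; apply: eq_bigr => k _.
by rewrite xE.
Qed.

End cube_moments.

(** * Orthogonal polynomials in the algorithm *)

Section mrpc_algebra.
Context {R : realType} {d : nat} (ch : mrpc_choices d) (L S : nat).
Variable mu : multinom d -> R.
Hypothesis posdef : hankel_posdef L mu.
Implicit Types (p q : mpoly d R) (a b g : multinom d).
Local Notation mf := (moment_functional mu).

Lemma moment_functionalM p q k l : (msize p <= k)%N -> (msize q <= l)%N ->
  mf (p * q) = \sum_(a : bmultinom d k) \sum_(b : bmultinom d l)
    mcoeff a p * mu (mnm_add a b) * mcoeff b q.
Proof.
move=> pk ql; rewrite {1}(mpolywE pk) {1}(mpolywE ql) big_distrlr/=.
rewrite moment_functional_sum; apply: eq_bigr => a _.
rewrite moment_functional_sum; apply: eq_bigr => b _.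
by rewrite -scalerAl -scalerAr -mpolyXD !moment_functionalZ moment_functionalX; ring.
Qed.

Lemma hankel_posdef_gt0 p : (msize p <= L.+1)%N -> p != 0 -> 0 < mf (p * p).
Proof.
move=> pL p0; rewrite (moment_functionalM pL pL); apply: posdef.
apply/existsP; rewrite -negb_forall; apply: contra p0 => /forallP h.
apply/eqP/mpolyP => a; rewrite mcoeff0.
have [aL|] := ltnP (mdeg a) L.+1; first by have /eqP := h (BMultinom aL).
by move=> aL; apply/eqP; rewrite mcoeff_eq0; apply: mmeasure_mnm_ge; exact: leq_trans aL.
Qed.

Lemma msize_supp p k : (forall a, mcoeff a p != 0 -> (mdeg a < k)%N) -> (msize p <= k)%N.
Proof.
move=> h; rewrite mmeasureE big_tnth; apply/bigmax_leqP => i _; apply: h.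
by rewrite -mcoeff_msupp mem_tnth.
Qed.

(** Invariant of the recursion: the polynomials in [acc] involve only the monomials [pre] already
    treated. Hence the new [U] has coefficient 1 at [a] and is nonzero, so positive definiteness
    gives it a positive norm; the normalisation can be undone, and [a] expands in the polynomials
    computed so far. *)
Lemma gram_schmidt_spec rest pre acc : uniq (pre ++ rest) ->
  (forall a, a \in pre ++ rest -> (mdeg a <= L)%N) -> size acc = size pre ->
  (forall q, q \in acc -> forall b, mcoeff b q != 0 -> b \in pre) ->
  let Q := gram_schmidt mu acc rest in
  [/\ size Q = size (pre ++ rest), take (size acc) Q = acc &
    forall i, (size pre <= i < size (pre ++ rest))%N -> exists c : nat -> R,
      mpolyX R (nth mnm0 (pre ++ rest) i) = \sum_(j < i.+1) c j *: nth 0 Q j].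
Proof.
elim: rest pre acc => [|a rest IH] pre acc u dL sz sup /=.
  rewrite cats0 take_size; split=> // i /andP[h1 h2].
  by have := leq_ltn_trans h1 h2; rewrite ltnn.
set U := mpolyX R a - _; set w := _^-1 *: U.
have Ua b : mcoeff b U != 0 -> b \in rcons pre a.
  rewrite mem_rcons inE; apply: contraNT; rewrite negb_or => /andP[ba bp].
  have ab : (a == b) = false by rewrite eq_sym (negbTE ba).
  rewrite /U mcoeffB mcoeffX ab sub0r oppr_eq0 raddf_sum big_seq big1//= => q qa.
  rewrite mcoeffZ; apply/eqP; rewrite mulf_eq0; apply/orP; right.
  by apply: contraNT bp; exact: sup.
have apre : a \notin pre.
  by move: u; rewrite cat_uniq => /and3P[_ /hasPn/(_ a)]; rewrite inE eqxx => /(_ isT).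
have Uaa : mcoeff a U = 1.
  rewrite /U mcoeffB mcoeffX eqxx raddf_sum big_seq big1 ?subr0//= => q qa.
  rewrite mcoeffZ; apply/eqP; rewrite mulf_eq0; apply/orP; right.
  by apply: contraNT apre; exact: sup.
have U0 : U != 0 by apply/eqP => U0; move: Uaa; rewrite U0 mcoeff0 => /eqP; rewrite eq_sym oner_eq0.
have UU : 0 < mf (U * U).
  apply: hankel_posdef_gt0 => //; apply: msize_supp => b /Ua; rewrite mem_rcons => ba.
  by rewrite ltnS; apply: dL; rewrite mem_cat inE; move: ba; rewrite inE => /orP[->|->]; rewrite ?orbT.
have [| | | |s1 s2 s3] := IH (rcons pre a) (rcons acc w).
- by rewrite cat_rcons.
- by rewrite cat_rcons.
- by rewrite !size_rcons sz.
- move=> q; rewrite mem_rcons inE => /orP[/eqP ->|qa] b.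
    by rewrite mcoeffZ mulf_eq0 negb_or => /andP[_]; exact: Ua.
  by move=> /(sup _ qa); rewrite mem_rcons inE => ->; rewrite orbT.
rewrite cat_rcons in s1 s3; set Q := gram_schmidt _ _ _ in s1 s2 s3 *.
have accQ : take (size acc) Q = acc.
  have := congr1 (take (size acc)) s2; rewrite take_takel ?size_rcons// => ->.
  by rewrite -cats1 take_size_cat.
split=> // i /andP[i1 i2]; move: i1; rewrite leq_eqVlt => /orP[/eqP <-|i1]; last first.
  by apply: s3; rewrite size_rcons i1.
pose c j := if (j < size acc)%N then mf (mpolyX R a * nth 0 acc j) else Num.sqrt (mf (U * U)).
exists c; rewrite big_ord_recr/= nth_cat ltnn subnn/= -sz {2}/c ltnn.
have -> : nth 0 Q (size acc) = w.
  by rewrite -(nth_take (n0 := size (rcons acc w))) ?size_rcons// -{1}(size_rcons acc w) s2 nth_rcons ltnn eqxx.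
rewrite /w scalerA mulfV ?scale1r ?gt_eqF ?sqrtr_gt0//.
rewrite (eq_bigr (fun j : 'I_(size acc) => mf (mpolyX R a * nth 0 acc j) *: nth 0 acc j)); last first.
  by move=> j _; rewrite /c ltn_ord -[in nth 0 Q j](cat_take_drop (size acc) Q) accQ nth_cat ltn_ord.
by rewrite /U (big_nth 0) big_mkord addrC subrK.
Qed.

Lemma mem_ordered_monomials a : (a \in ordered_monomials ch L) = (mdeg a <= L)%N.
Proof.
rewrite mem_sort; apply/mapP/idP => [[b _ ->]|aL]; first by rewrite -ltnS bmdeg.
have aL' : (mdeg a < L.+1)%N by [].
by exists (BMultinom aL') => //; rewrite mem_enum.
Qed.

Lemma uniq_ordered_monomials : uniq (ordered_monomials ch L).
Proof. by rewrite sort_uniq map_inj_uniq ?enum_uniq//; exact: val_inj. Qed.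

Lemma take_ordered_monomials a b : a \in ordered_monomials ch L ->
  b \in take (index a (ordered_monomials ch L)).+1 (ordered_monomials ch L) ->
  (mdeg b <= mdeg a)%N.
Proof.
set s := ordered_monomials ch L => sa bt.
have sb : b \in s by exact: mem_take bt.
have ib : (index b s <= index a s)%N by rewrite -ltnS index_ltn.
have ba : mord ch b a.
  rewrite -(nth_index mnm0 sa) -(nth_index mnm0 sb).
  apply: (sorted_leq_nth (@mord_trans _ ch)) => //; rewrite ?inE ?index_mem//.
  - by move=> x; have := mord_total ch x x; rewrite orbb.
  - by apply: sort_sorted; exact: mord_total.
rewrite leqNgt; apply/negP => ab.
have E : a = b by apply: (mord_anti (m := ch)); rewrite ba mord_graded.
by move: ab; rewrite E ltnn.
Qed.

(** As [basis_coef] is picked by [xget], it suffices to exhibit some coefficients. Gram-Schmidt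
    expands [a] over the basis elements of the monomials up to [a] in the order; since the order is
    graded, their degrees do not exceed that of [a]. *)
Lemma basis_coefP a : (mdeg a <= L)%N ->
  mpolyX R a = \sum_(b : bmultinom d (mdeg a).+1)
    basis_coef ch L mu a b *: orthobasis ch L mu b.
Proof.
move: a; rewrite /basis_coef.
match goal with |- context [xget ?x0 ?A] => apply: (@xgetPex _ x0 A) end => /=.
suff /choice[f fP] : forall a, exists c : multinom d -> R, (mdeg a <= L)%N ->
    mpolyX R a = \sum_(b : bmultinom d (mdeg a).+1) c b *: orthobasis ch L mu b.
  by exists f.
move=> a; have [aL|aL] := boolP (mdeg a <= L)%N; last by exists (fun=> 0).
pose s := ordered_monomials ch L.
have sa : a \in s by rewrite mem_ordered_monomials.
have [|//|//|//|/= s1 _ s3] := @gram_schmidt_spec s [::] [::].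
- exact: uniq_ordered_monomials.
- by move=> b; rewrite mem_ordered_monomials.
have [|c] := s3 (index a s); first by rewrite index_mem.
rewrite nth_index// => cE; set i := index a s in cE.
exists (fun b => if b \in take i.+1 s then c (index b s) else 0) => _.
rewrite cE (eq_bigr (fun b : bmultinom d (mdeg a).+1 => if (b : multinom d) \in take i.+1 s then
    c (index (b : multinom d) s) *: orthobasis ch L mu b else 0)); last first.
  by move=> b _; case: ifP => //; rewrite scale0r.
rewrite -big_mkcond/= -(@ssrcomplements.big_mksub _ _ _ _ _
   (bmultinom d (mdeg a).+1 : subFinType _) (fun b => c (index b s) *: orthobasis ch L mu b)).
- rewrite (big_nth mnm0) big_mkord size_takel ?index_mem//.
  apply: eq_bigr => j _; rewrite nth_take ?ltn_ord//.
  have js : (j < size s)%N by rewrite (leq_trans (ltn_ord j))// index_mem.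
  by rewrite /orthobasis -/s index_uniq//; exact: uniq_ordered_monomials.
- by rewrite take_uniq// uniq_ordered_monomials.
- by move=> b bt; rewrite ltnS; exact: take_ordered_monomials bt.
Qed.

(** Expanding the three factors in the orthonormal basis and using trilinearity recovers the
    functional on their product. The third factor has degree at most S <= L, so it has an expansion
    too. *)
Lemma approx_monomial_small g : (S <= L)%N -> (mdeg g <= 2 * L + S)%N ->
  approx_monomial ch L S mu g = mu g.
Proof.
move=> SL gL; rewrite /approx_monomial gL; have := dec3P ch gL.
case: (dec3 ch L S g) => [[g1 g2] g3] [gE [h1 h2 h3]].
rewrite -[RHS](moment_functionalX mu) gE !mpolyXD.
rewrite (basis_coefP h1) (basis_coefP h2) (basis_coefP (leq_trans h3 SL)).
rewrite big_distrlr/= mulr_suml moment_functional_sum; apply: eq_bigr => a _.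
rewrite mulr_suml moment_functional_sum; apply: eq_bigr => b _.
rewrite mulr_sumr moment_functional_sum; apply: eq_bigr => c _.
have E (x y z : R) (p q r : mpoly d R) : x *: p * (y *: q) * (z *: r) = (x * y * z) *: (p * q * r).
  by rewrite -!mul_mpolyC !mpolyCM; ring.
by rewrite E moment_functionalZ.
Qed.

End mrpc_algebra.

(** * One step of the scheme *)

Section lipschitz_measurable.
Context {R : realType} {d : nat}.

Lemma rat_approx (x : d.-tuple R) (e : R) : 0 < e ->
  exists q : d.-tuple rat, dist1 [tuple ratr (tnth q i) | i < d] x <= d%:R * e.
Proof.
move=> e0; have /choice[q hq] : forall i, exists q : rat, `|tnth x i - ratr q| <= e.
  move=> i; have [|q] := @rat_in_itvoo R (tnth x i - e) (tnth x i + e); first lra.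
  rewrite in_itv/= => /andP[h1 h2]; exists q; rewrite ler_norml; lra.
exists [tuple q i | i < d].
rewrite /dist1 mulr_natl -[d in _ *+ d]card_ord -sumr_const; apply: ler_sum => i _.
by rewrite !tnth_mktuple.
Qed.

(** The set {f > a} is the union, over the countably many rational points q, of the sets {x : a < f
    q - K |x - q|}: always f x >= f q - K |x - q|, with near equality for q close to x. *)
Lemma lipschitz_measurable (f : d.-tuple R -> R) (K : R) :
  (forall x y, `|f x - f y| <= K * dist1 y x) -> measurable_fun setT f.
Proof.
move=> fK mD; apply: (measurability _ (RGenOInfty.measurableE R)) => //.
move=> _ [_ [a ->] <-]; rewrite setTI.
pose pt (q : d.-tuple rat) : d.-tuple R := [tuple ratr (tnth q i) | i < d].
have -> : f @^-1` `]a, +oo[ =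
    \bigcup_(q : d.-tuple rat) [set x | a < f (pt q) - K * dist1 (pt q) x].
  apply/seteqP; split => x /=; rewrite in_itv/= andbT; last first.
    by move=> [q _ /=] h; have := fK x (pt q); rewrite ler_norml => /andP[]; lra.
  move=> ax; pose K1 : R := `|K| + 1; have K0 : 0 < K1 by rewrite /K1 ltr_pwDr.
  have dK : 0 < 2 * K1 * d.+1%:R by rewrite !mulr_gt0.
  pose e := (f x - a) / (2 * K1 * d.+1%:R) / 2.
  have e0 : 0 < e by rewrite !divr_gt0// subr_gt0.
  have [q hq] := rat_approx x e0; exists q => //=; rewrite -/(pt q) in hq *.
  have h := fK x (pt q); rewrite ler_norml in h; case/andP: h => _ h.
  have d0 : 0 <= dist1 (pt q) x by exact: dist1_ge0.
  have KK : K * dist1 (pt q) x <= K1 * dist1 (pt q) x.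
    by rewrite ler_wpM2r// /K1 (le_trans (ler_norm _))// lerDl.
  have h2 : K1 * dist1 (pt q) x <= K1 * (d%:R * e) by rewrite ler_wpM2l// ltW.
  have h3 : K1 * (d%:R * e) <= (f x - a) / 4.
    have -> : (f x - a) / 4 = K1 * (d.+1%:R * e).
      have D0 : (d.+1%:R : R) != 0 by rewrite pnatr_eq0.
      have E (A k D : R) : k != 0 -> D != 0 -> A / 4 = k * (D * (A / (2 * k * D) / 2)).
        by move=> k0 D1; field; rewrite ?k0 ?D1.
      by apply: E => //; rewrite gt_eqF.
    by rewrite ler_wpM2l ?(ltW K0)// ler_wpM2r ?(ltW e0)// ler_nat.
  lra.
apply: countable_bigcupT_measurable; first exact: countableP.
move=> q; rewrite -[X in measurable X]setTI.
have -> : [set x | a < f (pt q) - K * dist1 (pt q) x] =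
    (fun x => f (pt q) - K * dist1 (pt q) x) @^-1` `]a, +oo[.
  by apply/seteqP; split => x /=; rewrite in_itv/= andbT.
have mq : measurable_fun setT (fun x => f (pt q) - K * dist1 (pt q) x).
  by apply: measurable_funB => //; apply: measurable_funM => //; exact: measurable_dist1.
exact: mq.
Qed.

End lipschitz_measurable.

(** * Exponential functions of one step *)

Section euler_step.
Context {R : realType} {d m : nat}.
Implicit Types (x B : d.-tuple R) (A : 'M[R]_(d, m)) (u : m.-tuple R) (h s t : R).

Definition euler_step h B A x u : d.-tuple R :=
  [tuple tnth x i + tnth B i * h + (\sum_(j < m) A i j * tnth u j) * Num.sqrt h | i < d].

(** The sum of 2 cosh (t x_i): comparable with exp (t |x|), but its expectation under Gaussian noise
    is explicit. *)
Definition cosh_sum t x : R := \sum_(i < d) (expR (t * tnth x i) + expR (- (t * tnth x i))).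

Lemma cosh_sum_ge0 t x : 0 <= cosh_sum t x.
Proof. by rewrite sumr_ge0// => i _; rewrite addr_ge0 ?expR_ge0. Qed.

Lemma measurable_cosh_sum t : measurable_fun setT (cosh_sum t).
Proof.
apply: measurable_sum => i; apply: measurable_funD; apply: measurableT_comp => //.
  by apply: measurable_funM => //; exact: measurable_coord.
by apply: measurableT_comp => //; apply: measurable_funM => //; exact: measurable_coord.
Qed.

Lemma expR_norm_le_cosh_sum t x i : expR (t * `|tnth x i|) <= cosh_sum t x.
Proof.
rewrite /cosh_sum (bigD1 i)//= (@le_trans _ _ (expR (t * tnth x i) + expR (- (t * tnth x i))))//.
  case: (ger0P (tnth x i)) => _; first by rewrite lerDl expR_ge0.
  by rewrite mulrN lerDr expR_ge0.
by rewrite lerDl sumr_ge0// => j _; rewrite addr_ge0 ?expR_ge0.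
Qed.

Lemma norm1_le_max x : (0 < d)%N -> exists j, norm1 x <= d%:R * `|tnth x j|.
Proof.
move=> d0; pose j0 := Ordinal d0.
pose j := [arg max_(j > j0) `|tnth x j|]%O; exists j.
rewrite mulr_natl -[d in _ *+ d]card_ord -sumr_const; apply: ler_sum => i _.
by rewrite /j; case: arg_maxP => // k _; apply.
Qed.

Lemma expR_norm1_le t x : (0 < d)%N -> 0 <= t ->
  expR (t * norm1 x) <= cosh_sum (t * d%:R) x.
Proof.
move=> d0 t0; have [j hj] := norm1_le_max x d0.
apply: le_trans (expR_norm_le_cosh_sum _ _ j).
by rewrite ler_expR -mulrA ler_wpM2l.
Qed.

Lemma cosh_sum_mono s t x : 0 <= s <= t -> cosh_sum s x <= cosh_sum t x.
Proof.
move=> /andP[s0 st]; apply: ler_sum => i _.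
suff H (u v : R) : 0 <= u <= v -> expR u + expR (- u) <= expR v + expR (- v).
  case: (lerP 0 (tnth x i)) => xi.
    by apply: H; rewrite mulr_ge0//= ler_wpM2r.
  have := H (- (s * tnth x i)) (- (t * tnth x i)); rewrite !opprK.
  rewrite (addrC (expR (- _))) (addrC (expR (- (t * _)))) => HH; apply: HH.
  by rewrite -!mulrN mulr_ge0//= ?ler_wpM2r// oppr_ge0 ltW.
move=> /andP[u0 uv]; have := expR_gt0 u; have := expR_gt0 v.
rewrite !expRN; set a := expR u; set b := expR v => b0 a0.
have a1 : 1 <= a by rewrite -expR0 ler_expR.
have ab : a <= b by rewrite ler_expR.
rewrite -subr_ge0.
have -> : b + b^-1 - (a + a^-1) = (b - a) * (1 - (a * b)^-1).
  by field; rewrite (gt_eqF a0) (gt_eqF b0).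
have ab1 : 1 <= a * b by nra.
by rewrite mulr_ge0 ?subr_ge0// invf_le1//; lra.
Qed.

(* Convexity of exp, in a form which absorbs a drift of linear growth into an
   enlargement of the exponent. *)
Lemma expR_absorb (a b c : R) : 0 <= c ->
  expR (a + c * b) <= expR ((1 + c) * a) + c * expR ((1 + c) * b).
Proof.
move=> c0; have [ba|ab] := lerP b a.
  have h := expR_ge0 ((1 + c) * b).
  rewrite (@le_trans _ _ (expR ((1 + c) * a)))// ?lerDl ?mulr_ge0// ler_expR; nra.
pose v := c * (b - a); have v0 : 0 <= v by rewrite mulr_ge0// subr_ge0 ltW.
have E1 : expR (a + c * b) = expR ((1 + c) * a) * expR v.
  by rewrite -expRD; congr expR; rewrite /v; ring.
have h1 : expR v - 1 <= v * expR v.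
  have := expR_ge1Dx (- v); rewrite expRN => h.
  have e0 := expR_gt0 v; have : (1 - v) * expR v <= 1.
    by rewrite -ler_pdivlMr// div1r.
  lra.
have h2 : b - a <= expR (b - a) by have := expR_ge1Dx (b - a); lra.
have E2 : expR ((1 + c) * b) = expR ((1 + c) * a) * expR v * expR (b - a).
  by rewrite -!expRD; congr expR; rewrite /v; ring.
rewrite E1 E2; have := expR_gt0 ((1 + c) * a); set X := expR ((1 + c) * a) => X0.
have V0 := expR_gt0 v; set V := expR v in h1 V0 *; set W := expR (b - a) in h2 *.
have : X * (V - 1) <= X * (c * (W * V)).
  rewrite ler_wpM2l ?(ltW X0)// (le_trans h1)// /v -mulrA ler_wpM2l// ler_wpM2r// ltW//.
lra.
Qed.

(** The drift is bounded through the largest coordinate y by K (d y + 1). With c = h K d,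
    [expR_absorb] converts it into an exponent enlarged by the factor 1 + c and an additional term c
    G; both losses stay bounded over T / h steps. *)
Lemma cosh_sum_drift t h K x B (s : R) : (0 < d)%N -> 0 <= t -> 0 <= h -> 0 <= K ->
  (forall i, `|tnth B i| <= K * (norm1 x + 1)) ->
  \sum_(i < d) (expR (t * (tnth x i + tnth B i * h)) + expR (- (t * (tnth x i + tnth B i * h))))
  <= expR (t * h * K) * ((1 + 2 * d%:R * (h * K * d%:R)) * cosh_sum (t * (1 + h * K * d%:R)) x).
Proof.
move=> d0 t0 h0 K0 hB; have [j hj] := norm1_le_max x d0.
set c := h * K * d%:R; have c0 : 0 <= c by rewrite !mulr_ge0.
set G := cosh_sum _ x; set y := `|tnth x j| in hj.
have Gy : expR ((1 + c) * (t * y)) <= G.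
  by have := expR_norm_le_cosh_sum (t * (1 + c)) x j; rewrite -/y mulrCA mulrA.
have key (a : R) i : a <= t * `|tnth B i| * h -> forall u : R,
    expR (t * u + a) <= expR (t * h * K) * (expR ((1 + c) * (t * u)) + c * G).
  move=> ha u; have : expR (t * u + c * (t * y)) <= expR ((1 + c) * (t * u)) + c * G.
    by apply: (le_trans (expR_absorb _ _ c0)); rewrite lerD2l ler_wpM2l.
  move=> /(ler_wpM2l (expR_ge0 (t * h * K))); apply: le_trans.
  rewrite -expRD ler_expR; have th : 0 <= t * h by rewrite mulr_ge0.
  have h1 : t * `|tnth B i| * h <= t * h * (K * (d%:R * y + 1)).
    rewrite mulrAC ler_wpM2l// (le_trans (hB i))// ler_wpM2l// lerD2r//.
  have -> : t * h * K + (t * u + c * (t * y)) = t * u + t * h * (K * (d%:R * y + 1)).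
    by rewrite /c; ring.
  by rewrite lerD2l (le_trans ha).
have th i : `|t * (tnth B i * h)| = t * `|tnth B i| * h.
  by rewrite !normrM (ger0_norm t0) (ger0_norm h0) mulrA.
apply: (@le_trans _ _ (\sum_(i < d) expR (t * h * K) *
   (expR (t * (1 + c) * tnth x i) + expR (- (t * (1 + c) * tnth x i)) + 2 * c * G))).
  apply: ler_sum => i _.
  have -> : t * (tnth x i + tnth B i * h) = t * tnth x i + t * (tnth B i * h) by ring.
  rewrite opprD; have h1 := @key (t * (tnth B i * h)) i _ (tnth x i).
  have h2 := @key (- (t * (tnth B i * h))) i _ (- tnth x i).
  rewrite mulrN in h2.
  have -> : t * (1 + c) * tnth x i = (1 + c) * (t * tnth x i) by ring.
  rewrite mulrN in h2; move: h1 h2; rewrite -th => /(_ (ler_norm _)) h1.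
  rewrite -normrN => /(_ (ler_norm _)) h2.
  apply: (le_trans (lerD h1 h2)); rewrite -mulrDr ler_wpM2l ?expR_ge0//; lra.
rewrite -mulr_sumr ler_wpM2l ?expR_ge0// big_split/= -/(cosh_sum _ x) -/G sumr_const card_ord.
by rewrite -[_ *+ d]mulr_natl le_eqVlt; apply/orP; left; apply/eqP; ring.
Qed.

End euler_step.

(** * Taylor expansion of monomials *)

Section taylor.
Context {R : realType} {d : nat}.
Implicit Types (x y : d.-tuple R) (g : multinom d) (e : 'I_d -> R).

Definition mono_deriv i g x : R := meval (tnth x) (mderiv i (mpolyX R g)).

Definition mono_deriv2 i l g x : R :=
  meval (tnth x) (mderiv l (mderiv i (mpolyX R g))).

Definition mono_diff g x e : R := \sum_(i < d) mono_deriv i g x * e i.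

Definition mono_diff2 g x e : R :=
  2^-1 * \sum_(i < d) \sum_(l < d) mono_deriv2 i l g x * (e i * e l).

Lemma meval_mono g x : meval (tnth x) (mpolyX R g) = mono g x.
Proof. by rewrite mevalX. Qed.

Lemma mderivXU (i c : 'I_d) : mderiv i (mpolyX R (mnm1 c)) = mpolyC d (c == i)%:R.
Proof.
rewrite mderivX mnm1E; case: eqP => [->|_]; last by rewrite scale0r mpolyC0.
rewrite scale1r (_ : mnm_sub _ _ = mnm0) ?mpolyX0//.
by apply/mnmP => k; rewrite mnmBE subnn mnm0E.
Qed.

Lemma mono_derivU i c g x :
  mono_deriv i (mnm_add (mnm1 c) g) x =
  (c == i)%:R * mono g x + tnth x c * mono_deriv i g x.
Proof.
by rewrite /mono_deriv mpolyXD mderivM mderivXU mevalD !mevalM mevalC mevalXU meval_mono.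
Qed.

Lemma mono_deriv2U i l c g x :
  mono_deriv2 i l (mnm_add (mnm1 c) g) x =
  (c == i)%:R * mono_deriv l g x + (c == l)%:R * mono_deriv i g x
    + tnth x c * mono_deriv2 i l g x.
Proof.
rewrite /mono_deriv2 /mono_deriv mpolyXD mderivM mderivXU mderivD !mderivM mderivXU mderivC.
by rewrite !mevalD !mevalM !mevalC ?meval0 mul0r add0r mevalXU addrA.
Qed.

Lemma sum_delta c (f : 'I_d -> R) : \sum_(i < d) (c == i)%:R * f i = f c.
Proof.
rewrite (bigD1 c)//= eqxx mul1r big1 ?addr0// => i /negbTE.
by rewrite eq_sym => ->; rewrite mul0r.
Qed.

Lemma mono_diffU c g x e :
  mono_diff (mnm_add (mnm1 c) g) x e = tnth x c * mono_diff g x e + e c * mono g x.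
Proof.
rewrite /mono_diff mulr_sumr -(sum_delta c (fun i => e i * mono g x)) -big_split/=.
by apply: eq_bigr => i _; rewrite mono_derivU; ring.
Qed.

Lemma mono_diff2U c g x e :
  mono_diff2 (mnm_add (mnm1 c) g) x e = tnth x c * mono_diff2 g x e + e c * mono_diff g x e.
Proof.
rewrite /mono_diff2.
transitivity (2^-1 * ((\sum_(i < d) \sum_(l < d) (c == i)%:R * (mono_deriv l g x * (e i * e l))) +
   (\sum_(i < d) \sum_(l < d) (c == l)%:R * (mono_deriv i g x * (e i * e l))) +
   tnth x c * \sum_(i < d) \sum_(l < d) mono_deriv2 i l g x * (e i * e l))).
  congr (_ * _); rewrite mulr_sumr -!big_split/=; apply: eq_bigr => i _.
  rewrite mulr_sumr -!big_split/=; apply: eq_bigr => l _.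
  by rewrite mono_deriv2U; ring.
rewrite exchange_big/=.
under eq_bigr do rewrite sum_delta.
under [X in _ + X + _]eq_bigr do rewrite sum_delta.
rewrite (eq_bigr (fun j => e c * (mono_deriv j g x * e j))); last by move=> j _; ring.
rewrite [X in _ + X + _](eq_bigr (fun j => e c * (mono_deriv j g x * e j))); last by move=> j _; ring.
rewrite -!mulr_sumr -/(mono_diff g x e); by field.
Qed.

(** Induction on [g], one coordinate factor at a time, by the product rules above. The constants n,
    n^2 and n^3 are reproduced by the induction because (n + 1)^k exceeds n^k by at least
    n^(k-1). *)
Lemma mono_taylor g x y e (D Y : R) : 0 <= D -> 1 <= Y ->
  (forall i, `|tnth x i| + D <= Y) -> (forall i, `|e i| <= D) ->
  (forall i, tnth y i = tnth x i + e i) ->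
  [/\ `|mono g x| <= Y ^+ mdeg g,
      `|mono_diff g x e| <= (mdeg g)%:R * D * Y ^+ mdeg g,
      `|mono_diff2 g x e| <= (mdeg g)%:R ^+ 2 * D ^+ 2 * Y ^+ mdeg g
    & `|mono g y - mono g x - mono_diff g x e - mono_diff2 g x e| <=
      (mdeg g)%:R ^+ 3 * D ^+ 3 * Y ^+ mdeg g].
Proof.
move=> D0 Y1 xY eD yE; have Y0 : 0 <= Y by lra.
elim/(@mnm_induction d): g => [|c g [h1 h2 h3 h4]].
  have z1 : mono_diff mnm0 x e = 0.
    by rewrite /mono_diff big1// => i _; rewrite /mono_deriv mpolyX0 mderivC ?meval0 mul0r.
  have z2 : mono_diff2 mnm0 x e = 0.
    rewrite /mono_diff2 big1 ?mulr0// => i _; rewrite big1// => l _.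
    by rewrite /mono_deriv2 mpolyX0 mderivC mderiv0 ?meval0 mul0r.
  rewrite z1 z2 !mono0 mdeg0 !subr0 subrr normr0 normr1 expr0.
  by split; rewrite ?expr0n ?mul0r ?mulr0.
rewrite mono_diffU mono_diff2U !monoD !mono1 mdegD mdeg1 yE add1n -natr1 exprS.
set n : R := (mdeg g)%:R in h2 h3 h4 *; have n0 : 0 <= n by rewrite ler0n.
set V := Y ^+ mdeg g in h1 h2 h3 h4 *; have V0 : 0 <= V by rewrite exprn_ge0.
have xc : `|tnth x c| <= Y by have := xY c; lra.
have xe : `|tnth x c + e c| <= Y.
  by apply: (le_trans (ler_normD _ _)); have := xY c; have := eD c; lra.
have DcY : D <= Y by have := xY c; have := normr_ge0 (tnth x c); lra.
have ec := eD c.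
have VV : D * V <= Y * V by rewrite ler_wpM2r.
have DD (k : R) : 0 <= k -> k * (D * V) <= k * (Y * V) by move=> k0; rewrite ler_wpM2l.
have M (a b s t : R) : `|a| <= s -> `|b| <= t -> `|a * b| <= s * t.
  by move=> *; rewrite normrM ler_pM.
have n2 : 0 <= n ^+ 2 by rewrite exprn_ge0.
have D2 : 0 <= D ^+ 2 by rewrite exprn_ge0.
have YV : 0 <= Y * V by rewrite mulr_ge0.
have VYV : V <= Y * V by rewrite ler_peMl.
split.
- exact: M.
- apply: (le_trans (ler_normD _ _)); apply: (le_trans (lerD (M _ _ _ _ xc h2) (M _ _ _ _ ec h1))).
  have : D * V <= D * (Y * V) by rewrite ler_wpM2l.
  have -> : Y * (n * D * V) = n * D * (Y * V) by ring.
  lra.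
- apply: (le_trans (ler_normD _ _)); apply: (le_trans (lerD (M _ _ _ _ xc h3) (M _ _ _ _ ec h2))).
  have : n * D ^+ 2 * V <= n * D ^+ 2 * (Y * V) by rewrite ler_wpM2l// mulr_ge0.
  have -> : Y * (n ^+ 2 * D ^+ 2 * V) = n ^+ 2 * D ^+ 2 * (Y * V) by ring.
  have -> : D * (n * D * V) = n * D ^+ 2 * V by ring.
  have : 0 <= n * D ^+ 2 * (Y * V) by rewrite !mulr_ge0.
  have : 0 <= D ^+ 2 * (Y * V) by rewrite mulr_ge0.
  have -> : (n + 1) ^+ 2 * D ^+ 2 * (Y * V) = n ^+ 2 * D ^+ 2 * (Y * V) +
     2 * (n * D ^+ 2 * (Y * V)) + D ^+ 2 * (Y * V) by ring.
  lra.
- have -> : (tnth x c + e c) * mono g y - tnth x c * mono g x -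
      (tnth x c * mono_diff g x e + e c * mono g x) -
      (tnth x c * mono_diff2 g x e + e c * mono_diff g x e) =
    (tnth x c + e c) * (mono g y - mono g x - mono_diff g x e - mono_diff2 g x e) +
      e c * mono_diff2 g x e by ring.
  apply: (le_trans (ler_normD _ _)); apply: (le_trans (lerD (M _ _ _ _ xe h4) (M _ _ _ _ ec h3))).
  have D3 : 0 <= D ^+ 3 by rewrite exprn_ge0.
  have : n ^+ 2 * D ^+ 3 * V <= n ^+ 2 * D ^+ 3 * (Y * V) by rewrite ler_wpM2l// mulr_ge0.
  have -> : Y * (n ^+ 3 * D ^+ 3 * V) = n ^+ 3 * D ^+ 3 * (Y * V) by ring.
  have -> : D * (n ^+ 2 * D ^+ 2 * V) = n ^+ 2 * D ^+ 3 * V by ring.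
  have : 0 <= n ^+ 2 * D ^+ 3 * (Y * V) by rewrite !mulr_ge0.
  have : 0 <= n * D ^+ 3 * (Y * V) by rewrite !mulr_ge0.
  have : 0 <= D ^+ 3 * (Y * V) by rewrite mulr_ge0.
  have -> : (n + 1) ^+ 3 * D ^+ 3 * (Y * V) = n ^+ 3 * D ^+ 3 * (Y * V) +
     3 * (n ^+ 2 * D ^+ 3 * (Y * V)) + 3 * (n * D ^+ 3 * (Y * V)) + D ^+ 3 * (Y * V) by ring.
  lra.
Qed.

End taylor.

Section gauss_moments.
Context {R : realType} {dO} {Omega : measurableType dO} {m : nat}.
Variables (P : probability Omega R) (Z : {RV P >-> m.-tuple R}).
Hypothesis gZ : standard_gaussian Z.
Implicit Types (c a : 'I_m -> R) (t : R).

Lemma gauss_mgf_scaled c t : (\int[P]_w (expR (t * lin c (Z w)))%:E =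
  (expR (t ^+ 2 * (\sum_j c j ^+ 2) / 2))%:E)%E.
Proof.
have -> : (fun w => (expR (t * lin c (Z w)))%:E) = fun w => (expR (lin (fun j => t * c j) (Z w)))%:E.
  apply/funext => w; congr (expR _)%:E; rewrite /lin mulr_sumr.
  by apply: eq_bigr => j _; rewrite mulrA.
rewrite gauss_mgf//; congr (expR _)%:E; congr (_ / _).
by rewrite mulr_sumr; apply: eq_bigr => j _; rewrite exprMn.
Qed.

Lemma measurable_lin_RV c : measurable_fun setT (fun w => lin c (Z w)).
Proof. by apply: (measurableT_comp (measurable_lin c)); exact: measurable_funP. Qed.

Lemma gauss_exp c t : intg P (fun w => expR (t * lin c (Z w))) /\
  \int[P]_w expR (t * lin c (Z w)) = expR (t ^+ 2 * (\sum_j c j ^+ 2) / 2).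
Proof.
have h := mgf_intg (measurable_lin_RV c) (gauss_mgf_scaled c).
by split; [exact: h|exact: (mgf_exp (gauss_mgf_scaled c))].
Qed.

Lemma gauss_exp_abs c t : 0 <= t -> intg P (fun w => expR (t * `|lin c (Z w)|)) /\
  \int[P]_w expR (t * `|lin c (Z w)|) <= 2 * expR (t ^+ 2 * (\sum_j c j ^+ 2) / 2).
Proof.
move=> t0; split.
  exact: (mgf_intg_abs (measurable_lin_RV c) (gauss_mgf_scaled c)).
exact: (mgf_abs_le (measurable_lin_RV c) (gauss_mgf_scaled c)).
Qed.

Lemma sum_sqr_ge0 c : 0 <= \sum_j c j ^+ 2.
Proof. by rewrite sumr_ge0// => j _; exact: sqr_ge0. Qed.

Lemma gauss_mean c : intg P (fun w => lin c (Z w)) /\ \int[P]_w lin c (Z w) = 0.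
Proof.
split; first exact: (mgf_intg1 (measurable_lin_RV c) (gauss_mgf_scaled c)).
exact: (mgf_mean0 (measurable_lin_RV c) (sum_sqr_ge0 c) (gauss_mgf_scaled c)).
Qed.

Lemma gauss_var c : intg P (fun w => lin c (Z w) ^+ 2) /\
  \int[P]_w (lin c (Z w) ^+ 2) = \sum_j c j ^+ 2.
Proof.
split; first exact: (mgf_intg_pow (measurable_lin_RV c) (gauss_mgf_scaled c)).
exact: (mgf_var (measurable_lin_RV c) (sum_sqr_ge0 c) (gauss_mgf_scaled c)).
Qed.

Lemma gauss_cov c a : intg P (fun w => lin c (Z w) * lin a (Z w)) /\
  \int[P]_w (lin c (Z w) * lin a (Z w)) = \sum_j c j * a j.
Proof.
have E : (fun w => lin c (Z w) * lin a (Z w)) = fun w =>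
    2^-1 * (lin (fun j => c j + a j) (Z w) ^+ 2 - (lin c (Z w) ^+ 2 + lin a (Z w) ^+ 2)).
  apply/funext => w.
  have -> : lin (fun j => c j + a j) (Z w) = lin c (Z w) + lin a (Z w).
    by rewrite /lin -big_split; apply: eq_bigr => j _; rewrite mulrDl.
  by field.
have [i1 e1] := gauss_var (fun j => c j + a j).
have [i2 e2] := gauss_var c; have [i3 e3] := gauss_var a.
have i4 := intgD i2 i3; have i5 := intgB i1 i4.
rewrite E; split; first exact: intgZ.
rewrite RintegralZl// RintegralB// RintegralD// e1 e2 e3 -big_split -sumrB mulr_sumr/=.
by apply: eq_bigr => j _; field.
Qed.

End gauss_moments.

Lemma fact_le_exp n W : (n <= W)%N -> (n`! <= W ^ n)%N.
Proof.
elim: n => // n IH nW; rewrite factS expnS leq_mul//; exact: (IH (ltnW nW)).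
Qed.

(** n! <= W^n gives the weight W^n with a constant independent of n; this is how moments enter the
    weighted norm. *)
Lemma pow_le_expR (R : realType) (t : R) n W : 0 <= t -> (n <= W)%N ->
  t ^+ n <= W%:R ^+ n * expR t.
Proof.
move=> t0 nW; apply: (le_trans (exprn_fact_expR n t0)).
by rewrite ler_wpM2r ?expR_ge0// -natrX ler_nat fact_le_exp.
Qed.

(** * One step from a fixed point *)

Section inner_step.
Context {R : realType} {dO} {Omega : measurableType dO} {d m : nat}.
Variables (P : probability Omega R) (Z : {RV P >-> m.-tuple R}).
Hypothesis gZ : standard_gaussian Z.
Variables (h K : R) (x B : d.-tuple R) (A : 'M[R]_(d, m)).
Hypotheses (d0 : (0 < d)%N) (h0 : 0 < h) (h1 : h <= 1) (K0 : 0 <= K).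
Hypothesis hB : forall i, `|tnth B i| <= K * (norm1 x + 1).
Hypothesis hA : forall i, \sum_j A i j ^+ 2 <= K ^+ 2.

Let y w := euler_step h B A x (Z w).
Let u i w := lin (A i) (Z w).

Let yE w i : tnth (y w) i = tnth x i + (tnth B i * h + u i w * Num.sqrt h).
Proof. by rewrite tnth_mktuple -addrA. Qed.

Lemma euler_coord_exp i s : intg P (fun w => expR (s * tnth (y w) i)) /\
  \int[P]_w expR (s * tnth (y w) i) =
  expR (s * (tnth x i + tnth B i * h)) * expR (s ^+ 2 * h * (\sum_j A i j ^+ 2) / 2).
Proof.
have E : (fun w => expR (s * tnth (y w) i)) = fun w =>
    expR (s * (tnth x i + tnth B i * h)) * expR (s * Num.sqrt h * u i w).
  by apply/funext => w; rewrite -expRD yE; congr expR; ring.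
have [i1 e1] := gauss_exp gZ (A i) (s * Num.sqrt h).
rewrite E; split; first exact: intgZ.
by rewrite RintegralZl// e1 exprMn sqr_sqrtr// ltW.
Qed.

(** The Gaussian factor is exact and the drift is [cosh_sum_drift]. Bounding its two losses of the
    form 1 + O(h) by exponentials makes the estimate compose over many steps. *)
Lemma cosh_sum_inner t : 0 <= t -> intg P (fun w => cosh_sum t (y w)) /\
  \int[P]_w cosh_sum t (y w) <=
  expR (h * (t ^+ 2 * K ^+ 2 / 2 + t * K + 2 * d%:R ^+ 2 * K)) *
    cosh_sum (t * expR (h * K * d%:R)) x.
Proof.
move=> t0; have I i : intg P (fun w => expR (t * tnth (y w) i) + expR (- (t * tnth (y w) i))).
  apply: intgD; first by have [] := euler_coord_exp i t.
  by have [] := euler_coord_exp i (- t); under eq_fun do rewrite mulNr.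
split; first by apply: intg_sum => i _.
rewrite /cosh_sum Rexp_sum//.
have E i : \int[P]_w (expR (t * tnth (y w) i) + expR (- (t * tnth (y w) i))) <=
    expR (h * (t ^+ 2 * K ^+ 2 / 2)) *
    (expR (t * (tnth x i + tnth B i * h)) + expR (- (t * (tnth x i + tnth B i * h)))).
  have [i1 e1] := euler_coord_exp i t; have [i2 e2] := euler_coord_exp i (- t).
  have EN : (fun w => expR (- (t * tnth (y w) i))) = fun w => expR (- t * tnth (y w) i).
    by apply/funext => w; rewrite mulNr.
  rewrite RintegralD//; last by rewrite EN.
  rewrite EN e1 e2 sqrrN mulNr -mulrDl mulrC ler_wpM2r ?addr_ge0 ?expR_ge0// ler_expR.
  have -> : h * (t ^+ 2 * K ^+ 2 / 2) = t ^+ 2 * h * K ^+ 2 / 2 by ring.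
  by rewrite ler_wpM2r// ler_wpM2l// mulr_ge0 ?sqr_ge0// ltW.
apply: (le_trans (ler_sum _ (fun i _ => E i))); rewrite -mulr_sumr.
apply: (@le_trans _ _ (expR (h * (t ^+ 2 * K ^+ 2 / 2)) * (expR (t * h * K) *
   ((1 + 2 * d%:R * (h * K * d%:R)) * cosh_sum (t * (1 + h * K * d%:R)) x)))).
  by rewrite ler_wpM2l ?expR_ge0// cosh_sum_drift// ltW.
have c0 : 0 <= h * K * d%:R by rewrite !mulr_ge0// ltW.
have -> : expR (h * (t ^+ 2 * K ^+ 2 / 2 + t * K + 2 * d%:R ^+ 2 * K)) =
   expR (h * (t ^+ 2 * K ^+ 2 / 2)) * expR (t * h * K) * expR (2 * d%:R * (h * K * d%:R)).
  by rewrite -!expRD; congr expR; ring.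
rewrite -!mulrA !ler_wpM2l ?expR_ge0// ler_pM ?cosh_sum_ge0 ?expR_ge1Dx//.
  by rewrite addr_ge0// !mulr_ge0// ltW.
apply: cosh_sum_mono; rewrite mulr_ge0 ?addr_ge0 ?mulr_ge0//= ?(ltW h0)//.
by rewrite ler_wpM2l ?expR_ge1Dx.
Qed.

(** [Y0], plus the sum [U] of the absolute values of the noise terms, bounds the coordinates before
    and after the step and is at least 1, as [mono_taylor] requires. *)
Let Y0 := 1 + norm1 x + K * (norm1 x + 1).
Let U w := \sum_i `|u i w|.

Let N0 : 0 <= norm1 x. Proof. exact: norm1_ge0. Qed.
Let Y00 : 1 <= Y0. Proof. by rewrite /Y0 -addrA lerDl addr_ge0 ?mulr_ge0 ?addr_ge0. Qed.

Let U_exp : intg P (fun w => expR (2 * U w)) /\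
  \int[P]_w expR (2 * U w) <= 2 * d%:R * expR (2 * d%:R ^+ 2 * K ^+ 2).
Proof.
have I i : intg P (fun w => expR (2 * d%:R * `|u i w|)) /\
    \int[P]_w expR (2 * d%:R * `|u i w|) <= 2 * expR (2 * d%:R ^+ 2 * K ^+ 2).
  have t0 : 0 <= 2 * d%:R :> R by rewrite mulr_ge0.
  have [i1 e1] := gauss_exp_abs gZ (A i) t0; split => //; apply: (le_trans e1).
  rewrite ler_wpM2l// ler_expR ler_pdivrMr//.
  have -> : 2 * d%:R ^+ 2 * K ^+ 2 * 2 = (2 * d%:R) ^+ 2 * K ^+ 2 :> R by ring.
  by rewrite ler_wpM2l// exprn_ge0.
have mu i : measurable_fun setT (u i) by exact: measurable_lin_RV.
have mU : measurable_fun setT (fun w => expR (2 * U w)).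
  apply: measurableT_comp => //; apply: measurable_funM => //.
  by apply: measurable_sum => i; exact: measurableT_comp.
have le w : expR (2 * U w) <= \sum_i expR (2 * d%:R * `|u i w|).
  have [j] := norm1_le_max [tuple u i w | i < d] d0.
  rewrite tnth_mktuple /norm1 => hj.
  have {}hj : U w <= d%:R * `|u j w|.
    by rewrite (le_trans _ hj)// /U le_eqVlt; apply/orP; left; apply/eqP; apply: eq_bigr => i _; rewrite tnth_mktuple.
  apply: (@le_trans _ _ (expR (2 * d%:R * `|u j w|))).
    by rewrite ler_expR -mulrA ler_wpM2l.
  by rewrite (bigD1 j)//= lerDl sumr_ge0// => i _; exact: expR_ge0.
have IS : intg P (fun w => \sum_i expR (2 * d%:R * `|u i w|)).
  by apply: intg_sum => i _; have [] := I i.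
have IU : intg P (fun w => expR (2 * U w)).
  by apply: (intg_le mU _ IS) => w; rewrite ger0_norm ?expR_ge0.
split=> //; apply: (le_trans (Rexp_le IU IS le)).
rewrite Rexp_sum; last by move=> i _; have [] := I i.
apply: (@le_trans _ _ (\sum_(i < d) (2 * expR (2 * d%:R ^+ 2 * K ^+ 2)))).
  by apply: ler_sum => i _; have [] := I i.
by rewrite sumr_const card_ord -mulr_natl le_eqVlt; apply/orP; left; apply/eqP; ring.
Qed.

Let measurable_coord_step i : measurable_fun setT (fun w => tnth (y w) i).
Proof.
rewrite (_ : (fun w => _) = fun w => tnth x i + (tnth B i * h + u i w * Num.sqrt h)).
  apply: measurable_funD => //; apply: measurable_funD => //; apply: measurable_funM => //.
  exact: measurable_lin_RV.
by apply/funext => w; exact: yE.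
Qed.

(** The first and second moments of the increment produce h times the generator, apart from products
    of drifts of order h^2; the cubic remainder is of order h^(3/2), increments being of order sqrt
    h. Powers of the increment and of the state are paid by exp (2 Y), whose expectation is
    controlled by [U_exp]. The constants 12 and 2 come from 3! and 2!. *)
Lemma euler_mono_inner g W : (0 < W)%N -> (mdeg g <= W)%N ->
  intg P (fun w => mono g (y w)) /\
  `|\int[P]_w mono g (y w) - (mono g x +
     h * (\sum_i mono_deriv i g x * tnth B i +
          2^-1 * \sum_i \sum_l mono_deriv2 i l g x * (A *m A^T) i l))| <=
  W%:R ^+ (mdeg g + 3) * (h * Num.sqrt h) *
   (expR (2 * (1 + K)) * (12 * d%:R * expR (2 * d%:R ^+ 2 * K ^+ 2) + 2) *
    expR (2 * (1 + K) * norm1 x)).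
Proof.
move=> W0 gW; set n := mdeg g in gW *.
pose e w (i : 'I_d) := tnth B i * h + u i w * Num.sqrt h.
pose D w := Num.sqrt h * (K * (norm1 x + 1) + U w).
pose Y w := Y0 + U w.
have sh0 : 0 <= Num.sqrt h by exact: sqrtr_ge0.
have sh1 : Num.sqrt h <= 1 by rewrite -sqrtr1 ler_wsqrtr.
have hh : h = Num.sqrt h * Num.sqrt h by rewrite -expr2 sqr_sqrtr// ltW.
have hsh : h <= Num.sqrt h by rewrite {1}hh ler_piMl.
have K1 : 0 <= K * (norm1 x + 1) by rewrite mulr_ge0 ?addr_ge0.
have U0 w : 0 <= U w by rewrite sumr_ge0.
have uU w i : `|u i w| <= U w by rewrite /U (bigD1 i)//= lerDl sumr_ge0.
have xN i : `|tnth x i| <= norm1 x by rewrite /norm1 (bigD1 i)//= lerDl sumr_ge0.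
have Y1 w : 1 <= Y w by rewrite /Y -[1]addr0 lerD.
have D00 w : 0 <= D w by rewrite /D mulr_ge0// addr_ge0.
have DU w : D w <= K * (norm1 x + 1) + U w by rewrite /D ler_piMl// addr_ge0.
have T w := @mono_taylor R d g x (y w) (e w) (D w) (Y w) (D00 w) (Y1 w).
have {}T w : `|mono g (y w) - mono g x - mono_diff g x (e w) - mono_diff2 g x (e w)| <=
    n%:R ^+ 3 * D w ^+ 3 * Y w ^+ n /\ `|mono g (y w)| <= Y w ^+ n.
  split; last first.
    apply: mono_bound => i; rewrite yE (le_trans (ler_normD _ _))//.
    have := xN i; suff : `|e w i| <= D w by have := DU w; rewrite /Y /Y0; lra.
    rewrite (le_trans (ler_normD _ _))// !normrM (gtr0_norm h0) (ger0_norm sh0).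
    rewrite /D mulrDr lerD//; last by rewrite mulrC ler_wpM2l.
    by rewrite mulrC ler_pM// ltW.
  have [|||//] := T w.
  - by move=> i; have := xN i; have := DU w; rewrite /Y /Y0; lra.
  - move=> i; rewrite (le_trans (ler_normD _ _))// !normrM (gtr0_norm h0) (ger0_norm sh0).
    rewrite /D mulrDr lerD//; last by rewrite mulrC ler_wpM2l.
    by rewrite mulrC ler_pM// ltW.
  - by move=> i; rewrite yE.
have [IU EU] := U_exp.
have E2Y w : expR (2 * Y w) = expR (2 * Y0) * expR (2 * U w).
  by rewrite -expRD; congr expR; rewrite /Y; ring.
have I2Y : intg P (fun w => expR (2 * Y w)).
  by under eq_fun do rewrite E2Y; exact: intgZ.
have mY w : Y w ^+ n <= W%:R ^+ n * expR (Y w).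
  by apply: pow_le_expR => //; have := Y1 w; lra.
have W1 : 1 <= W%:R :> R by rewrite ler1n.
have Wn k : 0 <= W%:R ^+ k :> R by rewrite exprn_ge0.
have nW3 k : n%:R ^+ k <= W%:R ^+ k :> R by rewrite lerXn2r ?nnegrE// ler_nat.
have mg : measurable_fun setT (fun w => mono g (y w)).
  by apply: measurable_prod => i _; apply: measurable_funX; exact: measurable_coord_step.
have Ig : intg P (fun w => mono g (y w)).
  apply: (intg_le mg _ (intgZ (W%:R ^+ n) I2Y)) => w.
  have [_ Tw] := T w; apply: (le_trans Tw); apply: (le_trans (mY w)).
  by rewrite ler_wpM2l// ler_expR; have := Y1 w; lra.
split=> //.
have Iu i : intg P (u i) by have [] := gauss_mean gZ (A i).
have Eu i : \int[P]_w u i w = 0 by have [] := gauss_mean gZ (A i).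
have Ie i : intg P (fun w => e w i).
  apply: intgD; first exact: intg_cst.
  by rewrite /e; under eq_fun do rewrite mulrC; apply: intgZ.
have Ee i : \int[P]_w e w i = tnth B i * h.
  rewrite RintegralD//; last 2 first.
  - exact: intg_cst.
  - by under eq_fun do rewrite mulrC; apply: intgZ.
  by rewrite Rexp_cst RintegralZr// Eu mul0r addr0.
have eeE i l : (fun w => e w i * e w l) = fun w => tnth B i * tnth B l * h ^+ 2 +
    (tnth B i * h * Num.sqrt h * u l w + (tnth B l * h * Num.sqrt h * u i w +
     h * (u i w * u l w))).
  apply/funext => w; have -> : h * (u i w * u l w) = Num.sqrt h * Num.sqrt h * (u i w * u l w).
    by rewrite -hh.
  by rewrite /e; ring.
have Iuu i l : intg P (fun w => u i w * u l w) by have [] := gauss_cov gZ (A i) (A l).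
have Euu i l : \int[P]_w (u i w * u l w) = (A *m A^T) i l.
  have [_ ->] := gauss_cov gZ (A i) (A l).
  by rewrite !mxE; apply: eq_bigr => j _; rewrite mxE.
have Iee i l : intg P (fun w => e w i * e w l).
  by rewrite eeE; do ![apply: intgD|apply: intg_cst|apply: intgZ|exact: Iu|exact: Iuu].
have Eee i l : \int[P]_w (e w i * e w l) = tnth B i * tnth B l * h ^+ 2 + h * (A *m A^T) i l.
  rewrite eeE RintegralD//; last 2 first.
  - exact: intg_cst.
  - by do ![apply: intgD|apply: intgZ|exact: Iu|exact: Iuu].
  rewrite RintegralD//; last 2 first.
  - by apply: intgZ.
  - by do ![apply: intgD|apply: intgZ|exact: Iu|exact: Iuu].
  rewrite RintegralD//; last 2 first.
  - by apply: intgZ.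
  - by apply: intgZ.
  by rewrite Rexp_cst !RintegralZl// !Eu Euu !mulr0 !add0r.
have ID1 : intg P (fun w => mono_diff g x (e w)).
  by apply: intg_sum => i _; apply: intgZ.
have ED1 : \int[P]_w mono_diff g x (e w) = h * \sum_i mono_deriv i g x * tnth B i.
  rewrite /mono_diff Rexp_sum; last by move=> i _; apply: intgZ.
  by rewrite mulr_sumr; apply: eq_bigr => i _; rewrite RintegralZl// Ee; ring.
have ID2 : intg P (fun w => mono_diff2 g x (e w)).
  by apply: intgZ; apply: intg_sum => i _; apply: intg_sum => l _; apply: intgZ.
(* The second moments of the increment are h A A^T plus the products of the drifts; the latter form
   the correction estimated in [B2]. *)
have ED2 : \int[P]_w mono_diff2 g x (e w) =
    mono_diff2 g x (fun i => tnth B i * h) +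
    h * (2^-1 * \sum_i \sum_l mono_deriv2 i l g x * (A *m A^T) i l).
  rewrite /mono_diff2 RintegralZl//; last first.
    by apply: intg_sum => i _; apply: intg_sum => l _; apply: intgZ.
  rewrite Rexp_sum; last by move=> i _; apply: intg_sum => l _; apply: intgZ.
  rewrite mulrCA -mulrDr; congr (_ * _); rewrite mulr_sumr -big_split; apply: eq_bigr => i _ /=.
  rewrite Rexp_sum; last by move=> l _; apply: intgZ.
  rewrite mulr_sumr -big_split; apply: eq_bigr => l _ /=.
  by rewrite RintegralZl// Eee; ring.
have I1 := intgB Ig (intg_cst P (mono g x)).
have I2 := intgB I1 ID1; have I3 := intgB I2 ID2.
have EI : \int[P]_w (mono g (y w) - mono g x - mono_diff g x (e w) - mono_diff2 g x (e w)) =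
    \int[P]_w mono g (y w) - (mono g x +
     h * (\sum_i mono_deriv i g x * tnth B i +
          2^-1 * \sum_i \sum_l mono_deriv2 i l g x * (A *m A^T) i l)) -
    mono_diff2 g x (fun i => tnth B i * h).
  rewrite RintegralB// RintegralB// RintegralB//; last exact: intg_cst.
  by rewrite Rexp_cst ED1 ED2; ring.
set G := \int[P]_w mono g (y w) - _ in EI *.
have Wexp : W%:R ^+ (n + 3) = W%:R ^+ 3 * W%:R ^+ n :> R by rewrite addnC exprD.
have B1 : `|\int[P]_w (mono g (y w) - mono g x - mono_diff g x (e w) - mono_diff2 g x (e w))| <=
    W%:R ^+ (n + 3) * (h * Num.sqrt h) * 6 * (expR (2 * Y0) *
      (2 * d%:R * expR (2 * d%:R ^+ 2 * K ^+ 2))).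
  apply: (@le_trans _ _ (\int[P]_w (W%:R ^+ (n + 3) * (h * Num.sqrt h) * 6 * expR (2 * Y w)))).
    apply: Rexp_abs_le => //; first exact: intgZ.
    move=> w; have [Tw _] := T w; apply: (le_trans Tw).
    have D3 : D w ^+ 3 <= h * Num.sqrt h * (6 * expR (Y w)).
      rewrite /D exprMn {1}[_ ^+ 3]exprSr -{1}[_ ^+ 2]/(_ * _) -hh ler_wpM2l ?mulr_ge0// ?(ltW h0)//.
      apply: (@le_trans _ _ (Y w ^+ 3)).
        apply: lerXn2r; rewrite ?nnegrE; first by rewrite addr_ge0.
          by have := Y1 w; lra.
        by rewrite /Y /Y0; have := N0; lra.
      by have := @exprn_fact_expR R (Y w) 3; apply; have := Y1 w; lra.
    have -> : W%:R ^+ (n + 3) * (h * Num.sqrt h) * 6 * expR (2 * Y w) =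
       W%:R ^+ 3 * (h * Num.sqrt h * (6 * expR (Y w))) * (W%:R ^+ n * expR (Y w)).
      by rewrite Wexp (_ : 2 * Y w = Y w + Y w) ?expRD; ring.
    have Yw0 : 0 <= Y w by have := Y1 w; lra.
    apply: ler_pM => //; [by rewrite mulr_ge0 ?exprn_ge0|by rewrite exprn_ge0|].
    by apply: ler_pM; rewrite ?exprn_ge0.
  rewrite RintegralZl//; under eq_Rintegral do rewrite E2Y.
  rewrite RintegralZl// !ler_wpM2l ?expR_ge0// !mulr_ge0 ?exprn_ge0 ?(ltW h0)//.
have B2 : `|mono_diff2 g x (fun i => tnth B i * h)| <=
    W%:R ^+ (n + 3) * (h * Num.sqrt h) * 2 * expR (2 * Y0).
  pose D0 := h * (K * (norm1 x + 1)).
  have D0' : 0 <= D0 by rewrite /D0 mulr_ge0// ltW.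
  have D0Y : D0 <= K * (norm1 x + 1) by rewrite /D0 ler_piMl.
  have [||//|_ _ + _] := @mono_taylor R d g x [tuple tnth x i + tnth B i * h | i < d]
    (fun i => tnth B i * h) D0 Y0 D0' Y00.
  - by move=> i; have := xN i; rewrite /Y0; lra.
  - by move=> i; rewrite normrM (gtr0_norm h0) mulrC /D0 ler_wpM2l// ltW.
  - by move=> i; rewrite tnth_mktuple.
  move=> hD; apply: (le_trans hD).
  have Y0p : 0 <= Y0 by have := Y00; lra.
  have D2 : D0 ^+ 2 <= h * Num.sqrt h * (2 * expR Y0).
    have -> : D0 ^+ 2 = h * h * (K * (norm1 x + 1)) ^+ 2 by rewrite /D0; ring.
    apply: ler_pM.
    - by rewrite mulr_ge0// ltW.
    - by rewrite exprn_ge0.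
    - by rewrite ler_wpM2l// ltW.
    apply: (@le_trans _ _ (Y0 ^+ 2)); last exact: (@exprn_fact_expR R Y0 2).
    apply: lerXn2r; rewrite ?nnegrE//.
    rewrite /Y0; have := N0; lra.
  have -> : W%:R ^+ (n + 3) * (h * Num.sqrt h) * 2 * expR (2 * Y0) =
     W%:R ^+ 3 * (h * Num.sqrt h * (2 * expR Y0)) * (W%:R ^+ n * expR Y0).
    by rewrite Wexp (_ : 2 * Y0 = Y0 + Y0) ?expRD; ring.
  apply: ler_pM; [by rewrite mulr_ge0 ?exprn_ge0|by rewrite exprn_ge0| |exact: pow_le_expR].
  apply: ler_pM; rewrite ?exprn_ge0// (le_trans (nW3 2%N))//.
  by rewrite ler_weXn2l.
rewrite EI in B1.
apply: (le_trans (_ : _ <= `|G - mono_diff2 g x (fun i => tnth B i * h)| +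
   `|mono_diff2 g x (fun i => tnth B i * h)|)).
  by apply: le_trans (ler_normD _ _); rewrite subrK.
apply: (le_trans (lerD B1 B2)); rewrite le_eqVlt; apply/orP; left; apply/eqP.
have -> : 2 * Y0 = 2 * (1 + K) + 2 * (1 + K) * norm1 x by rewrite /Y0; ring.
rewrite expRD; ring.
Qed.

End inner_step.

Section coefficients.
Context {R : realType} {d m : nat}.
Implicit Types (b : d.-tuple R -> d.-tuple R) (s : d.-tuple R -> 'M[R]_(d, m)) (x y : d.-tuple R).

(** Growth and boundedness shared by the given and the truncated coefficients, so that measurability
    and exponential moments are proved once for both. *)
Definition admissible (K : R) b s : Prop :=
  [/\ forall i, measurable_fun setT (fun x => tnth (b x) i),
      forall i j, measurable_fun setT (fun x => s x i j),
      forall x i, `|tnth (b x) i| <= K * (norm1 x + 1)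
    & forall x i, \sum_j s x i j ^+ 2 <= K ^+ 2].

Definition sqdist x y : R := \sum_i (tnth x i - tnth y i) ^+ 2.

Lemma sqdist_ge0 x y : 0 <= sqdist x y.
Proof. by rewrite sumr_ge0// => i _; exact: sqr_ge0. Qed.

Lemma measurable_meval (p : mpoly d R) : measurable_fun setT (fun x : d.-tuple R => meval (tnth x) p).
Proof.
rewrite (_ : (fun x => _) = fun x => \sum_(g <- msupp p) mcoeff g p * mono g x).
  by apply: measurable_sum => g; apply: measurable_funM => //; exact: measurable_mono.
by apply/funext => x; rewrite meval_moment.
Qed.

Lemma measurable_norm1 : measurable_fun setT (@norm1 R d).
Proof.
by apply: measurable_sum => i; apply: measurableT_comp => //; exact: measurable_coord.
Qed.

Lemma measurable_euler_step h K b s : admissible K b s -> measurable_fun setT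
  (fun p : d.-tuple R * m.-tuple R => euler_step h (b p.1) (s p.1) p.1 p.2).
Proof.
case=> mb ms _ _; apply/measurable_fun_tnthP => i.
rewrite (_ : _ \o _ = fun p : d.-tuple R * m.-tuple R => tnth p.1 i + tnth (b p.1) i * h +
    (\sum_(j < m) s p.1 i j * tnth p.2 j) * Num.sqrt h); last first.
  by apply/funext => p /=; rewrite tnth_mktuple.
apply: measurable_funD.
  apply: measurable_funD; first exact: (measurableT_comp (measurable_coord i)).
  by apply: measurable_funM => //; exact: (measurableT_comp (mb i)).
apply: measurable_funM => //; apply: measurable_sum => j; apply: measurable_funM.
  exact: (measurableT_comp (ms i j)).
exact: (measurableT_comp (measurable_coord j)).
Qed.

End coefficients.

Section indep_le.
Context {d d1 d2} {T : measurableType d} {T1 : measurableType d1}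
  {T2 : measurableType d2} {R : realType}.
Variable P : probability T R.

Lemma indep_integral_le (X : {mfun T >-> T1}) (Y : {mfun T >-> T2})
    (f : T1 * T2 -> R) (F : T1 -> R) : indep_rv P X Y ->
  measurable_fun setT f -> measurable_fun setT F -> (forall z, 0 <= f z) ->
  (forall x, 0 <= F x) ->
  (forall x, \int[P]_w (f (x, Y w))%:E <= (F x)%:E)%E ->
  (\int[P]_w (f (X w, Y w))%:E <= \int[P]_w (F (X w))%:E)%E.
Proof.
move=> ind mf mF f0 F0 h.
have mE : measurable_fun setT (EFin \o f) by exact/measurable_EFinP.
have f0' z : (0 <= (EFin \o f) z)%E by rewrite lee_fin.
rewrite -[leLHS]/(\int[P]_w (EFin \o f) (X w, Y w))%E (indep_integral ind mE f0').
apply: ge0_le_integral => //.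
- by move=> w _; apply: integral_ge0 => w' _; exact: f0'.
- have mG : measurable_fun setT (fubini_F (distribution P Y) (EFin \o f)).
    exact: measurable_fun_fubini_tonelli_F.
  apply: (eq_measurable_fun _ _ (measurableT_comp mG (measurable_funP X))) => w _ /=.
  rewrite /fubini_F ge0_integral_distribution//; exact: measurableT_comp.
- by apply/measurable_EFinP; exact: measurableT_comp.
- by move=> w _; exact: h.
Qed.

Lemma ge0_integralZ (c : R) (f : T -> R) : 0 <= c -> measurable_fun setT f ->
  (forall w, 0 <= f w) ->
  (\int[P]_w (c * f w)%:E = c%:E * \int[P]_w (f w)%:E)%E.
Proof.
move=> c0 mf f0; under eq_integral do rewrite EFinM.
rewrite ge0_integralZl_EFin//; first by move=> w _; rewrite lee_fin.
exact/measurable_EFinP.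
Qed.

End indep_le.

(** * One step from a random point *)

Section outer_step.
Context {R : realType} {dO} {Omega : measurableType dO} {d m : nat}.
Variables (P : probability Omega R) (Z : {RV P >-> m.-tuple R}).
Hypothesis gZ : standard_gaussian Z.
Variables (h K : R).
Hypotheses (d0 : (0 < d)%N) (h0 : 0 < h) (h1 : h <= 1) (K0 : 0 <= K).

Section single.
Variables (X : {mfun Omega >-> d.-tuple R}).
Hypothesis ind : indep_rv P X Z.
Variables (b : d.-tuple R -> d.-tuple R) (s : d.-tuple R -> 'M[R]_(d, m)).
Hypothesis adm : admissible K b s.

Let F (p : d.-tuple R * m.-tuple R) := euler_step h (b p.1) (s p.1) p.1 p.2.
Let mF : measurable_fun setT F. Proof. exact: measurable_euler_step adm. Qed.
Let mX : measurable_fun setT X. Proof. exact: measurable_funP. Qed.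
Let mXZ : measurable_fun setT (fun w => (X w, Z w)).
Proof. by apply: measurable_fun_pair => //; exact: measurable_funP. Qed.

Lemma cosh_sum_step t : 0 <= t ->
  (\int[P]_w (cosh_sum t (F (X w, Z w)))%:E <=
   (expR (h * (t ^+ 2 * K ^+ 2 / 2 + t * K + 2 * d%:R ^+ 2 * K)))%:E *
   \int[P]_w (cosh_sum (t * expR (h * K * d%:R)) (X w))%:E)%E.
Proof.
move=> t0; case: adm => _ _ gb gs.
set C := expR _; have C0 : 0 <= C by exact: expR_ge0.
rewrite -ge0_integralZ//; last 2 first.
- exact: (measurableT_comp (measurable_cosh_sum _)).
- by move=> w; exact: cosh_sum_ge0.
apply: (@indep_integral_le _ _ _ _ _ _ R P X Z (fun p => cosh_sum t (F p))
  (fun x => C * cosh_sum (t * expR (h * K * d%:R)) x) ind).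
- exact: (measurableT_comp (measurable_cosh_sum t)).
- by apply: measurable_funM => //; exact: measurable_cosh_sum.
- by move=> p; exact: cosh_sum_ge0.
- by move=> x; rewrite mulr_ge0// cosh_sum_ge0.
move=> x.
have [I le] := @cosh_sum_inner R dO Omega d m P Z gZ h K x (b x) (s x) d0 h0 K0 (gb _) (gs _) t t0.
by rewrite (intg_EFin I) lee_fin.
Qed.

Definition generator g x : R := \sum_i mono_deriv i g x * tnth (b x) i +
          2^-1 * \sum_i \sum_l mono_deriv2 i l g x * (s x *m (s x)^T) i l.

Lemma measurable_generator g : measurable_fun setT (generator g).
Proof.
case: adm => mb ms _ _; apply: measurable_funD.
  by apply: measurable_sum => i; apply: measurable_funM => //; exact: measurable_meval.
apply: measurable_funM => //; apply: measurable_sum => i; apply: measurable_sum => l.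
apply: measurable_funM; first exact: measurable_meval.
rewrite (_ : (fun x => _) = fun x => \sum_j s x i j * s x l j).
  by apply: measurable_sum => j; apply: measurable_funM.
by apply/funext => x; rewrite !mxE; apply: eq_bigr => j _; rewrite mxE.
Qed.

Definition weak_const : R := expR (2 * (1 + K)) * (12 * d%:R * expR (2 * d%:R ^+ 2 * K ^+ 2) + 2).

Lemma mono_step g W : (0 < W)%N -> (mdeg g <= W)%N ->
  intg P (fun w => mono g (F (X w, Z w))) ->
  intg P (fun w => mono g (X w)) -> intg P (fun w => generator g (X w)) ->
  intg P (fun w => expR (2 * (1 + K) * norm1 (X w))) ->
  `|\int[P]_w mono g (F (X w, Z w)) - (\int[P]_w mono g (X w) + h * \int[P]_w generator g (X w))|
   <= W%:R ^+ (mdeg g + 3) * (h * Num.sqrt h) *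
      (weak_const * \int[P]_w expR (2 * (1 + K) * norm1 (X w))).
Proof.
move=> W0 gW I1 I2 I3 I4; case: adm => _ _ gb gs.
pose c := W%:R ^+ (mdeg g + 3) * (h * Num.sqrt h) * weak_const.
have E x := @euler_mono_inner R dO Omega d m P Z gZ h K x (b x) (s x) d0 h0 h1 K0 (gb _) (gs _) g W W0 gW.
have I5 := intgZ h I3.
have := @indep_expectation_close _ _ _ _ _ _ R P X Z ind (fun p => mono g (F p))
  (fun x => mono g x + h * generator g x)
  (fun x => c * expR (2 * (1 + K) * norm1 x)).
rewrite (_ : \int[P]_w (mono g (X w) + h * generator g (X w)) =
  \int[P]_w mono g (X w) + h * \int[P]_w generator g (X w)); last first.
  by rewrite RintegralD// RintegralZl.
rewrite (_ : \int[P]_w (c * expR (2 * (1 + K) * norm1 (X w))) =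
  W%:R ^+ (mdeg g + 3) * (h * Num.sqrt h) *
      (weak_const * \int[P]_w expR (2 * (1 + K) * norm1 (X w)))); last first.
  by rewrite RintegralZl// /c !mulrA.
apply.
- exact: (measurableT_comp (measurable_mono g)).
- apply: measurable_funD; first exact: measurable_mono.
  by apply: measurable_funM => //; exact: measurable_generator.
- exact: I1.
- by apply: intgD.
- exact: intgZ.
- by move=> x; have [] := E x.
- by move=> x; have [_] := E x; rewrite /c /weak_const -!mulrA.
Qed.

End single.

Section pair.
Variables (V : {mfun Omega >-> (d.-tuple R * d.-tuple R)%type}).
Hypothesis ind : indep_rv P V Z.
Variables (b1 b2 : d.-tuple R -> d.-tuple R) (s1 s2 : d.-tuple R -> 'M[R]_(d, m)).
Hypotheses (adm1 : admissible K b1 s1) (adm2 : admissible K b2 s2).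
Variable eps : R.
Hypothesis hb : forall x y, \sum_i (tnth (b1 x) i - tnth (b2 y) i) ^+ 2 <=
  2 * K ^+ 2 * sqdist x y + 2 * eps ^+ 2.
Hypothesis hs : forall x y, \sum_i \sum_j (s1 x i j - s2 y i j) ^+ 2 <=
  2 * K ^+ 2 * sqdist x y + 2 * eps ^+ 2.

Let F1 (p : d.-tuple R * m.-tuple R) := euler_step h (b1 p.1) (s1 p.1) p.1 p.2.
Let F2 (p : d.-tuple R * m.-tuple R) := euler_step h (b2 p.1) (s2 p.1) p.1 p.2.

Lemma measurable_sqdist : measurable_fun setT
  (fun p : d.-tuple R * d.-tuple R => sqdist p.1 p.2).
Proof.
apply: measurable_sum => i; apply: measurable_funX; apply: measurable_funB;
  exact: (measurableT_comp (measurable_coord i)).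
Qed.

(** Both schemes receive the same noise, so it enters only through the difference of the diffusion
    matrices, and the term linear in it has mean 0. For h <= 1, (D + B h)^2 <= (1 + h) D^2 + 2 h
    B^2; the constants 6 add 4 for the drift and 2 for the diffusion. *)
Let sqdist_inner x y : (\int[P]_w (sqdist (F1 (x, Z w)) (F2 (y, Z w)))%:E <=
  ((1 + h * (1 + 6 * K ^+ 2)) * sqdist x y + 6 * h * eps ^+ 2)%:E)%E.
Proof.
pose B i := tnth (b1 x) i - tnth (b2 y) i.
pose D i := tnth x i - tnth y i.
pose c i j := s1 x i j - s2 y i j.
have E w : sqdist (F1 (x, Z w)) (F2 (y, Z w)) = \sum_i ((D i + B i * h) ^+ 2 +
    (2 * (D i + B i * h) * Num.sqrt h * lin (c i) (Z w) + h * lin (c i) (Z w) ^+ 2)).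
  apply: eq_bigr => i _; rewrite !tnth_mktuple.
  have -> : lin (c i) (Z w) = \sum_j s1 x i j * tnth (Z w) j - \sum_j s2 y i j * tnth (Z w) j.
    by rewrite -sumrB; apply: eq_bigr => j _; rewrite mulrBl.
  have hh : h = Num.sqrt h ^+ 2 by rewrite sqr_sqrtr// ltW.
  rewrite /D /B /=; set u := \sum_j _; set v := \sum_j _.
  have -> : h * (u - v) ^+ 2 = Num.sqrt h ^+ 2 * (u - v) ^+ 2 by rewrite -hh.
  ring.
have I i : intg P (fun w => 2 * (D i + B i * h) * Num.sqrt h * lin (c i) (Z w) + h * lin (c i) (Z w) ^+ 2).
  by apply: intgD; apply: intgZ; [have [] := gauss_mean gZ (c i)|have [] := gauss_var gZ (c i)].
have I1 i : intg P (fun w => (D i + B i * h) ^+ 2 +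
    (2 * (D i + B i * h) * Num.sqrt h * lin (c i) (Z w) + h * lin (c i) (Z w) ^+ 2)).
  by apply: intgD => //; exact: intg_cst.
under eq_integral do rewrite E.
rewrite intg_EFin; last exact: intg_sum.
rewrite lee_fin Rexp_sum//.
have E1 i : \int[P]_w ((D i + B i * h) ^+ 2 +
    (2 * (D i + B i * h) * Num.sqrt h * lin (c i) (Z w) + h * lin (c i) (Z w) ^+ 2)) =
    (D i + B i * h) ^+ 2 + h * \sum_j c i j ^+ 2.
  have [i1 e1] := gauss_mean gZ (c i); have [i2 e2] := gauss_var gZ (c i).
  rewrite RintegralD//; last exact: intg_cst.
  rewrite RintegralD//; [|exact: intgZ|exact: intgZ].
  by rewrite Rexp_cst !RintegralZl// e1 e2 mulr0 add0r.
under eq_bigr do rewrite E1.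
rewrite big_split/= -mulr_sumr.
have h3 : \sum_i (D i + B i * h) ^+ 2 <= (1 + h) * sqdist x y + 2 * h * \sum_i B i ^+ 2.
  rewrite /sqdist !mulr_sumr -big_split; apply: ler_sum => i _ /=; rewrite -/(D i).
  have q1 := sqr_ge0 (D i - B i); have q2 := sqr_ge0 (B i).
  have : h * h * B i ^+ 2 <= h * B i ^+ 2 by rewrite ler_wpM2r// ler_piMl// ltW.
  have : 0 <= h * (D i - B i) ^+ 2 by rewrite mulr_ge0// ltW.
  move: (D i) (B i) => D' B'; nra.
have h4 := hb x y; have h5 := hs x y.
have := ler_wpM2l (ltW h0) h4; have := ler_wpM2l (ltW h0) h5.
move: h3; rewrite -/(B _) /=; set S1 := \sum_i B i ^+ 2; set S2 := \sum_i \sum_j _.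
move=> h3 h6 h7.
have -> : (1 + h * (1 + 6 * K ^+ 2)) * sqdist x y + 6 * h * eps ^+ 2 =
  (1 + h) * sqdist x y + 2 * (h * (2 * K ^+ 2 * sqdist x y + 2 * eps ^+ 2)) +
  h * (2 * K ^+ 2 * sqdist x y + 2 * eps ^+ 2) by ring.
rewrite lerD// (le_trans h3)// lerD2l -mulrA ler_wpM2l//.
Qed.

Lemma sqdist_step :
  (\int[P]_w (sqdist (F1 ((V w).1, Z w)) (F2 ((V w).2, Z w)))%:E <=
   (1 + h * (1 + 6 * K ^+ 2))%:E * \int[P]_w (sqdist (V w).1 (V w).2)%:E +
   (6 * h * eps ^+ 2)%:E)%E.
Proof.
pose G (p : (d.-tuple R * d.-tuple R) * m.-tuple R) : R :=
  sqdist (F1 (p.1.1, p.2)) (F2 (p.1.2, p.2)).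
have mV : measurable_fun setT V by exact: measurable_funP.
have mG : measurable_fun setT G.
  have m1 : measurable_fun setT (fun p : (d.-tuple R * d.-tuple R) * m.-tuple R => F1 (p.1.1, p.2)).
    apply: (measurableT_comp (measurable_euler_step h adm1)).
    by apply: measurable_fun_pair => //; exact: measurableT_comp.
  have m2 : measurable_fun setT (fun p : (d.-tuple R * d.-tuple R) * m.-tuple R => F2 (p.1.2, p.2)).
    apply: (measurableT_comp (measurable_euler_step h adm2)).
    by apply: measurable_fun_pair => //; exact: measurableT_comp.
  exact: (measurableT_comp measurable_sqdist (measurable_fun_pair m1 m2)).
have c0 : 0 <= 1 + h * (1 + 6 * K ^+ 2).
  by rewrite addr_ge0 ?mulr_ge0 ?addr_ge0 ?mulr_ge0 ?exprn_ge0// ltW.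
have e0 : 0 <= 6 * h * eps ^+ 2 by rewrite mulr_ge0 ?sqr_ge0// mulr_ge0// ltW.
have mS : measurable_fun setT (fun w => sqdist (V w).1 (V w).2).
  exact: (measurableT_comp measurable_sqdist).
apply: (@le_trans _ _ (\int[P]_w ((1 + h * (1 + 6 * K ^+ 2)) * sqdist (V w).1 (V w).2 +
   6 * h * eps ^+ 2)%:E)%E).
  apply: (@indep_integral_le _ _ _ _ _ _ R P V Z G
    (fun p => (1 + h * (1 + 6 * K ^+ 2)) * sqdist p.1 p.2 + 6 * h * eps ^+ 2) ind) => //.
  - by apply: measurable_funD => //; apply: measurable_funM => //; exact: measurable_sqdist.
  - by move=> p; exact: sqdist_ge0.
  - by move=> p; rewrite addr_ge0// mulr_ge0// sqdist_ge0.
  - by move=> p; exact: sqdist_inner.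
under eq_integral do rewrite EFinD.
rewrite ge0_integralD//; last 2 first.
- by move=> w _; rewrite lee_fin mulr_ge0// sqdist_ge0.
- by apply/measurable_EFinP; apply: measurable_funM.
rewrite ge0_integralZ//; last by move=> w; exact: sqdist_ge0.
have -> : (\int[P]_w (6 * h * eps ^+ 2)%:E = (6 * h * eps ^+ 2)%:E)%E.
  by rewrite integral_cst//= -[X in (_ * X)%E]/(P setT) probability_setT mule1.
by [].
Qed.

End pair.
End outer_step.

(** * The Euler law *)

Section chain.
Context {R : realType} {dO} {Omega : measurableType dO} {d m : nat}.
Variables (P : probability Omega R) (u0 : {RV P >-> d.-tuple R}) (z : nat -> {RV P >-> m.-tuple R}).
Hypothesis noise : noise_assumption u0 z.
Variables (h K : R).
Hypotheses (d0 : (0 < d)%N) (h0 : 0 < h) (h1 : h <= 1) (K0 : 0 <= K).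

Section measurability.
Variables (b : d.-tuple R -> d.-tuple R) (s : d.-tuple R -> 'M[R]_(d, m)).
Hypothesis adm : admissible K b s.

Lemma measurable_euler k : measurable_fun setT (euler u0 z h b s k).
Proof.
elim: k => [|k IH]; first exact: measurable_funP.
have mp : measurable_fun setT (fun w => (euler u0 z h b s k w, z k w)).
  by apply: measurable_fun_pair => //; exact: measurable_funP.
exact: (measurableT_comp (measurable_euler_step h adm) mp).
Qed.

Definition euler_mfun k : {mfun Omega >-> d.-tuple R} :=
  HB.pack (euler u0 z h b s k) (isMeasurableFun.Build _ _ _ _ _ (measurable_euler k)).

End measurability.

Variables (b1 b2 : d.-tuple R -> d.-tuple R) (s1 s2 : d.-tuple R -> 'M[R]_(d, m)).
Hypotheses (adm1 : admissible K b1 s1) (adm2 : admissible K b2 s2).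

Definition euler_pair k (w : Omega) : d.-tuple R * d.-tuple R :=
  (euler u0 z h b1 s1 k w, euler u0 z h b2 s2 k w).

Lemma measurable_euler_pair k : measurable_fun setT (euler_pair k).
Proof.
by apply: measurable_fun_pair; [exact: measurable_euler adm1 k|exact: measurable_euler adm2 k].
Qed.

Definition euler_pair_mfun k : {mfun Omega >-> (d.-tuple R * d.-tuple R)%type} :=
  HB.pack (euler_pair k) (isMeasurableFun.Build _ _ _ _ _ (measurable_euler_pair k)).

(** The states at time [k] use only the noise before [k]. The pair is treated as one variable
    because the mean-square comparison needs the joint state to be independent of the next noise. *)
Lemma euler_pair_indep_seq k N : indep_seq P N (euler_pair k) (fun j => z (j + k)).
Proof.
elim: k N => [|k IH] N.
  move=> A B mA mB; have := noise.2 N (fun x => A (x, x)) B _ mB.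
  rewrite [X in _ -> _ = (_ * X)%E](eq_bigr (fun j : 'I_N => P (z j @^-1` B j))); last first.
    by move=> j _; rewrite addn0.
  have -> : (euler_pair 0) @^-1` A = u0 @^-1` (fun x => A (x, x)) by [].
  move=> <-; last first.
    have mD : measurable_fun setT (fun x : d.-tuple R => (x, x)).
      exact: measurable_fun_pair.
    by rewrite -[X in measurable X]setTI; exact: (mD _ A mA).
  congr (P _); apply/seteqP; split => w /= [h2 h3]; split => // j jN; have := h3 j jN; by rewrite addn0.
have mPsi : measurable_fun setT (fun p : (d.-tuple R * d.-tuple R) * m.-tuple R =>
    (euler_step h (b1 p.1.1) (s1 p.1.1) p.1.1 p.2, euler_step h (b2 p.1.2) (s2 p.1.2) p.1.2 p.2)).
  have m1 : measurable_fun setT (fun p : (d.-tuple R * d.-tuple R) * m.-tuple R => (p.1.1, p.2)).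
    by apply: measurable_fun_pair => //; exact: measurableT_comp.
  have m2 : measurable_fun setT (fun p : (d.-tuple R * d.-tuple R) * m.-tuple R => (p.1.2, p.2)).
    by apply: measurable_fun_pair => //; exact: measurableT_comp.
  apply: measurable_fun_pair.
    exact: (measurableT_comp (measurable_euler_step h adm1) m1).
  exact: (measurableT_comp (measurable_euler_step h adm2) m2).
move=> A B mA mB.
have := @indep_seq_next _ _ _ _ _ _ _ _ R P (euler_pair_mfun k) (fun j => z (j + k)) N (IH N.+1) _ mPsi A B mA mB.
rewrite (_ : \prod_(j < N) P (z (j + k.+1) @^-1` B j) = \prod_(j < N) P (z (j.+1 + k) @^-1` B j))%E; last first.
  by apply: eq_bigr => j _; rewrite addnS.
move=> <-; congr (P _); apply/seteqP; split => w /= [h2 h3]; split => // j jN;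
  by have := h3 j jN; rewrite addnS.
Qed.

Lemma euler_pair_indep k : indep_rv P (euler_pair_mfun k) (z k).
Proof.
exact: (@indep_seq_head _ _ _ _ _ _ R P (euler_pair_mfun k) (fun j => z (j + k)) 0 (euler_pair_indep_seq k 1)).
Qed.

Lemma euler_indep k : indep_rv P (euler_mfun adm1 k) (z k).
Proof.
move=> A B mA mB; have mA' : measurable ((fst : d.-tuple R * d.-tuple R -> _) @^-1` A).
  by rewrite -[X in measurable X]setTI; exact: measurable_fst.
exact: (@euler_pair_indep k _ B mA' mB).
Qed.

(** Discrete Gronwall inequality for [sqdist_step], carried in the closed form 6 k h eps^2 exp (k h
    c). *)
Lemma euler_sqdist eps T k : k%:R * h <= T ->
  (forall x y, \sum_i (tnth (b1 x) i - tnth (b2 y) i) ^+ 2 <=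
    2 * K ^+ 2 * sqdist x y + 2 * eps ^+ 2) ->
  (forall x y, \sum_i \sum_j (s1 x i j - s2 y i j) ^+ 2 <=
    2 * K ^+ 2 * sqdist x y + 2 * eps ^+ 2) ->
  (\int[P]_w (sqdist (euler u0 z h b1 s1 k w) (euler u0 z h b2 s2 k w))%:E <=
    (6 * T * eps ^+ 2 * expR (T * (1 + 6 * K ^+ 2)))%:E)%E.
Proof.
move=> kT hb hs; pose c := 1 + 6 * K ^+ 2.
have c0 : 0 <= c by rewrite addr_ge0 ?mulr_ge0 ?exprn_ge0.
suff H : (\int[P]_w (sqdist (euler u0 z h b1 s1 k w) (euler u0 z h b2 s2 k w))%:E <=
    (6 * (k%:R * h) * eps ^+ 2 * expR (k%:R * h * c))%:E)%E.
  apply: (le_trans H); rewrite lee_fin; apply: ler_pM; rewrite ?expR_ge0//.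
  - by rewrite mulr_ge0 ?sqr_ge0// mulr_ge0// mulr_ge0// ltW.
  - by rewrite ler_wpM2r ?sqr_ge0// ler_wpM2l.
  - by rewrite ler_expR ler_wpM2r.
clear kT T; elim: k => [|k IH].
  rewrite (eq_integral (fun=> 0%E)) ?integral0 ?mul0r ?mulr0 ?mul0r//.
  by move=> w _; rewrite /sqdist big1// => i _; rewrite subrr expr0n.
have := @sqdist_step R dO Omega d m P (z k) (noise.1 k) h K h0 h1 K0 (euler_pair_mfun k)
  (euler_pair_indep k) _ _ _ _ adm1 adm2 eps hb hs.
move=> H; apply: (le_trans H).
have h2 : 0 <= 1 + h * (1 + 6 * K ^+ 2) by rewrite addr_ge0 ?mulr_ge0// ltW.
apply: (@le_trans _ _ ((1 + h * c)%:E * (6 * (k%:R * h) * eps ^+ 2 * expR (k%:R * h * c))%:E +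
   (6 * h * eps ^+ 2)%:E)%E).
  by rewrite leeD2r// lee_wpmul2l// lee_fin.
rewrite -EFinM -EFinD lee_fin -(natr1 k).
have e1 : 1 + h * c <= expR (h * c) by exact: expR_ge1Dx.
have -> : (k%:R + 1) * h * c = k%:R * h * c + h * c by ring.
rewrite expRD; set E1 := expR (k%:R * h * c); set E2 := expR (h * c) in e1 *.
have E11 : 1 <= E1 by rewrite -expR0 ler_expR !mulr_ge0// ltW.
have E21 : 1 <= E2 by rewrite -expR0 ler_expR mulr_ge0// ltW.
set q := 6 * h * eps ^+ 2; have q0 : 0 <= q by rewrite mulr_ge0 ?sqr_ge0 ?mulr_ge0// ltW.
have -> : (1 + h * c) * (6 * (k%:R * h) * eps ^+ 2 * E1) + q =
  k%:R * q * E1 * (1 + h * c) + q * 1 by rewrite /q; ring.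
have -> : 6 * ((k%:R + 1) * h) * eps ^+ 2 * (E1 * E2) =
  k%:R * q * E1 * E2 + q * (E1 * E2) by rewrite /q; ring.
rewrite lerD// ler_wpM2l//; last by nra.
by apply: mulr_ge0; last lra; exact: mulr_ge0.
Qed.

End chain.

(** * Exponential moments of the scheme *)

Section exp_moments.
Context {R : realType} {dO} {Omega : measurableType dO} {d m : nat}.
Variables (P : probability Omega R) (u0 : {RV P >-> d.-tuple R}) (z : nat -> {RV P >-> m.-tuple R}).
Hypothesis noise : noise_assumption u0 z.
Variables (h K T delta0 M0 : R).
Hypotheses (d0 : (0 < d)%N) (h0 : 0 < h) (h1 : h <= 1) (K0 : 0 <= K).
Hypotheses (T0 : 0 <= T) (delta00 : 0 < delta0) (init : initial_assumption u0 delta0 M0).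
Variables (b : d.-tuple R -> d.-tuple R) (s : d.-tuple R -> 'M[R]_(d, m)).
Hypothesis adm : admissible K b s.

Implicit Types t : R.

Let v k := euler u0 z h b s k.
Let c := h * K * d%:R.
Let kap (t : R) := t ^+ 2 * K ^+ 2 / 2 + t * K + 2 * d%:R ^+ 2 * K.

Let c0 : 0 <= c. Proof. by rewrite !mulr_ge0// ltW. Qed.

Let kap_mono (t1 t2 : R) : 0 <= t1 <= t2 -> kap t1 <= kap t2.
Proof.
move=> /andP[t10 t12]; rewrite /kap lerD2r; apply: lerD; last exact: ler_wpM2r.
apply: ler_wpM2r => //; apply: ler_wpM2r; first by rewrite exprn_ge0.
by apply: lerXn2r; rewrite ?nnegrE// (le_trans t10).
Qed.

Let kap_ge0 t : 0 <= t -> 0 <= kap t.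
Proof. by move=> t0; rewrite !addr_ge0 ?mulr_ge0 ?exprn_ge0. Qed.

(** Each step multiplies the exponent by exp c, so k steps lead back to the exponent t exp (k c) at
    time 0. The constants of the intermediate steps are all bounded by that of the largest exponent,
    [kap] being increasing. *)
Lemma euler_cosh_sum k t : 0 <= t ->
  (\int[P]_w (cosh_sum t (v k w))%:E <= (expR (k%:R * h * kap (t * expR (k%:R * c))))%:E *
     \int[P]_w (cosh_sum (t * expR (k%:R * c)) (u0 w))%:E)%E.
Proof.
elim: k t => [|k IH] t t0; first by rewrite !mul0r expR0 mulr1 mul1e.
have := @cosh_sum_step R dO Omega d m P (z k) (noise.1 k) h K d0 h0 K0
   (@euler_mfun R dO Omega d m P u0 z h K b s adm k)
   (@euler_indep R dO Omega d m P u0 z noise h K b b s s adm adm k) b s adm t t0.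
move=> H; apply: (le_trans H); rewrite -/c -/(kap t).
have tc0 : 0 <= t * expR c by rewrite mulr_ge0 ?expR_ge0.
have := IH _ tc0.
have -> : t * expR c * expR (k%:R * c) = t * expR (k.+1%:R * c).
  by rewrite -mulrA -expRD -(natr1 k); congr (_ * expR _); ring.
set t' := t * expR (k.+1%:R * c); set I0 := (\int[P]_w (cosh_sum t' (u0 w))%:E)%E => IH'.
apply: (@le_trans _ _ ((expR (h * kap t))%:E * ((expR (k%:R * h * kap t'))%:E * I0))%E).
  by rewrite lee_wpmul2l// lee_fin expR_ge0.
rewrite muleA -EFinM -expRD lee_wpmul2r//.
  by apply: integral_ge0 => w _; rewrite lee_fin cosh_sum_ge0.
rewrite lee_fin ler_expR -(natr1 k).
have -> : (k%:R + 1) * h * kap t' = h * kap t' + k%:R * h * kap t' by ring.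
rewrite lerD2r ler_wpM2l ?(ltW h0)//; apply: kap_mono; rewrite t0/= ler_peMr//.
by rewrite -expR0 ler_expR mulr_ge0.
Qed.

(** t N <= t^2 / (4 delta0) + delta0 N^2 trades the linear exponent for the Gaussian one of the
    assumption. *)
Lemma cosh_sum_initial t : 0 <= t ->
  (\int[P]_w (cosh_sum t (u0 w))%:E <= (2 * d%:R * expR (t ^+ 2 / (4 * delta0)) * M0)%:E)%E.
Proof.
move=> t0; set C := 2 * d%:R * _; have C0 : 0 <= C by rewrite !mulr_ge0 ?expR_ge0.
have mE : measurable_fun setT (fun w => expR (delta0 * enorm (u0 w) ^+ 2)).
  apply: measurableT_comp => //; apply: measurable_funM => //; apply: measurable_funX.
  by apply: (measurableT_comp (@measurable_enorm R d)); exact: measurable_funP.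
apply: (@le_trans _ _ (C%:E * \int[P]_w (expR (delta0 * enorm (u0 w) ^+ 2))%:E)%E); last first.
  by rewrite (EFinM C M0); apply: lee_wpmul2l => //; rewrite lee_fin.
rewrite -ge0_integralZ//.
apply: ge0_le_integral => //.
- by move=> w _; rewrite lee_fin cosh_sum_ge0.
- apply/measurable_EFinP; apply: (measurableT_comp (measurable_cosh_sum t)); exact: measurable_funP.
- by apply/measurable_EFinP; apply: measurable_funM.
move=> w _; rewrite lee_fin; set x := u0 w; set N := enorm x.
have N0 : 0 <= N by exact: enorm_ge0.
have E : expR (t * N) <= expR (t ^+ 2 / (4 * delta0)) * expR (delta0 * N ^+ 2).
  rewrite -expRD ler_expR -subr_ge0.
  have -> : t ^+ 2 / (4 * delta0) + delta0 * N ^+ 2 - t * N =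
      (t / 2 - delta0 * N) ^+ 2 / delta0 by field; rewrite gt_eqF.
  by rewrite divr_ge0 ?sqr_ge0// ltW.
apply: (@le_trans _ _ (\sum_(i < d) 2 * expR (t * N))).
  apply: ler_sum => i _; have xi := coord_le_enorm x i; rewrite -/N in xi.
  rewrite mulr2n mulrDl mul1r; move: xi; rewrite ler_norml => /andP[x1 x2].
  by rewrite lerD// ler_expR ?ler_wpM2l// -mulrN ler_wpM2l// lerNl.
rewrite sumr_const card_ord.
have -> : 2 * expR (t * N) *+ d = 2 * d%:R * expR (t * N) by rewrite -mulr_natr; ring.
have -> : C * expR (delta0 * N ^+ 2) =
  2 * d%:R * (expR (t ^+ 2 / (4 * delta0)) * expR (delta0 * N ^+ 2)) by rewrite /C; ring.
by apply: ler_wpM2l; rewrite ?mulr_ge0.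
Qed.

(** Of the form A exp (B t^2) with A and B independent of h and k; growth no faster than Gaussian
    later allows t to be of the order of the radius. *)
Definition exp_bound (t : R) : R :=
  expR (T * (K + 2 * d%:R ^+ 2 * K)) * (2 * d%:R * M0) *
  expR (expR (T * K * d%:R) ^+ 2 * (T * (K ^+ 2 / 2 + K) + (4 * delta0)^-1) * t ^+ 2).

Let M00 : 0 <= M0.
Proof.
rewrite -lee_fin; apply: (le_trans _ init); apply: integral_ge0 => w _.
by rewrite lee_fin expR_ge0.
Qed.

Lemma exp_bound_ge0 t : 0 <= exp_bound t.
Proof. by rewrite !mulr_ge0 ?expR_ge0. Qed.

Lemma euler_exp_moment k t : k%:R * h <= T -> 0 <= t ->
  (\int[P]_w (cosh_sum t (v k w))%:E <= (exp_bound t)%:E)%E.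
Proof.
move=> kT t0; apply: (le_trans (euler_cosh_sum k t0)).
set E := expR (T * K * d%:R); set t' := t * expR _.
have kh0 : 0 <= k%:R * h by rewrite mulr_ge0// ltW.
have t'0 : 0 <= t' by rewrite mulr_ge0 ?expR_ge0.
have t'E : t' <= E * t.
  rewrite /t' mulrC; apply: ler_wpM2r => //; rewrite ler_expR /c.
  have -> : k%:R * (h * K * d%:R) = k%:R * h * (K * d%:R) by ring.
  by rewrite -(mulrA T); apply: ler_wpM2r => //; rewrite mulr_ge0.
have t'2 : t' ^+ 2 <= E ^+ 2 * t ^+ 2.
  by rewrite -exprMn lerXn2r ?nnegrE ?mulr_ge0 ?expR_ge0.
apply: (@le_trans _ _ ((expR (k%:R * h * kap t'))%:E * (2 * d%:R * expR (t' ^+ 2 / (4 * delta0)) * M0)%:E)%E).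
  by rewrite lee_wpmul2l ?lee_fin ?expR_ge0// cosh_sum_initial.
rewrite -EFinM lee_fin.
have -> : expR (k%:R * h * kap t') * (2 * d%:R * expR (t' ^+ 2 / (4 * delta0)) * M0) =
  (2 * d%:R * M0) * expR (k%:R * h * kap t' + t' ^+ 2 / (4 * delta0)) by rewrite expRD; ring.
have -> : exp_bound t = 2 * d%:R * M0 * expR (T * (K + 2 * d%:R ^+ 2 * K) +
    E ^+ 2 * (T * (K ^+ 2 / 2 + K) + (4 * delta0)^-1) * t ^+ 2).
  by rewrite /exp_bound -/E expRD; ring.
apply: ler_wpM2l; first by rewrite !mulr_ge0.
rewrite ler_expR.
have kk : k%:R * h * kap t' <= T * kap t' by rewrite ler_wpM2r// kap_ge0.
have k2 : kap t' <= t' ^+ 2 * (K ^+ 2 / 2 + K) + (K + 2 * d%:R ^+ 2 * K).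
  rewrite /kap; have : t' * K <= (t' ^+ 2 + 1) * K by rewrite ler_wpM2r//; nra.
  by lra.
have k3 : T * kap t' <= T * (t' ^+ 2 * (K ^+ 2 / 2 + K) + (K + 2 * d%:R ^+ 2 * K)) by rewrite ler_wpM2l.
apply: (le_trans (lerD (le_trans kk k3) (lexx _))).
have D0 : 0 <= T * (K ^+ 2 / 2 + K) + (4 * delta0)^-1.
  by rewrite addr_ge0 ?mulr_ge0 ?addr_ge0 ?invr_ge0 ?mulr_ge0 ?sqr_ge0 ?(ltW delta00).
have k4 := ler_wpM2r D0 t'2.
have -> : T * (t' ^+ 2 * (K ^+ 2 / 2 + K) + (K + 2 * d%:R ^+ 2 * K)) + t' ^+ 2 / (4 * delta0) =
  T * (K + 2 * d%:R ^+ 2 * K) + t' ^+ 2 * (T * (K ^+ 2 / 2 + K) + (4 * delta0)^-1) by ring.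
by rewrite lerD2l (le_trans k4)// mulrAC.
Qed.

Lemma euler_norm1_exp k t : k%:R * h <= T -> 0 <= t ->
  intg P (fun w => expR (t * norm1 (v k w))) /\
  \int[P]_w expR (t * norm1 (v k w)) <= exp_bound (t * d%:R).
Proof.
move=> kT t0; have mv : measurable_fun setT (v k) by exact: (@measurable_euler R dO Omega d m P u0 z h K b s adm k).
apply: ge0_intg.
- apply: measurableT_comp => //; apply: measurable_funM => //.
  exact: (measurableT_comp (@measurable_norm1 R d)).
- by move=> w; exact: expR_ge0.
apply: (le_trans _ (euler_exp_moment kT (mulr_ge0 t0 (ler0n _ d)))).
apply: ge0_le_integral => //.
- apply/measurable_EFinP; apply: measurableT_comp => //; apply: measurable_funM => //.
  exact: (measurableT_comp (@measurable_norm1 R d)).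
- by apply/measurable_EFinP; exact: (measurableT_comp (measurable_cosh_sum _)).
by move=> w _; rewrite lee_fin expR_norm1_le.
Qed.

End exp_moments.

(** * Truncated coefficients *)

Section norms.
Context {R : realType} {d m : nat}.
Implicit Types (x y : d.-tuple R).

Lemma fnorm_sqr (A : 'M[R]_(d, m)) : fnorm A ^+ 2 = \sum_i \sum_j A i j ^+ 2.
Proof.
have E : \tr (A *m A^T) = \sum_i \sum_j A i j ^+ 2.
  rewrite /mxtrace; apply: eq_bigr => i _; rewrite mxE; apply: eq_bigr => j _.
  by rewrite mxE expr2.
rewrite /fnorm E sqr_sqrtr// sumr_ge0// => i _; rewrite sumr_ge0// => j _; exact: sqr_ge0.
Qed.

Lemma fnorm_ge0 (A : 'M[R]_(d, m)) : 0 <= fnorm A.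
Proof. exact: sqrtr_ge0. Qed.

Lemma row_le_fnorm (A : 'M[R]_(d, m)) i : \sum_j A i j ^+ 2 <= fnorm A ^+ 2.
Proof.
rewrite fnorm_sqr [leRHS](bigD1 i)//= lerDl sumr_ge0// => k _.
by rewrite sumr_ge0// => j _; exact: sqr_ge0.
Qed.

Lemma entry_le_fnorm (A : 'M[R]_(d, m)) i j : `|A i j| <= fnorm A.
Proof.
rewrite -(@ler_pXn2r _ 2)// ?nnegrE ?fnorm_ge0// real_normK ?num_real//.
apply: le_trans (row_le_fnorm A i); rewrite (bigD1 j)//= lerDl sumr_ge0// => k _.
exact: sqr_ge0.
Qed.

Lemma edist_sqr x y : edist x y ^+ 2 = sqdist x y.
Proof. by rewrite enorm_sqr; apply: eq_bigr => i _; rewrite tnth_mktuple. Qed.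

Lemma coord_le_edist x y i : `|tnth x i - tnth y i| <= edist x y.
Proof. by have := coord_le_enorm [tuple tnth x i - tnth y i | i < d] i; rewrite tnth_mktuple. Qed.

Lemma coord_le_norm1 x i : `|tnth x i| <= norm1 x.
Proof. by rewrite /norm1 (bigD1 i)//= lerDl sumr_ge0. Qed.

Lemma mono_le_exp (g : multinom d) x : `|mono g x| <= (mdeg g)`!%:R * expR (norm1 x).
Proof.
apply: (le_trans (mono_bound g (coord_le_norm1 x))).
by apply: exprn_fact_expR; exact: norm1_ge0.
Qed.

Lemma sqr_add_le (a c : R) : (a + c) ^+ 2 <= 2 * a ^+ 2 + 2 * c ^+ 2.
Proof. have := sqr_ge0 (a - c); nra. Qed.

End norms.

Section truncation.
Context {R : realType} {d m : nat}.
Variables (b : d.-tuple R -> d.-tuple R) (s : d.-tuple R -> 'M[R]_(d, m)).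
Variables (pb : d.-tuple (mpoly d R)) (ps : 'M[mpoly d R]_(d, m)) (rad K eps : R).
Hypothesis K0 : 0 <= K.
Hypothesis bG : forall x, enorm (b x) <= K * (enorm x + 1).
Hypothesis sB : forall x, fnorm (s x) <= K.
Hypothesis bL : forall x y, edist (b x) (b y) <= K * edist x y.
Hypothesis sL : forall x y, fnorm (s x - s y) <= K * edist x y.
Hypothesis eps01 : 0 <= eps <= 1.
Hypothesis close : forall x, cube rad x ->
  edist (b x) (vpoly_eval pb x) <= eps /\ fnorm (s x - mxpoly_eval ps x) <= eps.
Implicit Types (x y : d.-tuple R).

(** Leaves room for an error eps <= 1: the truncated drift is at most K (|x| + 1) + 1, and the rows
    of the truncated diffusion have squared norm at most 2 K^2 + 2. *)
Let K1 := 2 * K + 2.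

Let KK1 : K <= K1.
Proof. by rewrite /K1; have := K0; lra. Qed.

Let K10 : 0 <= K1.
Proof. by apply: le_trans KK1. Qed.

(* Truncation to the cube keeps the polynomial coefficients close to [b] and [s] everywhere. *)
Definition trunc_drift x : d.-tuple R :=
  [tuple tnth (b x) i + \1_(cube rad) x * (meval (tnth x) (tnth pb i) - tnth (b x) i) | i < d].

Definition trunc_diff x : 'M[R]_(d, m) :=
  \matrix_(i, j) (s x i j + \1_(cube rad) x * (meval (tnth x) (ps i j) - s x i j)).

Lemma trunc_in x : cube rad x -> trunc_drift x = vpoly_eval pb x /\ trunc_diff x = mxpoly_eval ps x.
Proof.
move=> xc; split; [apply: eq_from_tnth => i|apply/matrixP => i j];
  rewrite ?tnth_mktuple ?mxE indicE mem_set//= mul1r addrC subrK//.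
Qed.

Lemma trunc_out x : ~ cube rad x -> trunc_drift x = b x /\ trunc_diff x = s x.
Proof.
move=> xc; split; [apply: eq_from_tnth => i|apply/matrixP => i j];
  rewrite ?tnth_mktuple ?mxE indicE memNset//= mul0r addr0//.
Qed.

Lemma trunc_drift_close x : sqdist (b x) (trunc_drift x) <= eps ^+ 2.
Proof.
case/andP: eps01 => e0 _; have [xc|xc] := pselect (cube rad x).
  have [-> _] := trunc_in xc; rewrite -edist_sqr lerXn2r ?nnegrE ?edist_ge0//.
  by have [] := close xc.
by have [-> _] := trunc_out xc; rewrite /sqdist big1 ?sqr_ge0// => i _; rewrite subrr expr0n.
Qed.

Lemma trunc_diff_close x : \sum_i \sum_j (s x i j - trunc_diff x i j) ^+ 2 <= eps ^+ 2.
Proof.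
case/andP: eps01 => e0 _; have [xc|xc] := pselect (cube rad x).
  have [_ ->] := trunc_in xc.
  have -> : \sum_i \sum_j (s x i j - mxpoly_eval ps x i j) ^+ 2 = fnorm (s x - mxpoly_eval ps x) ^+ 2.
    by rewrite fnorm_sqr; apply: eq_bigr => i _; apply: eq_bigr => j _; rewrite !mxE.
  by rewrite lerXn2r ?nnegrE ?fnorm_ge0//; have [] := close xc.
have [_ ->] := trunc_out xc; rewrite big1 ?sqr_ge0// => i _; rewrite big1// => j _.
by rewrite subrr expr0n.
Qed.

Let bK x i : `|tnth (b x) i| <= K * (norm1 x + 1).
Proof.
apply: (le_trans (coord_le_enorm _ _)); apply: (le_trans (bG x)).
by rewrite ler_wpM2l// lerD2r enorm_le_norm1.
Qed.

Let sK x i : \sum_j s x i j ^+ 2 <= K ^+ 2.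
Proof. by apply: (le_trans (row_le_fnorm _ _)); rewrite lerXn2r ?nnegrE ?fnorm_ge0. Qed.

Let mb i : measurable_fun setT (fun x => tnth (b x) i).
Proof.
apply: (@lipschitz_measurable R d _ K) => x y; apply: (le_trans (coord_le_edist _ _ _)).
by apply: (le_trans (bL x y)); rewrite ler_wpM2l// edist_le_norm1.
Qed.

Let ms i j : measurable_fun setT (fun x => s x i j).
Proof.
apply: (@lipschitz_measurable R d _ K) => x y.
have := entry_le_fnorm (s x - s y) i j; rewrite !mxE => h; apply: (le_trans h).
by apply: (le_trans (sL x y)); rewrite ler_wpM2l// edist_le_norm1.
Qed.

Lemma admissible_coef : admissible K1 b s.
Proof.
split=> //.
- move=> x i; apply: (le_trans (bK x i)); rewrite ler_wpM2r ?addr_ge0 ?norm1_ge0//.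
- move=> x i; apply: (le_trans (sK x i)); by rewrite lerXn2r ?nnegrE.
Qed.

Let m1 : measurable_fun setT (\1_(@cube R d rad) : d.-tuple R -> R).
Proof. by apply: measurable_indic; exact: measurable_cube. Qed.

Lemma admissible_trunc : admissible K1 trunc_drift trunc_diff.
Proof.
case/andP: eps01 => e0 e1; split.
- move=> i; rewrite (_ : (fun x => _) = fun x => tnth (b x) i +
    \1_(cube rad) x * (meval (tnth x) (tnth pb i) - tnth (b x) i)).
    apply: measurable_funD => //; apply: measurable_funM => //; apply: measurable_funB => //.
    exact: measurable_meval.
  by apply/funext => x; rewrite tnth_mktuple.
- move=> i j; rewrite (_ : (fun x => _) = fun x => s x i j +
    \1_(cube rad) x * (meval (tnth x) (ps i j) - s x i j)).
    apply: measurable_funD => //; apply: measurable_funM => //; apply: measurable_funB => //.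
    exact: measurable_meval.
  by apply/funext => x; rewrite mxE.
- move=> x i; have h := coord_le_edist (b x) (trunc_drift x) i.
  have h2 : edist (b x) (trunc_drift x) <= eps.
    rewrite -(@ler_pXn2r _ 2)// ?nnegrE ?edist_ge0// edist_sqr; exact: trunc_drift_close.
  have h3 := bK x i; have N0 := norm1_ge0 x.
  have -> : tnth (trunc_drift x) i = tnth (b x) i - (tnth (b x) i - tnth (trunc_drift x) i) by ring.
  apply: (le_trans (ler_normB _ _)); have := K0; rewrite /K1; nra.
- move=> x i; have := trunc_diff_close x; rewrite (bigD1 i)//= => h.
  have {}h : \sum_j (s x i j - trunc_diff x i j) ^+ 2 <= eps ^+ 2.
    apply: le_trans h; rewrite lerDl sumr_ge0// => k _.
    by rewrite sumr_ge0// => j _; exact: sqr_ge0.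
  have : \sum_j trunc_diff x i j ^+ 2 <=
    2 * \sum_j s x i j ^+ 2 + 2 * \sum_j (s x i j - trunc_diff x i j) ^+ 2.
    rewrite !mulr_sumr -big_split; apply: ler_sum => j _ /=.
    by have := sqr_add_le (s x i j) (- (s x i j - trunc_diff x i j)); rewrite sqrrN subKr.
  move=> h2; apply: (le_trans h2); have h3 := sK x i.
  have : eps ^+ 2 <= 1 by rewrite -[leRHS](expr1n _ 2) lerXn2r ?nnegrE.
  have := K0; rewrite /K1; nra.
Qed.

Lemma trunc_drift_lipschitz x y : \sum_i (tnth (b x) i - tnth (trunc_drift y) i) ^+ 2 <=
  2 * K1 ^+ 2 * sqdist x y + 2 * eps ^+ 2.
Proof.
have h1 : sqdist (b x) (b y) <= K ^+ 2 * sqdist x y.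
  by rewrite -!edist_sqr -exprMn lerXn2r ?nnegrE ?edist_ge0 ?mulr_ge0 ?edist_ge0.
have h2 := trunc_drift_close y.
have h3 : \sum_i (tnth (b x) i - tnth (trunc_drift y) i) ^+ 2 <=
   2 * sqdist (b x) (b y) + 2 * sqdist (b y) (trunc_drift y).
  rewrite !mulr_sumr -big_split; apply: ler_sum => i _ /=.
  have := sqr_add_le (tnth (b x) i - tnth (b y) i) (tnth (b y) i - tnth (trunc_drift y) i).
  by rewrite subrKA.
have KK : K ^+ 2 * sqdist x y <= K1 ^+ 2 * sqdist x y.
  by rewrite ler_wpM2r ?sqdist_ge0// lerXn2r ?nnegrE.
lra.
Qed.

Lemma trunc_diff_lipschitz x y : \sum_i \sum_j (s x i j - trunc_diff y i j) ^+ 2 <=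
  2 * K1 ^+ 2 * sqdist x y + 2 * eps ^+ 2.
Proof.
have h1 : fnorm (s x - s y) ^+ 2 <= K ^+ 2 * sqdist x y.
  by rewrite -!edist_sqr -exprMn lerXn2r ?nnegrE ?fnorm_ge0 ?mulr_ge0 ?edist_ge0.
have h2 := trunc_diff_close y.
have h3 : \sum_i \sum_j (s x i j - trunc_diff y i j) ^+ 2 <=
   2 * fnorm (s x - s y) ^+ 2 + 2 * \sum_i \sum_j (s y i j - trunc_diff y i j) ^+ 2.
  rewrite fnorm_sqr !mulr_sumr -big_split; apply: ler_sum => i _ /=.
  rewrite !mulr_sumr -big_split; apply: ler_sum => j _ /=.
  have := sqr_add_le (s x i j - s y i j) (s y i j - trunc_diff y i j).
  by rewrite subrKA => h; rewrite [(s x - s y) i j]mxE [(- s y) i j]mxE.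
have KK : K ^+ 2 * sqdist x y <= K1 ^+ 2 * sqdist x y.
  by rewrite ler_wpM2r ?sqdist_ge0// lerXn2r ?nnegrE.
lra.
Qed.

End truncation.

Section moment_difference.
Context {R : realType} {dO} {Omega : measurableType dO} {d m : nat}.
Variables (P : probability Omega R) (X Y : Omega -> d.-tuple R).
Hypotheses (mX : measurable_fun setT X) (mY : measurable_fun setT Y).
Variables (eps S E1 : R).
Hypotheses (eps0 : 0 < eps).
Hypothesis hS : (\int[P]_w (sqdist (X w) (Y w))%:E <= (S * eps ^+ 2)%:E)%E.
Hypothesis hX : intg P (fun w => expR (2 * norm1 (X w))) /\ \int[P]_w expR (2 * norm1 (X w)) <= E1.
Hypothesis hY : intg P (fun w => expR (2 * norm1 (Y w))) /\ \int[P]_w expR (2 * norm1 (Y w)) <= E1.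

Lemma intg_mono (Z : Omega -> d.-tuple R) g : measurable_fun setT Z ->
  intg P (fun w => expR (2 * norm1 (Z w))) -> intg P (fun w => mono g (Z w)).
Proof.
move=> mZ iZ; apply: (intg_le _ _ (intgZ (mdeg g)`!%:R iZ)).
  exact: (measurableT_comp (measurable_mono g)).
move=> w; apply: (le_trans (mono_le_exp g _)); rewrite ler_wpM2l// ler_expR.
by have := norm1_ge0 (Z w); lra.
Qed.

(** [mono_lipschitz] is linear in the distance, and Young's inequality with weight [eps] separates
    the mean-square distance, of order eps^2, from an exponential moment bounded by [E1]. The result
    is linear in [eps]. *)
Lemma moment_difference g :
  `|\int[P]_w mono g (X w) - \int[P]_w mono g (Y w)| <=
  eps * (2^-1 * (S + d%:R * (mdeg g)%:R ^+ 2 * (2 * mdeg g)`!%:R * expR 1 * E1)).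
Proof.
set n := mdeg g; have [iX eX] := hX; have [iY eY] := hY.
have mS : measurable_fun setT (fun w => sqdist (X w) (Y w)).
  exact: (measurableT_comp measurable_sqdist (measurable_fun_pair mX mY)).
have [iS eS] := ge0_intg mS (fun w => sqdist_ge0 _ _) hS.
have i1 := intg_mono g mX iX; have i2 := intg_mono g mY iY.
rewrite -RintegralB//.
pose c := d%:R * n%:R ^+ 2 * (2 * n)`!%:R * expR 1 : R.
have c0 : 0 <= c by rewrite !mulr_ge0 ?expR_ge0 ?exprn_ge0.
pose B w := 2^-1 * (eps^-1 * sqdist (X w) (Y w) +
  eps * c * (2^-1 * (expR (2 * norm1 (X w)) + expR (2 * norm1 (Y w))))).
have i3 := intgZ eps^-1 iS; have i4 := intgZ 2^-1 (intgD iX iY).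
have i5 := intgZ (eps * c) i4; have iB : intg P B := intgZ 2^-1 (intgD i3 i5).
apply: (@le_trans _ _ (\int[P]_w B w)).
  apply: Rexp_abs_le => //; first exact: intgB.
  move=> w; set x := X w; set y := Y w.
  have Nx := norm1_ge0 x; have Ny := norm1_ge0 y.
  pose A := 1 + norm1 x + norm1 y; have A1 : 1 <= A by rewrite /A; lra.
  have xA i : `|tnth x i| <= A by rewrite (le_trans (coord_le_norm1 x i))// /A; lra.
  have yA i : `|tnth y i| <= A by rewrite (le_trans (coord_le_norm1 y i))// /A; lra.
  apply: (le_trans (mono_lipschitz g A1 xA yA)); rewrite -/n.
  have AA : A ^+ (2 * n) <= (2 * n)`!%:R * expR 1 * (2^-1 * (expR (2 * norm1 x) + expR (2 * norm1 y))).
    apply: (le_trans (exprn_fact_expR _ (le_trans ler01 A1))).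
    rewrite -mulrA ler_wpM2l// /A -addrA expRD ler_wpM2l ?expR_ge0// expRD.
    rewrite !(mulrDl 1 1) !mul1r !expRD; have := sqr_ge0 (expR (norm1 x) - expR (norm1 y)); nra.
  rewrite mulr_sumr /B -/x -/y /sqdist mulr_sumr.
  have -> : eps * c * (2^-1 * (expR (2 * norm1 x) + expR (2 * norm1 y))) =
    \sum_(i < d) (eps * n%:R ^+ 2 * ((2 * n)`!%:R * expR 1 * (2^-1 * (expR (2 * norm1 x) + expR (2 * norm1 y))))).
    by rewrite sumr_const card_ord -[RHS]mulr_natl /c; ring.
  rewrite -big_split mulr_sumr; apply: ler_sum => i _ /=.
  set D := tnth x i - tnth y i.
  apply: (@le_trans _ _ (2^-1 * (eps^-1 * D ^+ 2 + eps * n%:R ^+ 2 * A ^+ (2 * n)))).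
    have -> : eps^-1 * D ^+ 2 + eps * n%:R ^+ 2 * A ^+ (2 * n) =
       2 * (n%:R * A ^+ n * `|D|) + eps^-1 * (`|D| - eps * (n%:R * A ^+ n)) ^+ 2.
      rewrite -[D ^+ 2]real_normK ?num_real// mul2n -addnn exprD.
      by field; rewrite gt_eqF.
    by rewrite mulrDr mulKf// lerDl mulr_ge0// mulr_ge0 ?sqr_ge0// invr_ge0 ltW.
  rewrite ler_wpM2l// lerD2l; apply: ler_wpM2l => //.
  by rewrite mulr_ge0 ?exprn_ge0// ltW.
rewrite /B RintegralZl//; last exact: intgD.
rewrite RintegralD// !RintegralZl//; last exact: intgD.
rewrite RintegralD//.
have -> : eps * (2^-1 * (S + d%:R * n%:R ^+ 2 * (2 * n)`!%:R * expR 1 * E1)) =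
  2^-1 * (eps^-1 * (S * eps ^+ 2) + eps * c * (2^-1 * (E1 + E1))).
  by rewrite /c; field; rewrite gt_eqF.
rewrite ler_wpM2l// lerD//.
  by rewrite ler_wpM2l// invr_ge0 ltW.
apply: ler_wpM2l; first by rewrite mulr_ge0// ltW.
by rewrite ler_wpM2l// lerD.
Qed.

End moment_difference.

(** * The moment recursion *)

Section wnorm.
Context {R : realType} {d : nat}.
Variable W : nat.
Implicit Types (p q : mpoly d R) (g a : multinom d).

(** Dual to the norm max |e_g| / W^|g| on moment errors (see [moment_functional_diff]). *)
Definition wnorm p : R := \sum_(a <- msupp p) `|mcoeff a p| * W%:R ^+ mdeg a.

Lemma wnormE p k : (msize p <= k)%N ->
  wnorm p = \sum_(a : bmultinom d k) `|mcoeff a p| * W%:R ^+ mdeg a.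
Proof.
move=> pk; rewrite /wnorm (ssrcomplements.big_mksub (bmultinom d k : subFinType _))/=.
- by rewrite big_rmcond//= => i; move/memN_msupp_eq0 => ->; rewrite normr0 mul0r.
- by rewrite msupp_uniq.
- by move=> i /msize_mdeg_lt /leq_trans; apply.
Qed.

Lemma wnorm_ge0 p : 0 <= wnorm p.
Proof. by rewrite sumr_ge0// => a _; rewrite mulr_ge0 ?exprn_ge0. Qed.

Lemma wnorm0 : wnorm 0 = 0.
Proof. by rewrite /wnorm msupp0 big_nil. Qed.

Lemma wnormD p q : wnorm (p + q) <= wnorm p + wnorm q.
Proof.
pose k := maxn (msize (p + q)) (maxn (msize p) (msize q)).
rewrite (@wnormE _ k) ?leq_maxl// (@wnormE p k); last by rewrite leq_max leq_maxl orbT.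
rewrite (@wnormE q k); last by rewrite leq_max leq_maxr orbT.
rewrite -big_split; apply: ler_sum => a _ /=; rewrite mcoeffD -mulrDl.
by rewrite ler_wpM2r ?exprn_ge0// ler_normD.
Qed.

Lemma wnormZ c p : wnorm (c *: p) = `|c| * wnorm p.
Proof.
pose k := maxn (msize (c *: p)) (msize p).
rewrite (@wnormE _ k) ?leq_maxl// (@wnormE p k) ?leq_maxr//.
by rewrite mulr_sumr; apply: eq_bigr => a _; rewrite mcoeffZ normrM mulrA.
Qed.

Lemma wnorm_sum (I : Type) (s : seq I) (Q : pred I) (F : I -> mpoly d R) :
  wnorm (\sum_(i <- s | Q i) F i) <= \sum_(i <- s | Q i) wnorm (F i).
Proof.
elim/big_ind2 : _ => [|x1 x2 y1 y2 h1 h2|//]; first by rewrite wnorm0.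
by apply: (le_trans (wnormD _ _)); exact: lerD.
Qed.

Lemma wnormMX p g : wnorm (mpolyX R g * p) = W%:R ^+ mdeg g * wnorm p.
Proof.
rewrite mulrC /wnorm (perm_big _ (msuppMX p g)) big_map mulr_sumr.
by apply: eq_bigr => a _; rewrite mcoeffMX mdegD exprD; ring.
Qed.

Lemma moment_functional_diff (mu nu : multinom d -> R) p e :
  (forall a, a \in msupp p -> `|mu a - nu a| <= e * W%:R ^+ mdeg a) ->
  `|moment_functional mu p - moment_functional nu p| <= e * wnorm p.
Proof.
move=> h; rewrite /moment_functional -sumrB /wnorm mulr_sumr big_seq [leRHS]big_seq.
apply: (le_trans (ler_norm_sum _ _ _)); apply: ler_sum => a ap.
by rewrite -mulrBr normrM mulrCA ler_wpM2l// h.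
Qed.

Lemma moment_functional_bound (mu : multinom d -> R) p e :
  (forall a, a \in msupp p -> `|mu a| <= e * W%:R ^+ mdeg a) ->
  `|moment_functional mu p| <= e * wnorm p.
Proof.
move=> h; have := @moment_functional_diff mu (fun=> 0) p e.
have -> : moment_functional (fun=> 0) p = 0.
  by rewrite /moment_functional big1// => a _; rewrite mulr0.
by rewrite subr0; apply => a ap; rewrite subr0 h.
Qed.

End wnorm.

(** * The generator on polynomials *)

Section generator_polynomial.
Context {R : realType} {d m : nat}.
Variables (pb : d.-tuple (mpoly d R)) (ps : 'M[mpoly d R]_(d, m)).
Implicit Types (g : multinom d).

Definition gen_poly g : mpoly d R :=
  \sum_i mderiv i (mpolyX R g) * tnth pb i +
  2^-1 *: \sum_i \sum_l mderiv l (mderiv i (mpolyX R g)) * (ps *m ps^T) i l.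

Lemma mderiv2X i l g : mderiv l (mderiv i (mpolyX R g)) =
  ((g i)%:R * ((g l)%:R - (i == l)%:R)) *: mpolyX R (mnm_sub (mnm_sub g (mnm1 i)) (mnm1 l)).
Proof.
rewrite mderivX mderivZ mderivX scalerA mnmBE mnm1E; congr (_ *: _).
have [->|_] := eqVneq i l; last by rewrite subn0 subr0.
case: (g l) => [|n]; first by rewrite !mul0r.
by rewrite natrB.
Qed.

(** An mRPC step is an explicit Euler step for the moment equations, with the approximate
    expectation in place of the true one. This form lets the weighted norm act on a single
    polynomial. *)
Lemma mrpc_stepE (ch : mrpc_choices d) L S h mu g :
  mrpc_step ch L S h pb ps mu g =
  mu g + h * moment_functional (approx_monomial ch L S mu) (gen_poly g).
Proof.
rewrite /mrpc_step /gen_poly moment_functionalD moment_functionalZ mulrDr addrA.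
congr (_ + _ + _).
  congr (_ * _); rewrite moment_functional_sum; apply: eq_bigr => i _.
  by rewrite mderivX -scalerAl moment_functionalZ.
rewrite -mulrA; congr (_ * (_ * _)).
rewrite exchange_big moment_functional_sum; apply: eq_bigr => i _.
rewrite exchange_big moment_functional_sum; apply: eq_bigr => l _ /=.
rewrite mderiv2X -scalerAl moment_functionalZ -mulr_sumr; congr (_ * _).
by rewrite mxE mulr_sumr moment_functional_sum; apply: eq_bigr => j _; rewrite mxE mulrA.
Qed.

Lemma meval_gen_poly g x :
  generator (vpoly_eval pb) (mxpoly_eval ps) g x = meval (tnth x) (gen_poly g).
Proof.
rewrite /generator /gen_poly mevalD mevalZ !raddf_sum/=; congr (_ + _ * _).
  by apply: eq_bigr => i _; rewrite mevalM tnth_mktuple.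
apply: eq_bigr => i _; rewrite raddf_sum; apply: eq_bigr => l _ /=.
rewrite mevalM; congr (_ * _); rewrite !mxE raddf_sum/=; apply: eq_bigr => j _.
by rewrite !mxE mevalM.
Qed.

Lemma sum_coord2 g (c : R) : \sum_i \sum_l (g i)%:R * (g l)%:R * c = (mdeg g)%:R ^+ 2 * c.
Proof.
rewrite mdegE natr_sum expr2 -mulrA mulr_suml; apply: eq_bigr => i _.
by rewrite mulrA mulr_sumr mulr_suml; apply: eq_bigr => l _.
Qed.

Lemma sum_coord g : \sum_i (g i)%:R = (mdeg g)%:R :> R.
Proof. by rewrite mdegE natr_sum. Qed.

Variables (W S : nat) (MB MS : R).
Hypotheses (W0 : (0 < W)%N) (MB0 : 0 <= MB) (MS0 : 0 <= MS).
Hypothesis hpb : forall i, wnorm W (tnth pb i) <= MB /\ (msize (tnth pb i) <= S.+1)%N.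
Hypothesis hps : forall i l, wnorm W ((ps *m ps^T) i l) <= MS /\
  (msize ((ps *m ps^T) i l) <= S.+1)%N.

Lemma pow_mderiv1 g i : (g i)%:R * W%:R ^+ mdeg (mnm_sub g (mnm1 i)) * W%:R = (g i)%:R * W%:R ^+ mdeg g :> R.
Proof.
have [->|gi] := eqVneq (g i) 0%N; first by rewrite !mul0r.
have E : g = mnm_add (mnm1 i) (mnm_sub g (mnm1 i)) by rewrite addmC submK// lep1mP.
by rewrite {4}E mdegD mdeg1 add1n exprS; ring.
Qed.

Lemma pow_mderiv2 g i l : ((g i)%:R * ((g l)%:R - (i == l)%:R)) *
    W%:R ^+ mdeg (mnm_sub (mnm_sub g (mnm1 i)) (mnm1 l)) * W%:R ^+ 2 <=
  (g i)%:R * (g l)%:R * W%:R ^+ mdeg g :> R /\ 0 <= (g i)%:R * ((g l)%:R - (i == l)%:R) :> R.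
Proof.
pose g' := mnm_sub g (mnm1 i).
have E : (g i)%:R * ((g l)%:R - (i == l)%:R) = (g i)%:R * (g' l)%:R :> R.
  rewrite /g' mnmBE mnm1E; have [->|_] := eqVneq i l; last by rewrite subn0 subr0.
  by case: (g l) => [|n]; rewrite ?mul0r// natrB.
rewrite E -/g'; split; last by rewrite mulr_ge0.
have := pow_mderiv1 g' l; rewrite expr2 => E2.
have -> : (g i)%:R * (g' l)%:R * W%:R ^+ mdeg (mnm_sub g' (mnm1 l)) * (W%:R * W%:R) =
  (g i)%:R * ((g' l)%:R * W%:R ^+ mdeg (mnm_sub g' (mnm1 l)) * W%:R) * W%:R :> R by ring.
rewrite E2; have -> : (g i)%:R * ((g' l)%:R * W%:R ^+ mdeg g') * W%:R =
  (g' l)%:R * ((g i)%:R * W%:R ^+ mdeg g' * W%:R) :> R by ring.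
rewrite pow_mderiv1 mulrA ler_wpM2r ?exprn_ge0// mulrC ler_wpM2l// ler_nat.
by rewrite /g' mnmBE leq_subr.
Qed.

(** [pow_mderiv1] and [pow_mderiv2] clear the weights lost by differentiation; the sums of g_i and
    of g_i g_l, at most W and W^2, are then cancelled, and the masses of the coefficients remain. *)
Lemma wnorm_gen_poly g : (mdeg g <= W)%N -> wnorm W (gen_poly g) <= W%:R ^+ mdeg g * (MB + 2^-1 * MS).
Proof.
move=> gW; have W0' : 0 < W%:R :> R by rewrite ltr0n.
have gWR : (mdeg g)%:R <= W%:R :> R by rewrite ler_nat.
rewrite mulrDr; apply: (le_trans (wnormD _ _ _)); apply: lerD.
  rewrite -(ler_pM2r W0'); apply: (le_trans (ler_wpM2r (ltW W0') (wnorm_sum _ _ _ _))).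
  rewrite mulr_suml (@le_trans _ _ (\sum_i (g i)%:R * W%:R ^+ mdeg g * MB))//.
    apply: ler_sum => i _; rewrite mderivX -scalerAl wnormZ wnormMX ger0_norm//.
    have [h _] := hpb i.
    have -> : (g i)%:R * (W%:R ^+ mdeg (mnm_sub g (mnm1 i)) * wnorm W (tnth pb i)) * W%:R =
      ((g i)%:R * W%:R ^+ mdeg (mnm_sub g (mnm1 i)) * W%:R) * wnorm W (tnth pb i) :> R by ring.
    by rewrite pow_mderiv1 ler_wpM2l// mulr_ge0 ?exprn_ge0.
  rewrite -!mulr_suml sum_coord.
  have -> : W%:R ^+ mdeg g * MB * W%:R = W%:R * (W%:R ^+ mdeg g * MB) :> R by ring.
  by rewrite -mulrA ler_wpM2r// mulr_ge0 ?exprn_ge0.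
rewrite wnormZ ger0_norm// mulrCA ler_wpM2l//.
have W2 : 0 < W%:R ^+ 2 :> R by rewrite exprn_gt0.
rewrite -(ler_pM2r W2); apply: (@le_trans _ _ ((\sum_i \sum_l (g i)%:R * (g l)%:R * W%:R ^+ mdeg g * MS))).
  apply: (le_trans (ler_wpM2r (ltW W2) (wnorm_sum _ _ _ _))); rewrite mulr_suml.
  apply: ler_sum => i _; apply: (le_trans (ler_wpM2r (ltW W2) (wnorm_sum _ _ _ _))); rewrite mulr_suml.
  apply: ler_sum => l _; have [h1 h2] := pow_mderiv2 g i l; have [h3 _] := hps i l.
  rewrite mderiv2X -scalerAl wnormZ wnormMX (ger0_norm h2).
  set c := (g i)%:R * (_ - _) in h1 h2 *.
  set e := mdeg (mnm_sub _ _) in h1 *.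
  have -> : c * (W%:R ^+ e * wnorm W ((ps *m ps^T) i l)) * W%:R ^+ 2 =
     c * W%:R ^+ e * W%:R ^+ 2 * wnorm W ((ps *m ps^T) i l) by ring.
  apply: ler_pM; rewrite ?wnorm_ge0//.
  by rewrite mulr_ge0 ?exprn_ge0// mulr_ge0 ?exprn_ge0.
have -> : \sum_i \sum_l (g i)%:R * (g l)%:R * W%:R ^+ mdeg g * MS =
   (mdeg g)%:R ^+ 2 * (W%:R ^+ mdeg g * MS) :> R.
  rewrite -sum_coord2; apply: eq_bigr => i _; apply: eq_bigr => l _; ring.
rewrite mulrC ler_wpM2l ?mulr_ge0 ?exprn_ge0//.
by rewrite lerXn2r ?nnegrE.
Qed.

Lemma msupp_gen_poly g a : a \in msupp (gen_poly g) -> (mdeg a <= mdeg g + S)%N.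
Proof.
rewrite mcoeff_msupp => h; rewrite leqNgt; apply: contraNN h => ag; apply/eqP.
have key (c : R) g' (p : mpoly d R) : (msize p <= S.+1)%N -> (mdeg g' <= mdeg g)%N ->
    mcoeff a (c *: mpolyX R g' * p) = 0.
  move=> pS gg; apply/eqP; rewrite mcoeff_eq0 -scalerAl.
  apply/negP => /msuppZ_le; rewrite mulrC (perm_mem (msuppMX p g')) => /mapP[a' a'p E].
  have := msize_mdeg_lt a'p; move: ag; rewrite E mdegD => h1 h2.
  have := leq_trans h2 pS; rewrite ltnS => h3.
  by have := leq_trans h1 (leq_add gg h3); rewrite ltnn.
rewrite /gen_poly mcoeffD mcoeffZ !raddf_sum/= !big1 ?mulr0 ?addr0// => i _.
  rewrite raddf_sum/= big1// => l _; rewrite mderiv2X; apply: key; first by have [] := hps i l.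
  by rewrite (leq_trans (mdegB _ _))// mdegB.
by rewrite mderivX; apply: key; [have [] := hpb i|rewrite mdegB].
Qed.

Lemma mono_le_W g x : (mdeg g <= W)%N -> `|mono g x| <= W%:R ^+ mdeg g * expR (norm1 x) :> R.
Proof.
move=> gW; apply: (le_trans (mono_bound g (coord_le_norm1 x))).
by apply: pow_le_expR => //; exact: norm1_ge0.
Qed.

Lemma meval_gen_poly_bound g x : (mdeg g + S <= W)%N ->
  `|meval (tnth x) (gen_poly g)| <= W%:R ^+ mdeg g * (MB + 2^-1 * MS) * expR (norm1 x).
Proof.
move=> gW; rewrite meval_moment.
have := @moment_functional_bound _ _ W (fun a => mono a x) (gen_poly g) (expR (norm1 x)).
move=> h; apply: (le_trans (h _)).
  move=> a ag; rewrite mulrC; apply: mono_le_W.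
  exact: leq_trans (msupp_gen_poly ag) gW.
rewrite mulrC ler_wpM2r ?expR_ge0// wnorm_gen_poly//.
by rewrite (leq_trans _ gW)// leq_addr.
Qed.

(** The counterpart of [meval_gen_poly_bound] for coefficients of linear growth. Together they
    control the discrepancy outside the cube, where the truncated scheme does not follow the
    polynomials. *)
Lemma generator_bound (K : R) b s g x : 0 <= K -> @admissible R d m K b s -> (mdeg g <= W)%N ->
  `|generator b s g x| <= W%:R ^+ mdeg g * (K + K ^+ 2) * expR (2 * norm1 x).
Proof.
move=> K0 [_ _ gb gs] gW; have W0' : 0 < W%:R :> R by rewrite ltr0n.
have N0 := norm1_ge0 x; set N := norm1 x in N0 *; have gWR : (mdeg g)%:R <= W%:R :> R by rewrite ler_nat.
have e0 := expR_ge0 N.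
have B1 : `|\sum_i mono_deriv i g x * tnth (b x) i| <= W%:R ^+ mdeg g * expR N * (K * (N + 1)).
  rewrite -(ler_pM2r W0').
  apply: (le_trans (ler_wpM2r (ltW W0') (ler_norm_sum _ _ _))); rewrite mulr_suml.
  rewrite (@le_trans _ _ (\sum_i (g i)%:R * (W%:R ^+ mdeg g * expR N * (K * (N + 1)))))//.
    apply: ler_sum => i _; rewrite /mono_deriv mderivX mevalZ meval_mono !normrM normr_nat.
    have h : `|mono (mnm_sub g (mnm1 i)) x| <= W%:R ^+ mdeg (mnm_sub g (mnm1 i)) * expR N.
      by apply: mono_le_W; rewrite (leq_trans (mdegB _ _)).
    have -> : (g i)%:R * (W%:R ^+ mdeg g * expR N * (K * (N + 1))) =
      (g i)%:R * (W%:R ^+ mdeg (mnm_sub g (mnm1 i)) * expR N) * (K * (N + 1)) * W%:R.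
      rewrite -[RHS]mulrA; have := pow_mderiv1 g i; set p1 := _ ^+ mdeg (mnm_sub _ _) => E.
      transitivity ((g i)%:R * W%:R ^+ mdeg g * expR N * (K * (N + 1))); first by ring.
      by rewrite -E; ring.
    rewrite ler_wpM2r ?(ltW W0')//; apply: ler_pM; rewrite ?mulr_ge0//.
    by rewrite ler_wpM2l.
  by rewrite -mulr_suml sum_coord [leRHS]mulrC ler_wpM2r// !mulr_ge0 ?exprn_ge0// addr_ge0.
have B2 : `|\sum_i \sum_l mono_deriv2 i l g x * (s x *m (s x)^T) i l| <= W%:R ^+ mdeg g * expR N * K ^+ 2.
  have W2 : 0 < W%:R ^+ 2 :> R by rewrite exprn_gt0.
  rewrite -(ler_pM2r W2).
  apply: (le_trans (ler_wpM2r (ltW W2) (ler_norm_sum _ _ _))); rewrite mulr_suml.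
  rewrite (@le_trans _ _ (\sum_i \sum_l (g i)%:R * (g l)%:R * (W%:R ^+ mdeg g * expR N * K ^+ 2)))//.
    apply: ler_sum => i _; apply: (le_trans (ler_wpM2r (ltW W2) (ler_norm_sum _ _ _))); rewrite mulr_suml.
    apply: ler_sum => l _; rewrite /mono_deriv2 mderiv2X mevalZ meval_mono normrM.
    have [h1 h2] := pow_mderiv2 g i l; rewrite normrM (ger0_norm h2).
    set c := (g i)%:R * (_ - _) in h1 h2 *.
    have h : `|mono (mnm_sub (mnm_sub g (mnm1 i)) (mnm1 l)) x| <=
        W%:R ^+ mdeg (mnm_sub (mnm_sub g (mnm1 i)) (mnm1 l)) * expR N.
      by apply: mono_le_W; rewrite (leq_trans (mdegB _ _))// (leq_trans (mdegB _ _)).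
    set e := mdeg (mnm_sub _ _) in h1 h *.
    have hs : `|(s x *m (s x)^T) i l| <= K ^+ 2.
      rewrite mxE (eq_bigr (fun j => s x i j * s x l j)); last by move=> j _; rewrite mxE.
      have s1 := gs x i; have s2 := gs x l.
      apply: (le_trans (ler_norm_sum _ _ _)).
      apply: (@le_trans _ _ (\sum_j 2^-1 * (s x i j ^+ 2 + s x l j ^+ 2))).
        apply: ler_sum => j _; rewrite normrM -(real_normK (num_real (s x i j))) -(real_normK (num_real (s x l j))).
        have := sqr_ge0 (`|s x i j| - `|s x l j|); nra.
      rewrite -mulr_sumr big_split/=; lra.
    apply: (@le_trans _ _ (c * (W%:R ^+ e * expR N) * K ^+ 2 * W%:R ^+ 2)).
      rewrite ler_wpM2r ?(ltW W2)//; apply: ler_pM => //.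
        by apply: mulr_ge0.
      exact: ler_wpM2l.
    have -> : c * (W%:R ^+ e * expR N) * K ^+ 2 * W%:R ^+ 2 = (c * W%:R ^+ e * W%:R ^+ 2) * (expR N * K ^+ 2) by ring.
    have -> : (g i)%:R * (g l)%:R * (W%:R ^+ mdeg g * expR N * K ^+ 2) =
      ((g i)%:R * (g l)%:R * W%:R ^+ mdeg g) * (expR N * K ^+ 2) by ring.
    by rewrite ler_wpM2r// mulr_ge0// exprn_ge0.
  have -> : \sum_i \sum_l (g i)%:R * (g l)%:R * (W%:R ^+ mdeg g * expR N * K ^+ 2) =
     (mdeg g)%:R ^+ 2 * (W%:R ^+ mdeg g * expR N * K ^+ 2) :> R.
    by rewrite sum_coord2.
  rewrite mulrC ler_wpM2l ?mulr_ge0 ?exprn_ge0//.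
  by rewrite lerXn2r ?nnegrE.
pose A1 := \sum_i mono_deriv i g x * tnth (b x) i.
pose A2 := \sum_i \sum_l mono_deriv2 i l g x * (s x *m (s x)^T) i l.
rewrite -/A1 in B1; rewrite -/A2 in B2; rewrite -[generator b s g x]/(A1 + 2^-1 * A2).
have h2 : 0 <= (2^-1 : R) <= 1 by apply/andP; split; lra.
case/andP: h2 => h2 h2'.
have {}B2 : `|2^-1 * A2| <= W%:R ^+ mdeg g * expR N * K ^+ 2.
  by rewrite normrM (ger0_norm h2) (le_trans _ B2)// ler_piMl.
apply: (le_trans (ler_normD A1 (2^-1 * A2))).
have E2 : expR (2 * N) = expR N * expR N by rewrite -expRD; congr expR; ring.
have N1 : N + 1 <= expR N by rewrite addrC expR_ge1Dx.
have P0 : 0 <= W%:R ^+ mdeg g * expR N by rewrite mulr_ge0 ?exprn_ge0.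
apply: (@le_trans _ _ (W%:R ^+ mdeg g * expR N * (K * (N + 1) + K ^+ 2))).
  by rewrite mulrDr lerD.
rewrite E2; have -> : W%:R ^+ mdeg g * (K + K ^+ 2) * (expR N * expR N) =
  W%:R ^+ mdeg g * expR N * (K * expR N + K ^+ 2 * expR N) by ring.
rewrite ler_wpM2l// lerD//; first by rewrite ler_wpM2l.
by rewrite ler_peMr ?exprn_ge0//; lra.
Qed.

End generator_polynomial.

Section mrpc_error.
Context {R : realType} {d m : nat} (ch : mrpc_choices d).
Variables (L S : nat) (h : R) (pb : d.-tuple (mpoly d R)) (ps : 'M[mpoly d R]_(d, m)).
Variables (MB MS : R).
Local Notation W := (2 * L + 2 * S)%N.
Local Notation J := (2 * L + S)%N.
Hypotheses (L0 : (0 < L)%N) (SL : (S <= L)%N) (h0 : 0 <= h) (MB0 : 0 <= MB) (MS0 : 0 <= MS).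
Hypothesis hpb : forall i, wnorm W (tnth pb i) <= MB /\ (msize (tnth pb i) <= S.+1)%N.
Hypothesis hps : forall i l, wnorm W ((ps *m ps^T) i l) <= MS /\
  (msize ((ps *m ps^T) i l) <= S.+1)%N.
Variables (n : nat) (a e : nat -> multinom d -> R) (mu0 : multinom d -> R).
Let r k := mrpc_iter ch L S h pb ps mu0 k.
Let am k := approx_monomial ch L S (r k).
Variables (k1 k2 eout : R).
Hypotheses (k10 : 0 <= k1) (k20 : 0 <= k2) (eout0 : 0 <= eout).
Hypothesis pos : forall k, (k <= n)%N -> hankel_posdef L (r k).
Hypothesis init : forall g, (mdeg g <= J)%N -> a 0 g = mu0 g.
Hypothesis weak : forall k g, (k < n)%N -> (mdeg g <= J)%N ->
  `|a k.+1 g - (a k g + h * e k g)| <= W%:R ^+ mdeg g * (h * k1).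
Hypothesis tail : forall k g, (k < n)%N -> (mdeg g <= J)%N ->
  `|e k g - moment_functional (a k) (gen_poly pb ps g)| <= W%:R ^+ mdeg g * k2.
Hypothesis out : forall k g, (k <= n)%N -> (J < mdeg g <= W)%N ->
  `|a k g - am k g| <= W%:R ^+ mdeg g * eout.

Let M := MB + 2^-1 * MS.

(* In the weighted norm [max_g |e_g| / W^|g|] the generator is bounded by [M], so that
   the moment errors satisfy a discrete Gronwall inequality. *)
Lemma mrpc_error k g : (k <= n)%N -> (mdeg g <= W)%N ->
  `|a k g - am k g| <= expR (k%:R * h * M) * (eout + k%:R * h * (k1 + k2)) * W%:R ^+ mdeg g.
Proof.
have M0 : 0 <= M by rewrite /M addr_ge0 ?mulr_ge0.
have W0 : (0 < W)%N by rewrite addn_gt0 muln_gt0 L0.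
have kk : 0 <= k1 + k2 by rewrite addr_ge0.
(* Errors in degrees above [J] are not propagated by the recursion; at each time they are supplied
   by [out]. *)
have outb j g' : (j <= n)%N -> (J < mdeg g' <= W)%N ->
    `|a j g' - am j g'| <= expR (j%:R * h * M) * (eout + j%:R * h * (k1 + k2)) * W%:R ^+ mdeg g'.
  move=> jn gJ; apply: (le_trans (out jn gJ)); rewrite mulrC ler_wpM2r ?exprn_ge0//.
  have j1 : 0 <= j%:R * h * (k1 + k2) by rewrite !mulr_ge0.
  have j2 : 1 <= expR (j%:R * h * M) by rewrite -expR0 ler_expR !mulr_ge0.
  apply: (@le_trans _ _ (eout + j%:R * h * (k1 + k2))); first by rewrite lerDl.
  by apply: ler_peMl => //; exact: addr_ge0.
elim: k g => [|k IH] g kn gW.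
  have [gJ|gJ] := leqP (mdeg g) J; last by apply: outb; rewrite // gJ.
  rewrite /am approx_monomial_small ?init ?subrr ?normr0//; last exact: pos.
  by rewrite !mul0r expR0 addr0 mul1r mulr_ge0 ?exprn_ge0.
have [gJ|gJ] := leqP (mdeg g) J; last by apply: outb; rewrite // gJ.
have kn' := ltnW kn.
rewrite /am approx_monomial_small//; last exact: pos.
have -> : r k.+1 g = am k g + h * moment_functional (am k) (gen_poly pb ps g).
  by rewrite /r /= mrpc_stepE -/(r k) /am (approx_monomial_small ch (pos kn'))//.
set G := gen_poly pb ps g.
have IHg := IH g kn' gW.
set ek := expR _ * (_ + _) in IHg IH.
have ek0 : 0 <= ek by rewrite mulr_ge0 ?expR_ge0// addr_ge0// !mulr_ge0.
have h1 := weak kn gJ; have h2 := tail kn gJ.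
have h3 : `|moment_functional (a k) G - moment_functional (am k) G| <= W%:R ^+ mdeg g * (ek * M).
  apply: (le_trans (@moment_functional_diff _ _ W _ _ _ ek _)).
    move=> c cG; apply: IH => //; have := msupp_gen_poly hpb hps cG.
    by move=> cS; apply: (leq_trans cS); rewrite (leq_trans (leq_add gJ (leqnn S)))// -addnA addnn -mul2n.
  by rewrite [leRHS]mulrCA ler_wpM2l//; exact: (wnorm_gen_poly W0 MB0 MS0 hpb hps gW).
set V := W%:R ^+ mdeg g in IHg h1 h2 h3 *.
have V0 : 0 <= V by rewrite exprn_ge0.
(* In this order: weak error of one step, inherited error, tail outside the cube, and the generator
   acting on the previous errors, where degrees up to J + S = W occur. *)
have -> : a k.+1 g - (am k g + h * moment_functional (am k) G) =
  (a k.+1 g - (a k g + h * e k g)) + (a k g - am k g) + h * (e k g - moment_functional (a k) G)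
  + h * (moment_functional (a k) G - moment_functional (am k) G) by ring.
have b1 : `|h * (e k g - moment_functional (a k) G)| <= h * (V * k2).
  by rewrite normrM (ger0_norm h0) ler_wpM2l.
have b2 : `|h * (moment_functional (a k) G - moment_functional (am k) G)| <= h * (V * (ek * M)).
  by rewrite normrM (ger0_norm h0) ler_wpM2l.
apply: (@le_trans _ _ (V * (h * k1) + ek * V + h * (V * k2) + h * (V * (ek * M)))).
  apply: (le_trans (ler_normD _ _)); rewrite lerD//.
  apply: (le_trans (ler_normD _ _)); rewrite lerD//.
  by apply: (le_trans (ler_normD _ _)); rewrite lerD.
have -> : V * (h * k1) + ek * V + h * (V * k2) + h * (V * (ek * M)) =
  V * ((1 + h * M) * ek + h * (k1 + k2)) by ring.
rewrite mulrC ler_wpM2r// -(natr1 k).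
have -> : (k%:R + 1) * h * M = k%:R * h * M + h * M by ring.
rewrite expRD /ek; set E1 := expR (k%:R * h * M); set E2 := expR (h * M).
have e1 : 1 + h * M <= E2 by exact: expR_ge1Dx.
have E11 : 1 <= E1 by rewrite -expR0 ler_expR !mulr_ge0.
have E21 : 1 <= E2 by rewrite -expR0 ler_expR mulr_ge0.
set q := h * (k1 + k2); have q0 : 0 <= q by rewrite mulr_ge0.
set Q := eout + k%:R * h * (k1 + k2).
have Q0 : 0 <= Q by rewrite addr_ge0// !mulr_ge0.
have -> : eout + (k%:R + 1) * h * (k1 + k2) = Q + q by rewrite /Q /q; ring.
apply: (@le_trans _ _ (E2 * (E1 * Q) + E1 * E2 * q)); last by rewrite le_eqVlt; apply/orP; left; apply/eqP; ring.
rewrite lerD//; first by rewrite ler_wpM2r// mulr_ge0//; lra.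
by rewrite ler_peMl//; nra.
Qed.

End mrpc_error.

(** * All errors at a fixed step size *)

Section fixed_step.
Context {R : realType} {dO} {Omega : measurableType dO} {d m : nat}.
Variables (P : probability Omega R) (u0 : {RV P >-> d.-tuple R}) (z : nat -> {RV P >-> m.-tuple R}).
Hypothesis noise : noise_assumption u0 z.
Variables (h K T delta0 M0 : R).
Hypotheses (d0 : (0 < d)%N) (h0 : 0 < h) (h1 : h <= 1) (K0 : 0 <= K).
Hypotheses (T0 : 0 <= T) (delta00 : 0 < delta0) (init : initial_assumption u0 delta0 M0).
Variables (b : d.-tuple R -> d.-tuple R) (s : d.-tuple R -> 'M[R]_(d, m)).
Variables (pb : d.-tuple (mpoly d R)) (ps : 'M[mpoly d R]_(d, m)) (rad eps : R).
Hypothesis bG : forall x, enorm (b x) <= K * (enorm x + 1).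
Hypothesis sB : forall x, fnorm (s x) <= K.
Hypothesis bL : forall x y, edist (b x) (b y) <= K * edist x y.
Hypothesis sL : forall x y, fnorm (s x - s y) <= K * edist x y.
Hypothesis eps0 : 0 < eps.
Hypothesis eps1 : eps <= 1.
Hypothesis close : forall x, cube rad x ->
  edist (b x) (vpoly_eval pb x) <= eps /\ fnorm (s x - mxpoly_eval ps x) <= eps.

Let K1 := 2 * K + 2.
Let EB t := @exp_bound R d K1 T delta0 M0 t.
Let tb := trunc_drift b pb rad.
Let ts := trunc_diff s ps rad.
Let v k := euler u0 z h b s k.
Let vt k := euler u0 z h tb ts k.

Let K10 : 0 <= K1. Proof. by rewrite /K1; have := K0; lra. Qed.
Let eps01 : 0 <= eps <= 1. Proof. by rewrite eps1 ltW. Qed.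

Let adm : admissible K1 b s.
Proof. exact: (admissible_coef K0 bG sB bL sL). Qed.

Let admt : admissible K1 tb ts.
Proof. exact: (admissible_trunc K0 bG sB bL sL eps01 close). Qed.

Lemma euler_law_exp k t : k%:R * h <= T -> 0 <= t ->
  intg P (fun w => expR (t * norm1 (v k w))) /\
  \int[P]_w expR (t * norm1 (v k w)) <= EB (t * d%:R).
Proof. by move=> kT t0; exact: (euler_norm1_exp noise d0 h0 K10 T0 delta00 init adm kT t0). Qed.

Let vt_exp k t : k%:R * h <= T -> 0 <= t ->
  intg P (fun w => expR (t * norm1 (vt k w))) /\
  \int[P]_w expR (t * norm1 (vt k w)) <= EB (t * d%:R).
Proof. by move=> kT t0; exact: (euler_norm1_exp noise d0 h0 K10 T0 delta00 init admt kT t0). Qed.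

Let EB0 t : 0 <= EB t. Proof. exact: (exp_bound_ge0 K1 T init). Qed.

Let mvt k : measurable_fun setT (vt k). Proof. exact: (measurable_euler u0 z h admt). Qed.

Lemma euler_trunc_difference k g : k%:R * h <= T ->
  `|\int[P]_w mono g (v k w) - \int[P]_w mono g (vt k w)| <=
  eps * (2^-1 * (6 * T * expR (T * (1 + 6 * K1 ^+ 2)) +
    d%:R * (mdeg g)%:R ^+ 2 * (2 * mdeg g)`!%:R * expR 1 * EB (2 * d%:R))).
Proof.
move=> kT; have mv : measurable_fun setT (v k) by exact: (measurable_euler u0 z h adm).
apply: (moment_difference mv (@mvt k) eps0 _ (euler_law_exp kT _) (vt_exp kT _)) => //.
have := @euler_sqdist _ _ _ _ _ _ _ _ noise _ _ h0 h1 K10 _ _ _ _ adm admt eps T k kT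
  (trunc_drift_lipschitz K0 bL eps01 close) (trunc_diff_lipschitz K0 sL eps01 close).
by rewrite -[6 * T * eps ^+ 2 * _]mulrA [eps ^+ 2 * _]mulrC mulrA.
Qed.

Variables (ch : mrpc_choices d) (L S : nat) (MB MS : R).
Local Notation W := (2 * L + 2 * S)%N.
Local Notation J := (2 * L + S)%N.
Hypotheses (L0 : (0 < L)%N) (SL : (S <= L)%N) (MB0 : 0 <= MB) (MS0 : 0 <= MS).
Hypothesis hpb : forall i, wnorm W (tnth pb i) <= MB /\ (msize (tnth pb i) <= S.+1)%N.
Hypothesis hps : forall i l, wnorm W ((ps *m ps^T) i l) <= MS /\
  (msize ((ps *m ps^T) i l) <= S.+1)%N.
Variables (n : nat) (Cd theta q : R).
Hypotheses (nT : n%:R * h <= T) (Cd0 : 0 <= Cd) (theta0 : 0 <= theta) (q1 : 1 <= q).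
Hypothesis qW : q ^+ 2 <= W%:R.
Let r k := mrpc_iter ch L S h pb ps (initial_moment u0) k.
Hypothesis pos : forall k, (k <= n)%N -> hankel_posdef L (r k).
Hypothesis stab : forall k g, (k <= n)%N -> (J < mdeg g <= W)%N ->
  `|approx_monomial ch L S (r k) g| <= Cd * Num.sqrt (mdeg g)`!%:R.

Let M := MB + 2^-1 * MS.

Definition trunc_step_error : R := W%:R ^+ 3 * Num.sqrt h *
  (@weak_const R d K1 * EB (2 * (1 + K1) * d%:R)).
(** Exponential Chebyshev inequality outside the cube with a free exponent [theta]; the additional 2
    pays for the growth of the generator. *)
Definition tail_error : R :=
  (M + K1 + K1 ^+ 2) * (expR (- (theta * rad)) * EB ((theta + 2) * d%:R)).
(** In degrees above [J] the moments of the scheme and those of the algorithm are each at most a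
    constant times W^|g| q^(-|g|), so their difference is small without any comparison. The
    parameter [q] is free subject to q^2 <= W. *)
Definition high_error : R := (Cd + EB (q * d%:R)) * (q ^+ J)^-1.

Lemma trunc_rpc_error k g : (k <= n)%N -> (mdeg g <= W)%N ->
  `|\int[P]_w mono g (vt k w) - approx_monomial ch L S (r k) g| <=
  expR (T * M) * (high_error + T * (trunc_step_error + tail_error)) * W%:R ^+ mdeg g.
Proof.
move=> kn gW.
have W0 : (0 < W)%N by rewrite addn_gt0 muln_gt0 L0.
have W1 : 1 <= W%:R :> R by rewrite ler1n.
have MM0 : 0 <= M by rewrite /M addr_ge0 ?mulr_ge0.
have MK0 : 0 <= M + K1 + K1 ^+ 2 by apply: addr_ge0 (addr_ge0 MM0 K10) (exprn_ge0 _ K10).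
have jT j : (j <= n)%N -> j%:R * h <= T.
  by move=> jn; apply: le_trans nT; rewrite ler_wpM2r ?ler_nat// ltW.
have wc0 : 0 <= @weak_const R d K1.
  by rewrite /weak_const mulr_ge0 ?expR_ge0// addr_ge0// !mulr_ge0 ?expR_ge0.
have e10 : 0 <= trunc_step_error.
  by apply: mulr_ge0 (mulr_ge0 wc0 (EB0 _)); rewrite mulr_ge0 ?sqrtr_ge0 ?exprn_ge0.
have e20 : 0 <= tail_error.
  apply: mulr_ge0 (mulr_ge0 (expR_ge0 _) (EB0 _)).
  exact: MK0.
have q0 : 0 < q by exact: lt_le_trans ltr01 q1.
have e30 : 0 <= high_error.
  by apply: mulr_ge0 (addr_ge0 Cd0 (EB0 _)) _; rewrite invr_ge0 exprn_ge0// ltW.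
have Iexp j t : (j <= n)%N -> 0 <= t -> intg P (fun w => expR (t * norm1 (vt j w))).
  by move=> jn t0; have [] := vt_exp (jT j jn) t0.
have Imono j g' : (j <= n)%N -> intg P (fun w => mono g' (vt j w)).
  by move=> jn; apply: intg_mono; [exact: mvt|exact: Iexp].
have Imeval j (p : mpoly d R) : (j <= n)%N -> intg P (fun w => meval (tnth (vt j w)) p) /\
    \int[P]_w meval (tnth (vt j w)) p = moment_functional (fun g' => \int[P]_w mono g' (vt j w)) p.
  move=> jn; have E : (fun w => meval (tnth (vt j w)) p) =
      fun w => \sum_(g' <- msupp p) mcoeff g' p * mono g' (vt j w).
    by apply/funext => w; rewrite meval_moment.
  have I g' : intg P (fun w => mcoeff g' p * mono g' (vt j w)) by apply: intgZ; exact: Imono.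
  rewrite E; split; first exact: intg_sum.
  rewrite Rexp_sum// /moment_functional; apply: eq_bigr => g' _.
  by rewrite RintegralZl//; exact: Imono.
have Igen j g' : (j <= n)%N -> (mdeg g' <= W)%N -> intg P (fun w => generator tb ts g' (vt j w)).
  move=> jn g'W; apply: (intg_le _ _ (intgZ (W%:R ^+ mdeg g' * (K1 + K1 ^+ 2)) (@Iexp j 2 jn _))) => //.
    exact: (measurableT_comp (measurable_generator admt g')).
  by move=> w; exact: (generator_bound W0).
have := @mrpc_error R d m ch L S h pb ps MB MS L0 SL (ltW h0) MB0 MS0 hpb hps n
  (fun j g' => \int[P]_w mono g' (vt j w)) (fun j g' => \int[P]_w generator tb ts g' (vt j w))
  (initial_moment u0) trunc_step_error tail_error high_error e10 e20 e30 pos.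
(* The truncated scheme starts from [u0], so the initial moments coincide by definition. *)
move=> H; have {}H := H (fun g' _ => erefl).
apply: (@le_trans _ _ (expR (k%:R * h * M) * (high_error + k%:R * h * (trunc_step_error + tail_error)) *
    W%:R ^+ mdeg g)); last first.
  rewrite ler_wpM2r ?exprn_ge0//; have kT := jT k kn.
  have kh0 : 0 <= k%:R * h by rewrite mulr_ge0// ltW.
  apply: ler_pM; rewrite ?expR_ge0//.
  - by rewrite addr_ge0// mulr_ge0// addr_ge0.
  - by rewrite ler_expR ler_wpM2r.
  - by rewrite lerD2l ler_wpM2r// addr_ge0.
apply: H => // {k kn g gW} k g kn gW.
- have gW' : (mdeg g <= W)%N by rewrite (leq_trans gW)// leq_add2l leq_pmull.
  have kn' := ltnW kn.
  have := @mono_step R dO Omega d m P (z k) (noise.1 k) h K1 d0 h0 h1 K10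
    (euler_mfun u0 z h admt k) (@euler_indep R dO Omega d m P u0 z noise h K1 tb tb ts ts admt admt k) tb ts admt g W W0 gW'
    (Imono k.+1 g kn) (Imono k g kn') (Igen k g kn' gW').
  have t0 : 0 <= 2 * (1 + K1) by rewrite mulr_ge0// addr_ge0.
  have [I1 E1] := vt_exp (jT k kn') t0.
  move=> /(_ I1) hh; apply: (le_trans hh).
  have -> : W%:R ^+ mdeg g * (h * trunc_step_error) = W%:R ^+ (mdeg g + 3) * (h * Num.sqrt h) *
     (@weak_const R d K1 * EB (2 * (1 + K1) * d%:R)) by rewrite /trunc_step_error exprD; ring.
  by rewrite ler_wpM2l ?mulr_ge0 ?exprn_ge0 ?sqrtr_ge0 ?(ltW h0)// ler_wpM2l.
- have gW' : (mdeg g <= W)%N by rewrite (leq_trans gW)// leq_add2l leq_pmull.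
  have gS : (mdeg g + S <= W)%N by rewrite (leq_trans (leq_add gW (leqnn S)))// -addnA addnn -mul2n.
  have kn' := ltnW kn.
  have [I1 <-] := Imeval k (gen_poly pb ps g) kn'.
  have I2 := Igen k g kn' gW'; rewrite -RintegralB//.
  have t20 : 0 <= theta + 2 by rewrite addr_ge0.
  have [I3 E3] := vt_exp (jT k kn') t20.
  set c := W%:R ^+ mdeg g * (M + K1 + K1 ^+ 2) * expR (- (theta * rad)).
  have c0 : 0 <= c by apply: mulr_ge0 (mulr_ge0 (exprn_ge0 _ _) MK0) (expR_ge0 _).
  apply: (@le_trans _ _ (\int[P]_w (c * expR ((theta + 2) * norm1 (vt k w))))); last first.
    rewrite RintegralZl// /tail_error -/EB (_ : W%:R ^+ mdeg g * _ = c * EB ((theta + 2) * d%:R)).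
      exact: ler_wpM2l.
    by rewrite /c; ring.
  apply: Rexp_abs_le => //; [exact: intgB|exact: intgZ|].
  move=> w; set x := vt k w.
  have [xc|xc] := pselect (cube rad x).
    have [t1 t2] := trunc_in b s pb ps xc.
    have -> : generator tb ts g x = generator (vpoly_eval pb) (mxpoly_eval ps) g x.
      by rewrite /generator /tb /ts t1 t2.
    by rewrite meval_gen_poly subrr normr0 mulr_ge0 ?expR_ge0.
  have [i xi] : exists i, rad < `|tnth x i|.
    by move/existsNP: xc => [i /negP]; rewrite -ltNge => hx; exists i.
  have Nr : rad <= norm1 x by rewrite ltW// (lt_le_trans xi)// coord_le_norm1.
  have N0 := norm1_ge0 x.
  have b1 := generator_bound W0 x K10 admt gW'.
  have b2 := meval_gen_poly_bound W0 MB0 MS0 hpb hps x gS; rewrite -/M in b2.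
  apply: (le_trans (ler_normB _ _)); apply: (le_trans (lerD b1 b2)).
  have e2 : expR (norm1 x) <= expR (2 * norm1 x) by rewrite ler_expR; lra.
  have V0 : 0 <= W%:R ^+ mdeg g :> R by rewrite exprn_ge0.
  apply: (@le_trans _ _ (W%:R ^+ mdeg g * (M + K1 + K1 ^+ 2) * expR (2 * norm1 x))).
    have := ler_wpM2l (mulr_ge0 V0 MM0) e2.
    have -> : W%:R ^+ mdeg g * (M + K1 + K1 ^+ 2) * expR (2 * norm1 x) =
      W%:R ^+ mdeg g * (K1 + K1 ^+ 2) * expR (2 * norm1 x) + W%:R ^+ mdeg g * M * expR (2 * norm1 x) by ring.
    by move=> e3; rewrite lerD2l.
  rewrite /c -!mulrA -expRD !mulrA ler_wpM2l//.
    exact: mulr_ge0 V0 MK0.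
  rewrite ler_expR.
  have -> : - (theta * rad) + (theta + 2) * norm1 x = 2 * norm1 x + theta * (norm1 x - rad) by ring.
  by rewrite lerDl mulr_ge0// subr_ge0.
case/andP: (gW) => gJ gWW; have kT := jT k kn.
have V0 : 0 <= W%:R ^+ mdeg g :> R by rewrite exprn_ge0.
have qJ : (q ^+ mdeg g)^-1 <= (q ^+ J)^-1.
  by rewrite lef_pV2 ?posrE ?exprn_gt0// ler_weXn2l// ltnW.
have qg0 : 0 < q ^+ mdeg g by rewrite exprn_gt0.
(* With n = |g|, sqrt (n!) <= W^(n/2), and q^2 <= W turns this into W^n q^(-n). *)
have b1 : `|approx_monomial ch L S (r k) g| <= Cd * (W%:R ^+ mdeg g * (q ^+ mdeg g)^-1).
  apply: (le_trans (stab kn gW)); rewrite ler_wpM2l//.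
  rewrite -(@ler_pXn2r _ 2)// ?nnegrE ?sqrtr_ge0//; last by rewrite mulr_ge0 ?invr_ge0// ltW.
  rewrite sqr_sqrtr// expr_div_n ler_pdivlMr ?exprn_gt0//.
  have f1 : (mdeg g)`!%:R <= W%:R ^+ mdeg g :> R by rewrite -natrX ler_nat fact_le_exp.
  have f2 : (q ^+ mdeg g) ^+ 2 <= W%:R ^+ mdeg g.
    by rewrite -exprM mulnC exprM lerXn2r ?nnegrE ?exprn_ge0// ltW.
  by rewrite [leRHS]expr2; apply: ler_pM; rewrite ?exprn_ge0// ltW.
have [I1 E1] := vt_exp kT (ltW q0).
(* (q |x|)^n <= W^n exp (q |x|): the exponential moment with exponent [q] gains the factor
   q^(-n). *)
have b2 : `|\int[P]_w mono g (vt k w)| <= W%:R ^+ mdeg g * (q ^+ mdeg g)^-1 * EB (q * d%:R).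
  apply: (@le_trans _ _ (\int[P]_w (W%:R ^+ mdeg g * (q ^+ mdeg g)^-1 * expR (q * norm1 (vt k w))))).
    apply: Rexp_abs_le; [exact: Imono|exact: intgZ|] => w.
    apply: (le_trans (mono_bound g (coord_le_norm1 (vt k w)))).
    have := @pow_le_expR R (q * norm1 (vt k w)) (mdeg g) W (mulr_ge0 (ltW q0) (norm1_ge0 _)) gWW.
    by rewrite exprMn mulrC -ler_pdivlMr// mulrAC.
  by rewrite RintegralZl// ler_wpM2l// mulr_ge0// invr_ge0 ltW.
apply: (le_trans (ler_normB _ _)); apply: (le_trans (lerD b2 b1)).
rewrite /high_error -/EB.
have -> : W%:R ^+ mdeg g * (q ^+ mdeg g)^-1 * EB (q * d%:R) + Cd * (W%:R ^+ mdeg g * (q ^+ mdeg g)^-1) =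
  W%:R ^+ mdeg g * ((Cd + EB (q * d%:R)) * (q ^+ mdeg g)^-1) by ring.
by rewrite ler_wpM2l// ler_wpM2l// addr_ge0.
Qed.

End fixed_step.

(** * Choice of the truncation levels *)

(** Meant for theta = c x: since (c x + 2)^2 <= 2 (c x)^2 + 8, the Gaussian growth of the
    exponential moment in theta consumes only half of the gain c x^2 when B D^2 c = 1/4. *)
Lemma quadratic_absorb (R : realFieldType) (B D c x : R) : 0 <= B -> B * D ^+ 2 * c = 4^-1 ->
  - (c * x * x) + B * ((c * x + 2) * D) ^+ 2 <= 8 * B * D ^+ 2 - c / 2 * x ^+ 2.
Proof.
move=> B0 E; have h : 0 <= B * (D * (c * x - 2)) ^+ 2 by rewrite mulr_ge0 ?sqr_ge0.
have E1 : B * D ^+ 2 * c * (c * x ^+ 2) = 4^-1 * (c * x ^+ 2) by rewrite E.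
have -> : B * ((c * x + 2) * D) ^+ 2 =
  2 * (B * D ^+ 2 * c * (c * x ^+ 2)) + 8 * B * D ^+ 2 - B * (D * (c * x - 2)) ^+ 2 by ring.
rewrite E1 -subr_ge0; apply: le_trans h _; rewrite le_eqVlt; apply/orP; left; apply/eqP.
by field.
Qed.

Lemma affine_le_exp (R : realType) (C K K2 y M : R) : 0 <= C -> 0 <= K -> 0 <= K2 -> 0 <= y ->
  M <= C * y -> M + K + K2 <= (C + K + K2) * expR y.
Proof.
move=> C0 K0 K20 y0 h; have e : 1 + y <= expR y by exact: expR_ge1Dx.
have e1 : 1 <= expR y by lra.
have ey : y <= expR y by lra.
rewrite !mulrDl; apply: lerD; last by rewrite ler_peMr.
by apply: lerD; [apply: (le_trans h); exact: ler_wpM2l|rewrite ler_peMr].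
Qed.

(** * Growth rates for large radius *)

Section asymptotics.
Context {R : realType}.
Implicit Types (x y p : R).

Definition eventually_ge (Q : R -> Prop) := exists x0 : R, forall x, x0 <= x -> Q x.

Lemma eventually_and Q1 Q2 : eventually_ge Q1 -> eventually_ge Q2 ->
  eventually_ge (fun x => Q1 x /\ Q2 x).
Proof.
move=> [a ha] [b hb]; exists (Num.max a b) => x.
by rewrite ge_max => /andP[xa xb]; split; [exact: ha|exact: hb].
Qed.

Lemma eventually_powR p (B : R) : 0 < p -> eventually_ge (fun x => B <= x `^ p).
Proof.
move=> p0; pose B1 := Num.max 1 B; have B10 : 0 < B1 by rewrite lt_max ltr01.
exists (B1 `^ p^-1) => x Bx.
have -> : B <= x `^ p = true; last by [].
apply: (@le_trans _ _ B1); first by rewrite le_max lexx orbT.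
have -> : B1 = (B1 `^ p^-1) `^ p by rewrite -powRrM mulVf ?gt_eqF// powRr1// ltW.
apply: ge0_ler_powR => //; rewrite ?nnegrE ?powR_ge0//; first exact: ltW.
exact: le_trans (powR_ge0 _ _) Bx.
Qed.

Lemma eventually_le (B : R) : eventually_ge (fun x => B <= x).
Proof. by exists B. Qed.

Lemma sqrt_expR x : Num.sqrt (expR x) = expR (x / 2).
Proof.
have -> : expR x = expR (x / 2) ^+ 2 by rewrite expr2 -expRD; congr expR; field.
by rewrite sqrtr_sqr ger0_norm ?expR_ge0.
Qed.

Lemma powR_ge_self x p : 1 <= x -> 1 < p -> x <= x `^ p.
Proof.
move=> x1 p1; rewrite -{1}[x]powRr1; last by lra.
by apply: ler_powR => //; exact: ltW.
Qed.

Variables (lambda1 lambda2 eta : R).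
Hypotheses (l2 : 0 < lambda2) (l12 : lambda2 <= lambda1) (eta1 : 1 < eta) (eta2 : eta < 2).

Lemma level_bounds lambda x : 0 < lambda -> 0 <= x ->
  (level lambda eta x)%:R <= lambda * x `^ eta /\
  lambda * x `^ eta - 1 <= (level lambda eta x)%:R.
Proof.
move=> l0 x0; have h : 0 <= lambda * x `^ eta by rewrite mulr_ge0 ?powR_ge0// ltW.
have /andP[h1 h2] := truncn_itv h; split=> //.
by move: h2; rewrite -natr1; lra.
Qed.

Lemma level_le x : 0 <= x -> (level lambda2 eta x <= level lambda1 eta x)%N.
Proof. by move=> x0; apply: le_truncn; rewrite ler_wpM2r ?powR_ge0. Qed.

(** For large x, S >= (lambda2 / 2) x^eta, so that x^r S^(-r) is of order x^(- r (eta - 1)). *)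
Lemma approximation_error_small (C r eps : R) : 0 < r -> 0 < eps -> 0 < C ->
  eventually_ge (fun x => (0 < level lambda2 eta x)%N /\
    C * x `^ r * (level lambda2 eta x)%:R `^ (- r) <= eps).
Proof.
move=> r0 eps0 C0.
have p0 : 0 < (eta - 1) * r by rewrite mulr_gt0// subr_gt0.
have [a ha] := eventually_and (eventually_le 1) (eventually_and (eventually_le (2 / lambda2))
  (eventually_powR (C / ((lambda2 / 2) `^ r * eps)) p0)).
exists a => x /ha[x1 [x2 x3]].
have x0 : 0 < x by lra.
have [_ lS] := level_bounds l2 (ltW x0).
have yx := powR_ge_self x1 eta1; set y := x `^ eta in lS yx *.
set S := level lambda2 eta x in lS *.
have l2y : 2 <= lambda2 * y.
  by rewrite mulrC -ler_pdivrMr// (le_trans x2).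
have S2 : lambda2 / 2 * y <= S%:R by lra.
have S0 : 0 < S%:R :> R by lra.
split; first by rewrite ltr0n in S0.
have y0 : 0 < y by rewrite powR_gt0.
have h : (lambda2 / 2) `^ r * (x `^ r * x `^ ((eta - 1) * r)) <= S%:R `^ r.
  have -> : x `^ r * x `^ ((eta - 1) * r) = y `^ r.
    rewrite -powRD; last by apply/implyP => _; rewrite gt_eqF.
    by rewrite /y -powRrM; congr (_ `^ _); ring.
  rewrite -powRM ?(ltW y0)//; last by rewrite divr_ge0// ltW.
  apply: ge0_ler_powR => //; rewrite ?nnegrE ?(ltW S0) ?(ltW r0)//.
  by rewrite mulr_ge0 ?(ltW y0)// divr_ge0// ltW.
have Sr : 0 < S%:R `^ r by rewrite powR_gt0.
rewrite powRN ler_pdivrMr// (le_trans _ (ler_wpM2l (ltW eps0) h))//.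
have l2r : 0 < (lambda2 / 2) `^ r by rewrite powR_gt0// divr_gt0.
have xr : 0 <= x `^ r by exact: powR_ge0.
have := x3; rewrite ler_pdivrMr ?mulr_gt0// => h2.
have := ler_wpM2l xr h2; rewrite mulrC => h3; apply: (le_trans h3).
by rewrite le_eqVlt; apply/orP; left; apply/eqP; ring.
Qed.

Variables (T K A0 B0 Cd Cbs wc c1 D eps : R) (ell : nat).
Hypotheses (T0 : 0 < T) (K0 : 0 <= K) (A00 : 0 <= A0) (B00 : 0 < B0) (Cd0 : 0 <= Cd).
Hypotheses (Cbs0 : 0 < Cbs) (wc0 : 0 <= wc) (D0 : 0 < D) (eps0 : 0 < eps).

Let EB t := A0 * expR (B0 * t ^+ 2).

(* [exp (C R^eta)] is beaten by [h = exp (- R^2 / 2)] and by the Gaussian tails because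
   [eta < 2], and by [q^-J] because [J] is of order [R^eta] and [q] is a free parameter. *)
Lemma total_error_small : eventually_ge (fun x =>
  let L := level lambda1 eta x in let S := level lambda2 eta x in
  let W := (2 * L + 2 * S)%N in let J := (2 * L + S)%N in
  exists theta q : R, [/\ 0 <= theta, 1 <= q, q ^+ 2 <= W%:R &
    forall M h : R, 0 <= M <= Cbs * x `^ eta -> h = expR (- (x ^+ 2 / 2)) ->
    expR (T * M) * ((Cd + EB (q * D)) * (q ^+ J)^-1 +
      T * (W%:R ^+ 3 * Num.sqrt h * (wc * EB c1) +
           (M + K + K ^+ 2) * (expR (- (theta * x)) * EB ((theta + 2) * D)))) * W%:R ^+ ell <= eps]).
Proof.
have l1 : 0 < lambda1 by exact: lt_le_trans l12.
(* The value required by [quadratic_absorb]; the exponent theta will be c x. *)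
pose c := (4 * B0 * D ^+ 2)^-1.
have c0 : 0 < c by rewrite invr_gt0 !mulr_gt0// exprn_gt0.
(* sqrt h = exp (- x^2 / 4) and the tail factor exp (- c x^2 / 2) are both at most exp (- c'
   x^2). *)
pose c' := Num.min 4^-1 (c / 2).
have c'0 : 0 < c' by rewrite /c' lt_min; apply/andP; split; [rewrite invr_gt0|exact: divr_gt0].
have c'4 : c' <= 4^-1 by rewrite ge_min lexx.
have c'c : c' <= c / 2 by rewrite ge_min lexx orbT.
(* With y = x^eta, exp (a y) collects the growing factors: exp (T M), two powers of [W] at exp (4
   lambda1 y) each, and exp y for [M] itself. Decay with a + 1 instead of a then leaves exp (-
   y). *)
pose a := T * Cbs + 8 * lambda1 + 1.
have a0 : 0 < a by rewrite !addr_gt0// mulr_gt0.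
(* As J >= lambda1 y - 1, the power q^J = exp (t J) is at least exp ((a + 1) y) up to the factor exp
   t. *)
pose t := (a + 1) / lambda1.
have t0 : 0 < t by rewrite divr_gt0// addr_gt0.
pose q := expR t.
pose c2 := Cd + EB (q * D).
pose c3 := A0 * expR (8 * B0 * D ^+ 2).
pose Ctot := ell`!%:R * (c2 * expR t + T * (6 * (wc * EB c1) + (Cbs + K + K ^+ 2) * c3)).
have EB0 u : 0 <= EB u by rewrite mulr_ge0 ?expR_ge0.
have c20 : 0 <= c2 by rewrite addr_ge0.
have c30 : 0 <= c3 by rewrite mulr_ge0 ?expR_ge0.
have k0 : 0 <= Cbs + K + K ^+ 2 by rewrite addr_ge0 ?addr_ge0 ?exprn_ge0// ltW.
have w10 : 0 <= wc * EB c1 by rewrite mulr_ge0.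
have eta20 : 0 < 2 - eta by rewrite subr_gt0.
have [x0 hx0] := eventually_and (eventually_le 1) (eventually_and (eventually_powR ((a + 1) / c') eta20)
  (eventually_and (eventually_le (Ctot / eps)) (eventually_le ((q ^+ 2 + 2) / (2 * lambda1))))).
exists x0 => x /hx0[x1 [x2 [x3 x4]]] L S W J.
exists (c * x), q; have xp : 0 < x by lra.
have [L1 L2] := level_bounds l1 (ltW xp); have [S1 S2] := level_bounds l2 (ltW xp).
rewrite -/L in L1 L2; rewrite -/S in S1 S2.
have yx := powR_ge_self x1 eta1; set y := x `^ eta in L1 L2 S1 S2 yx *.
have yp : 0 < y by rewrite powR_gt0.
have ay : (a + 1) * y <= c' * x ^+ 2.
  have -> : x ^+ 2 = x `^ (2 - eta) * y.
    rewrite -powRD; last by apply/implyP => _; rewrite gt_eqF.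
    by rewrite subrK -powR_mulrn// ltW.
  by rewrite mulrA ler_wpM2r ?(ltW yp)// mulrC -ler_pdivrMr.
have WE : W%:R = 2 * L%:R + 2 * S%:R :> R by rewrite natrD !natrM.
have l2y : lambda2 * y <= lambda1 * y by rewrite ler_wpM2r// ltW.
have W4 : W%:R <= 4 * lambda1 * y by rewrite WE; lra.
have S0 : 0 <= S%:R :> R by [].
split.
- by rewrite mulr_ge0// ltW.
- by rewrite -expR0 ler_expR ltW.
- have : q ^+ 2 + 2 <= x * (2 * lambda1) by rewrite -ler_pdivrMr// mulr_gt0.
  have : x * (2 * lambda1) <= y * (2 * lambda1) by rewrite ler_wpM2r// mulr_ge0// ltW.
  by rewrite WE; lra.
move=> M h /andP[M0 MC] ->.
have Wp k : W%:R ^+ k <= k`!%:R * expR (4 * lambda1 * y).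
  apply: (le_trans (exprn_fact_expR k (ler0n _ W))).
  by rewrite ler_wpM2l// ler_expR.
have E1 : expR (T * M) <= expR (T * Cbs * y) by rewrite ler_expR -mulrA ler_wpM2l// ltW.
have JL : lambda1 * y - 1 <= J%:R.
  by rewrite natrD natrM; have := ler0n R L; lra.
have E2 : (q ^+ J)^-1 <= expR t * expR (- ((a + 1) * y)).
  rewrite /q -expRM_natl -expRN -expRD ler_expR.
  have -> : (a + 1) * y = t * (lambda1 * y) by rewrite /t mulrA divfK ?gt_eqF.
  have := ler_wpM2l (ltW t0) JL; rewrite mulrBr mulr1 [J%:R * t]mulrC; lra.
have Ec x2' : c' <= x2' -> expR (- (x2' * x ^+ 2)) <= expR (- ((a + 1) * y)).
  by move=> hc; rewrite ler_expR lerN2 (le_trans ay)// ler_wpM2r// exprn_ge0// ltW.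
have E3 : Num.sqrt (expR (- (x ^+ 2 / 2))) <= expR (- ((a + 1) * y)).
  rewrite sqrt_expR; have -> : - (x ^+ 2 / 2) / 2 = - (4^-1 * x ^+ 2) by field.
  exact: Ec.
have E4 : expR (- (c * x * x)) * EB ((c * x + 2) * D) <= c3 * expR (- ((a + 1) * y)).
  rewrite /EB /c3 mulrCA -(mulrA A0); apply: ler_wpM2l => //.
  apply: (@le_trans _ _ (expR (8 * B0 * D ^+ 2) * expR (- (c / 2 * x ^+ 2)))); last first.
    by apply: ler_wpM2l (Ec _ c'c); exact: expR_ge0.
  rewrite -!expRD ler_expR.
  have cE : B0 * D ^+ 2 * c = 4^-1.
    by rewrite /c; field; rewrite (gt_eqF D0) (gt_eqF B00).
  exact: quadratic_absorb (ltW B00) cE.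
have E5 : M + K + K ^+ 2 <= (Cbs + K + K ^+ 2) * expR y.
  by apply: affine_le_exp => //; rewrite ?exprn_ge0// ltW.
set ea := expR (- ((a + 1) * y)) in E2 E3 E4; have ea0 : 0 <= ea by exact: expR_ge0.
set e4 := expR (4 * lambda1 * y) in Wp; have e41 : 1 <= e4.
  by rewrite -expR0 ler_expR !mulr_ge0// ltW.
have ey1 : 1 <= expR y by rewrite -expR0 ler_expR ltW.
have e40 : 0 <= e4 by exact: le_trans ler01 e41.
have ey0 : 0 <= expR y by exact: expR_ge0.
pose e5 := e4 * expR y; have e5a : e4 <= e5 by rewrite /e5 ler_peMr.
have e51 : 1 <= e5 by exact: le_trans e5a.
have e5b : expR y <= e5 by rewrite /e5 ler_peMl.
have q0 : 0 < q by exact: expR_gt0.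
have T1 : c2 * (q ^+ J)^-1 <= c2 * expR t * ea * e5.
  apply: (@le_trans _ _ (c2 * (expR t * ea))); first by rewrite ler_wpM2l.
  by rewrite mulrA ler_peMr// !mulr_ge0 ?expR_ge0.
have T2 : W%:R ^+ 3 * Num.sqrt (expR (- (x ^+ 2 / 2))) * (wc * EB c1) <= 6 * (wc * EB c1) * ea * e5.
  apply: (@le_trans _ _ (6 * e4 * ea * (wc * EB c1))).
    rewrite ler_wpM2r//; apply: ler_pM; rewrite ?exprn_ge0 ?sqrtr_ge0//; exact: (Wp 3%N).
  have := ler_wpM2l (mulr_ge0 (mulr_ge0 (ler0n R 6) w10) ea0) e5a.
  by apply: le_trans; rewrite le_eqVlt; apply/orP; left; apply/eqP; ring.
have T3 : (M + K + K ^+ 2) * (expR (- (c * x * x)) * EB ((c * x + 2) * D)) <=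
    (Cbs + K + K ^+ 2) * c3 * ea * e5.
  apply: (@le_trans _ _ ((Cbs + K + K ^+ 2) * expR y * (c3 * ea))).
    apply: ler_pM => //; first by rewrite addr_ge0 ?addr_ge0 ?exprn_ge0.
    by rewrite mulr_ge0 ?expR_ge0.
  have := ler_wpM2l (mulr_ge0 (mulr_ge0 k0 c30) ea0) e5b.
  by apply: le_trans; rewrite le_eqVlt; apply/orP; left; apply/eqP; ring.
set X1 := c2 * _ in T1; rewrite -/c2.
set X2 := W%:R ^+ 3 * _ * _ in T2 *; set X3 := (M + _ + _) * _ in T3 *.
have X10 : 0 <= X1 by rewrite mulr_ge0// invr_ge0 exprn_ge0// ltW.
have X20 : 0 <= X2 by rewrite mulr_ge0// mulr_ge0 ?exprn_ge0 ?sqrtr_ge0.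
have X30 : 0 <= X3.
  apply: mulr_ge0; first by rewrite addr_ge0 ?addr_ge0 ?exprn_ge0.
  by rewrite mulr_ge0 ?expR_ge0.
have B1 : X1 + T * (X2 + X3) <= (c2 * expR t + T * (6 * (wc * EB c1) + (Cbs + K + K ^+ 2) * c3)) * (ea * e5).
  have := ler_wpM2l (ltW T0) (lerD T2 T3).
  have -> : (c2 * expR t + T * (6 * (wc * EB c1) + (Cbs + K + K ^+ 2) * c3)) * (ea * e5) =
    c2 * expR t * ea * e5 + T * (6 * (wc * EB c1) * ea * e5 + (Cbs + K + K ^+ 2) * c3 * ea * e5) by ring.
  by move=> h2; exact: lerD.
apply: (@le_trans _ _ (expR (T * Cbs * y) * ((c2 * expR t + T * (6 * (wc * EB c1) + (Cbs + K + K ^+ 2) * c3)) * (ea * e5)) *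
   (ell`!%:R * e4))).
  apply: ler_pM; [|by rewrite exprn_ge0| |exact: Wp].
    by rewrite mulr_ge0 ?expR_ge0// addr_ge0// mulr_ge0 ?addr_ge0// ltW.
  by apply: ler_pM; rewrite ?expR_ge0// addr_ge0// mulr_ge0 ?addr_ge0// ltW.
have -> : expR (T * Cbs * y) * ((c2 * expR t + T * (6 * (wc * EB c1) + (Cbs + K + K ^+ 2) * c3)) * (ea * e5)) *
   (ell`!%:R * e4) = Ctot * (expR (T * Cbs * y) * ea * e4 * expR y * e4) by rewrite /Ctot /e5; ring.
have -> : expR (T * Cbs * y) * ea * e4 * expR y * e4 = expR (- y).
  by rewrite /ea /e4 -!expRD /a; congr expR; ring.
have Ct0 : 0 <= Ctot.
  apply: mulr_ge0 => //; apply: addr_ge0; first by rewrite mulr_ge0 ?expR_ge0.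
  by apply: mulr_ge0; [exact: ltW|apply: addr_ge0; apply: mulr_ge0].
rewrite expRN ler_pdivrMr ?expR_gt0// mulrC -ler_pdivrMr//.
apply: (le_trans x3); apply: (le_trans yx).
by apply: le_trans (expR_ge1Dx y); rewrite lerDr.
Qed.

End asymptotics.

Section masses.
Context {R : realType} {d m : nat}.
Variables (pb : R -> R -> nat -> d.-tuple (mpoly d R)).
Variables (ps : R -> R -> nat -> 'M[mpoly d R]_(d, m)).
Variables (h rad : R) (L S : nat).
Local Notation W := (2 * L + 2 * S)%N.

Lemma deg_msize (p : mpoly d R) n : (deg p <= n)%N -> (msize p <= n.+1)%N.
Proof. by move=> h'; rewrite (leq_trans (leqSpred _)). Qed.

Lemma drift_mass_ge0 : 0 <= drift_mass pb h rad L S.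
Proof. by rewrite sumr_ge0// => a _; rewrite mulr_ge0 ?enorm_ge0 ?exprn_ge0. Qed.

Lemma diffusion_mass_ge0 : 0 <= diffusion_mass ps h rad L S.
Proof. by rewrite sumr_ge0// => a _; rewrite mulr_ge0 ?fnorm_ge0 ?exprn_ge0. Qed.

Lemma wnorm_le_drift_mass i : (deg (tnth (pb h rad S) i) <= S)%N ->
  wnorm W (tnth (pb h rad S) i) <= drift_mass pb h rad L S /\
  (msize (tnth (pb h rad S) i) <= S.+1)%N.
Proof.
move=> /deg_msize dS; split=> //; rewrite (wnormE _ dS); apply: ler_sum => a _.
rewrite ler_wpM2r ?exprn_ge0//.
by have := coord_le_enorm [tuple mcoeff a (tnth (pb h rad S) i) | i < d] i; rewrite tnth_mktuple.
Qed.

Lemma wnorm_le_diffusion_mass i l : (forall i j, (2 * deg (ps h rad S i j) <= S)%N) ->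
  wnorm W ((ps h rad S *m (ps h rad S)^T) i l) <= diffusion_mass ps h rad L S /\
  (msize ((ps h rad S *m (ps h rad S)^T) i l) <= S.+1)%N.
Proof.
move=> dS; have mS : (msize ((ps h rad S *m (ps h rad S)^T) i l) <= S.+1)%N.
  rewrite mxE; apply: (leq_trans (mmeasure_sum _ _ _ _)); apply/bigmax_leqP => j _.
  rewrite mxE; set p := ps h rad S i j; set q := ps h rad S l j.
  have [->|p0] := eqVneq p 0; first by rewrite mul0r mmeasure0.
  have [->|q0] := eqVneq q 0; first by rewrite mulr0 mmeasure0.
  rewrite msizeM//; have := dS i j; have := dS l j; rewrite -/p -/q /deg.
  rewrite (mpolySpred _ p0) (mpolySpred _ q0) /=.
  move: (msize p).-1 (msize q).-1 => a c hc ha.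
  rewrite addnS ltnS -(leq_pmul2l (isT : (0 < 2)%N)) mulnDr.
  by rewrite (leq_trans (leq_add ha hc))// addnn -mul2n.
split=> //; rewrite (wnormE _ mS); apply: ler_sum => a _.
rewrite ler_wpM2r ?exprn_ge0//.
by have := entry_le_fnorm (map_mx (mcoeff a) (ps h rad S *m (ps h rad S)^T)) i l; rewrite mxE.
Qed.

End masses.

Section hankel.
Context {R : realType} {d : nat}.

Lemma hankel_posdef_eq L (mu nu : multinom d -> R) :
  (forall g, (mdeg g <= 2 * L)%N -> mu g = nu g) -> hankel_posdef L mu -> hankel_posdef L nu.
Proof.
move=> E H c c0; have := H c c0; congr (0 < _); apply: eq_bigr => a _; apply: eq_bigr => a' _.
rewrite E// mdegD mul2n -addnn leq_add//; by rewrite -ltnS bmdeg.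
Qed.

End hankel.

Lemma mrpc_iter0 (R : realType) d (ch : mrpc_choices d) L S m h
    (pb : d.-tuple (mpoly d R)) (ps : 'M[mpoly d R]_(d, m)) mu0 k :
  mrpc_iter ch L S h pb ps mu0 k mnm0 = mu0 mnm0.
Proof.
elim: k => //= k IH; rewrite mrpc_stepE IH /gen_poly !big1 ?scaler0 ?addr0 ?moment_functional0 ?mulr0 ?addr0//.
  by move=> i _; rewrite big1// => l _; rewrite mpolyX0 mderivC mderiv0 mul0r.
by move=> i _; rewrite mpolyX0 mderivC mul0r.
Qed.

(** * Convergence of the mRPC moments to the Euler moments *)

Section moments_close.
Variables (R : realType) (K T delta0 : R).
Hypotheses (K_gt0 : 0 < K) (T_gt0 : 0 < T) (delta0_gt0 : 0 < delta0).
Variables (d : nat) (lambda1 lambda2 eta r Cdelta : R).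
Hypotheses (d0 : (0 < d)%N) (l2 : 0 < lambda2) (l12 : lambda2 <= lambda1)
  (eta1 : 1 < eta) (eta2 : eta < 2) (r0 : 0 < r) (Cd0 : 0 < Cdelta).
Variables (ell : nat) (Capp Cbs Rstar M0 eps : R).
Hypotheses (Capp0 : 0 < Capp) (Cbs0 : 0 < Cbs) (eps0 : 0 < eps).

Let K1 := 2 * K + 2.

(** With |M0| the bound is nonnegative before any initial law is given. *)
Definition law_exp_bound (t : R) : R := @exp_bound R d K1 T delta0 `|M0| (t * d%:R).

Lemma law_exp_bound_ge0 t : 0 <= law_exp_bound t.
Proof.
rewrite /law_exp_bound /exp_bound; apply: mulr_ge0; last exact: expR_ge0.
by apply: mulr_ge0; rewrite ?expR_ge0// mulr_ge0.
Qed.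

(** The threshold on the radius is chosen before the probability space, the noise dimension and the
    coefficients, hence depends on the constants only. *)
Lemma moments_close : eventually_ge (fun x =>
  forall (m : nat) (dO : measure_display) (Omega : measurableType dO)
    (P : probability Omega R)
    (u0 : {RV P >-> d.-tuple R}) (z : nat -> {RV P >-> m.-tuple R})
    (b : R -> d.-tuple R -> d.-tuple R)
    (sigma : R -> d.-tuple R -> 'M[R]_(d, m))
    (pb : R -> R -> nat -> d.-tuple (mpoly d R))
    (ps : R -> R -> nat -> 'M[mpoly d R]_(d, m))
    (ch : mrpc_choices d),
    noise_assumption u0 z ->
    coefficient_assumption T b sigma pb ps
      K r Capp lambda1 lambda2 eta Cbs Rstar ->
    initial_assumption u0 delta0 M0 ->
    stability_assumption T pb ps u0 ch lambda1 lambda2 eta 1 Rstar Cdelta ->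
  forall n k : nat, (0 < n)%N -> (k <= n)%N ->
    let h := step_size T n in
    h < 1 -> radius 1 h = x ->
    [/\ measurable_fun setT (euler u0 z h (b h) (sigma h) k),
      forall t, 0 <= t -> intg P (fun w => expR (t * norm1 (euler u0 z h (b h) (sigma h) k w))) /\
        \int[P]_w expR (t * norm1 (euler u0 z h (b h) (sigma h) k w)) <= law_exp_bound t,
      rpc_moment pb ps u0 ch lambda1 lambda2 eta 1 h k mnm0 = 1,
      forall g, (mdeg g <= ell)%N ->
        `|rpc_moment pb ps u0 ch lambda1 lambda2 eta 1 h k g| <= Cdelta * Num.sqrt (mdeg g)`!%:R &
      forall g, (mdeg g <= ell)%N ->
        `|\int[P]_w mono g (euler u0 z h (b h) (sigma h) k w) -
          rpc_moment pb ps u0 ch lambda1 lambda2 eta 1 h k g| <= eps]).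
Proof.
have l1 : 0 < lambda1 by exact: lt_le_trans l12.
have K0 : 0 <= K by exact: ltW.
have K10 : 0 <= K1 by rewrite addr_ge0// mulr_ge0.
have T0 : 0 <= T by exact: ltW.
pose Cm : R := 2^-1 * (6 * T * expR (T * (1 + 6 * K1 ^+ 2)) +
    d%:R * ell%:R ^+ 2 * (2 * ell)`!%:R * expR 1 * law_exp_bound 2).
have Cm0 : 0 <= Cm.
  apply: mulr_ge0 => //; apply: addr_ge0; first by rewrite !mulr_ge0 ?expR_ge0.
  by rewrite mulr_ge0 ?law_exp_bound_ge0// !mulr_ge0 ?expR_ge0 ?exprn_ge0.
(* Half of [eps] goes to the replacement of the coefficients, the other half to the mRPC error of
   the truncated scheme. *)
pose eps' := Num.min 1 (eps / (2 * (Cm + 1))).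
have Cm1 : 0 < 2 * (Cm + 1) by rewrite mulr_gt0// ltr_wpDl.
have eps'0 : 0 < eps' by rewrite lt_min ltr01 divr_gt0.
have eps'1 : eps' <= 1 by rewrite ge_min lexx.
have eps'C : eps' * Cm <= eps / 2.
  have : eps' <= eps / (2 * (Cm + 1)) by rewrite ge_min lexx orbT.
  rewrite ler_pdivlMr// => h; have : eps' * (Cm + Cm) <= eps' * (2 * (Cm + 1)).
    by rewrite ler_wpM2l ?(ltW eps'0)//; lra.
  rewrite mulrDr; lra.
pose B0 := expR (T * K1 * d%:R) ^+ 2 * (T * (K1 ^+ 2 / 2 + K1) + (4 * delta0)^-1).
have B00 : 0 < B0.
  apply: mulr_gt0; first by rewrite exprn_gt0 ?expR_gt0.
  rewrite ltr_wpDl ?invr_gt0 ?mulr_gt0// mulr_ge0// addr_ge0// divr_ge0// exprn_ge0//.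
pose A0 := expR (T * (K1 + 2 * d%:R ^+ 2 * K1)) * (2 * d%:R * `|M0|).
have A00 : 0 <= A0 by rewrite !mulr_ge0 ?expR_ge0.
have wc0 : 0 <= @weak_const R d K1.
  by rewrite /weak_const mulr_ge0 ?expR_ge0// addr_ge0// !mulr_ge0 ?expR_ge0.
have dR : 0 < d%:R :> R by rewrite ltr0n.
have e2 : 0 < eps / 2 by rewrite divr_gt0.
(* A large radius ensures x >= 1, x > Rstar, ell <= 2L, a small approximation error and a small
   total error. *)
have [x0 hx0] := eventually_and (eventually_and (eventually_le 1) (eventually_le (Rstar + 1)))
  (eventually_and (eventually_le ((ell%:R + 2) / (2 * lambda1)))
  (eventually_and (approximation_error_small l2 eta1 r0 eps'0 Capp0)
    (@total_error_small R lambda1 lambda2 eta l2 l12 eta1 eta2 T K1 A0 B0 Cdelta Cbs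
      (@weak_const R d K1) (2 * (1 + K1) * d%:R) d%:R (eps / 2) ell T_gt0 K10 A00 B00 (ltW Cd0)
      Cbs0 wc0 dR e2))).
exists x0 => x /hx0[[x1 xR] [xl [[S0 appx] htot]]].
move=> m dO Omega P u0 z b sigma pb ps ch noise [lip app mass] init stab n k n0 kn h h1 radx.
have xp : 0 < x by exact: lt_le_trans ltr01 x1.
have xRs : Rstar < x by apply: lt_le_trans xR; rewrite ltrDl.
have nR : 0 < n%:R :> R by rewrite ltr0n.
have h0 : 0 < h by rewrite divr_gt0.
have nhT : n%:R * h = T by rewrite /h /step_size mulrC divfK ?gt_eqF.
have kT : k%:R * h <= T by rewrite -nhT ler_wpM2r ?ler_nat// ltW.
have [bG sS bL sL] := lip n n0; rewrite -/h in bG sS bL sL.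
have [pbd psd papp] := app n n0 x (level lambda2 eta x) xp; rewrite -/h in pbd psd papp.
have hs := stab n n0; cbv zeta in hs; rewrite -/h radx in hs; have [hank sbd] := hs xRs.
have mg := mass n n0 x xRs; rewrite -/h in mg.
set L := level lambda1 eta x in hank sbd mg.
set S := level lambda2 eta x in hank sbd mg pbd psd papp appx S0.
have SL : (S <= L)%N by apply: level_le => //; exact: ltW.
have L0 : (0 < L)%N by exact: leq_trans SL.
have rE g j : rpc_moment pb ps u0 ch lambda1 lambda2 eta 1 h j g =
  mrpc_moment ch L S h (pb h x S) (ps h x S) (initial_moment u0) j g.
  by rewrite /rpc_moment radx.
pose W := (2 * L + 2 * S)%N.
have ellW : (ell <= W)%N.
  rewrite -(ler_nat R) /W natrD !natrM.
  have [_ Lb] := level_bounds eta l1 (ltW xp); rewrite -/L in Lb.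
  have := powR_ge_self x1 eta1; set y := x `^ eta in Lb *.
  move: xl; rewrite ler_pdivrMr ?mulr_gt0// => xl xy.
  have h2 : x * (2 * lambda1) <= y * (2 * lambda1) by rewrite ler_wpM2r// mulr_ge0// ltW.
  have := ler0n R S; lra.
have pos j : (j <= n)%N -> hankel_posdef L (mrpc_iter ch L S h (pb h x S) (ps h x S) (initial_moment u0) j).
  move=> jn; apply: hankel_posdef_eq (hank j jn) => g gL; rewrite rE /mrpc_moment.
  by rewrite (leq_trans gL)// leq_addr.
have amE g j : (j <= n)%N -> rpc_moment pb ps u0 ch lambda1 lambda2 eta 1 h j g =
    approx_monomial ch L S (mrpc_iter ch L S h (pb h x S) (ps h x S) (initial_moment u0) j) g.
  move=> jn; rewrite rE /mrpc_moment; case: ifP => // gJ.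
  by rewrite (approx_monomial_small ch (pos j jn)).
have sB y : fnorm (sigma h y) <= K.
  rewrite -lee_fin; apply: ltW; apply: le_lt_trans sS.
  by apply: ereal_sup_ubound; exists y.
have close y : cube x y -> edist (b h y) (vpoly_eval (pb h x S) y) <= eps' /\
    fnorm (sigma h y - mxpoly_eval (ps h x S) y) <= eps'.
  move=> yc; have [a1 a2] := papp S0 y yc.
  by split; [exact: le_trans a1 appx|exact: le_trans a2 appx].
have init' : initial_assumption u0 delta0 `|M0|.
  by apply: (le_trans init); rewrite lee_fin ler_norm.
have hpb i := @wnorm_le_drift_mass R d pb h x L S i (pbd i).
have hps i l := @wnorm_le_diffusion_mass R d m ps h x L S i l psd.
have adm : admissible K1 (b h) (sigma h) by exact: (admissible_coef K0 bG sB bL sL).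
have gexp t : 0 <= t -> intg P (fun w => expR (t * norm1 (euler u0 z h (b h) (sigma h) k w))) /\
        \int[P]_w expR (t * norm1 (euler u0 z h (b h) (sigma h) k w)) <= law_exp_bound t.
  by move=> t0; exact: (euler_law_exp noise d0 h0 K0 T0 delta0_gt0 init' bG sB bL sL kT t0).
have [theta [q [theta0 q1 qW htot2]]] := htot.
have hx : h = expR (- (x ^+ 2 / 2)).
  have lnh : ln h < 0 by apply: ln_lt0; rewrite h0 h1.
  have -> : x ^+ 2 = - 2 * ln h.
    rewrite -radx /radius sqrtr1 invr1 mul1r sqr_sqrtr//.
    by rewrite mulNr oppr_ge0 mulr_ge0_le0// ltW.
  have -> : - (- 2 * ln h / 2) = ln h by field.
  by rewrite lnK.
have MB0 := drift_mass_ge0 pb h x L S; have MS0 := diffusion_mass_ge0 ps h x L S.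
split.
- exact: (measurable_euler u0 z h adm k).
- exact: gexp.
- rewrite rE /mrpc_moment mdeg0 leq0n mrpc_iter0 /initial_moment.
  under eq_Rintegral do rewrite mono0.
  by rewrite Rexp_cst.
- by move=> g gl; apply: sbd => //; exact: leq_trans gl ellW.
move=> g gl; rewrite (amE g k kn).
have gW : (mdeg g <= W)%N by exact: leq_trans gl ellW.
have d1 := @euler_trunc_difference R dO Omega d m P u0 z noise h K T delta0 `|M0| d0 h0 (ltW h1) K0 T0
  delta0_gt0 init' (b h) (sigma h) (pb h x S) (ps h x S) x eps' bG sB bL sL eps'0 eps'1 close k g kT.
have stab' j g' : (j <= n)%N -> (2 * L + S < mdeg g' <= W)%N ->
    `|approx_monomial ch L S (mrpc_iter ch L S h (pb h x S) (ps h x S) (initial_moment u0) j) g'| <=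
    Cdelta * Num.sqrt (mdeg g')`!%:R.
  by move=> jn /andP[_ g'W]; rewrite -amE//; exact: sbd.
have nT : n%:R * h <= T by rewrite nhT.
have d2 := @trunc_rpc_error R dO Omega d m P u0 z noise h K T delta0 `|M0| d0 h0 (ltW h1) K0 T0
  delta0_gt0 init' (b h) (sigma h) (pb h x S) (ps h x S) x eps' bG sB bL sL eps'0 eps'1 close
  ch L S _ _ L0 SL MB0 MS0 hpb hps n Cdelta theta q nT (ltW Cd0) theta0 q1 qW pos stab' k g kn gW.
set I1 := \int[P]_w _ in d1 *; set I2 := \int[P]_w _ in d1 d2.
rewrite -[I1](subrK I2) -addrA; apply: (le_trans (ler_normD _ _)).
have -> : eps = eps / 2 + eps / 2 by field.
apply: lerD.
  apply: (le_trans d1); apply: le_trans eps'C; apply: ler_wpM2l; first exact: ltW.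
  apply: ler_wpM2l => //; rewrite lerD2l; apply: ler_wpM2r; first exact: law_exp_bound_ge0.
  apply: ler_wpM2r; first exact: expR_ge0.
  apply: ler_pM; rewrite ?mulr_ge0 ?exprn_ge0//.
    by rewrite ler_wpM2l// lerXn2r ?nnegrE// ler_nat.
  by rewrite ler_nat leq_fact // leq_mul2l.
apply: (le_trans d2); apply: le_trans (htot2 (drift_mass pb h x L S + 2^-1 * diffusion_mass ps h x L S) h _ hx); last first.
  by apply/andP; split; [rewrite addr_ge0// mulr_ge0|exact: mg].
apply: ler_wpM2l.
  have EB0 t : 0 <= @exp_bound R d K1 T delta0 `|M0| t.
    by rewrite /exp_bound; apply: mulr_ge0 (expR_ge0 _); rewrite mulr_ge0 ?expR_ge0// mulr_ge0.
  have mk : 0 <= drift_mass pb h x L S + 2^-1 * diffusion_mass ps h x L S + K1 + K1 ^+ 2.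
    by rewrite !addr_ge0 ?exprn_ge0// mulr_ge0.
  apply: mulr_ge0 (expR_ge0 _) (addr_ge0 _ (mulr_ge0 T0 (addr_ge0 _ _))).
  - apply: mulr_ge0 (addr_ge0 (ltW Cd0) (EB0 _)) _.
    by rewrite invr_ge0 exprn_ge0// (le_trans ler01).
  - by apply: mulr_ge0 (mulr_ge0 wc0 (EB0 _)); rewrite mulr_ge0 ?sqrtr_ge0 ?exprn_ge0.
  - exact: mulr_ge0 mk (mulr_ge0 (expR_ge0 _) (EB0 _)).
by rewrite ler_weXn2l// ler1n addn_gt0 muln_gt0 L0.
Qed.

End moments_close.

(** * Matching measures *)

Lemma law_probability {dO dT} {Omega : measurableType dO} {T : measurableType dT} {R : realType}
    (P : probability Omega R) (X : Omega -> T) : measurable_fun setT X ->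
  exists2 mu : probability T R, (mu : set T -> \bar R) = pushforward P X &
    forall f : T -> R, measurable_fun setT f -> intg P (fun w => f (X w)) ->
      intg mu f /\ \int[mu]_x f x = \int[P]_w f (X w).
Proof.
move=> mX.
pose X' : {RV P >-> T} := HB.pack X (isMeasurableFun.Build _ _ _ _ _ mX).
exists (distribution P X') => // f mf If; have mf' : measurable_fun setT (EFin \o f).
  exact/measurable_EFinP.
split.
  have := @integrable_pushforward _ _ _ _ _ _ mX P setT (EFin \o f) mf' If measurableT.
  by apply.
by rewrite /Rintegral (@integral_distribution _ _ _ _ _ P X' (EFin \o f)).
Qed.

Section cube_law.
Context {R : realType} {d : nat}.
Implicit Types (mu nu : probability (d.-tuple R) R) (rad : R) (g : multinom d).

Lemma cube_supported_integral nu rad (f : d.-tuple R -> R) A : 0 <= A ->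
  measurable_fun setT f -> (forall x, cube rad x -> `|f x| <= A) -> nu (cube rad) = 1%E ->
  intg nu f /\ \int[nu]_x f x = \int[nu]_(x in cube rad) f x.
Proof.
move=> A0 mf fA nu1; have mC := @measurable_cube R d rad.
have mN : measurable (~` @cube R d rad) by exact: measurableC.
have nuN : nu (~` cube rad) = 0%E by rewrite probability_setC// nu1 subee.
have DE : [set: d.-tuple R] `\` ~` cube rad = cube rad by rewrite setTD setCK.
have If : intg nu f.
  apply/integrableP; split; first exact/measurable_EFinP.
  have maf : measurable_fun setT (fun x => `|(f x)%:E|%E).
    by apply: measurableT_comp => //; exact/measurable_EFinP.
  rewrite (@ge0_negligible_integral _ _ _ nu setT (~` cube rad) (fun x => `|(f x)%:E|%E))// DE.
  apply: (@le_lt_trans _ _ (\int[nu]_(x in cube rad) (cst A%:E) x)%E).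
    apply: ge0_le_integral => //=; first exact: measurable_funS maf.
  have -> : (\int[nu]_(x in cube rad) (cst A%:E) x = A%:E * nu (cube rad))%E by exact: integral_cst.
  by rewrite nu1 mule1 ltry.
by split=> //; rewrite /Rintegral (negligible_integral mN measurableT If nuN) DE.
Qed.

Definition cube_moment mu rad g : R := \int[mu]_x (\1_(cube rad) x * mono g x).

Lemma intg_cube_moment mu rad g : intg mu (mono g) ->
  intg mu (fun x => \1_(cube rad) x * mono g x).
Proof.
move=> Ig; apply: (intg_le _ _ (intg_abs Ig)).
  apply: measurable_funM; last exact: measurable_mono.
  exact: measurable_indic (@measurable_cube R d rad).
by move=> x; rewrite indicE; case: (x \in _); rewrite ?mul1r// mul0r normr0.
Qed.

Lemma integral_cube_moment mu rad q (p : mpoly d R) : (msize p <= q.+1)%N ->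
  (forall g, (mdeg g <= q)%N -> intg mu (mono g)) ->
  (\int[mu]_(x in cube rad) (meval (tnth x) p)%:E = (moment_functional (cube_moment mu rad) p)%:E)%E.
Proof.
move=> pq Ig; have Ia (a : bmultinom d q.+1) :
    intg mu (fun x => mcoeff a p * (\1_(cube rad) x * mono a x)).
  by apply: intgZ; apply: intg_cube_moment; apply: Ig; rewrite -ltnS bmdeg.
rewrite integral_mkcond (_ : _ \_ _ = EFin \o (fun x =>
    \sum_(a : bmultinom d q.+1) mcoeff a p * (\1_(cube rad) x * mono a x))); last first.
  apply/funext => x; rewrite /patch /= indicE; case: ifPn => xc /=; congr EFin.
    rewrite meval_moment (moment_functionalE _ pq); apply: eq_bigr => a _.
    by rewrite mul1r.
  by rewrite big1// => a _; rewrite mul0r mulr0.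
rewrite intg_EFin; last by apply: intg_sum => a _.
rewrite Rexp_sum; last by move=> a _.
rewrite (moment_functionalE _ pq); congr EFin; apply: eq_bigr => a _.
by rewrite RintegralZl//; apply: intg_cube_moment; apply: Ig; rewrite -ltnS bmdeg.
Qed.

(** Off the cube the l1 norm N is at least [rad], so exp N <= exp (- rad) exp (2 N). *)
Lemma cube_moment_tail mu rad g B : intg mu (mono g) -> 0 <= rad ->
  intg mu (fun x => expR (2 * norm1 x)) -> \int[mu]_x expR (2 * norm1 x) <= B ->
  `|\int[mu]_x mono g x - cube_moment mu rad g| <= expR (- rad) * (mdeg g)`!%:R * B.
Proof.
move=> Ig r0 Ie eB; have Ic := intg_cube_moment rad Ig.
rewrite -RintegralB//.
apply: (@le_trans _ _ (\int[mu]_x (expR (- rad) * (mdeg g)`!%:R * expR (2 * norm1 x)))).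
  apply: Rexp_abs_le; [exact: intgB|exact: intgZ|move=> x].
  have e0 : 0 <= expR (- rad) * (mdeg g)`!%:R * expR (2 * norm1 x).
    by rewrite !mulr_ge0 ?expR_ge0.
  rewrite indicE; have [xc|xc] := boolP (x \in cube rad); first by rewrite mul1r subrr normr0.
  rewrite mul0r subr0; apply: (le_trans (mono_le_exp g x)).
  rewrite mulrAC mulrC ler_wpM2r// -expRD ler_expR.
  have : rad <= norm1 x; last by lra.
  move: xc; rewrite notin_setE => /existsNP[i] /negP; rewrite -ltNge => /ltW xi.
  exact: le_trans xi (coord_le_norm1 x i).
by rewrite RintegralZl// ler_wpM2l// mulr_ge0 ?expR_ge0.
Qed.

(** A normalised p >= - eps on the cube becomes nonnegative after adding eps, and the positivity
    bound applies once it is renormalised. Hence p has integral at least lam / 2 - lam / 8 over the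
    cube, and replacing the cube moments by [mm] costs at most lam / 4. The functional of [mm] is
    thus positive on p, as [cube_moment_measure] asks. *)
Lemma cube_matching_measure mu q rad (lam e : R) (mm : multinom d -> R) :
  0 < rad -> 0 < lam -> 0 <= e -> 8 * #|{: bmultinom d q.+1}|%:R * e <= lam -> mm mnm0 = 1 ->
  (forall g, (mdeg g <= q)%N -> intg mu (mono g)) ->
  (forall g, (mdeg g <= q)%N -> `|cube_moment mu rad g - mm g| <= 2 * e) ->
  (forall p : mpoly d R, (deg p <= q)%N ->
    \sum_(a : bmultinom d q.+1) mcoeff a p ^+ 2 = 1 ->
    (forall x : d.-tuple R, cube rad x -> 0 <= meval (tnth x) p) ->
    (lam%:E <= \int[mu]_(x in cube rad) (meval (tnth x) p)%:E)%E) ->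
  exists nu : probability (d.-tuple R) R, nu (cube rad) = 1%E /\
    forall g, (mdeg g <= q)%N -> (\int[nu]_(x in cube rad) mono g x)%R = mm g.
Proof.
move=> r0 lam0 e0 elam mm1 Ig close pos.
(* The bound 1/4 keeps the norm of the shifted polynomial at least 1/2, even if the constant
   coefficient of [p] is close to -1. *)
pose eps := Num.min (lam / 8) 4^-1.
have eps0 : 0 < eps by rewrite lt_min; apply/andP; split; [exact: divr_gt0|rewrite invr_gt0].
have eps1 : eps <= 4^-1 by rewrite ge_min lexx orbT.
have epsl : eps <= lam / 8 by rewrite ge_min lexx.
apply: (cube_moment_measure r0 eps0 mm1) => p pq p1 pc.
have pa (a : bmultinom d q.+1) : `|mcoeff a p| <= 1.
  rewrite -(@ler_pXn2r _ 2)// ?nnegrE// expr1n real_normK ?num_real// -p1.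
  by rewrite (bigD1 a)//= lerDl sumr_ge0// => b _; exact: sqr_ge0.
have lt0q : (mdeg (mnm0 : multinom d) < q.+1)%N by rewrite mdeg0.
pose z0 : bmultinom d q.+1 := BMultinom lt0q.
have coefE (a : bmultinom d q.+1) :
    mcoeff a (p + mpolyC d eps) = mcoeff a p + eps * (a == z0)%:R.
  by rewrite mcoeffD mcoeffC.
clearbody z0.
pose S := \sum_(a : bmultinom d q.+1) mcoeff a (p + mpolyC d eps) ^+ 2.
have SE : S = 1 + 2 * eps * mcoeff z0 p + eps ^+ 2.
  rewrite /S -addrA -[X in _ = X + _]p1 (bigD1 z0)//= [in RHS](bigD1 z0)//= coefE eqxx mulr1.
  rewrite (eq_bigr (fun a : bmultinom d q.+1 => mcoeff a p ^+ 2)); last first.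
    by move=> a /negbTE az; rewrite coefE az mulr0 addr0.
  ring.
have S4 : 4^-1 <= S.
  have := pa z0; rewrite ler_norml => /andP[l1 l2].
  have := ler_wpM2l (ltW eps0) l1; have := sqr_ge0 eps; rewrite SE; lra.
have S0 : 0 < S by apply: lt_le_trans S4; rewrite invr_gt0.
pose c : R := Num.sqrt S; have c0 : 0 < c by rewrite sqrtr_gt0.
have c2 : 2^-1 <= c.
  rewrite -(@ler_pXn2r _ 2)// ?nnegrE ?invr_ge0 ?(ltW c0)// sqr_sqrtr ?(ltW S0)//.
  by have -> : 2^-1 ^+ 2 = 4^-1 :> R by field.
pose p' : mpoly d R := c^-1 *: (p + mpolyC d eps).
have p'q : (msize p' <= q.+1)%N.
  apply: (leq_trans (mmeasureZ_le _ _ _)); apply: (leq_trans (mmeasureD_le _ _ _)).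
  by rewrite geq_max pq mmeasureC (leq_trans (leq_b1 _)).
have p'd : (deg p' <= q)%N by move: p'q; rewrite /deg; case: (mmeasure _ p').
have p'1 : \sum_(a : bmultinom d q.+1) mcoeff a p' ^+ 2 = 1.
  under eq_bigr => a _ do rewrite mcoeffZ exprMn.
  by rewrite -mulr_sumr -/S exprVn sqr_sqrtr ?ltW// mulVf// gt_eqF.
have p'c (x : d.-tuple R) : cube rad x -> 0 <= meval (tnth x) p'.
  move=> /pc; rewrite mevalZ mevalD mevalC => h.
  by rewrite mulr_ge0 ?invr_ge0 ?(ltW c0)//; lra.
have := pos p' p'd p'1 p'c; rewrite (integral_cube_moment _ p'q Ig) lee_fin.
rewrite moment_functionalZ moment_functionalD.
have -> : moment_functional (cube_moment mu rad) (mpolyC d eps) = eps * cube_moment mu rad mnm0.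
  by rewrite -[mpolyC d eps]mulr1 mul_mpolyC -mpolyX0 moment_functionalZ moment_functionalX.
have c1 : cube_moment mu rad mnm0 <= 1.
  rewrite -(Rexp_cst mu 1); apply: Rexp_le; [apply: intg_cube_moment|exact: intg_cst|].
    by apply: Ig; rewrite mdeg0.
  by move=> x; rewrite mono0 mulr1 indicE; case: (_ \in _).
rewrite mulrC ler_pdivlMr// => h1.
have h2 : lam * 2^-1 <= lam * c by rewrite ler_wpM2l// ltW.
have h3 : eps * cube_moment mu rad mnm0 <= eps by rewrite ler_piMr// ltW.
have h4 : `|moment_functional (cube_moment mu rad) p - moment_functional mm p| <=
    #|{: bmultinom d q.+1}|%:R * (2 * e).
  rewrite !(moment_functionalE _ pq) -sumrB (le_trans (ler_norm_sum _ _ _))//.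
  rewrite [leRHS]mulr_natl -sumr_const; apply: ler_sum => a _.
  rewrite -mulrBr normrM -[leRHS]mul1r; apply: ler_pM => //.
  by apply: close; rewrite -ltnS bmdeg.
move: h4; rewrite ler_norml => /andP[_]; move: h1 h2 h3 epsl elam.
set u := _ * (2 * e); rewrite (_ : 8 * _ * e = 4 * u); last by rewrite /u; ring.
lra.
Qed.
End cube_law.

Lemma axis_monomial (R : realType) d (i : 'I_d) n :
  exists2 g : multinom d, mdeg g = n & forall x : d.-tuple R, mono g x = tnth x i ^+ n.
Proof.
elim: n => [|n [g gn gE]].
  by exists mnm0; [exact: mdeg0|move=> x; rewrite mono0].
exists (mnm_add (mnm1 i) g); first by rewrite mdegD mdeg1 gn.
by move=> x; rewrite monoD mono1 gE exprS.
Qed.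

(** Converts the bound of the stability assumption into the sub-Gaussian growth that [W1_moments]
    expects. *)
Lemma sqrt_fact_le (R : realType) p : Num.sqrt (2 * p)`!%:R <= (2 * p)%:R ^+ p :> R.
Proof.
rewrite -(@ler_pXn2r _ 2)// ?nnegrE ?exprn_ge0// sqr_sqrtr// -exprM mulnC -natrX ler_nat.
exact: fact_le_exp.
Qed.

(** The growth of [mm] passes to [nu] by matching, and to [mu] up to an error of at most 1, which is
    absorbed because the reference value (2p)^p, p = l./2, is at least 1. *)
Lemma W1_cube_matching (R : realType) d (Cd : R) : (0 < d)%N -> 0 <= Cd ->
  exists2 C : R, 0 < C & forall l : nat, (1 < l)%N -> exists2 eps : R, 0 < eps &
  forall (mu nu : probability (d.-tuple R) R) (rad : R) (mm : multinom d -> R), 0 <= rad ->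
  (forall g, (mdeg g <= l)%N -> intg mu (mono g)) ->
  (forall g, (mdeg g <= l)%N -> `|\int[mu]_x mono g x - mm g| <= eps) ->
  (forall g, (mdeg g <= l)%N -> `|mm g| <= Cd * Num.sqrt (mdeg g)`!%:R) ->
  nu (cube rad) = 1%E ->
  (forall g, (mdeg g <= l)%N -> (\int[nu]_(x in cube rad) mono g x)%R = mm g) ->
  (W1 mu nu <= (C / Num.sqrt l%:R)%:E)%E.
Proof.
move=> d0 Cd0; have M0 : 0 <= Cd + 1 by rewrite addr_ge0.
have [C C0 HC] := W1_moments d0 M0.
exists C => // l l1; have [eps eps0 He] := HC l l1.
exists (Num.min eps 1); first by rewrite lt_min eps0 ltr01.
move=> mu nu rad mm r0 Ig close mmb nu1 match_.
have eps_eps : Num.min eps 1 <= eps by rewrite ge_min lexx.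
have eps_1 : Num.min eps 1 <= 1 by rewrite ge_min lexx orbT.
have nuE g : (mdeg g <= l)%N -> intg nu (mono g) /\ \int[nu]_x mono g x = mm g.
  move=> gl; have [] := @cube_supported_integral R d nu rad (mono g) (rad ^+ mdeg g) _
    (@measurable_mono R d g) _ nu1; rewrite ?exprn_ge0//.
    by move=> x xc; exact: mono_bound.
  by move=> I E; split=> //; rewrite -match_.
have p1 : (2 * l./2 <= l)%N by rewrite mul2n -[leqRHS](odd_double_half l) leq_addl.
have mpos : 0 <= (2 * l./2)%:R ^+ l./2 :> R by rewrite exprn_ge0.
have mge1 : 1 <= (2 * l./2)%:R ^+ l./2 :> R.
  by rewrite exprn_ege1// ler1n muln_gt0 half_gt0.
have mmp g : mdeg g = (2 * l./2)%N -> mm g <= Cd * (2 * l./2)%:R ^+ l./2.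
  move=> gE; apply: (le_trans (ler_norm _)); apply: le_trans (mmb g _) _; rewrite gE//.
  by rewrite ler_wpM2l// sqrt_fact_le.
apply: He => //.
- by move=> g /nuE[].
- by move=> g gl; rewrite (nuE g gl).2; exact: le_trans (close g gl) eps_eps.
- move=> i; have [g gE gx] := @axis_monomial R d i (2 * l./2).
  under eq_Rintegral do rewrite -gx.
  have := close g; rewrite gE => /(_ p1); rewrite ler_norml => /andP[_ h].
  have := mmp g gE; rewrite mulrDl mul1r; move: h mge1 eps_1; lra.
- move=> i; have [g gE gx] := @axis_monomial R d i (2 * l./2).
  under eq_Rintegral do rewrite -gx.
  rewrite (nuE g _).2 ?gE//; apply: (le_trans (mmp g gE)); rewrite ler_wpM2r//.
  by rewrite lerDl.
Qed.

Theorem theorem2p4 (R : realType) (K T delta0 : R)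
    (K_gt0 : 0 < K) (T_gt0 : 0 < T) (delta0_gt0 : 0 < delta0) :
  exists2 delta : R, 0 < delta &
  forall (d : nat) (lambda1 lambda2 eta s r Cdelta : R),
    (0 < d)%N -> 0 < lambda2 <= lambda1 -> 1 < eta < 2 -> 0 < s < 2^-1 ->
    0 < r -> 0 < Cdelta ->
  exists2 C : R, 0 < C &
  forall (ell : nat) (Capp Cbs Rstar M0 h0 Rpos : R) (lambda : nat -> R),
    (0 < ell)%N -> 0 < Capp -> 0 < Cbs -> 0 < Rstar -> 0 < h0 -> 0 < Rpos ->
    (forall q, 0 < lambda q) ->
  exists2 hell : R, 0 < hell &
  forall (m : nat) (dO : measure_display) (Omega : measurableType dO)
    (P : probability Omega R)
    (u0 : {RV P >-> d.-tuple R}) (z : nat -> {RV P >-> m.-tuple R})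
    (b : R -> d.-tuple R -> d.-tuple R)
    (sigma : R -> d.-tuple R -> 'M[R]_(d, m))
    (pb : R -> R -> nat -> d.-tuple (mpoly d R))
    (ps : R -> R -> nat -> 'M[mpoly d R]_(d, m))
    (ch : mrpc_choices d),
    (0 < m)%N ->
    noise_assumption u0 z ->
    coefficient_assumption T b sigma pb ps
      K r Capp lambda1 lambda2 eta Cbs Rstar ->
    initial_assumption u0 delta0 M0 ->
    stability_assumption T pb ps u0 ch lambda1 lambda2 eta delta
      Rstar Cdelta ->
    positivity_assumption T b sigma u0 z h0 Rpos lambda ->
  forall n k : nat, (0 < n)%N -> step_size T n < hell -> (k <= n)%N ->
    let h := step_size T n in
    let muk := euler_law u0 z h (b h) (sigma h) k in
    let bound := C * ell%:R `^ (- s)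
      + C * (- ln h) `^ (- (r * (eta - 1) / 2)) in
    (exists2 nu : probability (d.-tuple R) R,
       matches_rpc pb ps u0 ch lambda1 lambda2 eta delta ell h k nu &
       (W1 muk nu <= bound%:E)%E) /\
    ((1 < ell)%N -> forall nu : probability (d.-tuple R) R,
       matches_rpc pb ps u0 ch lambda1 lambda2 eta delta ell h k nu ->
       (W1 muk nu <= bound%:E)%E).
Proof.
(* The value 1 suffices because [theta] and [q] in [total_error_small] adapt to the exponential
   moments, whatever [K], [T] and [delta0]. *)
exists 1 => // d lambda1 lambda2 eta s r Cdelta d0 /andP[l20 l12] /andP[eta1 eta2] /andP[s0 s2] r0 Cd0.
(* [C] is fixed here, before [ell]; only the tolerances below depend on [ell]. *)
have [C C0 HC] := @W1_cube_matching R d Cdelta d0 (ltW Cd0).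
exists C => // ell Capp Cbs Rstar M0 h0 Rpos lambda ell0 Capp0 Cbs0 Rstar0 h00 Rpos0 lam0.
(* Matching the mean alone does not bring two measures close, so at least order 2 is matched. *)
pose l2 := maxn ell 2; have l21 : (1 < l2)%N by rewrite leq_max orbT.
have [eps1 eps10 HW] := HC l2 l21.
pose N : R := #|{: bmultinom d l2.+1}|%:R.
have N0 : 0 <= N by rewrite /N.
(* [eps1] serves the transport estimate. The second value is the margin of [cube_matching_measure],
   to which the mRPC error and the truncation to the cube contribute [e] each. *)
pose e := Num.min eps1 (lambda l2 / (8 * (N + 1))).
have N8 : 0 < 8 * (N + 1) by rewrite mulr_gt0// ltr_wpDl.
have e0 : 0 < e by rewrite lt_min eps10/=; exact: divr_gt0 (lam0 _) N8.
have ee1 : e <= eps1 by rewrite ge_min lexx.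
have elam : 8 * N * e <= lambda l2.
  have : e <= lambda l2 / (8 * (N + 1)) by rewrite ge_min lexx orbT.
  rewrite ler_pdivlMr// => h; rewrite mulrC; apply: le_trans h.
  by rewrite ler_wpM2l ?(ltW e0)// ler_wpM2l// lerDl.
pose B := @law_exp_bound R K T delta0 d M0 2.
have B0 : 0 <= B by exact: law_exp_bound_ge0.
pose A := l2`!%:R * B; have A0 : 0 <= A by exact: mulr_ge0.
have [x0 hx0] := eventually_and (@moments_close R K T delta0 K_gt0 T_gt0 delta0_gt0 d lambda1 lambda2
    eta r Cdelta d0 l20 l12 eta1 eta2 r0 Cd0 l2 Capp Cbs Rstar M0 e Capp0 Cbs0 e0)
  (eventually_and (eventually_le 1) (eventually_and (eventually_le (Rpos + 1)) (eventually_le (A / e)))).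
pose x1 := Num.max x0 1.
have x10 : 0 <= x1 by rewrite le_max ler01 orbT.
(* For h below exp (- x1^2 / 2) the radius exceeds x1, hence the threshold x0. *)
exists (Num.min h0 (expR (- (x1 ^+ 2 / 2)))); first by rewrite lt_min h00 expR_gt0.
move=> m dO Omega P u0 z b sigma pb ps ch m0 noise coef init stab pos n k n0.
rewrite lt_min => /andP[hh0 hx] kn h muk bound; rewrite -/h in hh0 hx.
have hp : 0 < h by rewrite divr_gt0// ltr0n.
have lnh : x1 ^+ 2 <= - 2 * ln h.
  have : ln h <= - (x1 ^+ 2 / 2) by rewrite -[leRHS]expRK ler_ln ?posrE ?expR_gt0// ltW.
  lra.
have h1 : h < 1.
  apply: (lt_le_trans hx); rewrite -expR0 ler_expR oppr_le0 divr_ge0// exprn_ge0//.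
pose x := radius 1 h.
have xE : x = Num.sqrt (- 2 * ln h) by rewrite /x /radius sqrtr1 invr1 mul1r.
have x1x : x1 <= x.
  rewrite -(@ler_pXn2r _ 2)// ?nnegrE ?xE ?sqrtr_ge0// sqr_sqrtr//.
  by rewrite (le_trans _ lnh)// exprn_ge0.
have x0x : x0 <= x by apply: le_trans x1x; rewrite le_max lexx.
have [moments [xge1 [xRpos xA]]] := hx0 x x0x.
have [mv vexp rpc1 rpcB close] :=
  moments m dO Omega P u0 z b sigma pb ps ch noise coef init stab n k n0 kn h1 erefl.
have xp : 0 < x by exact: lt_le_trans ltr01 xge1.
have [mu muE mu_int] := law_probability P mv.
have two0 : 0 <= 2 :> R by [].
have [I2 B2] := vexp 2 two0.
have Ig g : intg mu (mono g) /\
    \int[mu]_y mono g y = \int[P]_w mono g (euler u0 z h (b h) (sigma h) k w).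
  by apply: mu_int; [exact: measurable_mono|exact: intg_mono].
have [Ie Ee] : intg mu (fun y => expR (2 * norm1 y)) /\ \int[mu]_y expR (2 * norm1 y) =
    \int[P]_w expR (2 * norm1 (euler u0 z h (b h) (sigma h) k w)).
  apply: (mu_int (fun y => expR (2 * norm1 y))) => //.
  by apply: measurableT_comp => //; apply: measurable_funM => //; exact: measurable_norm1.
pose rpc := rpc_moment pb ps u0 ch lambda1 lambda2 eta 1 h k.
have close' g : (mdeg g <= l2)%N -> `|\int[mu]_y mono g y - rpc g| <= e.
  by move=> gl; rewrite (Ig g).2; exact: close.
have tail g : (mdeg g <= l2)%N -> `|\int[mu]_y mono g y - cube_moment mu x g| <= e.
  move=> gl; apply: (@le_trans _ _ (expR (- x) * (mdeg g)`!%:R * B)).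
    by apply: cube_moment_tail; rewrite ?(Ig g).1 ?(ltW xp) ?Ie ?Ee.
  apply: (@le_trans _ _ (expR (- x) * A)).
    rewrite -mulrA ler_wpM2l ?expR_ge0// ler_wpM2r// ler_nat; exact: leq_fact.
  rewrite expRN mulrC ler_pdivrMr ?expR_gt0// mulrC.
  have : A <= x * e by rewrite -ler_pdivrMr.
  move=> /le_trans; apply; rewrite ler_wpM2r ?(ltW e0)//.
  by have := expR_ge1Dx x; lra.
(* ell^(-s) >= ell^(-1/2) >= l2^(-1/2) as s < 1/2, and the logarithmic term is nonnegative. *)
have bE : C / Num.sqrt l2%:R <= bound.
  have l2R : 0 < l2%:R :> R by rewrite ltr0n ltnW.
  have ellR : 1 <= ell%:R :> R by rewrite ler1n.
  apply: (@le_trans _ _ (C * ell%:R `^ (- s))); last first.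
    by rewrite /bound lerDl mulr_ge0 ?powR_ge0// ltW.
  have q1 : 0 < (ell%:R : R) `^ s by rewrite powR_gt0// ltr0n.
  have q2 : 0 < Num.sqrt l2%:R :> R by rewrite sqrtr_gt0.
  rewrite ler_pM2l// powRN lef_pV2 ?posrE//.
  have -> : Num.sqrt l2%:R = l2%:R `^ 2^-1 :> R by rewrite powR12_sqrt// ltW.
  have le1 : (ell%:R : R) `^ s <= ell%:R `^ 2^-1 by apply: ler_powR => //; exact: ltW.
  apply: (le_trans le1).
  by rewrite ge0_ler_powR ?nnegrE ?ler_nat ?leq_maxl// ltW.
have W1nu (nu : probability (d.-tuple R) R) :
    matches_rpc pb ps u0 ch lambda1 lambda2 eta 1 l2 h k nu -> (W1 muk nu <= bound%:E)%E.
  move=> [nu1 numatch]; rewrite /muk /euler_law -muE.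
  have bE' : ((C / Num.sqrt l2%:R)%:E <= bound%:E)%E by rewrite lee_fin.
  apply: le_trans bE'; apply: (HW mu nu x rpc (ltW xp) _ _ _ nu1 numatch).
  - by move=> g _; have [] := Ig g.
  - by move=> g gl; exact: le_trans (close' g gl) ee1.
  - exact: rpcB.
split; last first.
  move=> ell1 nu hnu; apply: W1nu; rewrite /l2 (_ : maxn ell 2 = ell)//.
  exact/maxn_idPl.
have [nu [nu1 numatch]] : exists nu : probability (d.-tuple R) R, nu (cube x) = 1%E /\
    forall g, (mdeg g <= l2)%N -> (\int[nu]_(y in cube x) mono g y)%R = rpc g.
  apply: (@cube_matching_measure R d mu l2 x (lambda l2) e rpc) => //; first exact: ltW.
  - by move=> g _; have [] := Ig g.
  - move=> g gl; rewrite -(subrKA (\int[mu]_y mono g y)) (le_trans (ler_normD _ _))//.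
    rewrite distrC; have := tail g gl; have := close' g gl; lra.
  - move=> p pd p1 pc; have [_ pos2] := pos n n0 hh0 k kn.
    rewrite muE; apply: pos2 => //; apply: lt_le_trans xRpos.
    by rewrite ltrDl.
exists nu; first by split=> // g gl; apply: numatch; rewrite (leq_trans gl)// leq_maxl.
by apply: W1nu; split.
Qed.
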